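(* Let $p\in\mathbb N$, $\epsilon\in(0,1)$ and let $q_\epsilon$ be such that $\epsilon^2\sqrt{q_\epsilon}\log q_\epsilon<\frac12$ (with $q_\epsilon\to+\infty$ as $\epsilon\to0$). Let $u_0$ be such that $\widehat{u_0}$ is $2\pi$-periodic, located modulo $2\pi$ only in a neighborhood of zero of radius less than $\eta\frac{\pi}{p}$ with $0<\eta<1$, and having Fourier coefficients $\{\alpha_k\}$ (i.e. $\widehat{u_0}(\xi)=\sum_{k\in\mathbb Z}\alpha_ke^{-ik\xi}$, $u_0=\sum_k\alpha_k\delta_k$) such that $\|\{\alpha_k\}\|_{l^{2,s}}\leq\epsilon$ for some $s>\frac12$. Let $u(t,x)$ be the solution, described in the context, of $$i\partial_tu+\Delta u\pm\frac12\left(|u|^2-\frac{M}{2\pi t}\right)u=0,\qquad M=\sum_{k\in\mathbb Z}|\alpha_k|^2,$$ obtained from $\{\alpha_k\}$. Then for all $t_{p,q}=\frac1{2\pi}\frac pq$ with $1\leq q\leq q_\epsilon$ odd and for all $x\in\mathbb R$ at distance larger than $\frac\eta q$ from $\frac1q\mathbb Z$, the function $u$ almost vanishes in the sense $$|u(t_{p,q},x)|\leq\epsilon .$$ Moreover, the solution can concentrate near $\frac1q\mathbb Z$ in the sense that there is a family of sequences $\{\alpha_k^\lambda\}_{k\in\mathbb Z}$, with $\|\{\alpha_k^\lambda\}\|_{l^{2,s}}\to0$ as $\lambda\to\infty$, such that the corresponding solutions $u^\lambda$ (obtained in the same way from $\{\alpha_k^\lambda\}$) satisfy $$\left|\frac{u^\lambda(t_{p,q},0)}{e^{it_{p,q}\Delta}\alpha_0^\lambda\delta_0(0)}\right|\longrightarrow\infty\qquad\text{as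 }\lambda\to\infty .$$
   Context: Here $\Delta=\partial_x^2$ on $\mathbb R$, $e^{it\Delta}\delta_k(x)=\dfrac{e^{i\frac{(x-k)^2}{4t}}}{\sqrt{4\pi it}}$ (in particular $e^{it\Delta}\alpha\delta_0(0)=\alpha/\sqrt{4\pi it}$), $\widehat{\delta_k}(\xi)=e^{-ik\xi}$, and $\|\{\alpha_k\}\|_{l^{2,s}}^2=\sum_{k\in\mathbb Z}(1+|k|)^{2s}|\alpha_k|^2$. ''Located modulo $2\pi$ only in a neighborhood of zero of radius less than $r$'' means that the restriction of $\widehat{u_0}$ to $[-\pi,\pi]$ is supported in an interval $[-r',r']$ with $r'<r$. The solution obtained from a sequence $\{\alpha_k\}\in l^{2,s}$, $s>\frac12$, is the following: for $0<\gamma<1$ there exist $T>0$ and a unique solution on $(0,T)$ of the equation of the form $$u(t,x)=\sum_{k\in\mathbb Z}e^{\mp i\frac{|\alpha_k|^2}{4\pi}\log\sqrt t}(\alpha_k+R_k(t))e^{it\Delta}\delta_k(x),$$ with $\sup_{0<t<T}t^{-\gamma}\|\{R_k(t)\}\|_{l^{2,s}}+t\|\{\partial_tR_k(t)\}\|_{l^{2,s}}<C$; it is global in time when $s\ge1$. The times $t_{p,q}$ considered are understood to lie in the interval of existence of the solution. *)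

(* Defs.v *)
(* Stdlib reals with Coquelicot. *)
From Stdlib Require Export Reals ZArith Arith.
From Coquelicot Require Export Coquelicot.

Local Open Scope R_scope.

(* Sums over Z are the limits of the symmetric partial sums
   a 0 + sum_(1 <= n <= N) (a n + a (-n)).  All families summed below are
   absolutely summable, so the order of summation is irrelevant. *)
Definition zterm {V : AbelianMonoid} (a : Z -> V) (n : nat) : V :=
  match n with
  | O => a 0%Z
  | S _ => plus (a (Z.of_nat n)) (a (- Z.of_nat n)%Z)
  end.

Definition is_zsum (a : Z -> C) (l : C) : Prop :=
  @is_series R_AbsRing C_R_NormedModule (zterm (V := C_R_NormedModule) a) l.

Definition ex_zsumR (a : Z -> R) : Prop :=
  ex_series (zterm (V := R_NormedModule) a).

Definition zsumR (a : Z -> R) : R := Series (zterm (V := R_NormedModule) a).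

Definition l2s_term (s : R) (a : Z -> C) (k : Z) : R :=
  Rpower (1 + Rabs (IZR k)) (2 * s) * Cmod (a k) ^ 2.

Definition in_l2s (s : R) (a : Z -> C) : Prop := ex_zsumR (l2s_term s a).

(* The value is meaningful only together with [in_l2s s a]. *)
Definition l2s_norm (s : R) (a : Z -> C) : R := sqrt (zsumR (l2s_term s a)).

Definition mass (a : Z -> C) : R := zsumR (fun k => Cmod (a k) ^ 2).

Definition cis (theta : R) : C := (cos theta, sin theta).

(* e^{it Delta} delta_k (x) for t > 0; the principal square root of 4 pi i t
   is sqrt (4 pi t) e^{i pi/4}. *)
Definition free_delta (k : Z) (t x : R) : C :=
  (cis ((x - IZR k) ^ 2 / (4 * t)) / (RtoC (sqrt (4 * PI * t)) * cis (PI / 4)))%C.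

(* uhat(xi) = sum_k a_k e^{-ik xi}, the Fourier transform of sum_k a_k delta_k. *)
Definition has_fourier_coefficients (uhat : R -> C) (a : Z -> C) : Prop :=
  forall xi : R, is_zsum (fun k => (a k * cis (- IZR k * xi))%C) (uhat xi).

Definition periodic_2pi (uhat : R -> C) : Prop :=
  forall xi : R, uhat (xi + 2 * PI) = uhat xi.

Definition located_mod_2pi (uhat : R -> C) (r : R) : Prop :=
  exists r' : R, 0 <= r' < r /\
    forall xi : R, - PI <= xi <= PI -> r' < Rabs xi -> uhat xi = RtoC 0.

Definition test_function (a b : R) (phi : R -> R) : Prop :=
  (forall (n : nat) (x : R), ex_derive_n phi n x) /\
  (forall x : R, ~ (a < x < b) -> phi x = 0).

(* Integral over R of f phi, for phi vanishing outside (a, b). *)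
Definition pairing (a b : R) (f : R -> C) (phi : R -> R) : C :=
  @RInt C_R_CompleteNormedModule (fun x => (f x * RtoC (phi x))%C) a b.

(* i u_t + u_xx + (sigma/2) (|u|^2 - M/(2 pi t)) u = 0 on (0,T) x R, with sigma = +1
   or -1.  For s close to 1/2 the function u is only continuous in x, so the
   equation is read in the sense of distributions in x, for every t in (0,T). *)
Definition nls (sigma M T : R) (u : R -> R -> C) : Prop :=
  forall (a b : R) (phi : R -> R), a < b -> test_function a b phi ->
  forall t : R, 0 < t < T ->
  exists D : C,
    @is_derive R_AbsRing C_R_NormedModule
      (fun tau : R => pairing a b (u tau) phi) t D /\
    (Ci * D + pairing a b (u t) (Derive_n phi 2)
      + RtoC (sigma / 2) *
        pairing a b
          (fun x => RtoC (Cmod (u t x) ^ 2 - M / (2 * PI * t)) * u t x) phi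
      = RtoC 0)%C.

(* u(t,x) = sum_k e^{-sigma i |a_k|^2/(4 pi) log sqrt t} (a_k + R_k(t)) e^{it Delta} delta_k (x)
   for 0 < t < T. *)
Definition ansatz (sigma T : R) (a : Z -> C) (Rk : R -> Z -> C)
    (u : R -> R -> C) : Prop :=
  forall t x : R, 0 < t < T ->
  is_zsum
    (fun k => (cis (- sigma * (Cmod (a k) ^ 2 / (4 * PI)) * ln (sqrt t))
               * (a k + Rk t k) * free_delta k t x)%C)
    (u t x).

(* sup_{0<t<T} t^(-gamma) ||R(t)||_{l^{2,s}} + t ||R'(t)||_{l^{2,s}} < infinity *)
Definition remainder_bound (s gamma T : R) (Rk : R -> Z -> C) : Prop :=
  exists (dRk : R -> Z -> C) (K : R),
  forall t : R, 0 < t < T ->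
    (forall k : Z,
       @is_derive R_AbsRing C_R_NormedModule (fun tau : R => Rk tau k) t (dRk t k)) /\
    in_l2s s (Rk t) /\ in_l2s s (dRk t) /\
    Rpower t (- gamma) * l2s_norm s (Rk t) + t * l2s_norm s (dRk t) < K.

Definition solution_from (sigma s gamma : R) (a : Z -> C) (T : R)
    (u : R -> R -> C) : Prop :=
  in_l2s s a /\ nls sigma (mass a) T u /\
  exists Rk : R -> Z -> C, ansatz sigma T a Rk u /\ remainder_bound s gamma T Rk.

Definition t_pq (p q : nat) : R := 1 / (2 * PI) * (INR p / INR q).

(* Main.v *)
From Stdlib Require Import List Permutation Lra Lia Psatz Classical ClassicalEpsilon
  FunctionalExtensionality.
Require Import Defs.
Import ListNotations.
Local Open Scope R_scope.

(** The solution is written [u(t,x) = sum_k A_k(t) e_k(t,x)] with [e_k] the free evolution of the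
    Dirac mass at [k].  Testing the equation against smooth functions and using that the Fourier
    coefficients of an absolutely convergent series are unique, it becomes a system for the modes,
    [A_k' = i (sigma/(8 PI t)) (N_k - 2 M A_k)], where
    [N_k = sum_{a,b} A_{k-a} conj(A_{k-a-b}) A_{k-b} e^{-i a b/(2t)}]
    ([nls_of_modes], [modes_of_nls]).  The terms with [a b = 0] have no oscillation; once the mass
    [sum |A_k|^2 = M] is known to be conserved they only rotate [A_k], which is the logarithmic
    phase of the ansatz.  In the other terms the singular factor [1/t] is compensated by the
    oscillation, since [e^{-i a b/(2t)}/t] is, up to a constant factor and bounded terms, the
    derivative of [t e^{-i a b/(2t)}/(a b)] ([dC_Snf], [dC_Wnf]).

    Almost vanishing.  At [t = p/(2 PI q)] the phase [e^{i k^2/(4t)} = e^{i PI q k^2/(2p)}] is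
    [2p]-periodic in [k], because [k^2] changes by a multiple of [4p] when [k] changes by [2p];
    so the free evolution at [x] is a combination of the values of the Fourier transform of the
    data at [PI (q x + m)/p].  These vanish away from [Z/q] when that transform
    is located near zero ([linear_vanish]).  It remains to bound the remainder
    [R_k = e^{i th_k ln t} A_k - alpha_k], where [th_k = sigma |alpha_k|^2/(8 PI)], in [l^1] by
    [6/5 eps/q]; the modulus of [e_k] is [(2p/q)^(-1/2)], so for large [p] the interval of times
    is long and a plain smallness argument would lose.  The gain comes from the localisation
    again.  As soon as some point is at distance more than [eta/q] from [Z/q], one has [eta < 1/2], and
    a function located at distance less than [PI/(2p)] of zero is orthogonal to its translates by
    multiples of [PI/p]; hence its mass is equidistributed among the classes of indices modulo
    [2p] ([equidistributed]) and no single coefficient has more than a fraction [1/(2p)] of it.  A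
    sequence of that kind is spread out, which bounds its mass by [2 eps^2/(p+2)]
    ([mass_localised]).  With this bound the estimates close on the whole interval
    [(0, p/(2 PI)]] ([bootstrap]).  They combine the normal form, a trilinear bound
    that uses only the mass ([trilinear_kk]), a cubic bound that uses the weight
    [(1+|k|)^{1/2}] ([cubic_l2]), and the observation that the non-oscillating terms rotate the
    modes without moving their moduli ([modulus_lip]).  The phases [e^{-i th_k ln t}] cost a term
    [eps^3 |ln t|], which the condition on [q_eps] controls ([arithmetic_budget]).

    Concentration.  Data with two modes, [alpha_0] much smaller than [alpha_1], evolve almost
    linearly, so at [x = 0] the solution is of the size of [alpha_1] while the denominator is of
    the size of [alpha_0] ([concentration]).  The solution itself is found by iterating the
    integrated mode system from time zero in a weighted [l^1] space, an algebra under convolution;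
    the normal form makes each iterate bounded down to [t = 0] ([picard]). *)

(** * Finite sums over lists *)

Definition rsum {I : Type} (f : I -> R) (l : list I) : R :=
  fold_right (fun i s => f i + s) 0 l.
Definition csum {I : Type} (f : I -> C) (l : list I) : C :=
  fold_right (fun i s => (f i + s)%C) (RtoC 0) l.

Section FiniteSums.
Context {I : Type}.
Implicit Types (l m : list I) (f g : I -> R).

Lemma rsum_app f l m : rsum f (l ++ m) = rsum f l + rsum f m.
Proof. induction l as [|a l IH]; simpl; [|rewrite IH]; lra. Qed.

Lemma rsum_ext f g l : (forall i, In i l -> f i = g i) -> rsum f l = rsum g l.
Proof.
  induction l as [|a l IH]; simpl; intros H; [reflexivity|].
  rewrite (H a), IH by auto; reflexivity.
Qed.

Lemma rsum_le f g l : (forall i, In i l -> f i <= g i) -> rsum f l <= rsum g l.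
Proof.
  induction l as [|a l IH]; simpl; intros H; [lra|].
  apply Rplus_le_compat; auto.
Qed.

Lemma rsum_nonneg f l : (forall i, In i l -> 0 <= f i) -> 0 <= rsum f l.
Proof.
  induction l as [|a l IH]; simpl; intros H; [lra|].
  apply Rplus_le_le_0_compat; auto.
Qed.

Lemma rsum_plus f g l : rsum (fun i => f i + g i) l = rsum f l + rsum g l.
Proof. induction l as [|a l IH]; simpl; [|rewrite IH]; lra. Qed.

Lemma rsum_scal c f l : rsum (fun i => c * f i) l = c * rsum f l.
Proof. induction l as [|a l IH]; simpl; [|rewrite IH]; lra. Qed.

Lemma rsum_scal_r c f l : rsum (fun i => f i * c) l = rsum f l * c.
Proof. induction l as [|a l IH]; simpl; [|rewrite IH]; lra. Qed.

Lemma rsum_const c l : rsum (fun _ => c) l = INR (length l) * c.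
Proof.
  induction l as [|a l IH]; [simpl; lra|].
  cbn [rsum fold_right length]; fold (rsum (fun _ : I => c) l).
  rewrite S_INR, IH; lra.
Qed.

Lemma rsum_0 l : rsum (fun _ : I => 0) l = 0.
Proof. rewrite rsum_const; lra. Qed.

Lemma rsum_perm f l m : Permutation l m -> rsum f l = rsum f m.
Proof. induction 1; simpl; lra. Qed.

Lemma rsum_incl f l m :
  (forall i, 0 <= f i) -> NoDup l -> incl l m -> rsum f l <= rsum f m.
Proof.
  intros Hf Hl; revert m; induction l as [|a l IH]; intros m Hi; simpl.
  - apply rsum_nonneg; auto.
  - inversion_clear Hl as [|? ? Hn Hl'].
    destruct (in_split a m) as (m1 & m2 & ->); [apply Hi; left; reflexivity|].
    rewrite rsum_app; simpl.
    enough (rsum f l <= rsum f (m1 ++ m2)) by (rewrite rsum_app in *; lra).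
    apply IH; [assumption|].
    intros x Hx. destruct (in_app_or _ _ _ (Hi x (or_intror Hx))) as [H|[H|H]].
    + apply in_or_app; auto.
    + subst; contradiction.
    + apply in_or_app; auto.
Qed.

Lemma rsum_le1 f l a : (forall i, 0 <= f i) -> In a l -> f a <= rsum f l.
Proof.
  intros Hf Ha.
  replace (f a) with (rsum f [a]) by (simpl; lra).
  apply rsum_incl; auto.
  - repeat constructor; auto.
  - intros x [<-|[]]; assumption.
Qed.

Lemma rsum_CS f g l :
  rsum (fun i => f i * g i) l ^ 2 <= rsum (fun i => f i ^ 2) l * rsum (fun i => g i ^ 2) l.
Proof.
  assert (H : forall x, 0 <= rsum (fun i => f i ^ 2) l * x ^ 2
            - 2 * x * rsum (fun i => f i * g i) l + rsum (fun i => g i ^ 2) l).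
  { intros x. replace (_ + _) with (rsum (fun i => (x * f i - g i) ^ 2) l).
    - apply rsum_nonneg; intros; apply pow2_ge_0.
    - induction l as [|a l IH]; simpl; [lra|]. simpl in IH; rewrite IH; ring. }
  set (a := rsum (fun i => f i ^ 2) l) in *.
  set (b := rsum (fun i => f i * g i) l) in *.
  set (c := rsum (fun i => g i ^ 2) l) in *.
  assert (Ha : 0 <= a) by (apply rsum_nonneg; intros; apply pow2_ge_0).
  destruct (Req_dec a 0) as [E|E].
  - destruct (Req_dec b 0) as [Eb|Eb]; [rewrite E, Eb; lra|].
    specialize (H ((c + 1) / (2 * b))). rewrite E in H.
    replace (2 * ((c + 1) / (2 * b)) * b) with (c + 1) in H by (field; assumption). lra.
  - specialize (H (b / a)).
    replace (a * (b / a) ^ 2 - 2 * (b / a) * b + c) with ((a * c - b ^ 2) / a) in H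
      by (field; assumption).
    assert (0 <= (a * c - b ^ 2) / a * a) by (apply Rmult_le_pos; lra).
    replace ((a * c - b ^ 2) / a * a) with (a * c - b ^ 2) in H0 by (field; assumption).
    lra.
Qed.

Lemma csum_app (f : I -> C) l m : csum f (l ++ m) = (csum f l + csum f m)%C.
Proof. induction l as [|a l IH]; simpl; [|rewrite IH]; ring. Qed.

Lemma csum_ext (f g : I -> C) l : (forall i, In i l -> f i = g i) -> csum f l = csum g l.
Proof.
  induction l as [|a l IH]; simpl; intros H; [reflexivity|].
  rewrite (H a), IH by auto; reflexivity.
Qed.

Lemma csum_plus (f g : I -> C) l :
  csum (fun i => f i + g i)%C l = (csum f l + csum g l)%C.
Proof. induction l as [|a l IH]; simpl; [|rewrite IH]; ring. Qed.

Lemma csum_scal c (f : I -> C) l : csum (fun i => c * f i)%C l = (c * csum f l)%C.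
Proof. induction l as [|a l IH]; simpl; [|rewrite IH]; ring. Qed.

Lemma csum_perm (f : I -> C) l m : Permutation l m -> csum f l = csum f m.
Proof.
  induction 1; simpl; try congruence; ring.
Qed.

Lemma Cmod_csum (f : I -> C) l : Cmod (csum f l) <= rsum (fun i => Cmod (f i)) l.
Proof.
  induction l as [|a l IH]; simpl; [rewrite Cmod_0; lra|].
  eapply Rle_trans; [apply Cmod_triangle|lra].
Qed.

Lemma Re_csum (f : I -> C) l : Re (csum f l) = rsum (fun i => Re (f i)) l.
Proof. induction l as [|a l IH]; simpl; [|rewrite <- IH]; reflexivity. Qed.

Lemma csum_RtoC f l : csum (fun i => RtoC (f i)) l = RtoC (rsum f l).
Proof. induction l as [|a l IH]; simpl; [|rewrite IH, RtoC_plus]; reflexivity. Qed.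

End FiniteSums.

Lemma rsum_map {I J} (f : J -> R) (h : I -> J) (l : list I) : rsum f (map h l) = rsum (fun i => f (h i)) l.
Proof. induction l as [|a l IH]; simpl; [|rewrite IH]; reflexivity. Qed.

Lemma rsum_swap {I J} (f : I -> J -> R) (l : list I) (m : list J) :
  rsum (fun i => rsum (f i) m) l = rsum (fun j => rsum (fun i => f i j) l) m.
Proof.
  induction l as [|a l IH]; simpl; [rewrite rsum_const; lra|].
  rewrite IH, <- rsum_plus; reflexivity.
Qed.

Lemma rsum_prod {I J} (f : I * J -> R) (l : list I) (m : list J) :
  rsum f (list_prod l m) = rsum (fun i => rsum (fun j => f (i, j)) m) l.
Proof.
  induction l as [|a l IH]; simpl; [reflexivity|].
  rewrite rsum_app, rsum_map, IH; reflexivity.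
Qed.

Lemma csum_map {I J} (f : J -> C) (h : I -> J) (l : list I) : csum f (map h l) = csum (fun i => f (h i)) l.
Proof. induction l as [|a l IH]; simpl; [|rewrite IH]; reflexivity. Qed.

Lemma csum_prod {I J} (f : I * J -> C) (l : list I) (m : list J) :
  csum f (list_prod l m) = csum (fun i => csum (fun j => f (i, j)) m) l.
Proof.
  induction l as [|a l IH]; simpl; [reflexivity|].
  rewrite csum_app, csum_map, IH; reflexivity.
Qed.

Lemma csum_swap {I J} (f : I -> J -> C) l (m : list J) :
  csum (fun i => csum (f i) m) l = csum (fun j => csum (fun i => f i j) l) m.
Proof.
  induction l as [|a l IH]; simpl.
  - induction m; simpl; [|rewrite <- IHm]; ring.
  - rewrite IH, <- csum_plus; reflexivity.
Qed.

Lemma nodup_ex {I} (l : list I) : exists l', NoDup l' /\ forall x, In x l' <-> In x l.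
Proof.
  induction l as [|a l (l' & Hd & Hl')].
  - exists []; split; [constructor|tauto].
  - destruct (classic (In a l')) as [H|H].
    + exists l'; split; [assumption|]. intros x; rewrite Hl'; simpl.
      split; [auto|intros [<-|Hx]; auto]. apply Hl'; assumption.
    + exists (a :: l'); split; [constructor; assumption|].
      intros x; simpl; rewrite Hl'; tauto.
Qed.

Lemma nodup_diff {I} (F G : list I) :
  NoDup F -> NoDup G -> incl F G ->
  exists H, NoDup H /\ (forall i, In i H -> ~ In i F) /\ Permutation G (F ++ H).
Proof.
  intros HF; revert G; induction F as [|a F IH]; intros G HG Hi.
  - exists G; repeat split; simpl; auto.
  - inversion_clear HF as [|? ? Hn HF'].
    destruct (in_split a G) as (m1 & m2 & ->); [apply Hi; left; reflexivity|].
    assert (HG' : NoDup (m1 ++ m2)) by (eapply NoDup_remove_1; eassumption).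
    assert (Ha : ~ In a (m1 ++ m2)) by (eapply NoDup_remove_2; eassumption).
    destruct (IH HF' (m1 ++ m2)) as (H & H1 & H2 & H3); [assumption| |].
    { intros x Hx. destruct (in_app_or _ _ _ (Hi x (or_intror Hx))) as [K|[K|K]].
      - apply in_or_app; auto.
      - subst; contradiction.
      - apply in_or_app; auto. }
    exists H; repeat split; [assumption| |].
    + intros i Hi1 [<-|Hi2]; [|exact (H2 i Hi1 Hi2)].
      apply Ha, (Permutation_in _ (Permutation_sym H3)), in_or_app; auto.
    + simpl. apply Permutation_trans with (a :: m1 ++ m2).
      * apply Permutation_sym, Permutation_middle.
      * constructor; assumption.
Qed.

(** * Unconditional sums *)

Lemma is_half e : 0 < e -> 0 < e / 2.
Proof. lra. Qed.


(** For a nonnegative family this is summability with a bound on the sum. *)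
Definition bnd {I} (f : I -> R) (B : R) : Prop :=
  forall l, NoDup l -> rsum f l <= B.

(** Convergence along the finite subsets of an arbitrary index type, so that rearrangements and
    sums over products of index types need no enumeration. *)
Definition ev {I} (P : list I -> Prop) : Prop :=
  exists F, forall G, NoDup G -> incl F G -> P G.

Definition hasum {I} (f : I -> C) (v : C) : Prop :=
  forall e, 0 < e -> ev (fun G => Cmod (csum f G - v) < e).

Definition asum {I} (f : I -> C) : Prop := exists B, bnd (fun i => Cmod (f i)) B.

Definition tsum {I} (f : I -> C) : C := epsilon (inhabits (RtoC 0)) (hasum f).

Lemma ev_and {I} (P Q : list I -> Prop) : ev P -> ev Q -> ev (fun G => P G /\ Q G).
Proof.
  intros (F1 & H1) (F2 & H2); exists (F1 ++ F2); intros G HG Hi; split.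
  - apply H1; auto. intros x Hx; apply Hi, in_or_app; auto.
  - apply H2; auto. intros x Hx; apply Hi, in_or_app; auto.
Qed.

Lemma ev_mono {I} (P Q : list I -> Prop) :
  (forall G, NoDup G -> P G -> Q G) -> ev P -> ev Q.
Proof. intros H (F & HF); exists F; auto. Qed.

Lemma ev_ex {I} (P : list I -> Prop) : ev P -> exists G, NoDup G /\ P G.
Proof.
  intros (F & HF). destruct (nodup_ex F) as (G & HG & Hi).
  exists G; split; auto. apply HF; auto. intros x; apply Hi.
Qed.

Lemma ev_all {I J} (l : list J) (P : J -> list I -> Prop) :
  (forall j, In j l -> ev (P j)) -> ev (fun G => forall j, In j l -> P j G).
Proof.
  induction l as [|a l IH]; intros H.
  - exists []; intros G _ _ j [].
  - assert (H1 := ev_and _ _ (H a (or_introl eq_refl)) (IH (fun j Hj => H j (or_intror Hj)))).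
    revert H1; apply ev_mono. intros G _ [Ha Hl] j [<-|Hj]; auto.
Qed.

Lemma ev_incl {I} (F : list I) : ev (fun G => incl F G).
Proof. exists F; auto. Qed.

Lemma Cmod_tri_le (x y : C) B : Cmod x + Cmod y <= B -> Cmod (x + y) <= B.
Proof. intros H. eapply Rle_trans; [apply Cmod_triangle|exact H]. Qed.

Lemma Cmod_sub_sym (x y : C) : Cmod (x - y) = Cmod (y - x).
Proof. replace (y - x)%C with (- (x - y))%C by ring. symmetry; apply Cmod_opp. Qed.

Lemma Cmod_tri3 (x y z : C) : Cmod (x - z) <= Cmod (x - y) + Cmod (y - z).
Proof. replace (x - z)%C with ((x - y) + (y - z))%C by ring. apply Cmod_triangle. Qed.

Lemma Ceq_eps (x y : C) : (forall e, 0 < e -> Cmod (x - y) <= e) -> x = y.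
Proof.
  intros H. assert (H0 : Cmod (x - y) = 0).
  { apply Rle_antisym; [|apply Cmod_ge_0].
    apply le_epsilon; intros e He; specialize (H e He); lra. }
  apply Cmod_eq_0 in H0. replace x with ((x - y) + y)%C by ring. rewrite H0; ring.
Qed.

Lemma hasum_unique {I} (f : I -> C) v w : hasum f v -> hasum f w -> v = w.
Proof.
  intros Hv Hw; apply Ceq_eps; intros e He.
  destruct (ev_ex _ (ev_and _ _ (Hv _ (is_half _ He)) (Hw _ (is_half _ He))))
    as (G & _ & H1 & H2).
  pose proof (Cmod_tri3 v (csum f G) w). rewrite (Cmod_sub_sym v (csum f G)) in H. lra.
Qed.

Lemma hasum_ext {I} (f g : I -> C) v : (forall i, f i = g i) -> hasum f v -> hasum g v.
Proof. intros H; replace g with f; auto. apply functional_extensionality; auto. Qed.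

Lemma hasum_plus {I} (f g : I -> C) v w :
  hasum f v -> hasum g w -> hasum (fun i => f i + g i)%C (v + w)%C.
Proof.
  intros Hv Hw e He.
  generalize (ev_and _ _ (Hv _ (is_half _ He)) (Hw _ (is_half _ He))).
  apply ev_mono; intros G _ [H1 H2]. rewrite csum_plus.
  replace (_ - _)%C with ((csum f G - v) + (csum g G - w))%C by ring.
  eapply Rle_lt_trans; [apply Cmod_triangle|lra].
Qed.

Lemma hasum_scal {I} c (f : I -> C) v : hasum f v -> hasum (fun i => c * f i)%C (c * v)%C.
Proof.
  intros Hv e He. assert (0 <= Cmod c) by apply Cmod_ge_0.
  assert (Hd : 0 < e / (Cmod c + 1)) by (apply Rdiv_lt_0_compat; lra).
  generalize (Hv _ Hd); apply ev_mono; intros G _ H1. rewrite csum_scal.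
  replace (_ - _)%C with (c * (csum f G - v))%C by ring. rewrite Cmod_mult.
  apply Rle_lt_trans with (Cmod c * (e / (Cmod c + 1))).
  - apply Rmult_le_compat_l; lra.
  - replace e with ((Cmod c + 1) * (e / (Cmod c + 1))) at 2 by (field; lra).
    apply Rmult_lt_compat_r; lra.
Qed.

Lemma hasum_minus {I} (f g : I -> C) v w :
  hasum f v -> hasum g w -> hasum (fun i => f i - g i)%C (v - w)%C.
Proof.
  intros Hv Hw. replace (v - w)%C with (v + (- (1)) * w)%C by ring.
  apply hasum_ext with (fun i => f i + (- (1)) * g i)%C; [intros; ring|].
  apply hasum_plus; [|apply hasum_scal]; assumption.
Qed.

Lemma hasum_0 {I} : hasum (fun _ : I => RtoC 0) (RtoC 0).
Proof.
  intros e He; exists []; intros G _ _.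
  replace (csum _ G) with (RtoC 0).
  - replace (RtoC 0 - RtoC 0)%C with (RtoC 0) by ring. rewrite Cmod_0; lra.
  - induction G; simpl; [|rewrite <- IHG]; ring.
Qed.

Lemma Cconj_minus (x y : C) : Cconj (x - y) = (Cconj x - Cconj y)%C.
Proof. unfold Cminus, Cplus, Copp, Cconj; simpl; f_equal; ring. Qed.

Lemma csum_conj {I} (f : I -> C) l : csum (fun i => Cconj (f i)) l = Cconj (csum f l).
Proof.
  induction l as [|a l IH]; simpl; [|rewrite IH];
    unfold Cplus, Cconj, RtoC; simpl; f_equal; ring.
Qed.

Lemma hasum_conj {I} (f : I -> C) v : hasum f v -> hasum (fun i => Cconj (f i)) (Cconj v).
Proof.
  intros H e He; generalize (H e He); apply ev_mono; intros G _ HG.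
  rewrite csum_conj, <- Cconj_minus, Cmod_conj. assumption.
Qed.

Lemma hasum_bound {I} (f : I -> C) v B :
  hasum f v -> bnd (fun i => Cmod (f i)) B -> Cmod v <= B.
Proof.
  intros H HB. apply le_epsilon; intros e He.
  destruct (ev_ex _ (H e He)) as (G & HG & H1).
  pose proof (Cmod_tri3 v (csum f G) 0%R).
  replace (v - 0)%C with v in H0 by ring. replace (csum f G - 0)%C with (csum f G) in H0 by ring.
  rewrite Cmod_sub_sym in H0. pose proof (Cmod_csum f G). specialize (HB G HG). lra.
Qed.

Lemma hasum_bij {I J} (f : J -> C) (h : I -> J) (k : J -> I) v :
  (forall i, k (h i) = i) -> (forall j, h (k j) = j) ->
  hasum f v -> hasum (fun i => f (h i)) v.
Proof.
  intros H1 H2 Hv e He. destruct (Hv e He) as (F & HF).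
  exists (map k F); intros G HG Hi. rewrite <- csum_map. apply HF.
  - apply FinFun.Injective_map_NoDup; [|assumption].
    intros x y E; rewrite <- (H1 x), <- (H1 y), E; reflexivity.
  - intros j Hj. rewrite <- (H2 j). apply in_map, Hi, in_map, Hj.
Qed.

Lemma bnd_le {I} (f g : I -> R) A B :
  (forall i, f i <= g i) -> A <= B -> bnd g A -> bnd f B.
Proof.
  intros H HA Hg l Hl. apply Rle_trans with (rsum g l); [apply rsum_le; auto|].
  apply Rle_trans with A; auto.
Qed.

Lemma bnd_mono {I} (f g : I -> R) B : (forall i, f i <= g i) -> bnd g B -> bnd f B.
Proof. intros H; apply bnd_le; [exact H|apply Rle_refl]. Qed.

Lemma bnd_plus {I} (f g : I -> R) A B : bnd f A -> bnd g B -> bnd (fun i => f i + g i) (A + B).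
Proof. intros H1 H2 l Hl. rewrite rsum_plus. apply Rplus_le_compat; auto. Qed.

Lemma bnd_scal {I} c (f : I -> R) A : 0 <= c -> bnd f A -> bnd (fun i => c * f i) (c * A).
Proof. intros Hc H l Hl. rewrite rsum_scal. apply Rmult_le_compat_l; auto. Qed.

Lemma bnd_nonneg {I} (f : I -> R) A : bnd f A -> 0 <= A.
Proof. intros H. specialize (H [] (NoDup_nil _)). simpl in H; lra. Qed.

Lemma bnd_inj {I J} (f : J -> R) (h : I -> J) A :
  (forall x y, h x = h y -> x = y) -> bnd f A -> bnd (fun i => f (h i)) A.
Proof.
  intros Hh H l Hl. rewrite <- rsum_map. apply H.
  apply FinFun.Injective_map_NoDup; assumption.
Qed.

Lemma bnd_term {I} (f : I -> R) A i : bnd f A -> f i <= A.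
Proof.
  intros H. specialize (H [i]). simpl in H. rewrite Rplus_0_r in H. apply H.
  constructor; [intros []|constructor].
Qed.

Lemma prod_cover {I J} (l : list (I * J)) :
  exists li lj, NoDup li /\ NoDup lj /\ incl l (list_prod li lj).
Proof.
  destruct (nodup_ex (map fst l)) as (li & H1 & H2).
  destruct (nodup_ex (map snd l)) as (lj & H3 & H4).
  exists li, lj; repeat split; auto. intros [x y] H. apply in_prod.
  - apply H2. apply (in_map fst) in H; assumption.
  - apply H4. apply (in_map snd) in H; assumption.
Qed.

Lemma NoDup_prod {I J} (l : list I) (m : list J) :
  NoDup l -> NoDup m -> NoDup (list_prod l m).
Proof.
  intros Hl Hm; induction Hl as [|a l Ha Hl IH]; simpl; [constructor|].
  apply NoDup_app; [|assumption|].
  - apply FinFun.Injective_map_NoDup; [|assumption]. intros x y E; congruence.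
  - intros [x y] Hx Hy. apply in_map_iff in Hx as (z & E & _).
    apply in_prod_iff in Hy as [Hy _]. congruence.
Qed.

(** Tonelli for bounds: a finite set of pairs is contained in a finite rectangle. *)
Lemma bnd_sigma {I J} (f : I * J -> R) g B :
  (forall i j, 0 <= f (i, j)) -> (forall i, bnd (fun j => f (i, j)) (g i)) -> bnd g B ->
  bnd f B.
Proof.
  intros Hf H1 H2 l Hl. destruct (prod_cover l) as (li & lj & Hi & Hj & Hc).
  apply Rle_trans with (rsum f (list_prod li lj)).
  - apply rsum_incl; auto. intros []; auto.
  - rewrite rsum_prod. apply Rle_trans with (rsum g li); [|auto].
    apply rsum_le; intros i _; apply H1; assumption.
Qed.

Lemma bnd_prod {I J} (f : I -> R) (g : J -> R) A B :
  (forall i, 0 <= f i) -> (forall j, 0 <= g j) -> bnd f A -> bnd g B ->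
  bnd (fun ij => f (fst ij) * g (snd ij)) (A * B).
Proof.
  intros Hf Hg HA HB. apply bnd_sigma with (fun i => f i * B); simpl.
  - intros; apply Rmult_le_pos; auto.
  - intros i. apply bnd_scal; auto.
  - intros l Hl. rewrite rsum_scal_r. apply Rmult_le_compat_r; auto.
    eapply bnd_nonneg; eassumption.
Qed.

Lemma bnd_fiber {I J} (f : I * J -> R) B i : bnd f B -> bnd (fun j => f (i, j)) B.
Proof. intros H. apply (bnd_inj f (fun j => (i, j))); [congruence|assumption]. Qed.

Lemma bnd_tail {I} (f : I -> R) B : (forall i, 0 <= f i) -> bnd f B ->
  forall e, 0 < e -> exists F, NoDup F /\
    forall G, NoDup G -> (forall i, In i G -> ~ In i F) -> rsum f G <= e.
Proof.
  intros Hf HB e He.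
  set (E := fun x => exists l, NoDup l /\ x = rsum f l).
  destruct (completeness E) as (m & Hub & Hlub).
  - exists B. intros x (l & Hl & ->); auto.
  - exists 0, []; split; [constructor|reflexivity].
  - destruct (classic (exists F, NoDup F /\ m - e < rsum f F)) as [(F & HF & Hm)|Hn].
    + exists F; split; [assumption|]. intros G HG Hd.
      assert (rsum f (F ++ G) <= m).
      { apply Hub. exists (F ++ G); split; [|reflexivity].
        apply NoDup_app; auto. intros i H1 H2; exact (Hd i H2 H1). }
      rewrite rsum_app in H. lra.
    + assert (m <= m - e); [|lra]. apply Hlub. intros x (l & Hl & ->).
      apply Rnot_lt_le; intros Hlt. apply Hn; exists l; auto.
Qed.

Lemma csum_diff_tail {I} (f : I -> C) (F G : list I) e :
  NoDup F -> (forall H, NoDup H -> (forall i, In i H -> ~ In i F) ->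
                rsum (fun i => Cmod (f i)) H <= e) ->
  NoDup G -> incl F G -> Cmod (csum f G - csum f F) <= e.
Proof.
  intros HF Ht HG Hi. destruct (nodup_diff F G HF HG Hi) as (H & H1 & H2 & H3).
  rewrite (csum_perm f _ _ H3), csum_app.
  replace (_ - _)%C with (csum f H) by ring.
  eapply Rle_trans; [apply Cmod_csum|auto].
Qed.

Global Instance ev_filter {I} : ProperFilter (@ev I).
Proof.
  constructor.
  - intros P HP. destruct (ev_ex P HP) as (G & _ & H). exists G; exact H.
  - constructor.
    + exists []; auto.
    + intros P Q; apply ev_and.
    + intros P Q H; apply ev_mono; auto.
Qed.

Lemma Cmod_parts (z : C) : Rabs (fst z) <= Cmod z /\ Rabs (snd z) <= Cmod z.
Proof. split; (eapply Rle_trans; [|apply Rmax_Cmod]); [apply Rmax_l|apply Rmax_r]. Qed.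

Lemma Cmod_le_parts (z : C) m : Rabs (fst z) <= m -> Rabs (snd z) <= m -> Cmod z <= 2 * m.
Proof.
  intros H1 H2. eapply Rle_trans; [apply Cmod_2Rmax|]. pose proof (Rabs_pos (fst z)).
  assert (sqrt 2 <= 2) by (rewrite <- (sqrt_pow2 2) at 2 by lra; apply sqrt_le_1_alt; lra).
  pose proof (sqrt_pos 2). apply Rmult_le_compat; try lra.
  - eapply Rle_trans; [|apply Rmax_l]; assumption.
  - apply Rmax_lub; assumption.
Qed.

Lemma ball_Cmod (x y : C) e :
  @ball C_R_CompleteNormedModule x e y -> Cmod (x - y) < 2 * e.
Proof.
  intros [H1 H2]. change (Rabs (fst y - fst x) < e) in H1.
  change (Rabs (snd y - snd x) < e) in H2.
  set (m := Rmax (Rabs (fst y - fst x)) (Rabs (snd y - snd x))).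
  assert (m < e) by (apply Rmax_lub_lt; assumption).
  apply Rle_lt_trans with (2 * m); [|lra]. rewrite Cmod_sub_sym. apply Cmod_le_parts; [apply Rmax_l|apply Rmax_r].
Qed.

Lemma Cmod_ball (x y : C) e : Cmod (x - y) < e -> @ball C_R_CompleteNormedModule x e y.
Proof.
  intros H. rewrite Cmod_sub_sym in H. destruct (Cmod_parts (y - x)%C) as [H1 H2].
  split; (eapply Rle_lt_trans; [|exact H]); assumption.
Qed.

(** Completeness of [C] along the filter of finite sets, the tails being uniformly small. *)
Lemma asum_ex {I} (f : I -> C) : asum f -> exists v, hasum f v.
Proof.
  intros (B & HB).
  assert (Hc : @cauchy C_R_CompleteNormedModule (fun P => ev (fun G => P (csum f G)))).
  { intros [e He]. destruct (bnd_tail _ _ (fun i => Cmod_ge_0 (f i)) HB _ (is_half _ He))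
      as (F & HF & Ht).
    exists (csum f F). exists F; intros G HG Hi. apply Cmod_ball. rewrite Cmod_sub_sym.
    eapply Rle_lt_trans; [apply csum_diff_tail with (e := e / 2); eauto|simpl; lra]. }
  assert (HPF : ProperFilter (fun P : C -> Prop => ev (fun G => P (csum f G)))).
  { exact (filtermap_proper_filter (list I) C (csum f) (@ev I) ev_filter). }
  exists (@lim C_R_CompleteNormedModule (fun P => ev (fun G => P (csum f G)))).
  intros e He. assert (He2 : 0 < e / 2) by lra.
  generalize (@complete_cauchy C_R_CompleteNormedModule _ HPF Hc (mkposreal _ He2)). apply ev_mono.
  intros G _ HG. apply ball_Cmod in HG. rewrite Cmod_sub_sym. replace e with (2 * (e / 2)) by field. exact HG.
Qed.

Lemma tsum_ok {I} (f : I -> C) : asum f -> hasum f (tsum f).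
Proof. intros H. apply (epsilon_spec (inhabits (RtoC 0)) (hasum f)), asum_ex, H. Qed.

Lemma tsum_eq {I} (f : I -> C) v : hasum f v -> tsum f = v.
Proof.
  intros H. apply (hasum_unique f); [|assumption].
  apply (epsilon_spec (inhabits (RtoC 0)) (hasum f)). exists v; assumption.
Qed.

Lemma asum_scal {I} c (f : I -> C) : asum f -> asum (fun i => c * f i)%C.
Proof.
  intros (B & HB); exists (Cmod c * B).
  apply bnd_le with (fun i => Cmod c * Cmod (f i)) (Cmod c * B);
    [intros; rewrite Cmod_mult; lra|lra|]. apply bnd_scal; [apply Cmod_ge_0|assumption].
Qed.

Lemma asum_plus {I} (f g : I -> C) : asum f -> asum g -> asum (fun i => f i + g i)%C.
Proof.
  intros (A & HA) (B & HB); exists (A + B).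
  eapply bnd_mono; [|exact (bnd_plus _ _ _ _ HA HB)].
  intros; apply Cmod_triangle.
Qed.

(** Over a rectangle of enough rows and columns the double sum is close both to [v] and, row by row, to the
    partial sum of [g]. *)
Lemma hasum_fubini {I J} (f : I * J -> C) (g : I -> C) v :
  asum f -> hasum f v -> (forall i, hasum (fun j => f (i, j)) (g i)) -> hasum g v.
Proof.
  intros (B & HB) Hv Hg e He.
  destruct (Hv _ (is_half _ He)) as (F & HF).
  exists (map fst F); intros G HG Hi.
  set (d := e / 2 / (INR (length G) + 1)).
  assert (HL : 0 < INR (length G) + 1) by (pose proof (pos_INR (length G)); lra).
  assert (Hd : 0 < d) by (apply Rdiv_lt_0_compat; lra).
  destruct (ev_ex (fun m => (forall i, In i G -> Cmod (csum (fun j => f (i, j)) m - g i) < d)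
     /\ incl (map snd F) m)) as (m & Hm & H1 & H2).
  { apply ev_and; [|apply ev_incl]. apply ev_all; intros i _. apply Hg; assumption. }
  assert (H3 : Cmod (csum f (list_prod G m) - v) < e / 2).
  { apply HF; [apply NoDup_prod; assumption|]. intros [x y] Hx. apply in_prod.
    - apply Hi. apply (in_map fst) in Hx; assumption.
    - apply H2. apply (in_map snd) in Hx; assumption. }
  assert (H4 : Cmod (csum g G - csum f (list_prod G m)) <= INR (length G) * d).
  { rewrite csum_prod, <- rsum_const.
    replace (_ - _)%C with (csum (fun i => g i - csum (fun j => f (i, j)) m)%C G).
    - eapply Rle_trans; [apply Cmod_csum|]. apply rsum_le; intros i Hi'.
      rewrite Cmod_sub_sym. left; auto.
    - clear. induction G; simpl; [|rewrite IHG]; ring. }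
  assert (INR (length G) * d < e / 2).
  { unfold d. apply Rlt_le_trans with ((INR (length G) + 1) * (e / 2 / (INR (length G) + 1))).
    - apply Rmult_lt_compat_r; [exact Hd|lra].
    - right; field; lra. }
  pose proof (Cmod_tri3 (csum g G) (csum f (list_prod G m)) v). lra.
Qed.

Lemma bnd_hasum_fiber {I J} (f : I * J -> C) (g : I -> C) B :
  bnd (fun x => Cmod (f x)) B -> (forall i, hasum (fun j => f (i, j)) (g i)) ->
  bnd (fun i => Cmod (g i)) B.
Proof.
  intros HB Hg G HG. apply le_epsilon; intros e He.
  set (d := e / (INR (length G) + 1)).
  assert (HL : 0 < INR (length G) + 1) by (pose proof (pos_INR (length G)); lra).
  assert (Hd : 0 < d) by (apply Rdiv_lt_0_compat; lra).
  destruct (ev_ex (fun m => forall i, In i G -> Cmod (csum (fun j => f (i, j)) m - g i) < d))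
    as (m & Hm & H1).
  { apply ev_all; intros i _. apply Hg; assumption. }
  apply Rle_trans with (rsum (fun i => d + rsum (fun j => Cmod (f (i, j))) m) G).
  - apply rsum_le; intros i Hi. pose proof (Cmod_tri3 (g i) (csum (fun j => f (i, j)) m) 0%R).
    replace (g i - 0)%C with (g i) in H by ring.
    replace (csum (fun j => f (i, j)) m - 0)%C with (csum (fun j => f (i, j)) m) in H by ring.
    rewrite Cmod_sub_sym in H. specialize (H1 i Hi).
    pose proof (Cmod_csum (fun j => f (i, j)) m). lra.
  - rewrite rsum_plus, rsum_const.
    pose proof (HB _ (NoDup_prod G m HG Hm)). rewrite rsum_prod in H.
    assert (INR (length G) * d <= e).
    { unfold d. apply Rle_trans with ((INR (length G) + 1) * (e / (INR (length G) + 1))).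
      - apply Rmult_le_compat_r; [left; exact Hd|lra].
      - right; field; lra. }
    lra.
Qed.

Lemma asum_prod {I J} (f : I -> C) (g : J -> C) :
  asum f -> asum g -> asum (fun x => f (fst x) * g (snd x))%C.
Proof.
  intros (A & HA) (B & HB). exists (A * B).
  eapply bnd_mono; [|
    apply (bnd_prod (fun i => Cmod (f i)) (fun j => Cmod (g j)) A B); try eassumption;
    intros; apply Cmod_ge_0].
  intros; simpl; rewrite Cmod_mult; lra.
Qed.

Lemma hasum_prod {I J} (f : I -> C) (g : J -> C) v w :
  asum f -> asum g -> hasum f v -> hasum g w ->
  hasum (fun x => f (fst x) * g (snd x))%C (v * w)%C.
Proof.
  intros Hf Hg Hv Hw. pose proof (asum_prod f g Hf Hg) as Ha.
  destruct (asum_ex _ Ha) as (z & Hz).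
  replace (v * w)%C with z; [assumption|].
  apply (hasum_unique (fun i => f i * w)%C).
  - apply (hasum_fubini (fun x => f (fst x) * g (snd x))%C); [assumption..|].
    intros i; simpl. apply hasum_scal; assumption.
  - rewrite Cmult_comm. apply hasum_ext with (fun i => w * f i)%C; [intros; ring|].
    apply hasum_scal; assumption.
Qed.

Lemma hasum_single {I} (f : I -> C) (i0 : I) :
  (forall i, i <> i0 -> f i = RtoC 0) -> hasum f (f i0).
Proof.
  intros H e He; exists [i0]; intros G HG Hi.
  destruct (in_split i0 G) as (l & m & ->); [apply Hi; left; reflexivity|].
  apply NoDup_remove_2 in HG. rewrite csum_app; simpl.
  assert (Hz : forall k, (forall i, In i k -> i <> i0) -> csum f k = RtoC 0).
  { induction k; simpl; intros Hk; [reflexivity|]. rewrite IHk, H by auto. ring. }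
  rewrite (Hz l), (Hz m).
  - replace (_ - _)%C with (RtoC 0) by ring. rewrite Cmod_0; lra.
  - intros i Hm ->; apply HG, in_or_app; auto.
  - intros i Hm ->; apply HG, in_or_app; auto.
Qed.

Lemma hasum_Re_ge {I} (f : I -> C) v (l : list I) :
  hasum f v -> (forall i, 0 <= Re (f i)) -> NoDup l -> rsum (fun i => Re (f i)) l <= Re v.
Proof.
  intros Hv Hp Hl. apply le_epsilon; intros e He.
  destruct (ev_ex _ (ev_and _ _ (Hv e He) (ev_incl l))) as (G & HG & H1 & H2).
  pose proof (rsum_incl _ _ _ Hp Hl H2). rewrite <- (Re_csum f G) in H.
  pose proof (re_le_Cmod (csum f G - v)%C).
  assert (Hr : Re (csum f G - v) = Re (csum f G) - Re v) by
    (unfold Re, Cminus, Cplus, Copp; simpl; ring).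
  rewrite Hr in H0. apply Rabs_le_between in H0 as [H0 H0']. lra.
Qed.

(** * Sums over the integers *)

Fixpoint zbox (N : nat) : list Z :=
  match N with
  | O => [0%Z]
  | S n => Z.of_nat (S n) :: (- Z.of_nat (S n))%Z :: zbox n
  end.

Lemma in_zbox N k : In k (zbox N) <-> (Z.abs k <= Z.of_nat N)%Z.
Proof.
  induction N as [|n IH]; cbn [zbox In].
  - lia.
  - rewrite IH. lia.
Qed.

Lemma nodup_zbox N : NoDup (zbox N).
Proof.
  induction N as [|n IH]; cbn [zbox].
  - repeat constructor; intros [].
  - constructor; [|constructor; [|assumption]].
    + intros [H|H]; [lia|apply in_zbox in H; lia].
    + intros H; apply in_zbox in H; lia.
Qed.

Lemma zbox_cover (l : list Z) : exists N0, forall N, (N0 <= N)%nat -> incl l (zbox N).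
Proof.
  induction l as [|a l (N0 & IH)].
  - exists O; intros N _ x [].
  - exists (Nat.max (Z.abs_nat a) N0); intros N HN x [<-|Hx].
    + apply in_zbox; lia.
    + apply IH; [lia|assumption].
Qed.

Lemma rsum_zbox (f : Z -> R) N : rsum f (zbox N) = sum_n (zterm (V := R_NormedModule) f) N.
Proof.
  induction N as [|n IH].
  - rewrite sum_O; simpl; ring.
  - rewrite sum_Sn, <- IH. cbn [zbox]. unfold rsum at 1; cbn [fold_right].
    fold (rsum f (zbox n)). unfold zterm, plus; simpl. unfold plus; simpl. ring.
Qed.

Lemma csum_zbox (f : Z -> C) N : csum f (zbox N) = sum_n (zterm (V := C_R_NormedModule) f) N.
Proof.
  induction N as [|n IH].
  - rewrite sum_O; simpl; ring.
  - rewrite sum_Sn, <- IH. cbn [zbox]. unfold csum at 1; cbn [fold_right].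
    fold (csum f (zbox n)). unfold zterm.
    change (f (Z.of_nat (S n)) + (f (- Z.of_nat (S n))%Z + csum f (zbox n)) =
      csum f (zbox n) + (f (Z.of_nat (S n)) + f (- Z.of_nat (S n))%Z))%C. ring.
Qed.

(** The symmetric partial sums are the sums over the boxes [zbox N], which exhaust the integers. *)
Lemma hasum_is_zsum (f : Z -> C) v : hasum f v -> is_zsum f v.
Proof.
  intros H. unfold is_zsum, is_series.
  apply (filterlim_ext (fun N => csum f (zbox N))); [intros; apply csum_zbox|].
  apply filterlim_locally; intros [e He].
  destruct (H e He) as (F & HF). destruct (zbox_cover F) as (N0 & HN).
  exists N0; intros N HN'. apply Cmod_ball. rewrite Cmod_sub_sym. simpl.
  apply HF; [apply nodup_zbox|auto].
Qed.

Lemma is_zsum_hasum (f : Z -> C) v : asum f -> is_zsum f v -> hasum f v.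
Proof.
  intros Ha Hv. destruct (asum_ex f Ha) as (w & Hw).
  replace v with w; [assumption|].
  apply hasum_is_zsum in Hw. unfold is_zsum, is_series in *.
  exact (filterlim_locally_unique _ _ _ Hw Hv).
Qed.

Lemma bnd_zbox (f : Z -> R) B :
  (forall k, 0 <= f k) -> (forall N, rsum f (zbox N) <= B) -> bnd f B.
Proof.
  intros Hf H l Hl. destruct (zbox_cover l) as (N & HN).
  apply Rle_trans with (rsum f (zbox N)); [|auto].
  apply rsum_incl; auto.
Qed.

Lemma zterm_nonneg (f : Z -> R) n : (forall k, 0 <= f k) -> 0 <= zterm (V := R_NormedModule) f n.
Proof.
  intros H; destruct n; simpl; [auto|]. unfold plus; simpl. apply Rplus_le_le_0_compat; auto.
Qed.

Lemma Rle_plus_r (x y : R) : 0 <= y -> x <= @plus R_NormedModule x y.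
Proof. intros H. change (x <= x + y). lra. Qed.

Lemma ex_zsumR_bnd (f : Z -> R) : (forall k, 0 <= f k) -> ex_zsumR f -> bnd f (zsumR f).
Proof.
  intros Hf H. apply bnd_zbox; [assumption|]. intros N. rewrite rsum_zbox.
  apply Series_correct in H.
  apply (is_lim_seq_incr_compare (sum_n (zterm (V := R_NormedModule) f))); [exact H|].
  intros n. rewrite sum_Sn. apply Rle_plus_r, zterm_nonneg, Hf.
Qed.

Lemma bnd_ex_zsumR (f : Z -> R) B :
  (forall k, 0 <= f k) -> bnd f B -> ex_zsumR f /\ zsumR f <= B /\ 0 <= zsumR f.
Proof.
  intros Hf H.
  assert (Hex : ex_finite_lim_seq (sum_n (zterm (V := R_NormedModule) f))).
  { apply ex_finite_lim_seq_incr with B.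
    - intros n. rewrite sum_Sn. apply Rle_plus_r, zterm_nonneg, Hf.
    - intros n. rewrite <- rsum_zbox. apply H, nodup_zbox. }
  assert (Hs : ex_zsumR f).
  { destruct Hex as (l & Hl). exists l. exact Hl. }
  assert (Hl := Series_correct _ Hs).
  split; [assumption|]. split.
  - assert (Hb : Rbar_le (zsumR f) B); [|exact Hb].
    apply is_lim_seq_le with (u := sum_n (zterm (V := R_NormedModule) f)) (v := fun _ => B).
    + intros n. rewrite <- rsum_zbox. apply H, nodup_zbox.
    + exact Hl.
    + apply is_lim_seq_const.
  - assert (Hb : Rbar_le 0 (zsumR f)); [|exact Hb].
    apply is_lim_seq_le with (u := fun _ => 0) (v := sum_n (zterm (V := R_NormedModule) f)).
    + intros n. rewrite <- rsum_zbox. apply rsum_nonneg; auto.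
    + apply is_lim_seq_const.
    + exact Hl.
Qed.

Lemma zsumR_hasum (f : Z -> R) : (forall k, 0 <= f k) -> ex_zsumR f ->
  hasum (fun k => RtoC (f k)) (RtoC (zsumR f)).
Proof.
  intros Hf H. pose proof (ex_zsumR_bnd f Hf H) as Hb.
  intros e He. destruct (bnd_tail f _ Hf Hb (e / 2) (is_half _ He)) as (F & HF & Ht).
  destruct (zbox_cover F) as (N0 & HN).
  assert (Hlim : is_lim_seq (sum_n (zterm (V := R_NormedModule) f)) (zsumR f))
    by exact (Series_correct _ H).
  apply is_lim_seq_spec in Hlim.
  destruct (Hlim (mkposreal _ (is_half _ He))) as (N1 & H1).
  set (N := Nat.max N0 N1).
  exists (zbox N); intros G HG Hi.
  specialize (H1 N ltac:(lia)). rewrite <- rsum_zbox in H1.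
  rewrite csum_RtoC, <- RtoC_minus, Cmod_R.
  destruct (nodup_diff (zbox N) G (nodup_zbox N) HG Hi) as (K & K1 & K2 & K3).
  rewrite (rsum_perm _ _ _ K3), rsum_app.
  assert (rsum f K <= e / 2).
  { apply Ht; [assumption|]. intros i H2 H3. apply (K2 i H2), (HN N); [lia|assumption]. }
  assert (0 <= rsum f K) by (apply rsum_nonneg; auto).
  simpl in H1. apply Rabs_lt_between in H1. apply Rabs_lt_between. lra.
Qed.

(** * The spaces [l^{2,s}] *)

Definition jap (k : Z) : R := 1 + Rabs (IZR k).

Lemma jap_ge1 k : 1 <= jap k.
Proof. unfold jap; pose proof (Rabs_pos (IZR k)); lra. Qed.

Lemma Rpower_pos x y : 0 < Rpower x y.
Proof. apply exp_pos. Qed.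

Lemma l2s_term_nonneg s a k : 0 <= l2s_term s a k.
Proof.
  apply Rmult_le_pos; [left; apply Rpower_pos|apply pow2_ge_0].
Qed.

Lemma in_l2s_bnd s a : in_l2s s a -> bnd (l2s_term s a) (l2s_norm s a ^ 2).
Proof.
  intros H. pose proof (ex_zsumR_bnd _ (l2s_term_nonneg s a) H) as Hb.
  unfold l2s_norm. rewrite pow2_sqrt; [assumption|]. eapply bnd_nonneg; eassumption.
Qed.

Lemma bnd_in_l2s s a B : 0 <= B -> bnd (l2s_term s a) (B ^ 2) -> in_l2s s a /\ l2s_norm s a <= B.
Proof.
  intros HB H. destruct (bnd_ex_zsumR _ _ (l2s_term_nonneg s a) H) as (H1 & H2 & H3).
  split; [assumption|]. unfold l2s_norm. rewrite <- (sqrt_pow2 B HB). apply sqrt_le_1_alt, H2.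
Qed.

Lemma l2s_norm_nonneg s a : 0 <= l2s_norm s a.
Proof. apply sqrt_pos. Qed.

(** Mean value theorem for the primitive of [y^(-s)]: the sum of the right-hand sides telescopes. *)
Lemma Rpower_telescope s x : 1 < s -> 0 < x ->
  Rpower (x + 1) (- s) <= (Rpower x (1 - s) - Rpower (x + 1) (1 - s)) / (s - 1).
Proof.
  intros Hs Hx.
  destruct (MVT_gen (fun y => Rpower y (1 - s)) x (x + 1)
     (fun y => (1 - s) * Rpower y (- s))) as (c & Hc & E).
  - intros y Hy. rewrite Rmin_left, Rmax_right in Hy by lra.
    replace (- s) with (1 - s - 1) by ring.
    apply is_derive_Reals, derivable_pt_lim_power. lra.
  - intros y Hy. rewrite Rmin_left, Rmax_right in Hy by lra.
    apply derivable_continuous_pt. exists ((1 - s) * Rpower y (1 - s - 1)).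
    apply derivable_pt_lim_power. lra.
  - rewrite Rmin_left, Rmax_right in Hc by lra. cbv beta in E.
    replace (x + 1 - x) with 1 in E by ring.
    replace (Rpower x (1 - s) - Rpower (x + 1) (1 - s)) with ((s - 1) * Rpower c (- s)) by lra.
    replace ((s - 1) * Rpower c (- s) / (s - 1)) with (Rpower c (- s)) by (field; lra).
    rewrite !Rpower_Ropp. apply Rinv_le_contravar; [apply Rpower_pos|].
    apply Rle_Rpower_l; lra.
Qed.

Lemma sum_Rpower_le s N : 1 < s ->
  sum_f_R0 (fun n => Rpower (INR n + 2) (- s)) N
    <= Rpower 2 (- s) + (Rpower 2 (1 - s) - Rpower (INR N + 2) (1 - s)) / (s - 1).
Proof.
  intros Hs; induction N as [|n IH].
  - simpl. rewrite Rplus_0_l. unfold Rdiv. rewrite Rminus_diag. lra.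
  - rewrite tech5, S_INR.
    pose proof (pos_INR n). pose proof (Rpower_telescope s (INR n + 2) Hs ltac:(lra)).
    replace (INR n + 1 + 2) with (INR n + 2 + 1) by ring.
    unfold Rdiv in *. rewrite !Rmult_minus_distr_r in *. lra.
Qed.

Lemma rsum_zbox_even (g : nat -> R) (f : Z -> R) N :
  (forall k, f k = g (Z.abs_nat k)) ->
  rsum f (zbox (S N)) = g O + 2 * sum_f_R0 (fun n => g (S n)) N.
Proof.
  intros H. induction N as [|n IH].
  - cbn [zbox]. unfold rsum; cbn [fold_right]. rewrite !H.
    change (Z.abs_nat (Z.of_nat 1)) with 1%nat. change (Z.abs_nat (- Z.of_nat 1)) with 1%nat.
    change (Z.abs_nat 0) with O. simpl; ring.
  - cbn [zbox] in *. unfold rsum in *; cbn [fold_right] in *. rewrite IH.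
    rewrite (H (Z.of_nat (S (S n)))), (H (- Z.of_nat (S (S n)))%Z). rewrite tech5.
    replace (Z.abs_nat (Z.of_nat (S (S n)))) with (S (S n)) by lia.
    replace (Z.abs_nat (- Z.of_nat (S (S n)))) with (S (S n)) by lia. ring.
Qed.

Lemma bnd_even (g : nat -> R) (f : Z -> R) B :
  (forall k, f k = g (Z.abs_nat k)) -> (forall n, 0 <= g n) ->
  (forall N, g O + 2 * sum_f_R0 (fun n => g (S n)) N <= B) -> bnd f B.
Proof.
  intros H Hg HB. apply bnd_zbox; [intros; rewrite H; auto|].
  intros N. apply Rle_trans with (rsum f (zbox (S N))).
  - apply rsum_incl; [intros; rewrite H; auto|apply nodup_zbox|].
    intros k; rewrite !in_zbox; lia.
  - rewrite (rsum_zbox_even g); auto.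
Qed.

Lemma jap_INR k : jap k = INR (Z.abs_nat k) + 1.
Proof. unfold jap. rewrite INR_IZR_INZ, Zabs2Nat.id_abs, abs_IZR. ring. Qed.

Lemma bnd_jap s : 1 < s ->
  bnd (fun k => Rpower (jap k) (- s)) (1 + 2 * (Rpower 2 (- s) + Rpower 2 (1 - s) / (s - 1))).
Proof.
  intros Hs. apply bnd_even with (fun n => Rpower (INR n + 1) (- s)).
  - intros k; rewrite jap_INR; reflexivity.
  - intros n; left; apply Rpower_pos.
  - intros N. simpl INR at 1. rewrite Rplus_0_l.
    replace (Rpower 1 (- s)) with 1 by (unfold Rpower; rewrite ln_1, Rmult_0_r, exp_0; reflexivity).
    apply Rplus_le_compat_l, Rmult_le_compat_l; [lra|].
    replace (sum_f_R0 _ N) with (sum_f_R0 (fun n => Rpower (INR n + 2) (- s)) N).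
    + eapply Rle_trans; [apply sum_Rpower_le, Hs|]. apply Rplus_le_compat_l.
      unfold Rdiv; apply Rmult_le_compat_r; [left; apply Rinv_0_lt_compat; lra|].
      pose proof (Rpower_pos (INR N + 2) (1 - s)); lra.
    + apply sum_eq; intros n _. rewrite S_INR. f_equal; ring.
Qed.

(** Cauchy-Schwarz against the summable weight [(1+|k|)^(-2s)]. *)
Lemma l2s_l1 s a B (w : Z -> R) W :
  bnd (l2s_term s a) (B ^ 2) -> 0 <= B -> 0 <= W ->
  (forall k, 0 <= w k <= 1) ->
  bnd (fun k => w k * Rpower (jap k) (- (2 * s))) (W ^ 2) ->
  bnd (fun k => w k * Cmod (a k)) (W * B).
Proof.
  intros Ha HB HW Hw HWb l Hl.
  assert (H : rsum (fun k => w k * Cmod (a k)) l ^ 2 <= (W * B) ^ 2).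
  { replace (rsum _ l) with (rsum (fun k => (w k * Rpower (jap k) (- s)) *
        (Rpower (jap k) s * Cmod (a k))) l).
    - eapply Rle_trans; [apply rsum_CS|].
      replace ((W * B) ^ 2) with (W ^ 2 * B ^ 2) by ring.
      apply Rmult_le_compat; try (apply rsum_nonneg; intros; apply pow2_ge_0).
      + eapply Rle_trans; [|apply HWb, Hl]. apply rsum_le; intros k _.
        replace (- (2 * s)) with (- s + - s) by ring. rewrite Rpower_plus.
        specialize (Hw k). set (r := Rpower _ _).
        assert (0 < r) by apply Rpower_pos. assert (0 <= r * r) by nra.
        replace ((w k * r) ^ 2) with (w k * (w k * (r * r))) by ring.
        apply Rmult_le_compat_l; [lra|]. nra.
      + eapply Rle_trans; [|apply Ha, Hl]. apply rsum_le; intros k _.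
        unfold l2s_term. fold (jap k). replace (2 * s) with (s + s) by ring. rewrite Rpower_plus.
        right; ring.
    - apply rsum_ext; intros k _.
      replace ((w k * Rpower (jap k) (- s)) * (Rpower (jap k) s * Cmod (a k))) with
        (w k * Cmod (a k) * (Rpower (jap k) (- s) * Rpower (jap k) s)) by ring.
      rewrite <- Rpower_plus, Rplus_opp_l, Rpower_O; [ring|].
      pose proof (jap_ge1 k); lra. }
  apply Rsqr_incr_0_var; [unfold Rsqr; simpl in H; lra|apply Rmult_le_pos; assumption].
Qed.

(** * Uniformly summable families *)

Definition ind {I} (F : list I) (i : I) : R :=
  if excluded_middle_informative (In i F) then 0 else 1.

Lemma ind_in {I} (F : list I) i : In i F -> ind F i = 0.
Proof. intros H; unfold ind; destruct (excluded_middle_informative _); tauto. Qed.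

Lemma ind_out {I} (F : list I) i : ~ In i F -> ind F i = 1.
Proof. intros H; unfold ind; destruct (excluded_middle_informative _); tauto. Qed.

Lemma ind_01 {I} (F : list I) i : 0 <= ind F i <= 1.
Proof. unfold ind; destruct (excluded_middle_informative _); lra. Qed.

(** Summability uniform in the parameter [p]: a common bound, and tails outside a finite set that are
    small uniformly.  It is what termwise limits and derivatives in [p] require. *)
Definition US {P I : Type} (D : P -> Prop) (f : P -> I -> R) : Prop :=
  (forall p i, D p -> 0 <= f p i) /\
  (exists B, forall p, D p -> bnd (f p) B) /\
  (forall e, 0 < e -> exists F, forall p, D p -> bnd (fun i => ind F i * f p i) e).

Lemma ind_filter {I} (f : I -> R) (F l : list I) : NoDup l ->
  exists l', NoDup l' /\ (forall i, In i l' -> In i l /\ ~ In i F) /\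
    rsum (fun i => ind F i * f i) l = rsum f l'.
Proof.
  induction l as [|a l IH]; intros Hl.
  - exists []; split; [constructor|split; [intros i []|reflexivity]].
  - inversion_clear Hl as [|? ? Ha Hl']. destruct (IH Hl') as (l' & H1 & H2 & H3).
    destruct (classic (In a F)) as [Hi|Hi].
    + exists l'; repeat split; [assumption|right; apply H2; assumption|apply H2; assumption|].
      rewrite <- H3. simpl. rewrite (ind_in F a Hi). ring.
    + exists (a :: l'); repeat split.
      * constructor; [intros H; apply Ha, H2, H|assumption].
      * destruct H as [->|H]; [left; reflexivity|right; apply H2; assumption].
      * destruct H as [->|H]; [assumption|apply H2; assumption].
      * simpl. rewrite <- H3, (ind_out F a Hi). ring.
Qed.

Lemma US_const {P I} (D : P -> Prop) (f : I -> R) B :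
  (forall i, 0 <= f i) -> bnd f B -> US D (fun _ => f).
Proof.
  intros Hf HB. split; [auto|]. split; [exists B; auto|].
  intros e He. destruct (bnd_tail f B Hf HB e He) as (F & _ & HF).
  exists F; intros _ _ l Hl. destruct (ind_filter f F l Hl) as (l' & H1 & H2 & ->).
  apply HF; [assumption|]. intros i Hi; apply H2, Hi.
Qed.

Lemma US_le {P I} (D : P -> Prop) (f g : P -> I -> R) :
  (forall p i, D p -> 0 <= f p i <= g p i) -> US D g -> US D f.
Proof.
  intros H (H1 & (B & H2) & H3). split; [intros; apply H; assumption|]. split.
  - exists B. intros p Hp. eapply bnd_le; [intros i; apply (H p i Hp)|apply Rle_refl|auto].
  - intros e He; destruct (H3 e He) as (F & HF). exists F; intros p Hp.
    eapply bnd_mono; [|apply (HF p Hp)]. intros i.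
    apply Rmult_le_compat_l; [apply ind_01|apply H; assumption].
Qed.

Lemma US_plus {P I} (D : P -> Prop) (f g : P -> I -> R) :
  US D f -> US D g -> US D (fun p i => f p i + g p i).
Proof.
  intros (H1 & (B & H2) & H3) (H1' & (B' & H2') & H3'). split; [|split].
  - intros; apply Rplus_le_le_0_compat; auto.
  - exists (B + B'). intros p Hp; apply bnd_plus; auto.
  - intros e He. destruct (H3 _ (is_half _ He)) as (F & HF).
    destruct (H3' _ (is_half _ He)) as (F' & HF'). exists (F ++ F'); intros p Hp.
    apply bnd_le with (fun i => ind F i * f p i + ind F' i * g p i) (e / 2 + e / 2);
      [|lra|apply bnd_plus; auto].
    intros i. specialize (H1 p i Hp). specialize (H1' p i Hp).
    destruct (classic (In i (F ++ F'))) as [Hi|Hi].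
    + rewrite (ind_in _ _ Hi). pose proof (ind_01 F i). pose proof (ind_01 F' i). nra.
    + rewrite (ind_out _ _ Hi), (ind_out F), (ind_out F'); [lra|..];
        intros H; apply Hi, in_or_app; auto.
Qed.

Lemma US_scal {P I} (D : P -> Prop) c (f : P -> I -> R) :
  0 <= c -> US D f -> US D (fun p i => c * f p i).
Proof.
  intros Hc (H1 & (B & H2) & H3). split; [|split].
  - intros; apply Rmult_le_pos; auto.
  - exists (c * B); intros p Hp; apply bnd_scal; auto.
  - intros e He. assert (Hd : 0 < e / (c + 1)) by (apply Rdiv_lt_0_compat; lra).
    destruct (H3 _ Hd) as (F & HF). exists F; intros p Hp.
    apply bnd_le with (fun i => c * (ind F i * f p i)) (c * (e / (c + 1))).
    + intros i; right; ring.
    + apply Rle_trans with ((c + 1) * (e / (c + 1))).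
      * apply Rmult_le_compat_r; lra.
      * right; field; lra.
    + apply bnd_scal; auto.
Qed.

Lemma US_prod {P I J} (D : P -> Prop) (f : P -> I -> R) (g : P -> J -> R) :
  US D f -> US D g -> US D (fun p x => f p (fst x) * g p (snd x)).
Proof.
  intros (H1 & (B & H2) & H3) (H1' & (B' & H2') & H3'). split; [|split].
  - intros; apply Rmult_le_pos; auto.
  - exists (B * B'); intros p Hp; apply bnd_prod; auto.
  - intros e He. set (c := Rabs B + Rabs B' + 1).
    assert (Hc : 0 < c) by (unfold c; pose proof (Rabs_pos B); pose proof (Rabs_pos B'); lra).
    assert (Hd : 0 < e / c) by (apply Rdiv_lt_0_compat; lra).
    destruct (H3 _ Hd) as (F & HF). destruct (H3' _ Hd) as (F' & HF').
    exists (list_prod F F'); intros p Hp.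
    assert (HB : bnd (fun x => (ind F (fst x) * f p (fst x)) * g p (snd x)) (e / c * B')).
    { apply (bnd_prod (fun i => ind F i * f p i) (g p)); auto.
      intros i; apply Rmult_le_pos; [apply ind_01|auto]. }
    assert (HB' : bnd (fun x => f p (fst x) * (ind F' (snd x) * g p (snd x))) (B * (e / c))).
    { apply (bnd_prod (f p) (fun i => ind F' i * g p i)); auto.
      intros i; apply Rmult_le_pos; [apply ind_01|auto]. }
    eapply bnd_le; [| |exact (bnd_plus _ _ _ _ HB HB')].
    + intros [i j]; simpl. specialize (H1 p i Hp). specialize (H1' p j Hp).
      pose proof (ind_01 F i). pose proof (ind_01 F' j).
      assert (0 <= f p i * g p j) by (apply Rmult_le_pos; auto).
      destruct (classic (In (i, j) (list_prod F F'))) as [Hi|Hi].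
      * rewrite (ind_in _ _ Hi). nra.
      * rewrite (ind_out _ _ Hi). destruct (classic (In i F)) as [Hx|Hx].
        -- rewrite (ind_out F' j); [nra|]. intros Hy; apply Hi, in_prod; assumption.
        -- rewrite (ind_out F i Hx). nra.
    + apply Rle_trans with (e / c * (Rabs B + Rabs B')).
      * pose proof (Rmult_le_compat_l _ _ _ (Rlt_le _ _ Hd) (Rle_abs B)).
        pose proof (Rmult_le_compat_l _ _ _ (Rlt_le _ _ Hd) (Rle_abs B')). lra.
      * apply Rle_trans with (e / c * c); [|right; field; lra].
        apply Rmult_le_compat_l; [lra|unfold c; lra].
Qed.

Lemma preimage_list {I J} (h : J -> I) (F : list I) :
  (forall x y, h x = h y -> x = y) -> exists F', forall j, In j F' <-> In (h j) F.
Proof.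
  intros Hh; induction F as [|a F (F' & IH)].
  - exists []; simpl; tauto.
  - destruct (classic (exists j, h j = a)) as [(j & Hj)|Hn].
    + exists (j :: F'); intros x; simpl. rewrite IH. split; intros [H|H]; auto.
      * subst; auto.
      * left; apply Hh; congruence.
    + exists F'; intros x; simpl. rewrite IH. split; [auto|intros [H|H]; auto].
      exfalso; apply Hn; exists x; auto.
Qed.

Lemma US_inj {P I J} (D : P -> Prop) (f : P -> I -> R) (h : J -> I) :
  (forall x y, h x = h y -> x = y) -> US D f -> US D (fun p j => f p (h j)).
Proof.
  intros Hh (H1 & (B & H2) & H3). split; [auto|]. split.
  - exists B; intros p Hp. apply bnd_inj; auto.
  - intros e He; destruct (H3 e He) as (F & HF).
    destruct (preimage_list h F Hh) as (F' & HF'). exists F'; intros p Hp.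
    apply bnd_le with (fun j => ind F (h j) * f p (h j)) e; [|lra|].
    + intros j. replace (ind F' j) with (ind F (h j)); [lra|].
      destruct (classic (In j F')) as [H|H].
      * rewrite (ind_in F' _ H). apply ind_in, HF', H.
      * rewrite (ind_out F' _ H). apply ind_out. rewrite <- HF'; assumption.
    + apply (bnd_inj (fun i => ind F i * f p i) h); auto.
Qed.

Lemma US_asum {P I} (D : P -> Prop) (f : P -> I -> C) p :
  US D (fun p i => Cmod (f p i)) -> D p -> asum (f p).
Proof. intros (_ & (B & H) & _) Hp. exists B; auto. Qed.

(** By Cauchy-Schwarz an [l^1] tail is at most the [l^{2,s}] norm times the square root of a tail of the
    convergent series of [(1+|k|)^(-2s)], which is the same for all [p]. *)
Lemma US_l2s {P} (D : P -> Prop) (a : P -> Z -> C) s B :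
  1 / 2 < s -> 0 <= B -> (forall p, D p -> bnd (l2s_term s (a p)) (B ^ 2)) ->
  US D (fun p k => Cmod (a p k)).
Proof.
  intros Hs HB H. set (w := fun k => Rpower (jap k) (- (2 * s))).
  pose proof (bnd_jap (2 * s) ltac:(lra)) as Hw. set (W := 1 + _) in Hw.
    assert (HW : 0 <= W) by (eapply bnd_nonneg; eassumption).
    split; [intros; apply Cmod_ge_0|]. split.
  - exists (sqrt W * B); intros p Hp.
    apply bnd_le with (fun k => 1 * Cmod (a p k)) (sqrt W * B); [intros; lra|lra|].
    apply (l2s_l1 s (a p) B (fun _ => 1)); auto; [apply sqrt_pos|intros; lra|].
    rewrite pow2_sqrt by assumption.
    apply bnd_le with w W; [intros; unfold w; lra|lra|exact Hw].
  - intros e He. assert (Hd : 0 < (e / (B + 1)) ^ 2).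
      { apply pow_lt, Rdiv_lt_0_compat; lra. }
      destruct (bnd_tail w W) with (e := (e / (B + 1)) ^ 2) as (F & _ & HF); auto.
      { intros; left; apply Rpower_pos. }
      exists F; intros p Hp.
      apply bnd_le with (fun k => ind F k * Cmod (a p k)) (e / (B + 1) * B); [intros; lra| |].
      * apply Rle_trans with (e / (B + 1) * (B + 1)); [|right; field; lra].
        apply Rmult_le_compat_l; [left; apply Rdiv_lt_0_compat; lra|lra].
      * apply (l2s_l1 s); auto.
        -- left; apply Rdiv_lt_0_compat; lra.
        -- intros; apply ind_01.
        -- intros l Hl. destruct (ind_filter w F l Hl) as (l' & H1 & H2 & E).
           unfold w in E at 1; rewrite E. apply HF; auto. intros i Hi; apply H2, Hi.
Qed.

(** * Calculus for complex functions of a real variable *)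

Lemma Cmod_Ci : Cmod Ci = 1.
Proof. unfold Cmod, Ci; simpl. replace (0 * (0 * 1) + 1 * (1 * 1)) with 1 by ring. apply sqrt_1. Qed.

Definition dC (f : R -> C) (t : R) (D : C) : Prop :=
  @is_derive R_AbsRing C_R_NormedModule f t D.

Lemma norm_C (z : C) : @norm R_AbsRing C_R_NormedModule z = Cmod z.
Proof.
  unfold norm; simpl. unfold prod_norm, Cmod, norm; simpl. unfold abs; simpl.
  f_equal. rewrite !Rmult_1_r, <- !Rabs_mult, !Rabs_pos_eq by apply Rle_0_sqr. reflexivity.
Qed.

Lemma is_derive_eps {V : NormedModule R_AbsRing} (f : R -> V) t D :
  is_derive f t D <->
  forall e, 0 < e -> exists d, 0 < d /\ forall y, Rabs (y - t) < d ->
    norm (minus (minus (f y) (f t)) (scal (y - t) D)) <= e * Rabs (y - t).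
Proof.
  split.
  - intros [_ H] e He. specialize (H t (fun P HP => HP) (mkposreal e He)).
    destruct H as [d Hd]. exists d; split; [apply cond_pos|].
    intros y Hy. apply Hd. exact Hy.
  - intros H; split; [apply is_linear_scal_l|].
    intros x Hx [e He]. rewrite <- (is_filter_lim_locally_unique _ _ Hx).
    destruct (H e He) as (d & Hd & Hy). exists (mkposreal d Hd).
    intros y Hb. apply Hy. exact Hb.
Qed.

Lemma dC_eps (f : R -> C) t D :
  dC f t D <->
  forall e, 0 < e -> exists d, 0 < d /\ forall y, Rabs (y - t) < d ->
    Cmod (f y - f t - RtoC (y - t) * D)%C <= e * Rabs (y - t).
Proof.
  unfold dC. rewrite is_derive_eps.
  assert (E : forall y, @norm R_AbsRing C_R_NormedModule (minus (minus (f y) (f t)) (scal (y - t) D))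
     = Cmod (f y - f t - RtoC (y - t) * D)%C).
  { intros y. rewrite norm_C. f_equal. destruct D as [a b].
    unfold minus, plus, opp, scal; simpl. unfold prod_plus, prod_opp, prod_scal; simpl.
    unfold Cminus, Cplus, Copp, Cmult, RtoC; simpl.
    unfold plus, opp, scal; simpl. unfold mult; simpl. f_equal; ring. }
  split; intros H e He; destruct (H e He) as (d & Hd & Hy); exists d; split; auto;
    intros y Hb.
  - exact (Rle_trans _ _ _ (Req_le _ _ (eq_sym (E y))) (Hy y Hb)).
  - exact (Rle_trans _ _ _ (Req_le _ _ (E y)) (Hy y Hb)).
Qed.

Lemma C_decomp (z : C) : z = (RtoC (fst z) + Ci * RtoC (snd z))%C.
Proof.
  destruct z as [x y]. unfold RtoC, Ci, Cplus, Cmult; simpl.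
  apply injective_projections; simpl; ring.
Qed.

Lemma dC_comp (f : R -> C) t D :
  dC f t D <-> is_derive (fun x => fst (f x)) t (fst D) /\ is_derive (fun x => snd (f x)) t (snd D).
Proof.
  rewrite dC_eps, !is_derive_eps.
  assert (E1 : forall y, @norm R_AbsRing R_NormedModule
      (minus (minus (fst (f y)) (fst (f t))) (scal (y - t) (fst D)))
      = Rabs (fst (f y - f t - RtoC (y - t) * D)%C)).
  { intros y. unfold norm; simpl. unfold abs; simpl. f_equal.
    unfold minus, plus, opp, scal, mult; simpl. unfold mult; simpl. ring. }
  assert (E2 : forall y, @norm R_AbsRing R_NormedModule
      (minus (minus (snd (f y)) (snd (f t))) (scal (y - t) (snd D)))
      = Rabs (snd (f y - f t - RtoC (y - t) * D)%C)).
  { intros y. unfold norm; simpl. unfold abs; simpl. f_equal.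
    unfold minus, plus, opp, scal, mult; simpl. unfold mult; simpl. ring. }
  split.
  - intros H; split; intros e He; destruct (H e He) as (d & Hd & Hy); exists d; split; auto;
      intros y Hb.
    + refine (Rle_trans _ _ _ (Req_le _ _ (E1 y)) (Rle_trans _ _ _ _ (Hy y Hb))).
      eapply Rle_trans; [apply Rmax_l|apply Rmax_Cmod].
    + refine (Rle_trans _ _ _ (Req_le _ _ (E2 y)) (Rle_trans _ _ _ _ (Hy y Hb))).
      eapply Rle_trans; [apply Rmax_r|apply Rmax_Cmod].
  - intros [H1 H2] e He. assert (He2 : 0 < e / 2) by lra.
    destruct (H1 _ He2) as (d1 & Hd1 & Hy1). destruct (H2 _ He2) as (d2 & Hd2 & Hy2).
    exists (Rmin d1 d2); split; [apply Rmin_glb_lt; assumption|]. intros y Hb.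
    assert (Ha : Rabs (y - t) < d1) by (eapply Rlt_le_trans; [exact Hb|apply Rmin_l]).
    assert (Hc : Rabs (y - t) < d2) by (eapply Rlt_le_trans; [exact Hb|apply Rmin_r]).
    specialize (Hy1 y Ha). specialize (Hy2 y Hc).
    apply (Rle_trans _ _ _ (Req_le _ _ (eq_sym (E1 y)))) in Hy1.
    apply (Rle_trans _ _ _ (Req_le _ _ (eq_sym (E2 y)))) in Hy2.
    set (z := (f y - f t - RtoC (y - t) * D)%C) in *.
    rewrite (C_decomp z).
    apply Cmod_tri_le.
    rewrite Cmod_mult, !Cmod_R. rewrite Cmod_Ci; lra.
Qed.

Lemma dC_ext (f g : R -> C) t D : (forall x, f x = g x) -> dC f t D -> dC g t D.
Proof. intros H; replace g with f; auto. apply functional_extensionality; auto. Qed.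

Lemma dC_ext_loc (f g : R -> C) t D (a b : R) :
  a < t < b -> (forall x, a < x < b -> f x = g x) -> dC f t D -> dC g t D.
Proof.
  intros Ht H Hf. apply (is_derive_ext_loc f); [|exact Hf].
  assert (Hd : 0 < Rmin (t - a) (b - t)) by (apply Rmin_glb_lt; lra).
  exists (mkposreal _ Hd). intros y Hy. apply H.
  change (Rabs (y - t) < Rmin (t - a) (b - t)) in Hy. apply Rabs_lt_between' in Hy.
  pose proof (Rmin_l (t - a) (b - t)). pose proof (Rmin_r (t - a) (b - t)). lra.
Qed.

Lemma dC_eq f t D E : dC f t D -> D = E -> dC f t E.
Proof. intros H <-; exact H. Qed.

Lemma dC_const (c : C) t : dC (fun _ => c) t (RtoC 0).
Proof. apply dC_comp; simpl; split; apply @is_derive_const. Qed.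

Lemma dC_plus (f g : R -> C) t D E :
  dC f t D -> dC g t E -> dC (fun x => f x + g x)%C t (D + E)%C.
Proof.
  rewrite !dC_comp; intros [H1 H2] [H3 H4]; split; simpl; apply @is_derive_plus; assumption.
Qed.

Lemma is_derive_mult_R (f g : R -> R) t a b :
  is_derive f t a -> is_derive g t b -> is_derive (fun x => f x * g x) t (a * g t + f t * b).
Proof. intros H1 H2. apply (is_derive_mult f g); auto. intros; apply Rmult_comm. Qed.

Lemma dC_mult (f g : R -> C) t D E :
  dC f t D -> dC g t E -> dC (fun x => f x * g x)%C t (D * g t + f t * E)%C.
Proof.
  rewrite !dC_comp; intros [H1 H2] [H3 H4]; split; simpl.
  - pose proof (is_derive_minus _ _ _ _ _ (is_derive_mult_R _ _ _ _ _ H1 H3)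
      (is_derive_mult_R _ _ _ _ _ H2 H4)) as K.
    eapply (is_derive_ext _ _ _ _ (fun x => eq_refl)) in K.
    match type of K with is_derive _ _ ?a => match goal with |- is_derive _ _ ?b =>
      replace b with a; [exact K|] end end.
    unfold minus, plus, opp; simpl; ring.
  - pose proof (is_derive_plus _ _ _ _ _ (is_derive_mult_R _ _ _ _ _ H1 H4)
      (is_derive_mult_R _ _ _ _ _ H2 H3)) as K.
    match type of K with is_derive _ _ ?a => match goal with |- is_derive _ _ ?b =>
      replace b with a; [exact K|] end end.
    unfold minus, plus, opp; simpl; ring.
Qed.

Lemma dC_scal (c : C) (f : R -> C) t D : dC f t D -> dC (fun x => c * f x)%C t (c * D)%C.
Proof.
  intros H. pose proof (dC_mult _ _ _ _ _ (dC_const c t) H) as K.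
  replace (c * D)%C with (RtoC 0 * f t + c * D)%C by ring. exact K.
Qed.

Lemma dC_opp (f : R -> C) t D : dC f t D -> dC (fun x => - f x)%C t (- D)%C.
Proof.
  intros H. apply (dC_scal (- (1))%C) in H.
  replace (- D)%C with (- (1) * D)%C by ring.
  eapply dC_ext; [|exact H]. intros; simpl; ring.
Qed.

Lemma dC_minus (f g : R -> C) t D E :
  dC f t D -> dC g t E -> dC (fun x => f x - g x)%C t (D - E)%C.
Proof. intros H1 H2. apply dC_plus; [|apply dC_opp]; assumption. Qed.

Lemma dC_conj (f : R -> C) t D : dC f t D -> dC (fun x => Cconj (f x)) t (Cconj D).
Proof.
  rewrite !dC_comp; intros [H1 H2]; split; simpl; [assumption|].
  apply (is_derive_opp (fun x => snd (f x))); assumption.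
Qed.

Lemma dC_RtoC (f : R -> R) t D : is_derive f t D -> dC (fun x => RtoC (f x)) t (RtoC D).
Proof. intros H; apply dC_comp; simpl; split; [assumption|apply @is_derive_const]. Qed.

Lemma dC_cis (f : R -> R) t D :
  is_derive f t D -> dC (fun x => cis (f x)) t (Ci * RtoC D * cis (f t))%C.
Proof.
  intros H; apply dC_comp; unfold cis; simpl; split.
  - replace (_ - _) with (scal D (- sin (f t))) by
      (unfold scal; simpl; unfold mult; simpl; ring).
    apply (is_derive_comp cos f); [apply is_derive_Reals, derivable_pt_lim_cos|assumption].
  - replace (_ + _) with (scal D (cos (f t))) by
      (unfold scal; simpl; unfold mult; simpl; ring).
    apply (is_derive_comp sin f); [apply is_derive_Reals, derivable_pt_lim_sin|assumption].
Qed.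

Lemma dC_csum {I} (f : R -> I -> C) (D : I -> C) t (l : list I) :
  (forall i, In i l -> dC (fun x => f x i) t (D i)) -> dC (fun x => csum (f x) l) t (csum D l).
Proof.
  induction l as [|a l IH]; intros H; simpl; [apply dC_const|].
  apply dC_plus; [apply H; left; reflexivity|apply IH; intros; apply H; right; assumption].
Qed.

Lemma cis_mod x : Cmod (cis x) = 1.
Proof.
  unfold Cmod, cis; simpl. pose proof (sin2_cos2 x) as H. unfold Rsqr in H.
  replace (cos x * (cos x * 1) + sin x * (sin x * 1)) with 1 by lra. apply sqrt_1.
Qed.

Lemma cis_plus x y : cis (x + y) = (cis x * cis y)%C.
Proof.
  unfold cis, Cmult; simpl. rewrite cos_plus, sin_plus. f_equal; ring.
Qed.

Lemma cis_0 : cis 0 = RtoC 1.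
Proof. unfold cis. rewrite cos_0, sin_0. reflexivity. Qed.

Lemma cis_neg x : cis (- x) = Cconj (cis x).
Proof. unfold cis, Cconj; simpl. rewrite cos_neg, sin_neg. reflexivity. Qed.

Lemma cis_conj_r x : (cis x * Cconj (cis x))%C = RtoC 1.
Proof. rewrite <- cis_neg, <- cis_plus, Rplus_opp_r. apply cis_0. Qed.

Lemma polar (z : C) : exists c, Cmod c = 1 /\ (c * z)%C = RtoC (Cmod z).
Proof.
  destruct (Req_dec (Cmod z) 0) as [E|E].
  - exists (RtoC 1); split; [apply Cmod_1|]. rewrite E, (Cmod_eq_0 z E). ring.
  - exists (Cconj z / RtoC (Cmod z))%C.
    assert (Hz : RtoC (Cmod z) <> RtoC 0) by (intros H; apply RtoC_inj in H; auto). split.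
    + rewrite Cmod_div, Cmod_conj, Cmod_R by assumption.
      rewrite Rabs_pos_eq by apply Cmod_ge_0. field; assumption.
    + replace (Cconj z / RtoC (Cmod z) * z)%C with (z * Cconj z / RtoC (Cmod z))%C
        by (field; assumption).
      rewrite <- Cmod2_conj. replace (Cmod z ^ 2) with (Cmod z * Cmod z) by ring.
      rewrite RtoC_mult. field; assumption.
Qed.

Lemma Re_le_Cmod (z : C) : Re z <= Cmod z.
Proof. eapply Rle_trans; [apply Rle_abs|apply re_le_Cmod]. Qed.

(** Comparison with a scalar function rather than with a constant lets time-dependent velocity bounds be
    integrated exactly. *)
Lemma mvt_le (f : R -> R) (g : R -> R) (df dg : R -> R) a b :
  a <= b -> (forall t, a <= t <= b -> is_derive f t (df t)) ->
  (forall t, a <= t <= b -> is_derive g t (dg t)) ->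
  (forall t, a <= t <= b -> df t <= dg t) -> f b - f a <= g b - g a.
Proof.
  intros Hab Hf Hg H.
  destruct (MVT_gen (fun t => g t - f t) a b (fun t => dg t - df t)) as (c & Hc & E).
  - intros x Hx. rewrite Rmin_left, Rmax_right in Hx by assumption.
    apply (is_derive_minus g f); [apply Hg|apply Hf]; lra.
  - intros x Hx. rewrite Rmin_left, Rmax_right in Hx by assumption.
    apply continuity_pt_filterlim, (ex_derive_continuous (fun t => g t - f t)).
    exists (dg x - df x). apply (is_derive_minus g f); [apply Hg|apply Hf]; assumption.
  - rewrite Rmin_left, Rmax_right in Hc by assumption. cbv beta in E.
    specialize (H c Hc). assert (0 <= (dg c - df c) * (b - a)) by (apply Rmult_le_pos; lra). lra.
Qed.

Lemma dC_Re (f : R -> C) t D : dC f t D -> is_derive (fun x => Re (f x)) t (Re D).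
Proof. intros H; apply dC_comp in H; apply H. Qed.

(** The vector-valued mean value inequality follows from the scalar one applied to the real part of
    [c f], where the unimodular [c] turns [f b - f a] into its modulus. *)
Lemma mvt_C (f : R -> C) (g : R -> R) (df : R -> C) (dg : R -> R) a b :
  a <= b -> (forall t, a <= t <= b -> dC f t (df t)) ->
  (forall t, a <= t <= b -> is_derive g t (dg t)) ->
  (forall t, a <= t <= b -> Cmod (df t) <= dg t) -> Cmod (f b - f a) <= g b - g a.
Proof.
  intros Hab Hf Hg H. destruct (polar (f b - f a)) as (c & Hc & E).
  replace (Cmod (f b - f a)) with (Re (c * f b)%C - Re (c * f a)%C).
  - apply (mvt_le (fun t => Re (c * f t)%C) g (fun t => Re (c * df t)%C) dg); auto.
    + intros t Ht. apply dC_Re, dC_scal, Hf, Ht.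
    + intros t Ht. eapply Rle_trans; [apply Re_le_Cmod|].
      rewrite Cmod_mult, Hc, Rmult_1_l. apply H, Ht.
  - apply (f_equal Re) in E. simpl in E. simpl. unfold Re in *; simpl in *. lra.
Qed.

Lemma mvt_C_lip (f : R -> C) (df : R -> C) K a b x y :
  (forall t, a < t < b -> dC f t (df t)) -> (forall t, a < t < b -> Cmod (df t) <= K) ->
  a < x < b -> a < y < b -> Cmod (f y - f x) <= K * Rabs (y - x).
Proof.
  intros Hf H Hx Hy.
  assert (Hg : forall t, is_derive (fun t => K * t) t K).
  { intros t. auto_derive; [auto|ring]. }
  destruct (Rle_dec x y) as [L|L].
  - rewrite Rabs_pos_eq by lra. replace (K * (y - x)) with (K * y - K * x) by ring.
    apply (mvt_C f (fun t => K * t) df (fun _ => K)); auto; intros; [apply Hf|apply H]; lra.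
  - rewrite Cmod_sub_sym, Rabs_minus_sym, Rabs_pos_eq by lra.
    replace (K * (x - y)) with (K * x - K * y) by ring.
    apply (mvt_C f (fun t => K * t) df (fun _ => K)); auto; [lra|..]; intros; [apply Hf|apply H]; lra.
Qed.

(** Termwise differentiation: finite parts are differentiable and tails are Lipschitz with a
    uniformly small constant. *)
Lemma dC_hasum {I} (f g : R -> I -> C) (S : R -> C) a b t :
  a < t < b ->
  (forall x i, a < x < b -> dC (fun y => f y i) x (g x i)) ->
  (forall x, a < x < b -> hasum (f x) (S x)) ->
  US (fun x => a < x < b) (fun x i => Cmod (g x i)) ->
  dC S t (tsum (g t)).
Proof.
  intros Ht Hd HS HU. pose proof (US_asum _ _ t HU Ht) as Hg. apply tsum_ok in Hg.
  destruct HU as (_ & _ & HU). apply dC_eps; intros e He.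
  assert (He4 : 0 < e / 4) by lra.
  destruct (HU _ He4) as (F0 & HF0). destruct (nodup_ex F0) as (F & HF & HFi).
  assert (Htail : forall x, a < x < b -> forall H, NoDup H -> (forall i, In i H -> ~ In i F) ->
     rsum (fun i => Cmod (g x i)) H <= e / 4).
  { intros x Hx H HH Hi. eapply Rle_trans; [|apply (HF0 x Hx H HH)].
    right; apply rsum_ext; intros i Hi'. rewrite ind_out; [ring|]. rewrite <- HFi. auto. }
  pose proof (dC_csum f (g t) t F (fun i _ => Hd t i Ht)) as HdF.
  rewrite dC_eps in HdF. destruct (HdF _ He4) as (d & Hd0 & HdF').
  exists (Rmin d (Rmin (t - a) (b - t))); split.
  { repeat apply Rmin_glb_lt; lra. }
  intros y Hy.
  assert (Hyd : Rabs (y - t) < d) by (eapply Rlt_le_trans; [exact Hy|apply Rmin_l]).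
  assert (Hyab : a < y < b).
  { pose proof (Rmin_r d (Rmin (t - a) (b - t))). pose proof (Rmin_l (t - a) (b - t)).
    pose proof (Rmin_r (t - a) (b - t)). assert (Hy' : Rabs (y - t) < Rmin (t - a) (b - t)) by lra.
    apply Rabs_lt_between' in Hy'. lra. }
  specialize (HdF' y Hyd).
  destruct (Req_dec y t) as [->|Hyt].
  { replace (_ - _)%C with (RtoC 0) by (rewrite Rminus_diag; ring).
    rewrite Rminus_diag, Rabs_R0, Cmod_0; lra. }
  assert (Hpos : 0 < Rabs (y - t)) by (apply Rabs_pos_lt; lra).
  assert (Hq : 0 < e / 12 * Rabs (y - t)) by (apply Rmult_lt_0_compat; lra).
  assert (He12 : 0 < e / 12) by lra.
  destruct (ev_ex _ (ev_and _ _ (ev_and _ _ (HS y Hyab _ Hq) (HS t Ht _ Hq))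
     (ev_and _ _ (Hg _ He12) (ev_incl F)))) as (G & HG & ((H1 & H2) & H3 & H4)).
  destruct (nodup_diff F G HF HG H4) as (K & K1 & K2 & K3).
  assert (HL : Cmod (csum (f y) K - csum (f t) K) <= e / 4 * Rabs (y - t)).
  { apply (mvt_C_lip (fun x => csum (f x) K) (fun x => csum (g x) K) (e / 4) a b); auto.
    - intros x Hx; apply dC_csum; auto.
    - intros x Hx. eapply Rle_trans; [apply Cmod_csum|]. apply Htail; auto. }
  assert (HT : Cmod (RtoC (y - t) * csum (g t) K) <= Rabs (y - t) * (e / 4)).
  { rewrite Cmod_mult, Cmod_R. apply Rmult_le_compat_l; [lra|].
    eapply Rle_trans; [apply Cmod_csum|]. apply Htail; auto. }
  assert (HT3 : Cmod (RtoC (y - t) * (csum (g t) G - tsum (g t))) <= Rabs (y - t) * (e / 12)).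
  { rewrite Cmod_mult, Cmod_R. apply Rmult_le_compat_l; lra. }
  rewrite !(csum_perm _ _ _ K3), !csum_app in *.
  replace (S y - S t - RtoC (y - t) * tsum (g t))%C with
    ((csum (f y) F - csum (f t) F - RtoC (y - t) * csum (g t) F)
     + (csum (f y) K - csum (f t) K) + - (RtoC (y - t) * csum (g t) K)
     + - (csum (f y) F + csum (f y) K - S y) + (csum (f t) F + csum (f t) K - S t)
     + RtoC (y - t) * (csum (g t) F + csum (g t) K - tsum (g t)))%C by ring.
  match goal with |- Cmod (?z1 + ?z2 + - ?z3 + - ?z4 + ?z5 + ?z6)%C <= _ =>
    pose proof (Cmod_triangle (z1 + z2 + - z3 + - z4 + z5)%C z6) as T1;
    pose proof (Cmod_triangle (z1 + z2 + - z3 + - z4)%C z5) as T2;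
    pose proof (Cmod_triangle (z1 + z2 + - z3)%C (- z4)%C) as T3;
    pose proof (Cmod_triangle (z1 + z2)%C (- z3)%C) as T4;
    pose proof (Cmod_triangle z1 z2) as T5
  end.
  rewrite Cmod_opp in T3, T4. nra.
Qed.

(** * The cubic interaction on Fourier coefficients *)

(** [trip A k (a,b)] runs over the products [A_(j1) conj(A_(j2)) A_(j3)] with
    [j1 - j2 + j3 = k]; in these coordinates the phase [j1^2 - j2^2 + j3^2 - k^2] is [-2ab]. *)
Definition trip (A : Z -> C) (k : Z) (ab : Z * Z) : C :=
  (A (k - fst ab)%Z * Cconj (A (k - fst ab - snd ab)%Z) * A (k - snd ab)%Z)%C.

Definition dtrip (A D : Z -> C) (k : Z) (ab : Z * Z) : C :=
  (D (k - fst ab)%Z * Cconj (A (k - fst ab - snd ab)%Z) * A (k - snd ab)%Z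
   + A (k - fst ab)%Z * Cconj (D (k - fst ab - snd ab)%Z) * A (k - snd ab)%Z
   + A (k - fst ab)%Z * Cconj (A (k - fst ab - snd ab)%Z) * D (k - snd ab)%Z)%C.

Definition rtrip (x y z : Z -> R) (k : Z) (ab : Z * Z) : R :=
  x (k - fst ab)%Z * y (k - fst ab - snd ab)%Z * z (k - snd ab)%Z.

Definition ph (t : R) (ab : Z * Z) : C := cis (- (IZR (fst ab) * IZR (snd ab)) / (2 * t)).

(** [1/(ab)], and [0] when [ab = 0], since [/ 0 = 0]. *)
Definition kk (ab : Z * Z) : R := / IZR (fst ab) * / IZR (snd ab).

Definition nz (ab : Z * Z) : R :=
  if ((fst ab =? 0) || (snd ab =? 0))%Z%bool then 0 else 1.

Definition Ncub (t : R) (A : Z -> C) (k : Z) : C := tsum (fun ab => trip A k ab * ph t ab)%C.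
(** [Nres] keeps the oscillating interactions, [a b <> 0]; [Snf] is their primitive in the sense of
    [dC_Snf], and [Qnf] the part of its derivative in which the amplitudes move. *)
Definition Nres (t : R) (A : Z -> C) (k : Z) : C :=
  tsum (fun ab => RtoC (nz ab) * (trip A k ab * ph t ab))%C.
Definition Snf (t : R) (A : Z -> C) (k : Z) : C :=
  tsum (fun ab => RtoC (kk ab) * (trip A k ab * ph t ab))%C.
Definition Qnf (t : R) (A D : Z -> C) (k : Z) : C :=
  tsum (fun ab => RtoC (kk ab) * (dtrip A D k ab * ph t ab))%C.

Lemma kk_nz ab : kk ab * (IZR (fst ab) * IZR (snd ab)) = nz ab.
Proof.
  destruct ab as [a b]; unfold kk, nz; simpl.
  destruct (Z.eqb_spec a 0) as [->|Ha]; [simpl; ring|].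
  destruct (Z.eqb_spec b 0) as [->|Hb]; [simpl; ring|]. simpl.
  field. split; apply not_0_IZR; assumption.
Qed.

Lemma Rinv_IZR_le1 a : Rabs (/ IZR a) <= 1.
Proof.
  destruct (Z.eq_dec a 0) as [->|Ha]; [rewrite Rinv_0, Rabs_R0; lra|].
  rewrite Rabs_inv, <- abs_IZR. apply Rle_trans with (/ 1); [|rewrite Rinv_1; lra].
  apply Rinv_le_contravar; [lra|]. apply IZR_le. lia.
Qed.

Lemma kk_le1 ab : Rabs (kk ab) <= 1.
Proof.
  unfold kk; rewrite Rabs_mult. rewrite <- (Rmult_1_r 1).
  apply Rmult_le_compat; try apply Rabs_pos; apply Rinv_IZR_le1.
Qed.

Lemma nz_01 ab : 0 <= nz ab <= 1.
Proof. unfold nz; destruct (_ || _)%bool; lra. Qed.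

Lemma ph_mod t ab : Cmod (ph t ab) = 1.
Proof. apply cis_mod. Qed.

Lemma Cmod_trip A k ab :
  Cmod (trip A k ab) = rtrip (fun j => Cmod (A j)) (fun j => Cmod (A j)) (fun j => Cmod (A j)) k ab.
Proof. unfold trip, rtrip. rewrite !Cmod_mult, Cmod_conj. reflexivity. Qed.

Lemma Cmod_dtrip A D k ab (a := fun j => Cmod (A j)) (d := fun j => Cmod (D j)) :
  Cmod (dtrip A D k ab) <= rtrip d a a k ab + rtrip a d a k ab + rtrip a a d k ab.
Proof.
  unfold dtrip, rtrip, a, d. apply Cmod_tri_le.
  eapply Rle_trans; [apply Rplus_le_compat_r, Cmod_triangle|].
  rewrite !Cmod_mult, !Cmod_conj. lra.
Qed.

(** Passing from the three frequencies of a product to the frequency [k] of the output and the two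
    gaps [a, b] is a bijection; through it trilinear sums become sums over a product. *)
Definition unslant (i : Z * (Z * Z)) : (Z * Z) * Z :=
  let '(k, (a, b)) := i in ((k - a, k - a - b), k - b)%Z.
Definition slant (i : (Z * Z) * Z) : Z * (Z * Z) :=
  let '((j, l), m) := i in (j - l + m, (m - l, j - l))%Z.

Lemma slantK i : unslant (slant i) = i.
Proof. destruct i as [[j l] m]; simpl. repeat f_equal; ring. Qed.
Lemma unslantK i : slant (unslant i) = i.
Proof. destruct i as [k [a b]]; simpl. repeat f_equal; ring. Qed.

Lemma unslant_inj i j : unslant i = unslant j -> i = j.
Proof. intros H. rewrite <- (unslantK i), <- (unslantK j), H; reflexivity. Qed.

Lemma US_rtrip {P} (D : P -> Prop) (x y z : P -> Z -> R) :
  US D x -> US D y -> US D z ->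
  US D (fun p i => rtrip (x p) (y p) (z p) (fst i) (snd i)).
Proof.
  intros Hx Hy Hz.
  pose proof (US_inj D _ unslant unslant_inj (US_prod D _ _ (US_prod D _ _ Hx Hy) Hz)) as H.
  replace (fun p i => rtrip (x p) (y p) (z p) (fst i) (snd i)) with
    (fun p j => x p (fst (fst (unslant j))) * y p (snd (fst (unslant j))) * z p (snd (unslant j)));
    [exact H|].
  apply functional_extensionality; intros p; apply functional_extensionality.
  intros [k [a b]]; reflexivity.
Qed.

Lemma US_rtrip_k {P} (D : P -> Prop) (x y z : P -> Z -> R) k :
  US D x -> US D y -> US D z -> US D (fun p => rtrip (x p) (y p) (z p) k).
Proof.
  intros Hx Hy Hz. apply (US_inj D (fun p i => rtrip (x p) (y p) (z p) (fst i) (snd i))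
    (fun ab => (k, ab))); [congruence|]. apply US_rtrip; assumption.
Qed.

Lemma bnd_rtrip (x y z : Z -> R) X Y Z' :
  (forall k, 0 <= x k) -> (forall k, 0 <= y k) -> (forall k, 0 <= z k) ->
  bnd x X -> bnd y Y -> bnd z Z' ->
  bnd (fun i => rtrip x y z (fst i) (snd i)) (X * Y * Z').
Proof.
  intros Hx Hy Hz HX HY HZ.
  pose proof (bnd_inj _ unslant _ unslant_inj (bnd_prod _ _ _ _
    (fun i => Rmult_le_pos _ _ (Hx (fst i)) (Hy (snd i))) Hz (bnd_prod _ _ _ _ Hx Hy HX HY) HZ)) as H.
  eapply bnd_mono; [|exact H]. intros [k [a b]]; simpl. unfold rtrip; simpl. lra.
Qed.

Lemma rtrip_nonneg (x y z : Z -> R) k ab :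
  (forall k, 0 <= x k) -> (forall k, 0 <= y k) -> (forall k, 0 <= z k) -> 0 <= rtrip x y z k ab.
Proof. intros Hx Hy Hz. unfold rtrip. repeat apply Rmult_le_pos; auto. Qed.

Lemma asum_trip A : asum A ->
  exists B, bnd (fun i : Z * (Z * Z) => Cmod (trip A (fst i) (snd i))) B.
Proof.
  intros (B & H). exists (B * B * B).
  eapply bnd_le; [intros i; rewrite Cmod_trip; apply Rle_refl|apply Rle_refl|].
  apply bnd_rtrip; auto; intros; apply Cmod_ge_0.
Qed.

Lemma asum_trip_k A k (w : Z * Z -> R) t : asum A -> (forall ab, Rabs (w ab) <= 1) ->
  asum (fun ab => RtoC (w ab) * (trip A k ab * ph t ab))%C.
Proof.
  intros H Hw. destruct (asum_trip A H) as (B & HB). exists B.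
  apply (bnd_fiber _ _ k) in HB; simpl in HB.
  eapply bnd_mono; [|exact HB]. intros ab.
  rewrite !Cmod_mult, ph_mod, Cmod_R, Rmult_1_r.
  rewrite <- (Rmult_1_l (Cmod (trip A k ab))) at 2.
  apply Rmult_le_compat_r; [apply Cmod_ge_0|auto].
Qed.

Lemma asum_Ncub A k t : asum A -> asum (fun ab => trip A k ab * ph t ab)%C.
Proof.
  intros H. destruct (asum_trip_k A k (fun _ => 1) t H) as (B & HB).
  { intros; rewrite Rabs_R1; lra. }
  exists B. eapply bnd_mono; [|exact HB]. intros ab; simpl.
  rewrite (Cmod_mult 1), Cmod_1; lra.
Qed.

Lemma nz_abs ab : Rabs (nz ab) <= 1.
Proof. pose proof (nz_01 ab); rewrite Rabs_pos_eq; lra. Qed.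

Lemma hasum_Ncub A k t : asum A -> hasum (fun ab => trip A k ab * ph t ab)%C (Ncub t A k).
Proof. intros H; apply tsum_ok, asum_Ncub, H. Qed.

Lemma hasum_Nres A k t : asum A ->
  hasum (fun ab => RtoC (nz ab) * (trip A k ab * ph t ab))%C (Nres t A k).
Proof. intros H; apply tsum_ok, asum_trip_k; [assumption|apply nz_abs]. Qed.

Lemma hasum_Snf A k t : asum A ->
  hasum (fun ab => RtoC (kk ab) * (trip A k ab * ph t ab))%C (Snf t A k).
Proof. intros H; apply tsum_ok, asum_trip_k; [assumption|apply kk_le1]. Qed.

(** Summing over all [(k,(a,b))] first: the fibre sums are then summable in [k]. *)
Lemma bnd_Ncub A t : asum A -> exists B, bnd (fun k => Cmod (Ncub t A k)) B.
Proof.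
  intros H. destruct (asum_trip A H) as (B & HB). exists B.
  apply (bnd_hasum_fiber (fun i => trip A (fst i) (snd i) * ph t (snd i))%C).
  - eapply bnd_mono; [|exact HB]. intros i. rewrite Cmod_mult, ph_mod; lra.
  - intros k; apply (hasum_Ncub A k t H).
Qed.

Lemma hasum_fst0 {I J} (i0 : I) (f : J -> C) (w : I -> R) v :
  asum f -> w i0 = 1 -> (forall i, i <> i0 -> w i = 0) -> hasum f v ->
  hasum (fun x => RtoC (w (fst x)) * f (snd x))%C v.
Proof.
  intros Hf H1 H0 Hv.
  assert (Hw : hasum (fun i => RtoC (w i)) (RtoC 1)).
  { rewrite <- H1. apply (hasum_single (fun i => RtoC (w i)) i0).
    intros i Hi; rewrite H0 by assumption; reflexivity. }
  replace v with (RtoC 1 * v)%C by ring.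
  apply (hasum_prod (fun i => RtoC (w i)) f); auto.
  exists 1. intros l Hl. apply Rle_trans with (Re (RtoC 1)); [|simpl; lra].
  eapply Rle_trans; [|apply (hasum_Re_ge _ _ l Hw); [|assumption]].
  - right; apply rsum_ext; intros i _. rewrite Cmod_R. simpl. apply Rabs_pos_eq.
    destruct (classic (i = i0)) as [->|Hi]; [lra|rewrite H0 by assumption; lra].
  - intros i; simpl. destruct (classic (i = i0)) as [->|Hi]; [lra|rewrite H0 by assumption; lra].
Qed.

Definition eq0 (a : Z) : R := if (a =? 0)%Z then 1 else 0.

Lemma eq0_0 : eq0 0 = 1.
Proof. reflexivity. Qed.
Lemma eq0_n a : a <> 0%Z -> eq0 a = 0.
Proof. intros H; unfold eq0. destruct (Z.eqb_spec a 0); tauto. Qed.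

Lemma asum_sq (A : Z -> C) : asum A -> asum (fun k => A k * Cconj (A k))%C.
Proof.
  intros (B & HB). exists (B * B).
  apply bnd_le with (fun k => B * Cmod (A k)) (B * B);
    [|lra|apply bnd_scal; [eapply bnd_nonneg; eassumption|assumption]].
  intros k. rewrite Cmod_mult, Cmod_conj. apply Rmult_le_compat_r; [apply Cmod_ge_0|].
  apply (bnd_term _ _ k HB).
Qed.

(** The terms with [a = 0] sum to [m A_k] and so do those with [b = 0]; the term [a = b = 0] is
    counted twice. *)
Lemma Ncub_split (A : Z -> C) k t (m : C) : asum A -> hasum (fun j => A j * Cconj (A j))%C m ->
  Ncub t A k = (Nres t A k + 2 * m * A k - A k * Cconj (A k) * A k)%C.
Proof.
  intros HA Hm. pose proof (asum_sq A HA) as Hsq.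
  assert (Hk : forall h : Z -> Z, (forall x, h (h x) = x) ->
     hasum (fun b => A k * (A (h b) * Cconj (A (h b))))%C (A k * m)%C).
  { intros h Hh. apply hasum_scal. apply (hasum_bij (fun j => A j * Cconj (A j))%C h h); auto. }
  assert (Hka : forall h : Z -> Z, (forall x, h (h x) = x) ->
     asum (fun b => A k * (A (h b) * Cconj (A (h b))))%C).
  { intros h Hh. apply asum_scal. destruct Hsq as (B & HB). exists B.
    apply (bnd_inj (fun j => Cmod (A j * Cconj (A j)))); [|assumption].
    intros x y E; rewrite <- (Hh x), <- (Hh y), E; reflexivity. }
  set (h := fun b => (k - b)%Z).
  assert (Hh : forall x, h (h x) = x) by (intros; unfold h; ring).
  pose proof (hasum_fst0 0%Z _ eq0 _ (Hka h Hh) eq0_0 eq0_n (Hk h Hh)) as R1.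
  pose proof (hasum_bij _ (fun x : Z * Z => (snd x, fst x)) (fun x => (snd x, fst x)) _
     ltac:(intros []; reflexivity) ltac:(intros []; reflexivity) R1) as R2.
  assert (R3 : hasum (fun ab => RtoC (eq0 (fst ab) * eq0 (snd ab)) * (A k * Cconj (A k) * A k))%C
      (A k * Cconj (A k) * A k)%C).
  { pose proof (hasum_single (fun ab => RtoC (eq0 (fst ab) * eq0 (snd ab)) * (A k * Cconj (A k) * A k))%C
      (0%Z, 0%Z)) as H. simpl in H. rewrite !eq0_0 in H.
    replace (RtoC (1 * 1) * (A k * Cconj (A k) * A k))%C with (A k * Cconj (A k) * A k)%C in H
      by (rewrite Rmult_1_r; ring).
    apply H. intros [a b] Hab. simpl. destruct (Z.eq_dec a 0) as [->|Ha].
    - rewrite (eq0_n b) by congruence. rewrite Rmult_0_r; ring.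
    - rewrite (eq0_n a) by assumption. rewrite Rmult_0_l; ring. }
  apply tsum_eq.
  replace (Nres t A k + 2 * m * A k - A k * Cconj (A k) * A k)%C with
    (Nres t A k + (A k * m + A k * m - A k * Cconj (A k) * A k))%C by ring.
  eapply hasum_ext; [|apply hasum_plus; [apply (hasum_Nres A k t HA)|apply hasum_minus;
     [apply hasum_plus; [exact R1|exact R2]|exact R3]]].
  intros [a b]. unfold nz, trip, h; simpl. unfold eq0.
  destruct (Z.eqb_spec a 0) as [->|Ha]; destruct (Z.eqb_spec b 0) as [->|Hb]; simpl.
  - rewrite !Z.sub_0_r. unfold ph; simpl. replace (- (0 * 0) / (2 * t)) with 0 by (unfold Rdiv; ring).
    rewrite cis_0, Rmult_1_r. ring.
  - rewrite !Z.sub_0_r. unfold ph; simpl. replace (- (0 * IZR b) / (2 * t)) with 0 by (unfold Rdiv; ring).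
    rewrite cis_0, Rmult_0_r. ring.
  - rewrite !Z.sub_0_r. unfold ph; simpl. replace (- (IZR a * 0) / (2 * t)) with 0 by (unfold Rdiv; ring).
    rewrite cis_0, Rmult_0_l. ring.
  - rewrite Rmult_0_l. ring.
Qed.

Lemma dC_trip (A : R -> Z -> C) (D : Z -> C) t k ab :
  (forall j, dC (fun x => A x j) t (D j)) -> dC (fun x => trip (A x) k ab) t (dtrip (A t) D k ab).
Proof.
  intros H. unfold trip, dtrip.
  pose proof (dC_mult _ _ _ _ _ (dC_mult _ _ _ _ _ (H (k - fst ab)%Z)
    (dC_conj _ _ _ (H (k - fst ab - snd ab)%Z))) (H (k - snd ab)%Z)) as K.
  match type of K with dC _ _ ?a => match goal with |- dC _ _ ?b =>
    replace b with a; [exact K|ring] end end.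
Qed.

Lemma dC_ph t ab : 0 < t ->
  dC (fun x => ph x ab) t (Ci * RtoC (IZR (fst ab) * IZR (snd ab) / (2 * t ^ 2)) * ph t ab)%C.
Proof.
  intros Ht. unfold ph. apply (dC_cis (fun x => - (IZR (fst ab) * IZR (snd ab)) / (2 * x))).

  auto_derive; [apply Rgt_not_eq; lra|]. field; lra.
Qed.

(** The oscillating factor is an exact derivative up to the harmless factor [1/(ab)]: this is
    what turns the singular coefficient [1/t] of the mode equations into a bounded one. *)
Lemma dC_Snf (A D : R -> Z -> C) lo hi t k : 0 < lo -> lo < t < hi ->
  (forall x j, lo < x < hi -> dC (fun y => A y j) x (D x j)) ->
  US (fun x => lo < x < hi) (fun x j => Cmod (A x j)) ->
  US (fun x => lo < x < hi) (fun x j => Cmod (D x j)) ->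
  dC (fun x => Snf x (A x) k) t
    (Ci * RtoC (/ (2 * t ^ 2)) * Nres t (A t) k + Qnf t (A t) (D t) k)%C.
Proof.
  intros Hlo Ht Hd HA HD.
  assert (HAt : forall x, lo < x < hi -> asum (A x)) by (intros x; apply (US_asum _ A x HA)).
  set (g := fun x ab => (Ci * RtoC (/ (2 * x ^ 2)) * (RtoC (nz ab) * (trip (A x) k ab * ph x ab))
       + RtoC (kk ab) * (dtrip (A x) (D x) k ab * ph x ab))%C).
  pose proof (US_rtrip_k _ _ _ _ k HA HA HA) as U0.
  pose proof (US_plus _ _ _ (US_plus _ _ _ (US_rtrip_k _ _ _ _ k HD HA HA)
    (US_rtrip_k _ _ _ _ k HA HD HA)) (US_rtrip_k _ _ _ _ k HA HA HD)) as U1.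
  assert (E1 : forall x ab, Cmod (RtoC (kk ab) * (dtrip (A x) (D x) k ab * ph x ab)) <=
     Cmod (dtrip (A x) (D x) k ab)).
  { intros x ab. rewrite !Cmod_mult, ph_mod, Cmod_R, Rmult_1_r.
    rewrite <- (Rmult_1_l (Cmod (dtrip _ _ _ _))) at 2.
    apply Rmult_le_compat_r; [apply Cmod_ge_0|apply kk_le1]. }
  assert (U2 : US (fun x => lo < x < hi) (fun x ab => Cmod (RtoC (kk ab) * (dtrip (A x) (D x) k ab * ph x ab)))).
  { eapply US_le; [|exact U1]. intros x ab Hx. split; [apply Cmod_ge_0|].
    eapply Rle_trans; [apply E1|]. apply Cmod_dtrip. }
  assert (HQ : hasum (fun ab => RtoC (kk ab) * (dtrip (A t) (D t) k ab * ph t ab))%C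
     (Qnf t (A t) (D t) k)).
  { apply tsum_ok. exact (US_asum _ (fun x ab => RtoC (kk ab) * (dtrip (A x) (D x) k ab * ph x ab))%C t U2 Ht). }
  replace (Ci * RtoC (/ (2 * t ^ 2)) * Nres t (A t) k + Qnf t (A t) (D t) k)%C with (tsum (g t)).
  - apply (dC_hasum (fun x ab => RtoC (kk ab) * (trip (A x) k ab * ph x ab))%C g _ lo hi); auto.
    + intros x ab Hx.
      pose proof (dC_scal (RtoC (kk ab)) _ _ _ (dC_mult _ _ _ _ _
        (dC_trip A (D x) x k ab (fun j => Hd x j Hx)) (dC_ph x ab ltac:(lra)))) as K.
      match type of K with dC _ _ ?a => replace (g x ab) with a; [exact K|] end.
      unfold g. rewrite <- (kk_nz ab). unfold Rdiv. rewrite !RtoC_mult. ring.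
    + intros x Hx. apply hasum_Snf; auto.
    + eapply US_le; [|exact (US_plus _ _ _ (US_scal _ (/ (2 * lo ^ 2)) _
        ltac:(left; apply Rinv_0_lt_compat; nra) U0) U2)].
      intros x ab Hx. split; [apply Cmod_ge_0|]. unfold g.
      apply Cmod_tri_le. apply Rplus_le_compat_r.
      rewrite !Cmod_mult, ph_mod, !Cmod_R, Cmod_trip.
      rewrite Cmod_Ci.
      set (r := rtrip _ _ _ _ _).
      assert (0 <= r) by (apply rtrip_nonneg; intros; apply Cmod_ge_0).
      assert (Hi : 0 < / (2 * x ^ 2) <= / (2 * lo ^ 2)).
      { split; [apply Rinv_0_lt_compat; nra|apply Rinv_le_contravar; nra]. }
      rewrite (Rabs_pos_eq (/ _)) by lra. pose proof (nz_abs ab). pose proof (Rabs_pos (nz ab)).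
      rewrite Rmult_1_l, Rmult_1_r. apply Rmult_le_compat; [lra|apply Rmult_le_pos; lra|lra|].
      rewrite <- (Rmult_1_l r) at 2. apply Rmult_le_compat_r; lra.
  - apply tsum_eq. apply hasum_plus; [|exact HQ]. apply hasum_scal, hasum_Nres; auto.
Qed.

(** * Conservation of mass *)

(** Exchanging the output frequency with an input one, [(k,a,b) -> (k-a,-a,b)], conjugates each term of
    the quartic sum, so the sum is real. *)
Lemma hasum_flux_real (A : Z -> C) t : asum A ->
  exists W, hasum (fun k => Cconj (A k) * Ncub t A k)%C W /\ Cconj W = W.
Proof.
  intros HA. destruct (asum_trip A HA) as (B & HB). destruct HA as (B1 & HB1).
  assert (HA : asum A) by (exists B1; assumption).
  set (F := fun i : Z * (Z * Z) => (Cconj (A (fst i)) * (trip A (fst i) (snd i) * ph t (snd i)))%C).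
  assert (HF : asum F).
  { exists (B1 * B). apply bnd_le with (fun i => B1 * Cmod (trip A (fst i) (snd i))) (B1 * B);
      [|lra|apply bnd_scal; [eapply bnd_nonneg; eassumption|assumption]].
    intros i. unfold F. rewrite !Cmod_mult, Cmod_conj, ph_mod, Rmult_1_r.
    apply Rmult_le_compat_r; [apply Cmod_ge_0|apply (bnd_term _ _ (fst i) HB1)]. }
  destruct (asum_ex F HF) as (W & HW). exists W; split.
  - apply (hasum_fubini F); [assumption..|]. intros k. apply (hasum_scal (Cconj (A k)) (fun ab => trip A k ab * ph t ab)%C), hasum_Ncub, HA.
  - apply (hasum_unique F); [|assumption].
    set (h := fun i : Z * (Z * Z) => ((fst i - fst (snd i))%Z, (- fst (snd i), snd (snd i))%Z)).
    assert (Hh : forall i, h (h i) = i) by (intros [k [a b]]; unfold h; simpl; repeat f_equal; ring).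
    apply hasum_conj, (hasum_bij _ h h _ Hh Hh) in HW.
    eapply hasum_ext; [|exact HW]. intros [k [a b]]. unfold F, h, trip, ph; simpl.
    replace (k - a - - a)%Z with k by ring. replace (k - b - a)%Z with (k - a - b)%Z by ring.
    rewrite !Cmult_conj, !Cconj_conj, <- cis_neg, opp_IZR.
    replace (- (- (- IZR a * IZR b) / (2 * t))) with (- (IZR a * IZR b) / (2 * t))
      by (unfold Rdiv; ring). ring.
Qed.

Definition mode_rhs (sigma t : R) (d : Z -> R) (A : Z -> C) (k : Z) : C :=
  (Ci * RtoC (sigma / (8 * PI * t)) * (Ncub t A k - RtoC (d k) * A k))%C.

(** In the derivative of [sum |A_k|^2] the linear term is purely imaginary because [d k] is real, and so is
    the cubic one by [hasum_flux_real]. *)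
Lemma mass_const sigma (d : R -> Z -> R) (A D : R -> Z -> C) lo hi (m : R -> C) :
  (forall x j, lo < x < hi -> dC (fun y => A y j) x (D x j)) ->
  (forall x j, lo < x < hi -> D x j = mode_rhs sigma x (d x) (A x) j) ->
  US (fun x => lo < x < hi) (fun x j => Cmod (A x j)) ->
  US (fun x => lo < x < hi) (fun x j => Cmod (D x j)) ->
  (forall x, lo < x < hi -> hasum (fun j => A x j * Cconj (A x j))%C (m x)) ->
  forall x y, lo < x < hi -> lo < y < hi -> m x = m y.
Proof.
  intros Hd HD UA UD Hm.
  assert (Hm0 : forall x, lo < x < hi -> dC m x (RtoC 0)).
  { intros x Hx. set (g := fun y j => (D y j * Cconj (A y j) + A y j * Cconj (D y j))%C).
    replace (RtoC 0) with (tsum (g x)).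
    - apply (dC_hasum (fun y j => A y j * Cconj (A y j))%C g m lo hi); auto.
      + intros y j Hy. apply dC_mult; [|apply dC_conj]; auto.
      + destruct UA as (UA1 & (B & HB) & UA3).
        eapply US_le; [|exact (US_scal _ (2 * Rabs B) _ ltac:(pose proof (Rabs_pos B); lra) UD)].
        intros y j Hy. split; [apply Cmod_ge_0|]. unfold g.
        apply Cmod_tri_le. rewrite !Cmod_mult, !Cmod_conj.
        pose proof (bnd_term _ _ j (HB y Hy)) as Hb. simpl in Hb. pose proof (Rle_abs B).
        pose proof (Cmod_ge_0 (A y j)). pose proof (Cmod_ge_0 (D y j)). nra.
    - apply tsum_eq. pose proof (US_asum _ A x UA Hx) as HA.
      destruct (hasum_flux_real (A x) x HA) as (W & HW & EW).
      set (c := (Ci * RtoC (sigma / (8 * PI * x)))%C).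
      assert (Ec : Cconj c = (- c)%C).
      { unfold c, Ci, RtoC, Cconj, Cmult, Copp; simpl. apply injective_projections; simpl; ring. }
      pose proof (hasum_scal c _ _ HW) as H1. pose proof (hasum_conj _ _ H1) as H2.
      pose proof (hasum_plus _ _ _ _ H1 H2) as H3.
      rewrite Cmult_conj, EW, Ec in H3. replace (c * W + - c * W)%C with (RtoC 0) in H3 by ring.
      eapply hasum_ext; [|exact H3]. intros j. unfold g. rewrite HD by assumption.
      unfold mode_rhs. fold c.
      rewrite !Cmult_conj, Ec, Cconj_minus, !Cmult_conj, Cconj_conj.
      replace (Cconj (RtoC (d x j))) with (RtoC (d x j)); [ring|].
      unfold Cconj, RtoC; simpl. f_equal; ring. }
  intros x y Hx Hy. apply Ceq_eps; intros e He.
  pose proof (mvt_C_lip m (fun _ => RtoC 0) 0 lo hi y x Hm0) as H.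
  rewrite Rmult_0_l in H. specialize (H ltac:(intros; rewrite Cmod_0; lra) Hy Hx). lra.
Qed.

(** * The cubic nonlinearity in physical space *)

Lemma four_pi_pos t : 0 < t -> 0 < 4 * PI * t.
Proof. intros Ht; pose proof PI_RGT_0; apply Rmult_lt_0_compat; lra. Qed.

Lemma free_delta_mod k t x : 0 < t -> Cmod (free_delta k t x) = / sqrt (4 * PI * t).
Proof.
  intros Ht. unfold free_delta. pose proof PI_RGT_0.
  assert (Hs : 0 < sqrt (4 * PI * t)) by (apply sqrt_lt_R0, four_pi_pos, Ht).
  assert (Hn : (RtoC (sqrt (4 * PI * t)) * cis (PI / 4))%C <> RtoC 0).
  { intros E. apply (f_equal Cmod) in E. rewrite Cmod_mult, cis_mod, Cmod_R, Cmod_0 in E.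
    rewrite Rabs_pos_eq in E by lra. lra. }
  rewrite Cmod_div, Cmod_mult, !cis_mod, Cmod_R, Rabs_pos_eq by (assumption || lra).
  field; lra.
Qed.

Lemma Cinv_cis x : (/ cis x)%C = cis (- x).
Proof.
  assert (Hn : cis x <> RtoC 0).
  { intros E. apply (f_equal Cmod) in E. rewrite cis_mod, Cmod_0 in E. lra. }
  replace (cis (- x)) with (cis x * cis (- x) / cis x)%C by (field; assumption).
  rewrite <- cis_plus, Rplus_opp_r, cis_0. field; assumption.
Qed.

Lemma free_delta_cis k t x : 0 < t ->
  free_delta k t x = (RtoC (/ sqrt (4 * PI * t)) * cis ((x - IZR k) ^ 2 / (4 * t) - PI / 4))%C.
Proof.
  intros Ht. unfold free_delta. pose proof PI_RGT_0.
  assert (Hs : 0 < sqrt (4 * PI * t)) by (apply sqrt_lt_R0, four_pi_pos, Ht).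
  unfold Rminus. rewrite cis_plus, <- Cinv_cis, RtoC_inv by (apply Rgt_not_eq; lra).
  assert (Hn : cis (PI / 4) <> RtoC 0).
  { intros E. apply (f_equal Cmod) in E. rewrite cis_mod, Cmod_0 in E. lra. }
  field. split; [assumption|]. intros E; apply RtoC_inj in E. lra.
Qed.

(** Completing squares: the phases [(x-j)^2] of the three frequencies combine to that of [k = j1-j2+j3]
    with defect [-2ab]. *)
Lemma free_delta_triple t x k ab : 0 < t ->
  (free_delta (k - fst ab) t x * Cconj (free_delta (k - fst ab - snd ab) t x)
    * free_delta (k - snd ab) t x = RtoC (/ (4 * PI * t)) * (ph t ab * free_delta k t x))%C.
Proof.
  intros Ht. pose proof PI_RGT_0. destruct ab as [a b]; simpl. unfold ph; simpl.
  rewrite !free_delta_cis by assumption.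
  assert (Hs : 0 < 4 * PI * t) by (apply four_pi_pos, Ht).
  replace (/ (4 * PI * t)) with (/ sqrt (4 * PI * t) * / sqrt (4 * PI * t)).
  2:{ rewrite <- Rinv_mult, sqrt_sqrt by lra. reflexivity. }
  rewrite Cmult_conj, <- cis_neg.
  replace (Cconj (RtoC (/ sqrt (4 * PI * t)))) with (RtoC (/ sqrt (4 * PI * t)))
    by (unfold Cconj, RtoC; simpl; f_equal; ring).
  rewrite RtoC_mult. set (s := RtoC (/ sqrt (4 * PI * t))).
  match goal with |- (s * cis ?x1 * (s * cis ?x2) * (s * cis ?x3) = s * s * (cis ?x4 * (s * cis ?x5)))%C =>
    replace (s * cis x1 * (s * cis x2) * (s * cis x3))%C with (s * s * s * cis (x1 + x2 + x3))%C
      by (rewrite !cis_plus; ring);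
    replace (s * s * (cis x4 * (s * cis x5)))%C with (s * s * s * cis (x4 + x5))%C
      by (rewrite !cis_plus; ring)
  end.
  do 2 f_equal. rewrite !minus_IZR. field. lra.
Qed.

(** [|u|^2 u] is the triple product series of [u], regrouped by output frequency. *)
Lemma hasum_cubic (A : Z -> C) t x (u : C) : 0 < t -> asum A ->
  hasum (fun k => A k * free_delta k t x)%C u ->
  hasum (fun k => Ncub t A k * free_delta k t x)%C (RtoC (4 * PI * t) * (RtoC (Cmod u ^ 2) * u))%C.
Proof.
  intros Ht HA Hu. pose proof PI_RGT_0.
  assert (Hs : 0 < 4 * PI * t) by (apply four_pi_pos, Ht).
  destruct (asum_trip A HA) as (B & HB).
  assert (Ha : asum (fun k => A k * free_delta k t x)%C).
  { destruct HA as (B1 & HB1). exists (/ sqrt (4 * PI * t) * B1).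
    eapply bnd_mono; [|apply bnd_scal; [|exact HB1]].
    - intros k; simpl. rewrite Cmod_mult, free_delta_mod by assumption. lra.
    - left; apply Rinv_0_lt_compat, sqrt_lt_R0; assumption. }
  assert (Hac : asum (fun k => Cconj (A k * free_delta k t x))%C).
  { destruct Ha as (B1 & HB1). exists B1. eapply bnd_mono; [|exact HB1].
    intros k. rewrite Cmod_conj; lra. }
  pose proof (hasum_prod _ _ _ _ (asum_prod _ _ Ha Hac) Ha
    (hasum_prod _ _ _ _ Ha Hac Hu (hasum_conj _ _ Hu)) Hu) as H3.
  apply (hasum_bij _ unslant slant _ unslantK slantK) in H3.
  replace (RtoC (Cmod u ^ 2) * u)%C with (u * Cconj u * u)%C by (rewrite <- Cmod2_conj; reflexivity).
  apply (hasum_scal (RtoC (4 * PI * t))) in H3.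
  assert (E : forall i : Z * (Z * Z), (RtoC (4 * PI * t) *
      (A (fst (fst (unslant i))) * free_delta (fst (fst (unslant i))) t x *
       Cconj (A (snd (fst (unslant i))) * free_delta (snd (fst (unslant i))) t x) *
       (A (snd (unslant i)) * free_delta (snd (unslant i)) t x)) =
      trip A (fst i) (snd i) * ph t (snd i) * free_delta (fst i) t x)%C).
  { intros [k [a b]]; simpl.
    pose proof (free_delta_triple t x k (a, b) Ht) as E; simpl in E.
    rewrite Cmult_conj. unfold trip; simpl.
    match goal with |- (?c * (?x1 * ?y1 * (?x2 * ?y2) * (?x3 * ?y3)) = _)%C =>
      replace (c * (x1 * y1 * (x2 * y2) * (x3 * y3)))%C with
       (x1 * x2 * x3 * (c * (y1 * y2 * y3)))%C by ring end.
    rewrite E, RtoC_inv by (apply Rgt_not_eq; lra). field. intros E0. apply RtoC_inj in E0. lra. }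
  apply (hasum_ext _ _ _ E) in H3.
  refine (hasum_fubini _ _ _ _ H3 _).
  - exists (/ sqrt (4 * PI * t) * B). eapply bnd_mono; [|apply bnd_scal; [|exact HB]].
    + intros i; simpl. rewrite !Cmod_mult, ph_mod, free_delta_mod by assumption. lra.
    + left; apply Rinv_0_lt_compat, sqrt_lt_R0; assumption.
  - intros k; simpl. apply hasum_ext with (fun ab => free_delta k t x * (trip A k ab * ph t ab))%C.
    + intros; ring.
    + rewrite (Cmult_comm (Ncub t A k)). apply hasum_scal, hasum_Ncub, HA.
Qed.

(** * Absolutely convergent Fourier series *)

Lemma cis_2PI (j : Z) : cis (2 * PI * IZR j) = RtoC 1.
Proof.
  assert (H : forall n : nat, cis (2 * PI * INR n) = RtoC 1).
  { induction n as [|n IH]; [rewrite Rmult_0_r; apply cis_0|].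
    rewrite S_INR, Rmult_plus_distr_l, cis_plus, IH, Rmult_1_r.
    unfold cis. rewrite cos_2PI, sin_2PI. change (1, 0) with (RtoC 1). ring. }
  destruct (Z_le_gt_dec 0 j) as [L|L].
  - rewrite <- (Z2Nat.id j L), <- INR_IZR_INZ. apply H.
  - replace (2 * PI * IZR j) with (- (2 * PI * INR (Z.to_nat (- j)))).
    + rewrite cis_neg, H. unfold Cconj, RtoC; simpl; f_equal; ring.
    + rewrite INR_IZR_INZ, Z2Nat.id, opp_IZR by lia. ring.
Qed.

Lemma cis_shift x (j : Z) : cis (x + 2 * PI * IZR j) = cis x.
Proof. rewrite cis_plus, cis_2PI; ring. Qed.

Lemma cis_neq1 x : 0 < Rabs x < 2 * PI -> cis x <> RtoC 1.
Proof.
  intros Hx E. assert (Hc : cos x = 1) by (apply (f_equal fst) in E; exact E).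
  assert (Hc' : cos (Rabs x) = 1) by (unfold Rabs; destruct (Rcase_abs x); [rewrite cos_neg|]; exact Hc).
  replace (Rabs x) with (2 * (Rabs x / 2)) in Hc' by field.
  rewrite cos_2a_sin in Hc'. assert (Hs : 0 < sin (Rabs x / 2)) by (apply sin_gt_0; lra). nra.
Qed.

Lemma csum_0 {I} (l : list I) : csum (fun _ => RtoC 0) l = RtoC 0.
Proof. induction l as [|i l IH]; simpl; [|rewrite IH]; ring. Qed.

Definition rootsum (n : nat) (x : R) : C := csum (fun m => cis (INR m * x)) (seq 0 n).

Lemma rootsum_S n x : rootsum (S n) x = (rootsum n x + cis (INR n * x))%C.
Proof. unfold rootsum. rewrite seq_S, csum_app; simpl. ring. Qed.

Lemma rootsum_geom n x : ((cis x - 1) * rootsum n x = cis (INR n * x) - 1)%C.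
Proof.
  induction n as [|n IH].
  - unfold rootsum; simpl. rewrite Rmult_0_l, cis_0. ring.
  - rewrite rootsum_S, Cmult_plus_distr_l, IH, S_INR.
    replace ((INR n + 1) * x) with (INR n * x + x) by ring. rewrite cis_plus. ring.
Qed.

Lemma rootsum_1 n x : cis x = RtoC 1 -> rootsum n x = RtoC (INR n).
Proof.
  intros H. induction n as [|n IH]; [reflexivity|].
  rewrite rootsum_S, IH, S_INR, RtoC_plus. f_equal. clear IH.
  induction n as [|n IH]; [simpl; rewrite Rmult_0_l; apply cis_0|].
  rewrite S_INR. replace ((INR n + 1) * x) with (INR n * x + x) by ring.
  rewrite cis_plus, IH, H; ring.
Qed.

Lemma rootsum_0 n x (j : Z) : INR n * x = 2 * PI * IZR j -> cis x <> RtoC 1 -> rootsum n x = RtoC 0.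
Proof.
  intros H H1. pose proof (rootsum_geom n x) as E. rewrite H, cis_2PI in E.
  replace (1 - 1)%C with (RtoC 0) in E by ring.
  assert (Hn : (cis x - 1)%C <> RtoC 0).
  { intros K. apply H1. replace (cis x) with ((cis x - 1) + 1)%C by ring. rewrite K; ring. }
  replace (rootsum n x) with ((cis x - 1) * rootsum n x / (cis x - 1))%C by (field; assumption).
  rewrite E. field; assumption.
Qed.

Lemma rootsum_Re n x (j : Z) : INR n * x = 2 * PI * IZR j -> 0 <= Re (rootsum n x).
Proof.
  intros H. destruct (classic (cis x = RtoC 1)) as [E|E].
  - rewrite rootsum_1 by assumption. simpl. apply pos_INR.
  - rewrite (rootsum_0 n x j) by assumption. simpl; lra.
Qed.

Lemma Cmod_rootsum n x : Cmod (rootsum n x) <= INR n.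
Proof.
  unfold rootsum. eapply Rle_trans; [apply Cmod_csum|].
  rewrite (rsum_ext _ (fun _ => 1)) by (intros; apply cis_mod).
  rewrite rsum_const, length_seq. lra.
Qed.

Lemma hasum_csum {I J} (f : J -> I -> C) (v : J -> C) (l : list J) :
  (forall j, In j l -> hasum (f j) (v j)) -> hasum (fun i => csum (fun j => f j i) l) (csum v l).
Proof.
  induction l as [|a l IH]; intros H; simpl; [apply hasum_0|].
  apply (hasum_plus (f a)); [apply H; left; reflexivity|apply IH; intros; apply H; right; assumption].
Qed.

(** Averaging over the [n]-th roots of unity isolates the frequencies congruent to [k0] modulo [n]; as [n]
    grows only [k0] itself survives. *)
Lemma fourier_unique (c : Z -> C) : asum c ->
  (forall xi, hasum (fun k => c k * cis (- IZR k * xi))%C (RtoC 0)) -> forall k, c k = RtoC 0.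
Proof.
  intros (B & HB) H k0. apply Ceq_eps; intros e He.
  destruct (US_const (fun _ : unit => True) (fun k => Cmod (c k)) B
    (fun k => Cmod_ge_0 _) HB) as (_ & _ & HU).
  destruct (HU e He) as (F0 & HF0). specialize (HF0 tt Corelib.Init.Logic.I).
  destruct (zbox_cover (k0 :: F0)) as (N & HN). specialize (HN N (le_n N)).
  set (n := (2 * N + 1)%nat). assert (Hn : 0 < INR n) by (apply lt_0_INR; lia).
  set (y := fun k => 2 * PI * IZR (k0 - k) / INR n).
  assert (Hy : forall k, INR n * y k = 2 * PI * IZR (k0 - k)) by (intros; unfold y; field; lra).
  assert (H1 : hasum (fun k => RtoC (/ INR n) * (c k * rootsum n (y k)))%C (RtoC 0)).
  { replace (RtoC 0) with (RtoC (/ INR n) * csum (fun m : nat => RtoC 0) (seq 0 n))%C.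
    - apply hasum_scal. apply hasum_ext with
        (fun k => csum (fun m => cis (2 * PI * INR m * IZR k0 / INR n) *
           (c k * cis (- IZR k * (2 * PI * INR m / INR n))))%C (seq 0 n)).
      + intros k. unfold rootsum. rewrite <- csum_scal. apply csum_ext; intros m _.
        replace (INR m * y k) with (2 * PI * INR m * IZR k0 / INR n + - IZR k * (2 * PI * INR m / INR n)).
        * rewrite cis_plus; ring.
        * unfold y. rewrite minus_IZR. field; lra.
      + apply (hasum_csum (fun m k => cis (2 * PI * INR m * IZR k0 / INR n) *
           (c k * cis (- IZR k * (2 * PI * INR m / INR n))))%C (fun _ => RtoC 0)).
        intros m _. replace (RtoC 0) with (cis (2 * PI * INR m * IZR k0 / INR n) * 0)%C by ring.
        apply hasum_scal, H.
    - rewrite csum_0; ring. }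
  set (s := fun k => (RtoC (eq0 (k - k0)) * c k0)%C).
  assert (H2 : hasum s (c k0)).
  { replace (c k0) with (s k0) by (unfold s; rewrite Z.sub_diag, eq0_0; ring).
    apply hasum_single.
    intros i Hi; unfold s. rewrite eq0_n by lia. ring. }
  pose proof (hasum_minus _ _ _ _ H2 H1) as H3.
  apply (hasum_bound _ _ e) in H3; [exact H3|].
  eapply bnd_mono; [|exact HF0]. intros k. unfold s.
  assert (Hin : RtoC (INR n) <> RtoC 0) by (intros E; apply RtoC_inj in E; lra).
  destruct (Z.eq_dec k k0) as [->|Hk].
  - rewrite Z.sub_diag, eq0_0, rootsum_1.
    + rewrite RtoC_inv by lra. replace (_ - _)%C with (RtoC 0) by (field; assumption).
      rewrite Cmod_0. apply Rmult_le_pos; [apply ind_01|apply Cmod_ge_0].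
    + unfold y. rewrite Z.sub_diag. replace (2 * PI * 0 / INR n) with 0 by (field; lra). apply cis_0.
  - rewrite eq0_n by lia. rewrite Rmult_comm. destruct (classic (In k F0)) as [Hi|Hi].
    + rewrite (ind_in _ _ Hi), (rootsum_0 n (y k) (k0 - k)%Z); [|apply Hy|].
      * replace (_ - _)%C with (RtoC 0) by ring. rewrite Cmod_0; lra.
      * apply cis_neq1.
        assert (Hb : (0 < Z.abs (k0 - k) < Z.of_nat n)%Z).
        { assert (B1 : In k (zbox N)) by (apply HN; right; assumption).
          assert (B2 : In k0 (zbox N)) by (apply HN; left; reflexivity).
          apply in_zbox in B1, B2. unfold n. lia. }
        assert (HA : Rabs (y k) = 2 * PI * (IZR (Z.abs (k0 - k)) / INR n)).
        { unfold y, Rdiv. rewrite !Rabs_mult, Rabs_inv, abs_IZR, (Rabs_pos_eq 2), (Rabs_pos_eq PI),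
            (Rabs_pos_eq (INR n)); try lra. pose proof PI_RGT_0; lra. }
        rewrite HA. pose proof PI_RGT_0.
        assert (0 < IZR (Z.abs (k0 - k)) / INR n < 1).
        { split; [apply Rdiv_lt_0_compat; [apply IZR_lt; lia|lra]|].
          apply Rmult_lt_reg_r with (INR n); [lra|]. unfold Rdiv.
          rewrite Rmult_assoc, Rinv_l, Rmult_1_r, Rmult_1_l by lra.
          rewrite INR_IZR_INZ. apply IZR_lt; lia. }
        split; nra.
    + rewrite (ind_out _ _ Hi), Rmult_1_r.
      replace (_ - _)%C with (- (RtoC (/ INR n) * (c k * rootsum n (y k))))%C by ring.
      rewrite Cmod_opp, !Cmod_mult, Cmod_R, Rabs_pos_eq by (left; apply Rinv_0_lt_compat; lra).
      pose proof (Cmod_rootsum n (y k)) as Hr. pose proof (Cmod_ge_0 (c k)).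
      apply Rle_trans with (/ INR n * (Cmod (c k) * INR n)).
      * apply Rmult_le_compat_l; [left; apply Rinv_0_lt_compat; lra|apply Rmult_le_compat_l; lra].
      * right; field; lra.
Qed.

(** * Spectrally localised data *)

Lemma periodic_Z (f : R -> C) : periodic_2pi f -> forall (j : Z) xi, f (xi + 2 * PI * IZR j) = f xi.
Proof.
  intros Hf. assert (H : forall (n : nat) xi, f (xi + 2 * PI * INR n) = f xi).
  { induction n as [|n IH]; intros xi; [simpl; f_equal; ring|].
    rewrite S_INR. replace (xi + 2 * PI * (INR n + 1)) with (xi + 2 * PI * INR n + 2 * PI) by ring.
    rewrite Hf; apply IH. }
  intros j xi. destruct (Z_le_gt_dec 0 j) as [L|L].
  - rewrite <- (Z2Nat.id j L), <- INR_IZR_INZ. apply H.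
  - rewrite <- (H (Z.to_nat (- j))). rewrite INR_IZR_INZ, Z2Nat.id, opp_IZR by lia. f_equal; ring.
Qed.

Lemma nearest_int (y : R) : exists j : Z, Rabs (y - IZR j) <= 1 / 2.
Proof.
  exists (up (y - 1 / 2)). destruct (archimed (y - 1 / 2)) as [H1 H2]. apply Rabs_le; lra.
Qed.

Lemma located_vanish (f : R -> C) r' xi : periodic_2pi f ->
  (forall xi, - PI <= xi <= PI -> r' < Rabs xi -> f xi = RtoC 0) ->
  (forall j : Z, r' < Rabs (xi - 2 * PI * IZR j)) -> f xi = RtoC 0.
Proof.
  intros Hp Hl H. pose proof PI_RGT_0. destruct (nearest_int (xi / (2 * PI))) as (j & Hj).
  replace xi with (xi - 2 * PI * IZR j + 2 * PI * IZR j) by ring.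
  rewrite periodic_Z by assumption. apply Hl; [|apply H].
  replace (xi - 2 * PI * IZR j) with (2 * PI * (xi / (2 * PI) - IZR j)) by (field; lra).
  apply Rabs_le_between in Hj. split; nra.
Qed.

Lemma asum_twist (a : Z -> C) (w : Z -> C) : asum a -> (forall k, Cmod (w k) = 1) ->
  asum (fun k => a k * w k)%C.
Proof.
  intros (B & HB) Hw; exists B. eapply bnd_mono; [|exact HB].
  intros k. rewrite Cmod_mult, Hw. lra.
Qed.

(** The [f] is orthogonal to its translates by multiples of [PI/p], the supports being disjoint.  So the
    Fourier coefficients [sum_k |a_k|^2 e^{i PI j k/p}] of the mass distribution modulo [2p] vanish
    except for [j = 0]: each class modulo [2p] carries the same mass. *)
Lemma equidistributed (f : R -> C) (a : Z -> C) p r' m :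
  (1 <= p)%nat -> periodic_2pi f -> 2 * r' < PI / INR p ->
  (forall xi, - PI <= xi <= PI -> r' < Rabs xi -> f xi = RtoC 0) ->
  asum a -> has_fourier_coefficients f a ->
  hasum (fun k => a k * Cconj (a k))%C (RtoC m) -> forall k0, 2 * INR p * Cmod (a k0) ^ 2 <= m.
Proof.
  intros Hp Hper Hr Hloc Ha Hf Hm k0. pose proof PI_RGT_0.
  assert (Hp0 : 0 < INR p) by (apply lt_0_INR; lia).
  assert (Hfh : forall xi, hasum (fun k => a k * cis (- IZR k * xi))%C (f xi)).
  { intros xi. apply is_zsum_hasum; [|apply Hf]. apply asum_twist; [assumption|intros; apply cis_mod]. }
  set (n := (2 * p)%nat). assert (Hn : INR n = 2 * INR p) by (unfold n; rewrite mult_INR; simpl; ring).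
  set (th := fun j : nat => PI * INR j / INR p).
  assert (Hdis : forall j, (0 < j < n)%nat -> forall xi, (f xi * Cconj (f (xi + th j)%R) = 0)%C).
  { intros j Hj xi. destruct (classic (forall i : Z, r' < Rabs (xi - 2 * PI * IZR i))) as [K|K].
    { rewrite (located_vanish f r' xi) by assumption. ring. }
    destruct (classic (forall i : Z, r' < Rabs (xi + th j - 2 * PI * IZR i))) as [K'|K'].
    { rewrite (located_vanish f r' (xi + th j)) by assumption.
      unfold Cconj, RtoC, Cmult; simpl. apply injective_projections; simpl; ring. }
    exfalso. apply not_all_ex_not in K as (i & K). apply not_all_ex_not in K' as (i' & K').
    apply Rnot_lt_le, Rabs_le_between in K. apply Rnot_lt_le, Rabs_le_between in K'.
    assert (Hb : - (PI / INR p) < th j - 2 * PI * IZR (i' - i) < PI / INR p)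
      by (rewrite minus_IZR; lra).
    replace (th j - 2 * PI * IZR (i' - i)) with
      (PI / INR p * IZR (Z.of_nat j - 2 * Z.of_nat p * (i' - i))) in Hb.
    2:{ unfold th. rewrite minus_IZR, !mult_IZR, <- !INR_IZR_INZ. field. lra. }
    set (w := (Z.of_nat j - 2 * Z.of_nat p * (i' - i))%Z) in *.
    assert (Hq : 0 < PI / INR p) by (apply Rdiv_lt_0_compat; lra).
    assert (-1 < IZR w < 1) by (split; apply (Rmult_lt_reg_l (PI / INR p)); lra).
    assert (-1 < w < 1)%Z by (split; apply lt_IZR; lra).
    assert (Hjp : (0 < Z.of_nat j < 2 * Z.of_nat p)%Z) by (unfold n in Hj; lia).
    unfold w in *. set (d := (i' - i)%Z) in *. destruct (Z_le_gt_dec d 0); nia. }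
  (* the zeroth Fourier coefficient of the product of f with a translate, which vanishes *)
  assert (Hz : forall j, (0 < j < n)%nat ->
     hasum (fun k => a k * Cconj (a k) * cis (IZR k * th j))%C (RtoC 0)).
  { intros j Hj. set (b := fun k => Cconj (a k * cis (- IZR k * th j))%C).
    assert (Hb : asum b).
    { destruct Ha as (B & HB); exists B. eapply bnd_mono; [|exact HB].
      intros k; unfold b. rewrite Cmod_conj, Cmod_mult, cis_mod; lra. }
    set (g := fun x : Z * Z => (a (fst x + snd x)%Z * b (snd x))%C).
    set (h := fun x : Z * Z => ((fst x + snd x)%Z, snd x)).
    set (h' := fun x : Z * Z => ((fst x - snd x)%Z, snd x)).
    assert (Hh : forall x, h' (h x) = x) by (intros []; unfold h, h'; simpl; f_equal; ring).
    assert (Hh' : forall x, h (h' x) = x) by (intros []; unfold h, h'; simpl; f_equal; ring).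
    assert (Hg : asum g).
    { destruct (asum_prod _ _ Ha Hb) as (B & HB). exists B.
      apply (bnd_inj (fun x => Cmod (a (fst x) * b (snd x))) h); [|exact HB].
      intros x y E; rewrite <- (Hh x), <- (Hh y), E; reflexivity. }
    set (c := fun i : Z => tsum (fun l => g (i, l))).
    assert (Hc : forall i, hasum (fun l => g (i, l)) (c i)).
    { intros i. apply tsum_ok. destruct Hg as (B & HB). exists B. apply (bnd_fiber _ _ i HB). }
    assert (Hca : asum c).
    { destruct Hg as (B & HB). exists B. apply (bnd_hasum_fiber g); assumption. }
    assert (Hc0 : forall i, c i = RtoC 0).
    { apply fourier_unique; [assumption|]. intros xi.
      pose proof (Hfh (xi + th j)) as F2. apply hasum_conj in F2.
      assert (A1 : asum (fun k => a k * cis (- IZR k * xi))%C)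
        by (apply asum_twist; [assumption|intros; apply cis_mod]).
      assert (A2 : asum (fun k => Cconj (a k * cis (- IZR k * (xi + th j))))).
      { destruct Ha as (B & HB); exists B. eapply bnd_mono; [|exact HB].
        intros k. rewrite Cmod_conj, Cmod_mult, cis_mod; lra. }
      pose proof (hasum_prod _ _ _ _ A1 A2 (Hfh xi) F2) as F3.
      rewrite (Hdis j Hj) in F3.
      apply (hasum_bij _ h h' _ Hh Hh') in F3.
      refine (hasum_fubini (fun x => cis (- IZR (fst x) * xi) * g x)%C _ _ _ _ _).
      - destruct Hg as (B & HB); exists B. eapply bnd_mono; [|exact HB].
        intros x. rewrite Cmod_mult, cis_mod; lra.
      - eapply hasum_ext; [|exact F3]. intros [i l]. unfold g, b, h; simpl.
        rewrite !Cmult_conj, <- !cis_neg, plus_IZR.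
        match goal with |- (?x1 * cis ?t1 * (?x2 * cis ?t2) = cis ?t3 * (?x1 * (?x2 * cis ?t4)))%C =>
          replace (x1 * cis t1 * (x2 * cis t2))%C with (x1 * x2 * cis (t1 + t2))%C by (rewrite cis_plus; ring);
          replace (cis t3 * (x1 * (x2 * cis t4)))%C with (x1 * x2 * cis (t3 + t4))%C by (rewrite cis_plus; ring)
        end. do 2 f_equal. ring.
      - intros i; simpl. rewrite (Cmult_comm (c i)). apply hasum_scal, Hc. }
    pose proof (Hc 0%Z) as K. rewrite Hc0 in K. eapply hasum_ext; [|exact K].
    intros l. unfold g, b; simpl. rewrite Cmult_conj, <- cis_neg.
    replace (- (- IZR l * th j)) with (IZR l * th j) by ring. ring. }
  (* averaging over j extracts the class of k0 modulo 2p *)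
  assert (Hsum : hasum (fun k => RtoC (Cmod (a k) ^ 2) *
      rootsum n (2 * PI * IZR (k - k0) / INR n))%C (RtoC m)).
  { set (v := fun j : nat => if Nat.eqb j 0 then RtoC m else RtoC 0).
    replace (RtoC m) with (csum v (seq 0 n)).
    - apply hasum_ext with (fun k => csum (fun j => cis (- IZR k0 * th j) *
          (a k * Cconj (a k) * cis (IZR k * th j)))%C (seq 0 n)).
      + intros k. unfold rootsum. rewrite Cmod2_conj, <- csum_scal. apply csum_ext; intros j _.
        replace (INR j * (2 * PI * IZR (k - k0) / INR n)) with (- IZR k0 * th j + IZR k * th j).
        * rewrite cis_plus; ring.
        * unfold th. rewrite Hn, minus_IZR. field; lra.
      + apply (hasum_csum (fun j k => cis (- IZR k0 * th j) *
          (a k * Cconj (a k) * cis (IZR k * th j)))%C v). intros j Hj. unfold v.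
        apply in_seq in Hj. destruct (Nat.eqb_spec j 0) as [->|Hj0].
        * unfold th; simpl. apply hasum_ext with (fun k => a k * Cconj (a k))%C; [|exact Hm].
          intros k. replace (PI * 0 / INR p) with 0 by (field; lra).
          rewrite !Rmult_0_r, cis_0. ring.
        * replace (RtoC 0) with (cis (- IZR k0 * th j) * 0)%C by ring.
          apply hasum_scal, Hz. lia.
    - unfold n. replace (2 * p)%nat with (S (2 * p - 1)) by lia. simpl seq. simpl csum.
      unfold v at 1; simpl. replace (csum v _) with (RtoC 0); [ring|].
      assert (G : forall l, (forall j, In j l -> (0 < j)%nat) -> csum v l = RtoC 0).
      { induction l as [|i l IH]; intros Hl; [reflexivity|]. simpl. rewrite IH.
        - unfold v. destruct (Nat.eqb_spec i 0); [|ring].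
          specialize (Hl i (or_introl eq_refl)). lia.
        - intros; apply Hl; right; assumption. }
      symmetry; apply G. intros j Hj. apply in_seq in Hj. lia. }
  assert (Hpos : forall k, 0 <= Re (RtoC (Cmod (a k) ^ 2) * rootsum n (2 * PI * IZR (k - k0) / INR n))%C).
  { intros k. pose proof (rootsum_Re n (2 * PI * IZR (k - k0) / INR n) (k - k0)) as K.
    unfold Re, Cmult, RtoC in *; simpl. rewrite Rmult_0_l, Rminus_0_r.
    apply Rmult_le_pos; [apply (pow2_ge_0 (Cmod (a k)))|]. apply K.
    assert (0 < INR n) by (rewrite Hn; lra). field. lra. }
  pose proof (hasum_Re_ge _ _ [k0] Hsum Hpos) as K. simpl rsum in K.
  rewrite Z.sub_diag, rootsum_1 in K.
  - unfold Re, Cmult, RtoC in K; simpl in K. rewrite Hn in K.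
    specialize (K ltac:(constructor; [intros []|constructor])). simpl; lra.
  - replace (2 * PI * 0 / INR n) with 0; [apply cis_0|]. field. rewrite Hn; lra.
Qed.

(** Up to a factor independent of [k] the phase of [e_k] at time [p/(2 PI q)] is
    [e^{- i k th} g(k)] with [g(k) = e^{i PI q k^2/(2p)}] periodic modulo [2p].  Expanding [g] on the characters
    modulo [2p] writes the free evolution as a combination of the values [f (th + PI m/p)]. *)
Lemma linear_vanish (f : R -> C) (a : Z -> C) p q r' x :
  (1 <= p)%nat -> (1 <= q)%nat -> periodic_2pi f ->
  (forall xi, - PI <= xi <= PI -> r' < Rabs xi -> f xi = RtoC 0) ->
  asum a -> has_fourier_coefficients f a ->
  (forall m : Z, r' < PI * INR q / INR p * Rabs (x - IZR m / INR q)) ->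
  hasum (fun k => a k * free_delta k (t_pq p q) x)%C (RtoC 0).
Proof.
  intros Hp Hq Hper Hloc Ha Hf Hx. pose proof PI_RGT_0.
  assert (Hp0 : 0 < INR p) by (apply lt_0_INR; lia).
  assert (Hq0 : 0 < INR q) by (apply lt_0_INR; lia).
  assert (Hfh : forall xi, hasum (fun k => a k * cis (- IZR k * xi))%C (f xi)).
  { intros xi. apply is_zsum_hasum; [|apply Hf]. apply asum_twist; [assumption|intros; apply cis_mod]. }
  set (n := (2 * p)%nat). assert (Hn : INR n = 2 * INR p) by (unfold n; rewrite mult_INR; simpl; ring).
  assert (Hn0 : 0 < INR n) by lra.
  set (t := t_pq p q). assert (Ht : 0 < t).
  { unfold t, t_pq. apply Rmult_lt_0_compat; apply Rdiv_lt_0_compat; lra. }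
  set (gam := fun y : R => cis (PI * INR q * y ^ 2 / (2 * INR p))).
  set (th := PI * INR q * x / INR p).
  set (G := fun m : nat => (RtoC (/ INR n) * csum (fun l : nat => gam (INR l) *
      cis (INR m * (2 * PI * INR l / INR n))) (seq 0 n))%C).
  (* finite Fourier inversion modulo 2p *)
  assert (HG : forall k : Z, gam (IZR k) = csum (fun m => G m * cis (- IZR k * (PI * INR m / INR p)))%C (seq 0 n)).
  { intros k. unfold G.
    rewrite (csum_ext _ (fun m => RtoC (/ INR n) * csum (fun l => gam (INR l) *
        cis (INR m * (2 * PI * IZR (Z.of_nat l - k) / INR n))) (seq 0 n))%C).
    2:{ intros m _. rewrite <- Cmult_assoc. f_equal. rewrite Cmult_comm, <- csum_scal.
        apply csum_ext; intros l _.
        replace (INR m * (2 * PI * IZR (Z.of_nat l - k) / INR n)) with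
          (INR m * (2 * PI * INR l / INR n) + - IZR k * (PI * INR m / INR p)).
        - rewrite cis_plus; ring.
        - rewrite Hn, minus_IZR, <- INR_IZR_INZ. field; lra. }
    rewrite csum_scal, csum_swap.
    set (l0 := Z.to_nat (k mod Z.of_nat n)).
    pose proof (Z.mod_pos_bound k (Z.of_nat n) ltac:(unfold n; lia)) as Hl0.
    pose proof (Z.div_mod k (Z.of_nat n) ltac:(unfold n; lia)) as Hdm.
    set (d := (k / Z.of_nat n)%Z) in *.
    assert (Hk : k = (Z.of_nat l0 + Z.of_nat n * d)%Z) by (unfold l0; lia).
    rewrite (csum_ext _ (fun l => if Nat.eqb l l0 then (RtoC (INR n) * gam (IZR k))%C else RtoC 0)).
    - assert (Hlist : forall l : list nat, NoDup l ->
        csum (fun i => if Nat.eqb i l0 then (RtoC (INR n) * gam (IZR k))%C else RtoC 0) l =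
        if in_dec Nat.eq_dec l0 l then (RtoC (INR n) * gam (IZR k))%C else RtoC 0).
      { induction l as [|i l IH]; intros Hl; [reflexivity|]. inversion_clear Hl as [|? ? H1 H2].
        cbn [csum fold_right]. fold (csum (fun i => if Nat.eqb i l0 then (RtoC (INR n) * gam (IZR k))%C else RtoC 0) l).
        rewrite IH by assumption. destruct (Nat.eqb_spec i l0) as [->|Hi].
        - destruct (in_dec Nat.eq_dec l0 l); [contradiction|].
          destruct (in_dec Nat.eq_dec l0 (l0 :: l)) as [|K]; [ring|]. exfalso; apply K; left; reflexivity.
        - destruct (in_dec Nat.eq_dec l0 l) as [K|K];
            destruct (in_dec Nat.eq_dec l0 (i :: l)) as [K'|K']; try ring.
          + exfalso; apply K'; right; assumption.
          + exfalso; destruct K'; [congruence|contradiction]. }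
      rewrite Hlist by apply seq_NoDup.
      destruct (in_dec Nat.eq_dec l0 (seq 0 n)) as [K|K].
      + rewrite RtoC_inv by lra. field. intros E; apply RtoC_inj in E; lra.
      + exfalso; apply K, in_seq. unfold l0. lia.
    - intros l Hl. apply in_seq in Hl. rewrite csum_scal.
      change (csum _ _) with (rootsum n (2 * PI * IZR (Z.of_nat l - k) / INR n)).
      destruct (Nat.eqb_spec l l0) as [->|Hll].
      + rewrite rootsum_1.
        * rewrite (Cmult_comm (gam _)). f_equal. unfold gam. rewrite Hk.
          rewrite plus_IZR, mult_IZR, <- !INR_IZR_INZ, Hn.
          match goal with |- cis ?y1 = cis ?y2 => replace y2 with
            (y1 + 2 * PI * IZR (Z.of_nat q * (Z.of_nat l0 * d + Z.of_nat p * d * d))) end.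
          -- rewrite cis_shift; reflexivity.
          -- rewrite !mult_IZR, plus_IZR, !mult_IZR, <- !INR_IZR_INZ. field; lra.
        * replace (2 * PI * IZR (Z.of_nat l0 - k) / INR n) with (2 * PI * IZR (- d)); [apply cis_2PI|].
          replace (Z.of_nat l0 - k)%Z with (Z.of_nat n * - d)%Z by lia.
          rewrite mult_IZR, <- INR_IZR_INZ. field; lra.
      + rewrite (rootsum_0 n _ (Z.of_nat l - k)%Z); [ring|field; lra|].
        replace (2 * PI * IZR (Z.of_nat l - k) / INR n) with
          (2 * PI * IZR (Z.of_nat l - Z.of_nat l0) / INR n + 2 * PI * IZR (- d)).
        * rewrite cis_shift. apply cis_neq1.
          assert (Hb : (0 < Z.abs (Z.of_nat l - Z.of_nat l0) < Z.of_nat n)%Z) by (unfold l0 in *; lia).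
          assert (HA : Rabs (2 * PI * IZR (Z.of_nat l - Z.of_nat l0) / INR n) =
             2 * PI * (IZR (Z.abs (Z.of_nat l - Z.of_nat l0)) / INR n)).
          { unfold Rdiv. rewrite !Rabs_mult, Rabs_inv, abs_IZR, (Rabs_pos_eq 2), (Rabs_pos_eq PI),
            (Rabs_pos_eq (INR n)); lra. }
          rewrite HA.
          assert (0 < IZR (Z.abs (Z.of_nat l - Z.of_nat l0)) / INR n < 1).
          { split; [apply Rdiv_lt_0_compat; [apply IZR_lt; lia|lra]|].
            apply Rmult_lt_reg_r with (INR n); [lra|]. unfold Rdiv.
            rewrite Rmult_assoc, Rinv_l, Rmult_1_r, Rmult_1_l by lra.
            rewrite (INR_IZR_INZ n). apply IZR_lt; lia. }
          split; nra.
        * rewrite Hk. rewrite !minus_IZR, plus_IZR, mult_IZR, opp_IZR, <- !INR_IZR_INZ. field; lra. }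
  assert (Hv : forall m : nat, f (th + PI * INR m / INR p) = RtoC 0).
  { intros m. apply (located_vanish f r'); [assumption..|]. intros j.
    specialize (Hx (2 * Z.of_nat p * j - Z.of_nat m)%Z).
    replace (th + PI * INR m / INR p - 2 * PI * IZR j) with
      (PI * INR q / INR p * (x - IZR (2 * Z.of_nat p * j - Z.of_nat m) / INR q)).
    - rewrite Rabs_mult, (Rabs_pos_eq (PI * INR q / INR p)); [exact Hx|].
      left; apply Rdiv_lt_0_compat; [apply Rmult_lt_0_compat; lra|lra].
    - unfold th. rewrite minus_IZR, !mult_IZR, <- !INR_IZR_INZ. field; lra. }
  set (pre := (RtoC (/ sqrt (4 * PI * t)) * cis (x ^ 2 / (4 * t) - PI / 4))%C).
  replace (RtoC 0) with (pre * csum (fun m => G m * f (th + PI * INR m / INR p)%R) (seq 0 n))%C.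
  - apply hasum_ext with (fun k => pre * csum (fun m => G m *
       (a k * cis (- IZR k * (th + PI * INR m / INR p))))%C (seq 0 n))%C.
    + intros k. rewrite free_delta_cis by assumption.
      rewrite (csum_ext _ (fun m => (a k * cis (- IZR k * th)) *
         (G m * cis (- IZR k * (PI * INR m / INR p))))%C).
      2:{ intros m _. rewrite Rmult_plus_distr_l, cis_plus. ring. }
      rewrite csum_scal, <- HG. unfold pre, gam.
      replace ((x - IZR k) ^ 2 / (4 * t) - PI / 4) with
        (x ^ 2 / (4 * t) - PI / 4 + - IZR k * th + PI * INR q * IZR k ^ 2 / (2 * INR p)).
      * rewrite !cis_plus. ring.
      * unfold th, t, t_pq. field. lra.
    + apply hasum_scal. apply (hasum_csum (fun m k => G m *
       (a k * cis (- IZR k * (th + PI * INR m / INR p))))%C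
       (fun m => G m * f (th + PI * INR m / INR p)%R)%C).
      intros m _. apply hasum_scal, Hfh.
  - rewrite (csum_ext _ (fun _ => RtoC 0)).
    + rewrite csum_0; ring.
    + intros m _. rewrite Hv; ring.
Qed.

Lemma sum_triangle (p : nat) N :
  INR (p - 0) + 2 * sum_f_R0 (fun n => INR (p - S n)) N <= INR p ^ 2.
Proof.
  assert (H : 2 * sum_f_R0 (fun n => INR (p - S n)) N +
     INR (p - S N) * (INR (p - S N) - 1) <= INR p * (INR p - 1)).
  { assert (St : forall i, 2 * INR (p - S i) + INR (p - S i) * (INR (p - S i) - 1) <=
       INR (p - i) * (INR (p - i) - 1)).
    { intros i. destruct (le_lt_dec (S i) p) as [L|L].
      - replace (p - i)%nat with (S (p - S i)) by lia. rewrite S_INR. right; ring.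
      - replace (p - S i)%nat with O by lia. replace (p - i)%nat with O by lia. simpl; lra. }
    induction N as [|N IH].
    - specialize (St O). rewrite Nat.sub_0_r in St. simpl sum_f_R0. exact St.
    - rewrite tech5. specialize (St (S N)). lra. }
  rewrite Nat.sub_0_r.
  assert (0 <= INR (p - S N) * (INR (p - S N) - 1)).
  { destruct (p - S N)%nat as [|k]; [simpl; lra|]. rewrite S_INR. pose proof (pos_INR k). nra. }
  nra.
Qed.

(** As [1+|k| >= (p+1) - (p-|k|)_+] and the sum of [(p-|k|)_+] is [p^2], the bound [m/(2p)] on each
    [|a_k|^2] gives [E >= (p+1) m - p^2 m/(2p)]. *)
Lemma mass_localised (a : Z -> C) p m E :
  (1 <= p)%nat -> bnd (fun k => jap k * Cmod (a k) ^ 2) E ->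
  (forall e, 0 < e -> exists l, NoDup l /\ m - e <= rsum (fun k => Cmod (a k) ^ 2) l) ->
  (forall k, 2 * INR p * Cmod (a k) ^ 2 <= m) -> (INR p + 2) * m <= 2 * E.
Proof.
  intros Hp HE Hm Hk. assert (Hp0 : 1 <= INR p) by (apply (le_INR 1 p); lia).
  assert (Hm0 : 0 <= m).
  { specialize (Hk 0%Z). pose proof (pow2_ge_0 (Cmod (a 0%Z))). nra. }
  assert (Htri : bnd (fun k => INR (p - Z.abs_nat k)) (INR p ^ 2)).
  { apply bnd_even with (fun n => INR (p - n)); [reflexivity|intros; apply pos_INR|].
    apply sum_triangle. }
  apply le_epsilon; intros e He.
  destruct (Hm (e / (2 * (INR p + 1)))) as (l & Hl & Hle); [apply Rdiv_lt_0_compat; lra|].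
  assert (H1 : (INR p + 1) * rsum (fun k => Cmod (a k) ^ 2) l <= E + INR p ^ 2 * (m / (2 * INR p))).
  { rewrite <- rsum_scal. eapply Rle_trans; [|apply Rplus_le_compat; [apply HE, Hl|
      apply Rmult_le_compat_r; [|apply Htri, Hl]]].
    - rewrite <- rsum_scal_r, <- rsum_plus. apply rsum_le; intros k _.
      rewrite jap_INR. specialize (Hk k). pose proof (pow2_ge_0 (Cmod (a k))).
      assert (Hd : Cmod (a k) ^ 2 <= m / (2 * INR p)).
      { apply Rmult_le_reg_l with (2 * INR p); [lra|]. replace (2 * INR p * (m / (2 * INR p))) with m
          by (field; lra). lra. }
      assert (Hc : INR p <= INR (Z.abs_nat k) + INR (p - Z.abs_nat k)).
      { rewrite <- plus_INR. apply le_INR; lia. }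
      pose proof (pos_INR (p - Z.abs_nat k)). nra.
    - apply Rmult_le_pos; [lra|left; apply Rinv_0_lt_compat; lra]. }
  replace (INR p ^ 2 * (m / (2 * INR p))) with (INR p * m / 2) in H1 by (field; lra).
  assert (H2 : (INR p + 1) * (m - e / (2 * (INR p + 1))) <= (INR p + 1) * rsum (fun k => Cmod (a k) ^ 2) l)
    by (apply Rmult_le_compat_l; lra).
  replace ((INR p + 1) * (m - e / (2 * (INR p + 1)))) with ((INR p + 1) * m - e / 2) in H2 by (field; lra).
  lra.
Qed.

(** * Trilinear estimates *)

(** [|a|^(-1/3)]: the kernel [1/|a|] is its cube, and its fourth power is summable. *)
Definition vw (a : Z) : R := if (a =? 0)%Z then 0 else Rpower (Rabs (IZR a)) (- (1 / 3)).

Lemma vw_nonneg a : 0 <= vw a.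
Proof. unfold vw; destruct (Z.eqb a 0); [lra|left; apply Rpower_pos]. Qed.

Lemma Rpower_pow_mult x y n : 0 < x -> Rpower x y ^ n = Rpower x (y * INR n).
Proof.
  intros Hx. rewrite <- Rpower_pow by apply Rpower_pos. apply Rpower_mult.
Qed.

Lemma vw_cube a : vw a ^ 3 = Rabs (/ IZR a).
Proof.
  unfold vw. destruct (Z.eqb_spec a 0) as [->|Ha]; [rewrite Rinv_0, Rabs_R0; ring|].
  assert (0 < Rabs (IZR a)) by (apply Rabs_pos_lt, not_0_IZR, Ha).
  rewrite Rpower_pow_mult by assumption. simpl INR.
  replace (- (1 / 3) * (1 + 1 + 1)) with (- (1)) by field.
  rewrite Rpower_Ropp, Rpower_1, Rabs_inv by assumption. reflexivity.
Qed.

Lemma cbrt2_le : Rpower 2 (- (1 / 3)) <= 8 / 10.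
Proof.
  set (c := Rpower 2 (- (1 / 3))). assert (Hc : 0 < c) by apply Rpower_pos.
  assert (H : c ^ 3 = / 2).
  { unfold c. rewrite Rpower_pow_mult by lra. simpl INR.
    replace (- (1 / 3) * (1 + 1 + 1)) with (- (1)) by field.
    rewrite Rpower_Ropp, Rpower_1 by lra. reflexivity. }
  apply Rnot_lt_le; intros L. assert (H1 : 64 / 100 < c * c) by nra.
  assert (H2 : 512 / 1000 < c * (c * c)) by nra. simpl in H. lra.
Qed.

Lemma bnd_vw4 : bnd (fun a => vw a ^ 4) (76 / 10).
Proof.
  apply bnd_even with (fun n => match n with O => 0 | S m => Rpower (INR m + 1) (- (4 / 3)) end).
  - intros k. unfold vw. destruct (Z.eqb_spec k 0) as [->|Hk]; [simpl; ring|].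
    rewrite Rpower_pow_mult by (apply Rabs_pos_lt, not_0_IZR, Hk).
    destruct (Z.abs_nat k) as [|m] eqn:E; [lia|].
    rewrite <- S_INR, <- E, (INR_IZR_INZ (Z.abs_nat k)), Zabs2Nat.id_abs, abs_IZR. f_equal. simpl; field.
  - intros [|n]; [lra|left; apply Rpower_pos].
  - intros N. pose proof cbrt2_le as H0.
    assert (H43 : Rpower 2 (- (4 / 3)) <= 4 / 10).
    { replace (- (4 / 3)) with (- (1 / 3) + - (1)) by field.
      rewrite Rpower_plus, (Rpower_Ropp 2 1), Rpower_1 by lra. lra. }
    assert (H1 : Rpower 1 (- (4 / 3)) = 1)
      by (unfold Rpower; rewrite ln_1, Rmult_0_r, exp_0; reflexivity).
    rewrite Rplus_0_l. destruct N as [|N]; [simpl; rewrite Rplus_0_l, H1; lra|].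
    rewrite decomp_sum by lia. simpl pred. simpl INR at 1. rewrite Rplus_0_l, H1.
    pose proof (sum_Rpower_le (4 / 3) N ltac:(lra)) as HS.
    replace (1 - 4 / 3) with (- (1 / 3)) in HS by field.
    pose proof (Rpower_pos (INR N + 2) (- (1 / 3))).
    replace (4 / 3 - 1) with (1 / 3) in HS by field.
    rewrite (sum_eq _ (fun n => Rpower (INR n + 2) (- (4 / 3))) N); [lra|].
    intros i _. rewrite S_INR. f_equal. ring.
Qed.

Lemma Rmult_le_1 a x : 0 <= x -> a <= 1 -> a * x <= x.
Proof. intros; nra. Qed.

Lemma sqr_le_of (x y : R) : 0 <= y -> x ^ 2 <= y ^ 2 -> x <= y.
Proof.
  intros Hy H. apply Rnot_lt_le; intros L. nra.
Qed.

Lemma pow2_pow2 (x : R) : (x ^ 2) ^ 2 = x ^ 4.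
Proof. ring. Qed.

(** Convolution with [1/|a|] maps [l^2] to [l^4] (Hardy-Littlewood-Sobolev).  Splitting the kernel as
    [vw^2 vw], two applications of Cauchy-Schwarz leave only the summable [vw^4]. *)
Lemma hls4 (x : Z -> R) (L : list Z) X : NoDup L -> 0 <= X ->
  rsum (fun i => x i ^ 2) L <= X ^ 2 ->
  rsum (fun j => rsum (fun i => x i * vw (i - j) ^ 3) L ^ 4) L <= (76 / 10) ^ 3 * X ^ 4.
Proof.
  intros HL HX Hx. set (c := 76 / 10).
  assert (Hv : forall j, rsum (fun i => vw (i - j) ^ 4) L <= c).
  { intros j. apply (bnd_inj (fun a => vw a ^ 4) (fun i => (i - j)%Z) c); [lia|apply bnd_vw4|assumption]. }
  assert (Hv' : forall i, rsum (fun j => vw (i - j) ^ 4) L <= c).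
  { intros i. apply (bnd_inj (fun a => vw a ^ 4) (fun j => (i - j)%Z) c); [lia|apply bnd_vw4|assumption]. }
  set (s := fun j => rsum (fun i => x i ^ 2 * vw (i - j) ^ 2) L).
  assert (Hs0 : forall j, 0 <= s j).
  { intros j; apply rsum_nonneg; intros; apply Rmult_le_pos; apply pow2_ge_0. }
  assert (H1 : forall j, rsum (fun i => x i * vw (i - j) ^ 3) L ^ 2 <= c * s j).
  { intros j. rewrite (rsum_ext _ (fun i => vw (i - j) ^ 2 * (x i * vw (i - j)))) by (intros; ring).
    eapply Rle_trans; [apply rsum_CS|].
    rewrite (rsum_ext (fun i => (vw (i - j) ^ 2) ^ 2) (fun i => vw (i - j) ^ 4)) by (intros; ring).
    rewrite (rsum_ext (fun i => (x i * vw (i - j)) ^ 2) (fun i => x i ^ 2 * vw (i - j) ^ 2)) by (intros; ring).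
    apply Rmult_le_compat_r; [apply Hs0|apply Hv]. }
  assert (H2 : forall j, s j ^ 2 <= X ^ 2 * rsum (fun i => x i ^ 2 * vw (i - j) ^ 4) L).
  { intros j. unfold s. rewrite (rsum_ext _ (fun i => x i * (x i * vw (i - j) ^ 2))) by (intros; ring).
    eapply Rle_trans; [apply rsum_CS|].
    rewrite (rsum_ext (fun i => (x i * vw (i - j) ^ 2) ^ 2) (fun i => x i ^ 2 * vw (i - j) ^ 4)) by (intros; ring).
    apply Rmult_le_compat_r; [|assumption].
    apply rsum_nonneg; intros i _. apply Rmult_le_pos; [apply pow2_ge_0|apply pow_le, vw_nonneg]. }
  apply Rle_trans with (rsum (fun j => c ^ 2 * (X ^ 2 * rsum (fun i => x i ^ 2 * vw (i - j) ^ 4) L)) L).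
  - apply rsum_le; intros j _. rewrite <- pow2_pow2.
    apply Rle_trans with ((c * s j) ^ 2); [apply pow_incr; split; [apply pow2_ge_0|apply H1]|].
    rewrite Rpow_mult_distr. apply Rmult_le_compat_l; [apply pow2_ge_0|apply H2].
  - rewrite !rsum_scal, rsum_swap.
    rewrite (rsum_ext _ (fun i => x i ^ 2 * rsum (fun j => vw (i - j) ^ 4) L))
      by (intros; rewrite <- rsum_scal; reflexivity).
    apply Rle_trans with (c ^ 2 * (X ^ 2 * (c * X ^ 2))); [|right; ring].
    apply Rmult_le_compat_l; [apply pow2_ge_0|]. apply Rmult_le_compat_l; [apply pow2_ge_0|].
    apply Rle_trans with (rsum (fun i => x i ^ 2 * c) L).
    + apply rsum_le; intros i _. apply Rmult_le_compat_l; [apply pow2_ge_0|apply Hv'].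
    + rewrite rsum_scal_r. unfold c in *. nra.
Qed.

(** Two factors are put in [l^4] by [hls4] and the third in [l^2]; [21^2] exceeds [7.6^3]. *)
Lemma trilinear_fin (x y z : Z -> R) (L : list Z) X Y W : NoDup L -> 0 <= X -> 0 <= Y -> 0 <= W ->
  rsum (fun i => x i ^ 2) L <= X ^ 2 -> rsum (fun i => y i ^ 2) L <= Y ^ 2 ->
  rsum (fun i => z i ^ 2) L <= W ^ 2 ->
  rsum (fun j => y j * (rsum (fun i => x i * vw (i - j) ^ 3) L *
                        rsum (fun i => z i * vw (i - j) ^ 3) L)) L <= 21 * (X * Y * W).
Proof.
  intros HL HX HY HW Hx Hy Hz.
  set (f := fun j => rsum (fun i => x i * vw (i - j) ^ 3) L).
  set (g := fun j => rsum (fun i => z i * vw (i - j) ^ 3) L).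
  pose proof (hls4 x L X HL HX Hx) as F. pose proof (hls4 z L W HL HW Hz) as G.
  fold f in F. fold g in G. change (rsum (fun j => f j ^ 4) L <= (76 / 10) ^ 3 * X ^ 4) in F.
  change (rsum (fun j => g j ^ 4) L <= (76 / 10) ^ 3 * W ^ 4) in G.
  change (rsum (fun j => y j * (f j * g j)) L <= 21 * (X * Y * W)).
  assert (Q : rsum (fun j => (f j * g j) ^ 2) L <= (76 / 10) ^ 3 * (X * W) ^ 2).
  { apply sqr_le_of; [apply Rmult_le_pos; [lra|apply pow2_ge_0]|].
    rewrite (rsum_ext _ (fun j => f j ^ 2 * g j ^ 2)) by (intros; ring).
    eapply Rle_trans; [apply rsum_CS|].
    rewrite (rsum_ext (fun j => (f j ^ 2) ^ 2) (fun j => f j ^ 4)) by (intros; ring).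
    rewrite (rsum_ext (fun j => (g j ^ 2) ^ 2) (fun j => g j ^ 4)) by (intros; ring).
    replace (((76 / 10) ^ 3 * (X * W) ^ 2) ^ 2) with (((76 / 10) ^ 3 * X ^ 4) * ((76 / 10) ^ 3 * W ^ 4)) by ring.
    apply Rmult_le_compat; try assumption; apply rsum_nonneg; intros;
      rewrite <- pow2_pow2; apply pow2_ge_0. }
  apply sqr_le_of; [repeat apply Rmult_le_pos; lra|].
  eapply Rle_trans; [apply rsum_CS|].
  apply Rle_trans with (Y ^ 2 * ((76 / 10) ^ 3 * (X * W) ^ 2)).
  - apply Rmult_le_compat; try assumption; apply rsum_nonneg; intros; apply pow2_ge_0.
  - replace ((21 * (X * Y * W)) ^ 2) with (21 ^ 2 * (Y ^ 2 * (X * W) ^ 2)) by ring.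
    replace (Y ^ 2 * ((76 / 10) ^ 3 * (X * W) ^ 2)) with ((76 / 10) ^ 3 * (Y ^ 2 * (X * W) ^ 2)) by ring.
    apply Rmult_le_compat_r; [apply Rmult_le_pos; apply pow2_ge_0|lra].
Qed.

Lemma triple_cover (l : list ((Z * Z) * Z)) :
  exists L, NoDup L /\ incl l (list_prod (list_prod L L) L).
Proof.
  destruct (zbox_cover (map (fun x => fst (fst x)) l)) as (N1 & H1).
  destruct (zbox_cover (map (fun x => snd (fst x)) l)) as (N2 & H2).
  destruct (zbox_cover (map snd l)) as (N3 & H3).
  set (N := (N1 + N2 + N3)%nat).
  exists (zbox N); split; [apply nodup_zbox|]. intros [[a b] c] H.
  apply in_prod; [apply in_prod|].
  - apply (H1 N ltac:(lia)). apply (in_map (fun x => fst (fst x))) in H; exact H.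
  - apply (H2 N ltac:(lia)). apply (in_map (fun x => snd (fst x))) in H; exact H.
  - apply (H3 N ltac:(lia)). apply (in_map snd) in H; exact H.
Qed.

(** In the frequencies [j1, j2, j3] the weight [1/|ab|] is [1/(|j1-j2| |j3-j2|)], a product of two
    kernels attached to [j2]. *)
Lemma trilinear_kk (x y z : Z -> R) X Y W :
  (forall k, 0 <= x k) -> (forall k, 0 <= y k) -> (forall k, 0 <= z k) ->
  0 <= X -> 0 <= Y -> 0 <= W ->
  bnd (fun k => x k ^ 2) (X ^ 2) -> bnd (fun k => y k ^ 2) (Y ^ 2) -> bnd (fun k => z k ^ 2) (W ^ 2) ->
  bnd (fun i => Rabs (kk (snd i)) * rtrip x y z (fst i) (snd i)) (21 * (X * Y * W)).
Proof.
  intros x0 y0 z0 HX HY HW Hx Hy Hz.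
  set (F := fun i : (Z * Z) * Z => let '((i, j), l) := i in
     y j * ((x i * vw (i - j) ^ 3) * (z l * vw (l - j) ^ 3))).
  assert (HF0 : forall i, 0 <= F i).
  { intros [[i j] l]; unfold F. repeat apply Rmult_le_pos; auto; try apply vw_nonneg; lra. }
  assert (HF : bnd F (21 * (X * Y * W))).
  { intros l Hl. destruct (triple_cover l) as (L & HL & Hi).
    eapply Rle_trans; [apply (rsum_incl F l _ HF0 Hl Hi)|].
    rewrite rsum_prod, rsum_prod, rsum_swap.
    eapply Rle_trans; [|apply (trilinear_fin x y z L X Y W); auto].
    right. apply rsum_ext; intros j _. rewrite <- rsum_scal_r, <- rsum_scal.
    apply rsum_ext; intros i _. rewrite <- !rsum_scal.
    apply rsum_ext; intros k _. unfold F; simpl; ring. }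
  apply (bnd_inj F unslant _ unslant_inj) in HF.
  eapply bnd_mono; [|exact HF]. intros [k [a b]]. unfold F, rtrip, kk; simpl fst; simpl snd.
  cbn [unslant]. rewrite !vw_cube, Rabs_mult.
  replace (k - a - (k - a - b))%Z with b by ring. replace (k - b - (k - a - b))%Z with a by ring.
  right; ring.
Qed.

(** ** Convolution *)


Lemma eq0_01 a : 0 <= eq0 a <= 1.
Proof. unfold eq0; destruct (a =? 0)%Z; lra. Qed.

Lemma eq0_sq a : eq0 a * eq0 a = eq0 a.
Proof. unfold eq0; destruct (a =? 0)%Z; ring. Qed.

Lemma bnd_eq0 : bnd eq0 1.
Proof.
  intros l Hl. induction l as [|a l IH]; simpl; [lra|]. inversion_clear Hl as [|? ? Ha Hl'].
  destruct (Z.eq_dec a 0) as [->|Hn].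
  - rewrite eq0_0. replace (rsum eq0 l) with 0; [lra|].
    rewrite <- (rsum_0 l). apply rsum_ext; intros i Hi. rewrite eq0_n; [reflexivity|].
    intros ->; contradiction.
  - rewrite eq0_n by assumption. specialize (IH Hl'). lra.
Qed.

Section Convolution.
Context (L : list Z) (HL : NoDup L).

(** Convolutions restricted to a finite set [L]: [cv1] truncates, [cv2] and [cv3] are the double and triple
    convolutions.  Finite sums make Fubini an exchange of lists. *)
Definition cv1 (z : Z -> R) (e : Z) : R := rsum (fun l => eq0 (l - e) * z l) L.
Definition cv2 (y z : Z -> R) (d : Z) : R := rsum (fun j => y j * cv1 z (d - j)) L.
Definition cv3 (x y z : Z -> R) (k : Z) : R := rsum (fun i => x i * cv2 y z (k - i)) L.

Lemma cv2_swap y z d : cv2 y z d = cv2 z y d.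
Proof.
  unfold cv2, cv1.
  rewrite (rsum_ext _ (fun j => rsum (fun l => y j * (eq0 (l - (d - j)) * z l)) L))
    by (intros; rewrite rsum_scal; reflexivity).
  rewrite rsum_swap. apply rsum_ext; intros l _. rewrite <- rsum_scal.
  apply rsum_ext; intros j _.
  replace (eq0 (j - (d - l))) with (eq0 (l - (d - j))) by (f_equal; ring). ring.
Qed.

Lemma cv3_swap12 x y z k : cv3 x y z k = cv3 y x z k.
Proof.
  unfold cv3, cv2.
  rewrite (rsum_ext _ (fun i => rsum (fun j => x i * (y j * cv1 z (k - i - j))) L))
    by (intros; rewrite rsum_scal; reflexivity).
  rewrite rsum_swap. apply rsum_ext; intros l _. rewrite <- rsum_scal.
  apply rsum_ext; intros j _. replace (k - j - l)%Z with (k - l - j)%Z by ring. ring.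
Qed.

Lemma cv3_swap23 x y z k : cv3 x y z k = cv3 x z y k.
Proof. unfold cv3. apply rsum_ext; intros. rewrite cv2_swap; reflexivity. Qed.

Lemma cv3_plus x x' y z k : cv3 (fun i => x i + x' i) y z k = cv3 x y z k + cv3 x' y z k.
Proof. unfold cv3. rewrite <- rsum_plus. apply rsum_ext; intros; ring. Qed.

(** Minkowski for an [l^1] factor, obtained from Cauchy-Schwarz against the measure [r]. *)
Lemma young1 (r g : Z -> R) (K : list Z) R' G : NoDup K -> 0 <= R' -> 0 <= G ->
  (forall i, 0 <= r i) -> rsum r L <= R' -> bnd (fun k => g k ^ 2) G ->
  rsum (fun k => rsum (fun i => r i * g (k - i)%Z) L ^ 2) K <= R' ^ 2 * G.
Proof.
  intros HK HR HG Hr Hr1 Hg.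
  assert (H1 : forall k, rsum (fun i => r i * g (k - i)%Z) L ^ 2 <=
      R' * rsum (fun i => r i * g (k - i)%Z ^ 2) L).
  { intros k. rewrite (rsum_ext _ (fun i => sqrt (r i) * (sqrt (r i) * g (k - i)%Z))).
    2:{ intros i _. rewrite <- Rmult_assoc, sqrt_sqrt by auto. reflexivity. }
    eapply Rle_trans; [apply rsum_CS|].
    rewrite (rsum_ext (fun i => sqrt (r i) ^ 2) r) by (intros; apply pow2_sqrt; auto).
    rewrite (rsum_ext (fun i => (sqrt (r i) * g (k - i)%Z) ^ 2) (fun i => r i * g (k - i)%Z ^ 2)).
    2:{ intros i _. rewrite Rpow_mult_distr, pow2_sqrt by auto. reflexivity. }
    apply Rmult_le_compat_r; [|assumption].
    apply rsum_nonneg; intros; apply Rmult_le_pos; [auto|apply pow2_ge_0]. }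
  eapply Rle_trans; [apply rsum_le; intros k _; apply H1|].
  rewrite rsum_scal, rsum_swap.
  rewrite (rsum_ext _ (fun i => r i * rsum (fun k => g (k - i)%Z ^ 2) K))
    by (intros; rewrite <- rsum_scal; reflexivity).
  replace (R' ^ 2 * G) with (R' * (R' * G)) by ring. apply Rmult_le_compat_l; [assumption|].
  apply Rle_trans with (rsum (fun i => r i * G) L).
  - apply rsum_le; intros i _. apply Rmult_le_compat_l; [auto|].
    apply (bnd_inj (fun a => g a ^ 2) (fun k => (k - i)%Z)); [lia|assumption|assumption].
  - rewrite rsum_scal_r. apply Rmult_le_compat_r; assumption.
Qed.

Lemma cv1_bnd z W : (forall k, 0 <= z k) -> rsum (fun k => z k ^ 2) L <= W -> bnd (fun e => cv1 z e ^ 2) W.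
Proof.
  intros Hz HW K HK.
  apply Rle_trans with (rsum (fun e => rsum (fun l => eq0 (l - e) * z l ^ 2) L) K).
  - apply rsum_le; intros e _. unfold cv1.
    rewrite (rsum_ext _ (fun l => eq0 (l - e) * (eq0 (l - e) * z l))).
    2:{ intros; rewrite <- Rmult_assoc, eq0_sq; reflexivity. }
    eapply Rle_trans; [apply rsum_CS|].
    rewrite (rsum_ext (fun l => eq0 (l - e) ^ 2) (fun l => eq0 (l - e))).
    2:{ intros; simpl; rewrite Rmult_1_r; apply eq0_sq. }
    rewrite (rsum_ext (fun l => (eq0 (l - e) * z l) ^ 2) (fun l => eq0 (l - e) * z l ^ 2)).
    2:{ intros l _. rewrite <- (eq0_sq (l - e)) at 2. ring. }
    apply Rmult_le_1.
    + apply rsum_nonneg; intros; apply Rmult_le_pos; [apply eq0_01|apply pow2_ge_0].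
    + apply (bnd_inj eq0 (fun l => (l - e)%Z)); [lia|apply bnd_eq0|assumption].
  - rewrite rsum_swap. eapply Rle_trans; [|exact HW]. apply rsum_le; intros l _.
    rewrite rsum_scal_r. apply Rmult_le_1; [apply pow2_ge_0|].
    apply (bnd_inj eq0 (fun e => (l - e)%Z)); [lia|apply bnd_eq0|assumption].
Qed.

Lemma rsum_eq0_le (f : Z -> Z) : (forall x y, f x = f y -> x = y) -> rsum (fun l => eq0 (f l)) L <= 1.
Proof. intros H. apply (bnd_inj eq0 f); [exact H|apply bnd_eq0|assumption]. Qed.

Context (X : R).
Context (HX : 0 <= X).

Definition wt (x : Z -> R) : Prop :=
  (forall k, 0 <= x k) /\ rsum (fun k => jap k * x k ^ 2) L <= X ^ 2.

Lemma jap_inv k : 0 < / jap k <= 1.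
Proof.
  pose proof (jap_ge1 k). split; [apply Rinv_0_lt_compat; lra|].
  rewrite <- Rinv_1. apply Rinv_le_contravar; lra.
Qed.

Lemma rsum_jap2 : rsum (fun k => (/ jap k) ^ 2) L <= 25 / 10.
Proof.
  apply Rle_trans with (rsum (fun k => Rpower (jap k) (- (2))) L).
  - right; apply rsum_ext; intros k _. pose proof (jap_ge1 k).
    rewrite Rpower_Ropp. replace 2 with (INR 2) by (simpl; ring).
    rewrite Rpower_pow, pow_inv by lra. reflexivity.
  - eapply Rle_trans; [apply (bnd_jap 2 ltac:(lra) L HL)|].
    replace (1 - 2) with (- (1)) by ring. replace (- (2)) with (- (1) + - (1)) by ring.
    rewrite Rpower_plus. rewrite !(Rpower_Ropp 2 1), Rpower_1 by lra. lra.
Qed.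

Lemma rsum_jap32 : rsum (fun k => / jap k * sqrt (/ jap k)) L <= 454 / 100.
Proof.
  apply Rle_trans with (rsum (fun k => Rpower (jap k) (- (3 / 2))) L).
  - right; apply rsum_ext; intros k _. pose proof (jap_ge1 k).
    replace (- (3 / 2)) with (- (1) + - (/ 2)) by field.
    rewrite Rpower_plus, !Rpower_Ropp, Rpower_1, Rpower_sqrt by lra.
    rewrite sqrt_inv. reflexivity.
  - eapply Rle_trans; [apply (bnd_jap (3 / 2) ltac:(lra) L HL)|].
    replace (1 - 3 / 2) with (- (/ 2)) by field. replace (- (3 / 2)) with (- (1) + - (/ 2)) by field.
    rewrite Rpower_plus, !Rpower_Ropp, Rpower_1, Rpower_sqrt by lra.
    assert (Hs : / sqrt 2 <= 7072 / 10000).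
    { assert (H : 1.4141 <= sqrt 2).
      { rewrite <- (sqrt_pow2 1.4141) by lra. apply sqrt_le_1_alt; lra. }
      apply Rle_trans with (/ 1.4141); [apply Rinv_le_contravar; lra|lra]. }
    lra.
Qed.

(** Dividing each factor by the weight, Cauchy-Schwarz leaves the convolution of [1/jap] with itself,
    bounded by the sum of its squares. *)
Lemma cv2_bnd y z : wt y -> wt z -> bnd (fun d => cv2 y z d ^ 2) (25 / 10 * X ^ 4).
Proof.
  intros (Hy0 & Hy) (Hz0 & Hz) K HK.
  set (w := fun k => sqrt (jap k)).
  assert (Hw : forall k, 0 < w k) by (intros k; apply sqrt_lt_R0; pose proof (jap_ge1 k); lra).
  assert (Hw2 : forall k, w k ^ 2 = jap k) by (intros k; apply pow2_sqrt; pose proof (jap_ge1 k); lra).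
  assert (Hj : forall k, 0 < jap k) by (intros k; pose proof (jap_ge1 k); lra).
  set (P := fun d : Z => fun x : Z * Z => eq0 (snd x - (d - fst x))).
  assert (E : forall d, cv2 y z d = rsum (fun x => (P d x * / (w (fst x) * w (snd x))) *
     (P d x * ((w (fst x) * y (fst x)) * (w (snd x) * z (snd x))))) (list_prod L L)).
  { intros d. rewrite rsum_prod. unfold cv2, cv1, P; simpl.
    apply rsum_ext; intros j _. rewrite <- rsum_scal. apply rsum_ext; intros l _.
    rewrite <- (eq0_sq (l - (d - j))) at 1. field.
    split; apply Rgt_not_eq, Hw. }
  assert (B1 : forall d, rsum (fun x => (P d x * / (w (fst x) * w (snd x))) ^ 2) (list_prod L L) <= 25 / 10).
  { intros d. apply Rle_trans with (rsum (fun x => / 2 * (P d x * (/ jap (fst x)) ^ 2) +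
       / 2 * (P d x * (/ jap (snd x)) ^ 2)) (list_prod L L)).
    - apply rsum_le; intros [j l] _; unfold P; simpl fst; simpl snd.
      replace ((eq0 (l - (d - j)) * / (w j * w l)) ^ 2) with
        (eq0 (l - (d - j)) * (/ jap j * / jap l)).
      + pose proof (eq0_01 (l - (d - j))). pose proof (pow2_ge_0 (/ jap j - / jap l)). nra.
      + rewrite <- (eq0_sq (l - (d - j))) at 1. rewrite <- !Hw2. field.
        split; apply Rgt_not_eq, Hw.
    - rewrite rsum_plus, !rsum_scal, !rsum_prod.
      assert (C1 : rsum (fun j => rsum (fun l => P d (j, l) * (/ jap (fst (j, l))) ^ 2) L) L <= 25 / 10).
      { eapply Rle_trans; [|apply rsum_jap2]. apply rsum_le; intros j _. simpl fst.
        rewrite rsum_scal_r. apply Rmult_le_1; [apply pow2_ge_0|]. unfold P; simpl.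
        apply (rsum_eq0_le (fun l => (l - (d - j))%Z)); lia. }
      assert (C2 : rsum (fun j => rsum (fun l => P d (j, l) * (/ jap (snd (j, l))) ^ 2) L) L <= 25 / 10).
      { rewrite rsum_swap. eapply Rle_trans; [|apply rsum_jap2]. apply rsum_le; intros l _. simpl snd.
        rewrite rsum_scal_r. apply Rmult_le_1; [apply pow2_ge_0|]. unfold P; simpl.
        apply (rsum_eq0_le (fun j => (l - (d - j))%Z)); lia. }
      lra. }
  apply Rle_trans with (rsum (fun d => 25 / 10 * rsum (fun x => P d x *
     ((jap (fst x) * y (fst x) ^ 2) * (jap (snd x) * z (snd x) ^ 2))) (list_prod L L)) K).
  - apply rsum_le; intros d _. rewrite E. eapply Rle_trans; [apply rsum_CS|].
    rewrite (rsum_ext (fun i => (P d i * (w (fst i) * y (fst i) * (w (snd i) * z (snd i)))) ^ 2)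
      (fun x => P d x * ((jap (fst x) * y (fst x) ^ 2) * (jap (snd x) * z (snd x) ^ 2)))).
    2:{ intros [j l] _; simpl fst; simpl snd. unfold P; simpl fst; simpl snd.
        rewrite <- (eq0_sq (l - (d - j))) at 2. rewrite <- !Hw2. ring. }
    apply Rmult_le_compat_r; [|apply B1]. apply rsum_nonneg; intros x _.
    apply Rmult_le_pos; [apply eq0_01|]. pose proof (Hj (fst x)). pose proof (Hj (snd x)).
    apply Rmult_le_pos; apply Rmult_le_pos; try lra; apply pow2_ge_0.
  - rewrite rsum_scal. apply Rmult_le_compat_l; [lra|]. rewrite rsum_swap.
    apply Rle_trans with (rsum (fun x => (jap (fst x) * y (fst x) ^ 2) * (jap (snd x) * z (snd x) ^ 2)) (list_prod L L)).
    + apply rsum_le; intros [j l] _; simpl fst; simpl snd. rewrite rsum_scal_r.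
      apply Rmult_le_1.
      * pose proof (Hj j). pose proof (Hj l).
        apply Rmult_le_pos; apply Rmult_le_pos; try lra; apply pow2_ge_0.
      * unfold P; simpl. apply (bnd_inj eq0 (fun d => (l - (d - j))%Z)); [lia|apply bnd_eq0|assumption].
    + rewrite rsum_prod. simpl fst; simpl snd.
      rewrite (rsum_ext _ (fun j => jap j * y j ^ 2 * rsum (fun l => jap l * z l ^ 2) L))
        by (intros; rewrite <- rsum_scal; reflexivity).
      rewrite rsum_scal_r. replace (X ^ 4) with (X ^ 2 * X ^ 2) by ring.
      apply Rmult_le_compat; try assumption; apply rsum_nonneg; intros k _;
        (apply Rmult_le_pos; [left; apply Hj|apply pow2_ge_0]).
Qed.

Lemma amgm3 a b c : 0 <= a -> 0 <= b -> 0 <= c ->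
  a ^ 2 * b ^ 2 * c ^ 2 <= / 3 * (a ^ 3 * b ^ 3 + b ^ 3 * c ^ 3 + a ^ 3 * c ^ 3).
Proof.
  intros Ha Hb Hc. set (p := a * b). set (q := b * c). set (r := a * c).
  replace (a ^ 2 * b ^ 2 * c ^ 2) with (p * q * r) by (unfold p, q, r; ring).
  replace (a ^ 3 * b ^ 3 + b ^ 3 * c ^ 3 + a ^ 3 * c ^ 3) with (p ^ 3 + q ^ 3 + r ^ 3)
    by (unfold p, q, r; ring).
  assert (0 <= p + q + r) by (unfold p, q, r; nra).
  pose proof (pow2_ge_0 (p - q)). pose proof (pow2_ge_0 (q - r)). pose proof (pow2_ge_0 (p - r)).
  assert (0 <= (p + q + r) * ((p - q) ^ 2 + (q - r) ^ 2 + (p - r) ^ 2)) by (apply Rmult_le_pos; lra).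
  lra.
Qed.

(** Cauchy-Schwarz on the fibre [i+j+l = k] against the weights [jap^{1/2}]: the inverse weights
    contribute a sum of [1/(jap i jap j jap l)], which the inequality of means bounds by products of two
    factors [jap^{-3/2}], summable along the fibre with constant [4.54]. *)
Lemma cv3_bnd x y z : wt x -> wt y -> wt z ->
  bnd (fun k => cv3 x y z k ^ 2) ((454 / 100 * X ^ 3) ^ 2).
Proof.
  intros (Hx0 & Hx) (Hy0 & Hy) (Hz0 & Hz) K HK.
  set (w := fun k => sqrt (jap k)).
  assert (Hj : forall k, 0 < jap k) by (intros k; pose proof (jap_ge1 k); lra).
  assert (Hw : forall k, 0 < w k) by (intros k; apply sqrt_lt_R0, Hj).
  assert (Hw2 : forall k, w k ^ 2 = jap k) by (intros k; apply pow2_sqrt; left; apply Hj).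
  set (LL := list_prod L (list_prod L L)).
  set (P := fun k : Z => fun x : Z * (Z * Z) => eq0 (snd (snd x) - (k - fst x - fst (snd x)))).
  set (W := fun x : Z * (Z * Z) => w (fst x) * w (fst (snd x)) * w (snd (snd x))).
  assert (HW0 : forall u, 0 < W u) by (intros u; unfold W; repeat apply Rmult_lt_0_compat; apply Hw).
  set (V := fun u : Z * (Z * Z) => x (fst u) * y (fst (snd u)) * z (snd (snd u))).
  set (E3 := fun u : Z * (Z * Z) => (jap (fst u) * x (fst u) ^ 2) *
      (jap (fst (snd u)) * y (fst (snd u)) ^ 2) * (jap (snd (snd u)) * z (snd (snd u)) ^ 2)).
  assert (HE3 : forall u, 0 <= E3 u).
  { assert (Hjx : forall (f : Z -> R) k, 0 <= jap k * f k ^ 2).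
    { intros f k; apply Rmult_le_pos; [left; apply Hj|apply pow2_ge_0]. }
    intros u; unfold E3; apply Rmult_le_pos; [apply Rmult_le_pos|]; apply Hjx. }
  assert (E : forall k, cv3 x y z k = rsum (fun u => (P k u * / W u) * (P k u * (W u * V u))) LL).
  { intros k. unfold LL. rewrite rsum_prod. unfold cv3, cv2, cv1.
    apply rsum_ext; intros i _. rewrite rsum_prod, <- rsum_scal. apply rsum_ext; intros j _.
    rewrite <- !rsum_scal. apply rsum_ext; intros l _. unfold P, V; simpl.
    rewrite <- (eq0_sq (l - (k - i - j))) at 1. field. apply Rgt_not_eq, HW0. }
  set (v := fun k => / jap k * sqrt (/ jap k)).
  assert (Hv : forall k, 0 <= v k) by (intros k; apply Rmult_le_pos; [apply Rlt_le, jap_inv|apply sqrt_pos]).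
  pose proof rsum_jap32 as Hv32. fold v in Hv32. change (rsum v L <= 454 / 100) in Hv32.
  assert (Hv0 : 0 <= rsum v L) by (apply rsum_nonneg; auto).
  assert (B1 : forall k, rsum (fun u => (P k u * / W u) ^ 2) LL <= (454 / 100) ^ 2).
  { intros k.
    apply Rle_trans with (rsum (fun u => / 3 * (P k u * (v (fst u) * v (fst (snd u)))) +
      (/ 3 * (P k u * (v (fst (snd u)) * v (snd (snd u)))) +
       / 3 * (P k u * (v (fst u) * v (snd (snd u)))))) LL).
    - apply rsum_le; intros [i [j l]] _. unfold P, W; simpl fst; simpl snd.
      assert (Hs : forall n, (/ w n) ^ 3 = v n).
      { intros n. unfold v. rewrite sqrt_inv. fold (w n). rewrite <- Hw2. field.
        apply Rgt_not_eq, Hw. }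
      assert (Hi : forall n, 0 <= / w n) by (intros n; left; apply Rinv_0_lt_compat, Hw).
      pose proof (amgm3 (/ w i) (/ w j) (/ w l) (Hi i) (Hi j) (Hi l)) as HA.
      rewrite !Hs in HA.
      replace ((eq0 (l - (k - i - j)) * / (w i * w j * w l)) ^ 2) with
        (eq0 (l - (k - i - j)) * ((/ w i) ^ 2 * (/ w j) ^ 2 * (/ w l) ^ 2)).
      + pose proof (eq0_01 (l - (k - i - j))).
        apply Rle_trans with (eq0 (l - (k - i - j)) * (/ 3 * (v i * v j + v j * v l + v i * v l)));
          [apply Rmult_le_compat_l; lra|right; ring].
      + rewrite <- (eq0_sq (l - (k - i - j))) at 1. field.
        repeat split; apply Rgt_not_eq, Hw.
    - rewrite !rsum_plus, !rsum_scal. unfold LL.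
      assert (C0 : rsum (fun i => rsum (fun j => v i * v j) L) L <= (454 / 100) ^ 2).
      { rewrite (rsum_ext _ (fun i => v i * rsum v L)) by (intros; rewrite rsum_scal; reflexivity).
        rewrite rsum_scal_r. nra. }
      assert (C1 : rsum (fun u => P k u * (v (fst u) * v (fst (snd u)))) (list_prod L (list_prod L L)) <= (454 / 100) ^ 2).
      { rewrite rsum_prod. eapply Rle_trans; [|exact C0]. apply rsum_le; intros i _.
        rewrite rsum_prod. apply rsum_le; intros j _. simpl fst; simpl snd.
        rewrite rsum_scal_r. apply Rmult_le_1; [apply Rmult_le_pos; auto|].
        unfold P; simpl. apply (rsum_eq0_le (fun l => (l - (k - i - j))%Z)); lia. }
      assert (C2 : rsum (fun u => P k u * (v (fst (snd u)) * v (snd (snd u)))) (list_prod L (list_prod L L)) <= (454 / 100) ^ 2).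
      { rewrite rsum_prod, rsum_swap, rsum_prod. eapply Rle_trans; [|exact C0]. apply rsum_le; intros j _.
        apply rsum_le; intros l _. simpl fst; simpl snd.
        rewrite rsum_scal_r. apply Rmult_le_1; [apply Rmult_le_pos; auto|].
        unfold P; simpl. apply (rsum_eq0_le (fun i => (l - (k - i - j))%Z)); lia. }
      assert (C3 : rsum (fun u => P k u * (v (fst u) * v (snd (snd u)))) (list_prod L (list_prod L L)) <= (454 / 100) ^ 2).
      { rewrite rsum_prod. eapply Rle_trans; [|exact C0]. apply rsum_le; intros i _.
        rewrite rsum_prod, rsum_swap. apply rsum_le; intros l _. simpl fst; simpl snd.
        rewrite rsum_scal_r. apply Rmult_le_1; [apply Rmult_le_pos; auto|].
        unfold P; simpl. apply (rsum_eq0_le (fun j => (l - (k - i - j))%Z)); lia. }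
      lra. }
  apply Rle_trans with (rsum (fun k => (454 / 100) ^ 2 * rsum (fun u => P k u * E3 u) LL) K).
  - apply rsum_le; intros k _. rewrite E. eapply Rle_trans; [apply rsum_CS|].
    rewrite (rsum_ext (fun u => (P k u * (W u * V u)) ^ 2) (fun u => P k u * E3 u)).
    2:{ intros [i [j l]] _. unfold P, W, V, E3; simpl fst; simpl snd.
        rewrite <- (eq0_sq (l - (k - i - j))) at 2. rewrite <- !Hw2. ring. }
    apply Rmult_le_compat_r; [|apply B1]. apply rsum_nonneg; intros u _.
    apply Rmult_le_pos; [apply eq0_01|apply HE3].
  - rewrite rsum_scal. replace ((454 / 100 * X ^ 3) ^ 2) with ((454 / 100) ^ 2 * (X ^ 2 * (X ^ 2 * X ^ 2))) by ring.
    apply Rmult_le_compat_l; [apply pow2_ge_0|]. rewrite rsum_swap.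
    apply Rle_trans with (rsum E3 LL).
    + apply rsum_le; intros [i [j l]] _. rewrite rsum_scal_r. apply Rmult_le_1; [apply HE3|].
      unfold P; simpl. apply (bnd_inj eq0 (fun k => (l - (k - i - j))%Z)); [lia|apply bnd_eq0|assumption].
    + assert (HE : rsum E3 LL = rsum (fun k => jap k * x k ^ 2) L *
        (rsum (fun k => jap k * y k ^ 2) L * rsum (fun k => jap k * z k ^ 2) L)).
      { unfold LL, E3. rewrite rsum_prod, <- rsum_scal_r. apply rsum_ext; intros i _. simpl fst; simpl snd.
        rewrite <- rsum_scal_r, rsum_prod, <- rsum_scal. apply rsum_ext; intros j _. simpl fst; simpl snd.
        rewrite <- !rsum_scal. apply rsum_ext; intros l _. ring. }
      rewrite HE.
      assert (N : forall g : Z -> R, 0 <= rsum (fun k => jap k * g k ^ 2) L).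
      { intros g. apply rsum_nonneg; intros k _. apply Rmult_le_pos; [left; apply Hj|apply pow2_ge_0]. }
      apply Rmult_le_compat; [apply N|apply Rmult_le_pos; apply N|assumption|].
      apply Rmult_le_compat; auto.
Qed.
End Convolution.

Lemma l2_triangle (f g : Z -> R) (K : list Z) A B : 0 <= A -> 0 <= B ->
  rsum (fun k => f k ^ 2) K <= A ^ 2 -> rsum (fun k => g k ^ 2) K <= B ^ 2 ->
  rsum (fun k => (f k + g k) ^ 2) K <= (A + B) ^ 2.
Proof.
  intros HA HB Hf Hg.
  assert (H : rsum (fun k => f k * g k) K <= A * B).
  { apply sqr_le_of; [apply Rmult_le_pos; assumption|]. eapply Rle_trans; [apply rsum_CS|].
    rewrite Rpow_mult_distr. apply Rmult_le_compat; try assumption;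
      apply rsum_nonneg; intros; apply pow2_ge_0. }
  rewrite (rsum_ext _ (fun k => f k ^ 2 + (2 * (f k * g k) + g k ^ 2))) by (intros; ring).
  rewrite !rsum_plus, rsum_scal. lra.
Qed.

(** The expansion of the triple convolution of [alpha + rho]: all factors in the weighted space, one
    factor [rho], two, three.  The constant [1.5812] bounds the square root of [2.5]. *)
Definition Ncap (X r m : R) : R :=
  454 / 100 * X ^ 3 + 3 * (15812 / 10000 * (r * X ^ 2)) + 3 * (r ^ 2 * m) + r ^ 3.

(** Multilinear expansion; a factor [rh] in [l^1] is removed by Young's inequality and the remaining
    ones are measured in [l^2]. *)
Lemma cv3_sum_bnd (L K : list Z) (a a' rh rh' : Z -> R) X r m :
  NoDup L -> NoDup K -> 0 <= X -> 0 <= r -> 0 <= m ->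
  wt L X a -> wt L X a' ->
  (forall k, 0 <= rh k) -> (forall k, 0 <= rh' k) -> rsum rh L <= r -> rsum rh' L <= r ->
  rsum (fun k => a k ^ 2) L <= m ^ 2 -> rsum (fun k => a' k ^ 2) L <= m ^ 2 ->
  rsum (fun k => cv3 L (fun i => a i + rh i) (fun i => a' i + rh' i) (fun i => a i + rh i) k ^ 2) K
    <= Ncap X r m ^ 2.
Proof.
  intros HL HK HX Hr Hm Wa Wa' R0 R0' Hr1 Hr2 Hm1 Hm2.
  assert (S2 : forall f, (forall k, 0 <= f k) -> rsum f L <= r -> rsum (fun k => f k ^ 2) L <= r ^ 2).
  { intros f Hf Hs. apply Rle_trans with (rsum (fun k => f k * r) L).
    - apply rsum_le; intros k Hk. pose proof (rsum_le1 f L k Hf Hk). specialize (Hf k). nra.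
    - rewrite rsum_scal_r. nra. }
  assert (B1 : forall f g h, (forall k, 0 <= f k) -> rsum f L <= r -> wt L X g -> wt L X h ->
     rsum (fun k => cv3 L f g h k ^ 2) K <= (15812 / 10000 * (r * X ^ 2)) ^ 2).
  { intros f g h Hf Hs Hg Hh. eapply Rle_trans; [apply (young1 L f (cv2 L g h) K r (25 / 10 * X ^ 4))|].
    all: auto.
    - apply Rmult_le_pos; [lra|]. replace (X ^ 4) with ((X ^ 2) ^ 2) by ring. apply pow2_ge_0.
    - apply cv2_bnd; assumption.
    - replace ((15812 / 10000 * (r * X ^ 2)) ^ 2) with ((15812 / 10000) ^ 2 * (r ^ 2 * X ^ 4)) by ring.
      replace (r ^ 2 * (25 / 10 * X ^ 4)) with (25 / 10 * (r ^ 2 * X ^ 4)) by ring.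
      apply Rmult_le_compat_r; [|lra]. replace (r ^ 2 * X ^ 4) with ((r * X ^ 2) ^ 2) by ring. apply pow2_ge_0. }
  assert (B23 : forall f g h M, 0 <= M -> (forall k, 0 <= f k) -> rsum f L <= r ->
     (forall k, 0 <= g k) -> rsum g L <= r -> (forall k, 0 <= h k) -> rsum (fun k => h k ^ 2) L <= M ^ 2 ->
     rsum (fun k => cv3 L f g h k ^ 2) K <= (r ^ 2 * M) ^ 2).
  { intros f g h M HM Hf Hfs Hg Hgs Hh Hhs.
    replace ((r ^ 2 * M) ^ 2) with (r ^ 2 * (r ^ 2 * M ^ 2)) by ring.
    apply (young1 L f (cv2 L g h) K r); auto.
    - apply Rmult_le_pos; apply pow2_ge_0.
    - intros K' HK'. apply (young1 L g (cv1 L h) K' r); auto; [apply pow2_ge_0|].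
      apply cv1_bnd; assumption. }
  assert (A0 := proj1 Wa). assert (A0' := proj1 Wa').
  set (c1 := 15812 / 10000 * (r * X ^ 2)) in *. set (c2 := r ^ 2 * m). set (c3 := r ^ 3).
  set (c0 := 454 / 100 * X ^ 3).
  assert (P1 : 0 <= c1) by (unfold c1; apply Rmult_le_pos; [lra|apply Rmult_le_pos; [lra|apply pow2_ge_0]]).
  assert (P2 : 0 <= c2) by (unfold c2; apply Rmult_le_pos; [apply pow2_ge_0|lra]).
  assert (P3 : 0 <= c3) by (unfold c3; apply pow_le; lra).
  assert (P0 : 0 <= c0) by (unfold c0; apply Rmult_le_pos; [lra|apply pow_le; lra]).
  set (q := fun (f g h : Z -> R) (c : R) => rsum (fun k => cv3 L f g h k ^ 2) K <= c ^ 2).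
  assert (Sw12 : forall f g h c, q f g h c -> q g f h c).
  { intros f g h c H. unfold q in *. rewrite (rsum_ext _ (fun k => cv3 L f g h k ^ 2)); [exact H|].
    intros k _. rewrite (cv3_swap12 L g f h). reflexivity. }
  assert (Sw23 : forall f g h c, q f g h c -> q f h g c).
  { intros f g h c H. unfold q in *. rewrite (rsum_ext _ (fun k => cv3 L f g h k ^ 2)); [exact H|].
    intros k _. rewrite (cv3_swap23 L f h g). reflexivity. }
  assert (Add : forall f f' g h c c', 0 <= c -> 0 <= c' -> q f g h c -> q f' g h c' ->
     q (fun i => f i + f' i) g h (c + c')).
  { intros f f' g h c c' Hc Hc' H H'. unfold q in *.
    rewrite (rsum_ext _ (fun k => (cv3 L f g h k + cv3 L f' g h k) ^ 2))
      by (intros; rewrite cv3_plus; reflexivity).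
    apply l2_triangle; assumption. }
  assert (Q0 : forall f g h, wt L X f -> wt L X g -> wt L X h -> q f g h c0)
    by (intros f g h Hf Hg Hh; apply (cv3_bnd L HL X f g h Hf Hg Hh K HK)).
  assert (Q3 : forall f g h, (forall k, 0 <= f k) -> rsum f L <= r ->
     (forall k, 0 <= g k) -> rsum g L <= r -> (forall k, 0 <= h k) -> rsum h L <= r -> q f g h c3).
  { intros f g h. unfold q, c3. replace (r ^ 3) with (r ^ 2 * r) by ring. intros; apply B23; auto. }
  set (V := fun i => a i + rh i). set (V' := fun i => a' i + rh' i).
  replace (Ncap X r m) with ((c0 + c1 + (c1 + c2)) + (c1 + c2 + (c2 + c3)))
    by (unfold Ncap, c0, c1, c2, c3; ring).
  change (q V V' V ((c0 + c1 + (c1 + c2)) + (c1 + c2 + (c2 + c3)))).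
  assert (Add2 : forall f g g' h c c', 0 <= c -> 0 <= c' -> q f g h c -> q f g' h c' ->
     q f (fun i => g i + g' i) h (c + c')).
  { intros f g g' h c c' Hc Hc' H H'. apply Sw12, Add; auto. }
  assert (Add3 : forall f g h h' c c', 0 <= c -> 0 <= c' -> q f g h c -> q f g h' c' ->
     q f g (fun i => h i + h' i) (c + c')).
  { intros f g h h' c c' Hc Hc' H H'. apply Sw23, Add2; auto. }
  assert (Q1 : forall f g h, (forall k, 0 <= f k) -> rsum f L <= r -> wt L X g -> wt L X h -> q f g h c1)
    by (intros; unfold q; apply B1; assumption).
  assert (Q2 : forall f g h, (forall k, 0 <= f k) -> rsum f L <= r -> (forall k, 0 <= g k) ->
     rsum g L <= r -> (forall k, 0 <= h k) -> rsum (fun k => h k ^ 2) L <= m ^ 2 -> q f g h c2)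
    by (intros; unfold q; apply B23; assumption).
  apply Add; [lra|lra|apply Add2; [lra|lra|apply Add3|apply Add3]|
    apply Add2; [lra|lra|apply Add3|apply Add3]]; try assumption.
  - apply Q0; assumption.
  - apply Sw23, Sw12, Q1; assumption.
  - apply Sw12, Q1; assumption.
  - apply Sw12, Sw23, Q2; assumption.
  - apply Q1; assumption.
  - apply Sw23, Q2; assumption.
  - apply Q2; assumption.
  - apply Q3; assumption.
Qed.

Lemma wt_refl (N : nat) (X : R) (a : Z -> R) : (forall k, 0 <= a k) ->
  bnd (fun k => jap k * a k ^ 2) (X ^ 2) -> wt (zbox N) X a /\ wt (zbox N) X (fun k => a (- k)%Z).
Proof.
  intros Ha H. split; (split; [auto|]); [apply H, nodup_zbox|].
  apply (bnd_inj _ Z.opp) in H; [|intros; lia].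
  eapply Rle_trans; [|apply (H (zbox N)), nodup_zbox]. right; apply rsum_ext; intros k _.
  unfold jap. rewrite opp_IZR, Rabs_Ropp. reflexivity.
Qed.

Lemma cubic_l2 (v a rh : Z -> R) X r m : 0 <= X -> 0 <= r -> 0 <= m ->
  (forall k, 0 <= a k) -> (forall k, 0 <= rh k) -> (forall k, 0 <= v k <= a k + rh k) ->
  bnd (fun k => jap k * a k ^ 2) (X ^ 2) -> bnd rh r -> bnd (fun k => a k ^ 2) (m ^ 2) ->
  forall K M, NoDup K -> NoDup M ->
    rsum (fun k => rsum (rtrip v v v k) M ^ 2) K <= Ncap X r m ^ 2.
Proof.
  intros HX Hr Hm Ha Hrh Hv Hwa Hr1 Hm1 K M HK HM.
  set (V := fun i => a i + rh i). set (V' := fun i => a (- i)%Z + rh (- i)%Z).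
  set (js := flat_map (fun k => flat_map (fun ab : Z * Z =>
      [(k - fst ab)%Z; (- (k - fst ab - snd ab))%Z; (k - snd ab)%Z]) M) K).
  destruct (zbox_cover js) as (N & HN). specialize (HN N (le_n N)). set (L := zbox N) in *.
  apply Rle_trans with (rsum (fun k => cv3 L V V' V k ^ 2) K).
  - apply rsum_le; intros k Hk. apply pow_incr; split.
    { apply rsum_nonneg; intros ab _; apply rtrip_nonneg; apply Hv. }
    set (F := fun u : Z * (Z * Z) => V (fst u) * (V' (fst (snd u)) *
        (eq0 (snd (snd u) - (k - fst u - fst (snd u))) * V (snd (snd u))))).
    assert (HV : forall i, 0 <= V i) by (intros i; unfold V; specialize (Ha i); specialize (Hrh i); lra).
    assert (HV' : forall i, 0 <= V' i) by (intros i; apply (HV (- i)%Z)).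
    replace (cv3 L V V' V k) with (rsum F (list_prod L (list_prod L L))).
    2:{ rewrite rsum_prod. unfold cv3, cv2, cv1. apply rsum_ext; intros i _.
        rewrite rsum_prod, <- rsum_scal. apply rsum_ext; intros j _.
        rewrite <- !rsum_scal. reflexivity. }
    set (h := fun ab : Z * Z => ((k - fst ab)%Z, ((- (k - fst ab - snd ab))%Z, (k - snd ab)%Z))).
    apply Rle_trans with (rsum F (map h M)).
    + rewrite rsum_map. apply rsum_le; intros [c b] _. unfold F, h, rtrip, V, V'; simpl fst; simpl snd.
      replace (k - b - (k - (k - c) - - (k - c - b)))%Z with 0%Z by ring. rewrite eq0_0, Z.opp_involutive.
      rewrite Rmult_1_l, Rmult_assoc.
      repeat (apply Rmult_le_compat; try apply Hv; try (apply Rmult_le_pos; apply Hv)).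
    + apply rsum_incl.
      * intros u; unfold F. repeat apply Rmult_le_pos; auto. apply eq0_01.
      * apply FinFun.Injective_map_NoDup; [|assumption].
        intros [c b] [c' b'] E; unfold h in E; simpl in E. injection E; intros; f_equal; lia.
      * intros u Hu. apply in_map_iff in Hu as ([c b] & <- & Hcb). unfold h; simpl fst; simpl snd.
        assert (Hjs : forall j, In j [(k - c)%Z; (- (k - c - b))%Z; (k - b)%Z] -> In j L).
        { intros j Hj. apply HN. apply in_flat_map. exists k; split; [assumption|].
          apply in_flat_map. exists (c, b); split; [assumption|exact Hj]. }
        repeat apply in_prod; apply Hjs; simpl; auto.
  - destruct (wt_refl N X a Ha Hwa) as [W1 W2]. assert (HL : NoDup L) by apply nodup_zbox.
    assert (Hop : forall x y : Z, (- x)%Z = (- y)%Z -> x = y) by (intros; lia).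
    apply cv3_sum_bnd; auto.
    + apply (bnd_inj rh Z.opp); assumption.
    + apply (bnd_inj (fun k => a k ^ 2) Z.opp); assumption.
Qed.

(** * Normal form *)

(** [Wnf] is the oscillating part of [e^{i th ln t} A_k], of size [O(t)]; [Gnf] is the bounded remainder of
    its derivative. *)
Definition Wnf (sigma th t : R) (A : Z -> C) (k : Z) : C :=
  (cis (th * ln t) * (RtoC (sigma * t / (4 * PI)) * Snf t A k))%C.

Definition Gnf (sigma th t : R) (A D : Z -> C) (k : Z) : C :=
  (cis (th * ln t) * (RtoC (sigma / (4 * PI)) *
    ((1 + Ci * RtoC th) * Snf t A k + RtoC t * Qnf t A D k)))%C.

(** The factor [t] in [Wnf] turns the [1/(2t^2)] of [dC_Snf] into the [1/t] of the mode equations. *)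
Lemma dC_Wnf sigma th (A D : R -> Z -> C) lo hi t k : 0 < lo -> lo < t < hi ->
  (forall x j, lo < x < hi -> dC (fun y => A y j) x (D x j)) ->
  US (fun x => lo < x < hi) (fun x j => Cmod (A x j)) ->
  US (fun x => lo < x < hi) (fun x j => Cmod (D x j)) ->
  dC (fun x => Wnf sigma th x (A x) k) t
    (Ci * RtoC (sigma / (8 * PI * t)) * (cis (th * ln t) * Nres t (A t) k)
      + Gnf sigma th t (A t) (D t) k)%C.
Proof.
  intros Hlo Ht Hd HA HD. pose proof PI_RGT_0.
  assert (H1 : dC (fun x => cis (th * ln x)) t (Ci * RtoC (th * / t) * cis (th * ln t))%C).
  { apply (dC_cis (fun x => th * ln x)). auto_derive; [lra|ring]. }
  assert (H2 : dC (fun x => RtoC (sigma * x / (4 * PI))) t (RtoC (sigma / (4 * PI)))).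
  { apply (dC_RtoC (fun x => sigma * x / (4 * PI))). auto_derive; [auto|field; lra]. }
  pose proof (dC_mult _ _ _ _ _ H1 (dC_mult _ _ _ _ _ H2 (dC_Snf A D lo hi t k Hlo Ht Hd HA HD))) as K.
  match type of K with dC _ _ ?a => match goal with |- dC _ _ ?b =>
    replace b with a; [exact K|] end end.
  unfold Gnf.
  replace (sigma / (8 * PI * t)) with (sigma * t / (4 * PI) * / (2 * t ^ 2)) by (field; lra).
  replace (sigma * t / (4 * PI)) with (sigma / (4 * PI) * t) by (field; lra).
  rewrite !RtoC_mult.
  assert (Ht' : (RtoC (/ t) * RtoC t = 1)%C) by (rewrite <- RtoC_mult, Rinv_l by lra; reflexivity).
  set (c := cis _). set (S := Snf _ _ _). set (N := Nres _ _ _). set (Q := Qnf _ _ _ _).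
  set (s := RtoC (sigma / (4 * PI))).
  replace (Ci * (RtoC th * RtoC (/ t)) * c * (s * RtoC t * S))%C with
    (Ci * RtoC th * c * s * S * (RtoC (/ t) * RtoC t))%C by ring.
  rewrite Ht'. ring.
Qed.

(** * Passing to the limit in [l^2] bounds *)

Lemma bnd_sq_lim {J} (f : Z -> J -> C) (g : Z -> J -> R) (N : Z -> C) B : 0 <= B ->
  (forall k j, Cmod (f k j) <= g k j) ->
  (forall K M, NoDup K -> NoDup M -> rsum (fun k => rsum (g k) M ^ 2) K <= B ^ 2) ->
  (forall k, hasum (f k) (N k)) -> bnd (fun k => Cmod (N k) ^ 2) (B ^ 2).
Proof.
  intros HB Hfg Hg HN K HK.
  set (S := rsum (fun k => Cmod (N k) ^ 2) K).
  assert (HS : 0 <= S) by (apply rsum_nonneg; intros; apply pow2_ge_0).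
  rewrite <- (pow2_sqrt S HS). apply pow_incr; split; [apply sqrt_pos|].
  apply le_epsilon; intros e He. set (n := INR (length K) + 1).
  assert (Hn : 1 <= n) by (unfold n; pose proof (pos_INR (length K)); lra).
  assert (Hd : 0 < e / n) by (apply Rdiv_lt_0_compat; lra).
  destruct (ev_ex (fun M => forall k, In k K -> Cmod (csum (f k) M - N k) < e / n)) as (M & HM & H).
  { apply ev_all; intros k _. apply HN; assumption. }
  assert (H1 : S <= (B + e) ^ 2).
  { apply Rle_trans with (rsum (fun k => (rsum (g k) M + e / n) ^ 2) K).
    - apply rsum_le; intros k Hk. apply pow_incr; split; [apply Cmod_ge_0|].
      specialize (H k Hk). pose proof (Cmod_tri3 (N k) (csum (f k) M) 0%R) as T.
      replace (N k - 0)%C with (N k) in T by ring.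
      replace (csum (f k) M - 0)%C with (csum (f k) M) in T by ring.
      rewrite Cmod_sub_sym in T. pose proof (Cmod_csum (f k) M).
      assert (rsum (fun i => Cmod (f k i)) M <= rsum (g k) M) by (apply rsum_le; intros; apply Hfg). lra.
    - apply (l2_triangle (fun k => rsum (g k) M) (fun _ => e / n)); [assumption|lra|auto|].
      rewrite rsum_const. apply Rle_trans with (n * (e / n) ^ 2).
      + apply Rmult_le_compat_r; [apply pow2_ge_0|unfold n; lra].
      + replace (n * (e / n) ^ 2) with (e ^ 2 * / n) by (field; lra).
        rewrite <- (Rmult_1_r (e ^ 2)) at 2. apply Rmult_le_compat_l; [apply pow2_ge_0|].
        rewrite <- Rinv_1. apply Rinv_le_contravar; lra. }
  rewrite <- (sqrt_pow2 (B + e)) by lra. apply sqrt_le_1_alt, H1.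
Qed.

(** * Moduli are insensitive to rotations *)

Lemma is_derive_rsum {I} (f df : R -> I -> R) t (l : list I) :
  (forall i, In i l -> is_derive (fun x => f x i) t (df t i)) ->
  is_derive (fun x => rsum (f x) l) t (rsum (df t) l).
Proof.
  induction l as [|a l IH]; intros H; simpl.
  - apply @is_derive_const.
  - apply @is_derive_plus; [apply H; left; reflexivity|apply IH; intros; apply H; right; assumption].
Qed.

Lemma sign_choice {I} (y : I -> R) : exists c, forall i, Rabs (c i) <= 1 /\ c i * y i = Rabs (y i).
Proof.
  exists (fun i => if Rle_dec 0 (y i) then 1 else -1). intros i. destruct (Rle_dec 0 (y i)).
  - rewrite Rabs_R1, (Rabs_pos_eq (y i)) by assumption. lra.
  - rewrite (Rabs_left (-1)), (Rabs_left (y i)) by lra. lra.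
Qed.

Lemma polar_choice {I} (z : I -> C) : exists c, forall i, Cmod (c i) = 1 /\ (c i * z i)%C = RtoC (Cmod (z i)).
Proof.
  exists (fun i => epsilon (inhabits (RtoC 0)) (fun c => Cmod c = 1 /\ (c * z i)%C = RtoC (Cmod (z i)))).
  intros i. apply (epsilon_spec (inhabits (RtoC 0)) (fun c => Cmod c = 1 /\ (c * z i)%C = RtoC (Cmod (z i)))).
  apply polar.
Qed.

Lemma Cmod_sq (z : C) : Cmod z ^ 2 = fst z ^ 2 + snd z ^ 2.
Proof. unfold Cmod. rewrite pow2_sqrt; [reflexivity|]. nra. Qed.

(** The rotation [i lam Z] is orthogonal to [Z].  The modulus is regularised as [sqrt (|Z|^2 + d^2)] to be
    differentiable where [Z] vanishes. *)
Lemma modulus_lip {I} (Z : R -> I -> C) (lam : R -> I -> R) (E : R -> I -> C) (K : list I) s t Em :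
  s <= t ->
  (forall x k, s <= x <= t -> In k K -> dC (fun y => Z y k) x (Ci * RtoC (lam x k) * Z x k + E x k)%C) ->
  (forall x, s <= x <= t -> rsum (fun k => Cmod (E x k)) K <= Em) ->
  rsum (fun k => Rabs (Cmod (Z t k) - Cmod (Z s k))) K <= Em * (t - s).
Proof.
  intros Hst Hd HE. apply le_epsilon; intros e He.
  set (n := INR (length K) + 1).
  assert (Hn : 1 <= n) by (unfold n; pose proof (pos_INR (length K)); lra).
  set (d := e / (2 * n)). assert (Hd0 : 0 < d) by (apply Rdiv_lt_0_compat; lra).
  set (f := fun x k => sqrt (fst (Z x k) ^ 2 + snd (Z x k) ^ 2 + d ^ 2)).
  assert (Hp : forall x k, 0 < fst (Z x k) ^ 2 + snd (Z x k) ^ 2 + d ^ 2) by (intros; nra).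
  assert (Hf : forall x k, Cmod (Z x k) <= f x k <= Cmod (Z x k) + d).
  { intros x k. pose proof (Cmod_sq (Z x k)) as Q. pose proof (Cmod_ge_0 (Z x k)). unfold f. split.
    - unfold Cmod. apply sqrt_le_1_alt. nra.
    - rewrite <- (sqrt_pow2 (Cmod (Z x k) + d)) by lra. apply sqrt_le_1_alt. nra. }
  set (df := fun x k => (fst (Z x k) * fst (E x k) + snd (Z x k) * snd (E x k)) / f x k).
  assert (Hdf : forall x k, s <= x <= t -> In k K -> is_derive (fun y => f y k) x (df x k)).
  { intros x k Hx Hk. specialize (Hd x k Hx Hk). apply dC_comp in Hd as [H1 H2].
    pose proof (is_derive_plus _ _ _ _ _ (is_derive_plus _ _ _ _ _ (is_derive_mult_R _ _ _ _ _ H1 H1)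
      (is_derive_mult_R _ _ _ _ _ H2 H2)) (is_derive_const (d ^ 2) x)) as H3.
    assert (H4 : is_derive (fun y => fst (Z y k) ^ 2 + snd (Z y k) ^ 2 + d ^ 2) x
      (2 * (fst (Z x k) * fst (E x k) + snd (Z x k) * snd (E x k)))).
    { eapply is_derive_ext; [|match type of H3 with is_derive _ _ ?a =>
        match goal with |- is_derive _ _ ?b => replace b with a; [exact H3|] end end].
      - intros y; unfold plus; simpl. ring.
      - unfold plus, zero, Ci, RtoC, Cmult, Cplus; simpl. ring. }
    apply is_derive_sqrt in H4; [|apply Hp].
    match type of H4 with is_derive _ _ ?a => replace (df x k) with a; [exact H4|] end.
    unfold df, f. field. apply Rgt_not_eq, sqrt_lt_R0, Hp. }
  destruct (sign_choice (fun k => f t k - f s k)) as (c & Hc).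
  assert (HF : rsum (fun k => Rabs (f t k - f s k)) K <= Em * (t - s)).
  { replace (rsum _ K) with (rsum (fun k => c k * f t k) K - rsum (fun k => c k * f s k) K).
    - replace (Em * (t - s)) with (Em * t - Em * s) by ring.
      apply (mvt_le (fun x => rsum (fun k => c k * f x k) K) (fun x => Em * x)
        (fun x => rsum (fun k => c k * df x k) K) (fun _ => Em)); [assumption|..].
      + intros x Hx. apply (is_derive_rsum (fun y k => c k * f y k) (fun y k => c k * df y k)).
        intros k Hk. apply is_derive_scal, Hdf; assumption.
      + intros x Hx. auto_derive; [auto|ring].
      + intros x Hx. eapply Rle_trans; [|apply (HE x Hx)]. apply rsum_le; intros k Hk.
        eapply Rle_trans; [apply Rle_abs|]. rewrite Rabs_mult.
        assert (Hfp : 0 < f x k) by (apply sqrt_lt_R0, Hp).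
        assert (Rabs (df x k) <= Cmod (E x k)).
        { unfold df, Rdiv. rewrite Rabs_mult, Rabs_inv, (Rabs_pos_eq (f x k)) by lra.
          apply Rmult_le_reg_r with (f x k); [assumption|].
          rewrite Rmult_assoc, Rinv_l, Rmult_1_r by lra.
          apply Rle_trans with (Cmod (Z x k) * Cmod (E x k)).
          - apply sqr_le_of; [apply Rmult_le_pos; apply Cmod_ge_0|].
            rewrite pow2_abs, Rpow_mult_distr, !Cmod_sq.
            pose proof (pow2_ge_0 (fst (Z x k) * snd (E x k) - snd (Z x k) * fst (E x k))). nra.
          - rewrite Rmult_comm. apply Rmult_le_compat_l; [apply Cmod_ge_0|apply Hf]. }
        destruct (Hc k) as [Hc1 _]. pose proof (Rabs_pos (c k)). pose proof (Rabs_pos (df x k)). nra.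
    - rewrite (rsum_ext (fun k => Rabs (f t k - f s k)) (fun k => c k * f t k + (-1) * (c k * f s k))).
      + rewrite rsum_plus, rsum_scal; ring.
      + intros k _. rewrite <- (proj2 (Hc k)). ring. }
  apply Rle_trans with (rsum (fun k => Rabs (f t k - f s k) + d) K).
  - apply rsum_le; intros k _. pose proof (Hf t k). pose proof (Hf s k).
    apply Rabs_le. pose proof (Rle_abs (f t k - f s k)). pose proof (Rle_abs (- (f t k - f s k))).
    rewrite Rabs_Ropp in H2. lra.
  - rewrite rsum_plus, rsum_const. assert (INR (length K) * d <= e); [|lra].
    apply Rle_trans with (n * d); [apply Rmult_le_compat_r; unfold n; lra|].
    unfold d. replace (n * (e / (2 * n))) with (e / 2) by (field; lra). lra.
Qed.

(** Summed over a finite set the displacement is the real part of one function, after rotating each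
    component; this keeps the bound on the sum of the velocities without a loss in the cardinality. *)
Lemma displacement_le {I} (Z dZ : R -> I -> C) (g dg : R -> R) (K : list I) s t :
  s <= t ->
  (forall x k, s <= x <= t -> In k K -> dC (fun y => Z y k) x (dZ x k)) ->
  (forall x, s <= x <= t -> is_derive g x (dg x)) ->
  (forall x, s <= x <= t -> rsum (fun k => Cmod (dZ x k)) K <= dg x) ->
  rsum (fun k => Cmod (Z t k - Z s k)) K <= g t - g s.
Proof.
  intros Hst Hd Hg HE. destruct (polar_choice (fun k => Z t k - Z s k)%C) as (c & Hc).
  replace (rsum _ K) with (Re (csum (fun k => c k * Z t k)%C K) - Re (csum (fun k => c k * Z s k)%C K)).
  - apply (mvt_le (fun x => Re (csum (fun k => c k * Z x k)%C K)) g
      (fun x => Re (csum (fun k => c k * dZ x k)%C K)) dg); auto.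
    + intros x Hx. apply dC_Re. apply dC_csum. intros k Hk. apply dC_scal; auto.
    + intros x Hx. eapply Rle_trans; [apply Re_le_Cmod|]. eapply Rle_trans; [apply Cmod_csum|].
      eapply Rle_trans; [|apply (HE x Hx)]. right; apply rsum_ext; intros k _.
      rewrite Cmod_mult, (proj1 (Hc k)). ring.
  - rewrite !Re_csum. rewrite (rsum_ext (fun k => Cmod (Z t k - Z s k))
      (fun k => Re (c k * Z t k)%C + (-1) * Re (c k * Z s k)%C)).
    + rewrite rsum_plus, rsum_scal. ring.
    + intros k _. destruct (Hc k) as [_ E]. apply (f_equal Re) in E. simpl in E. rewrite <- E.
      unfold Re, Cmult, Cminus, Cplus, Copp; simpl. ring.
Qed.

(** * A priori bound on the remainder *)

Lemma bnd_sq_l1 (f : Z -> R) B : (forall k, 0 <= f k) -> bnd f B -> bnd (fun k => f k ^ 2) (B ^ 2).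
Proof.
  intros Hf H. apply bnd_le with (fun k => B * f k) (B * B); [|lra|apply bnd_scal; [|assumption]].
  - intros k. pose proof (bnd_term _ _ k H). specialize (Hf k). nra.
  - eapply bnd_nonneg; eassumption.
Qed.

Section Apriori.
Context (sigma T M m X : R) (al : Z -> C) (A D : R -> Z -> C).
Context (Hsig : Rabs sigma = 1) (Hm : 0 <= m) (HMm : M = m ^ 2) (HX : 0 <= X).

Let th (k : Z) : R := sigma * (Cmod (al k) ^ 2 / (8 * PI)).
Let B (t : R) (k : Z) : C := (cis (th k * ln t) * A t k)%C.

Context (Hd : forall t k, 0 < t < T -> dC (fun x => A x k) t (D t k)).
Context (HD : forall t k, 0 < t < T -> D t k = mode_rhs sigma t (fun _ => 2 * M) (A t) k).
Context (UA : forall lo, 0 < lo -> US (fun x => lo < x < T) (fun x k => Cmod (A x k))).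
Context (UD : forall lo, 0 < lo -> US (fun x => lo < x < T) (fun x k => Cmod (D x k))).
Context (Hmass : forall t, 0 < t < T -> hasum (fun k => A t k * Cconj (A t k))%C (RtoC M)).
Context (HalM : bnd (fun k => Cmod (al k) ^ 2) M).
Context (HalX : bnd (fun k => jap k * Cmod (al k) ^ 2) (X ^ 2)).

Lemma ap_asum t : 0 < t < T -> asum (A t).
Proof. intros Ht. apply (US_asum _ A t (UA (t / 2) ltac:(lra))). lra. Qed.

Lemma ap_mass t : 0 < t < T -> bnd (fun k => Cmod (A t k) ^ 2) M.
Proof.
  intros Ht l Hl. pose proof (hasum_Re_ge _ _ l (Hmass t Ht)) as H.
  eapply Rle_trans; [|apply H; [|assumption]].
  - right; apply rsum_ext; intros k _. rewrite <- Cmod2_conj. reflexivity.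
  - intros k. rewrite <- Cmod2_conj. apply (pow2_ge_0 (Cmod (A t k))).
Qed.

Lemma ap_B_mod t k : Cmod (B t k) = Cmod (A t k).
Proof. unfold B. rewrite Cmod_mult, cis_mod; ring. Qed.

Lemma ap_A_le t k : 0 < t < T -> Cmod (A t k) <= m.
Proof.
  intros Ht. apply sqr_le_of; [assumption|]. rewrite <- HMm.
  apply (bnd_term (fun k => Cmod (A t k) ^ 2) M k), ap_mass, Ht.
Qed.

Lemma ap_al_le k : Cmod (al k) <= m.
Proof.
  apply sqr_le_of; [assumption|]. rewrite <- HMm.
  apply (bnd_term (fun k => Cmod (al k) ^ 2) M k), HalM.
Qed.

Lemma ap_D t k : 0 < t < T ->
  D t k = (Ci * RtoC (sigma / (8 * PI * t)) * (Nres t (A t) k - A t k * Cconj (A t k) * A t k))%C.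
Proof.
  intros Ht. rewrite HD by assumption. unfold mode_rhs.
  rewrite (Ncub_split (A t) k t (RtoC M) (ap_asum t Ht) (Hmass t Ht)).
  rewrite RtoC_mult. ring.
Qed.

Definition rem_at (t : R) : Z -> R := fun k => Cmod (B t k - al k).

Lemma ap_A_split t k : 0 <= Cmod (A t k) <= Cmod (al k) + rem_at t k.
Proof.
  split; [apply Cmod_ge_0|]. rewrite <- ap_B_mod. unfold rem_at.
  replace (B t k) with (al k + (B t k - al k))%C at 1 by ring. apply Cmod_triangle.
Qed.

Lemma ap_D_l2 t r : 0 < t < T -> 0 <= r -> bnd (rem_at t) r ->
  bnd (fun k => Cmod (D t k) ^ 2) ((Ncap X r m / (8 * PI * t)) ^ 2).
Proof.
  intros Ht Hr Hrem. pose proof PI_RGT_0.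
  assert (HN : 0 <= Ncap X r m).
  { unfold Ncap. pose proof (pow_le X 3 HX). pose proof (pow_le r 3 Hr).
    assert (0 <= r * X ^ 2) by (apply Rmult_le_pos; [assumption|apply pow2_ge_0]).
    assert (0 <= r ^ 2 * m) by (apply Rmult_le_pos; [apply pow2_ge_0|assumption]). lra. }
  set (w := fun ab => nz ab - eq0 (fst ab) * eq0 (snd ab)).
  assert (Hw : forall ab, Rabs (w ab) <= 1).
  { intros [a b]; unfold w, nz, eq0; simpl. destruct (a =? 0)%Z; destruct (b =? 0)%Z; simpl;
      unfold Rminus; apply Rabs_le; lra. }
  pose proof (ap_asum t Ht) as HA.
  set (c := fun k => (Nres t (A t) k - A t k * Cconj (A t k) * A t k)%C).
  assert (Hc : forall k, hasum (fun ab => RtoC (w ab) * (trip (A t) k ab * ph t ab))%C (c k)).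
  { intros k.
    set (f0 := fun ab => (RtoC (eq0 (fst ab) * eq0 (snd ab)) * (trip (A t) k ab * ph t ab))%C).
    assert (H0 : hasum f0 (A t k * Cconj (A t k) * A t k)%C).
    { replace (A t k * Cconj (A t k) * A t k)%C with (f0 (0%Z, 0%Z)).
      - apply hasum_single. intros [a b] Hab. unfold f0; simpl.
        destruct (Z.eq_dec a 0) as [->|Ha].
        + rewrite (eq0_n b) by congruence. rewrite Rmult_0_r; ring.
        + rewrite (eq0_n a) by assumption. rewrite Rmult_0_l; ring.
      - unfold f0, trip, ph; simpl. rewrite !Z.sub_0_r, eq0_0.
        replace (- (0 * 0) / (2 * t)) with 0 by (unfold Rdiv; ring). rewrite cis_0, Rmult_1_r. ring. }
    pose proof (hasum_minus _ _ _ _ (hasum_Nres (A t) k t HA) H0) as H1.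
    eapply hasum_ext; [|exact H1]. intros ab. unfold w, f0. rewrite RtoC_minus. ring. }
  assert (Hb : bnd (fun k => Cmod (c k) ^ 2) (Ncap X r m ^ 2)).
  { apply (bnd_sq_lim (fun k ab => RtoC (w ab) * (trip (A t) k ab * ph t ab))%C
      (fun k => rtrip (fun j => Cmod (A t j)) (fun j => Cmod (A t j)) (fun j => Cmod (A t j)) k)); auto.
    - intros k ab. rewrite !Cmod_mult, ph_mod, Cmod_R, Cmod_trip, Rmult_1_r.
      apply Rmult_le_1; [apply rtrip_nonneg; intros; apply Cmod_ge_0|apply Hw].
    - apply (cubic_l2 _ (fun k => Cmod (al k)) (rem_at t)); auto; try (intros; apply Cmod_ge_0).
      + intros k; apply ap_A_split.
      + rewrite <- HMm; assumption. }
  assert (Hpt : 0 < 8 * PI * t) by (apply Rmult_lt_0_compat; lra).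
  apply (bnd_scal ((/ (8 * PI * t)) ^ 2)) in Hb; [|apply pow2_ge_0].
  eapply bnd_le; [| |exact Hb].
  - intros k; simpl. rewrite ap_D by assumption. fold (c k). rewrite !Cmod_mult, Cmod_R.
    rewrite Cmod_Ci.
    unfold Rdiv. rewrite Rabs_mult, Hsig, Rabs_inv, (Rabs_pos_eq (8 * PI * t)) by lra. right; ring.
  - right; field. lra.
Qed.

Lemma ap_T0 t : 0 < t < T ->
  bnd (fun i => Rabs (kk (snd i)) * Cmod (trip (A t) (fst i) (snd i))) (21 * m ^ 3).
Proof.
  intros Ht. replace (21 * m ^ 3) with (21 * (m * m * m)) by ring.
  eapply bnd_mono; [|apply (trilinear_kk (fun j => Cmod (A t j)) (fun j => Cmod (A t j))
    (fun j => Cmod (A t j)) m m m); auto; try (intros; apply Cmod_ge_0); rewrite <- HMm; apply ap_mass, Ht].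
  intros i. rewrite Cmod_trip. lra.
Qed.

Lemma ap_S t : 0 < t < T -> bnd (fun k => Cmod (Snf t (A t) k)) (21 * m ^ 3).
Proof.
  intros Ht.
  apply (bnd_hasum_fiber (fun i => RtoC (kk (snd i)) * (trip (A t) (fst i) (snd i) * ph t (snd i)))%C).
  - eapply bnd_mono; [|apply (ap_T0 t Ht)]. intros i.
    rewrite !Cmod_mult, ph_mod, Cmod_R. lra.
  - intros k; apply (hasum_Snf (A t) k t), ap_asum, Ht.
Qed.

Lemma ap_Q t r : 0 < t < T -> 0 <= r -> bnd (rem_at t) r ->
  bnd (fun k => t * Cmod (Qnf t (A t) (D t) k)) (63 * (m ^ 2 * (Ncap X r m / (8 * PI)))).
Proof.
  intros Ht Hr Hrem. pose proof PI_RGT_0.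
  pose proof (ap_D_l2 t r Ht Hr Hrem) as HDl.
  set (n := Ncap X r m / (8 * PI * t)) in *.
  assert (Hpt : 0 < 8 * PI * t) by (apply Rmult_lt_0_compat; lra).
  assert (HN : 0 <= Ncap X r m).
  { unfold Ncap. pose proof (pow_le X 3 HX). pose proof (pow_le r 3 Hr).
    assert (0 <= r * X ^ 2) by (apply Rmult_le_pos; [assumption|apply pow2_ge_0]).
    assert (0 <= r ^ 2 * m) by (apply Rmult_le_pos; [apply pow2_ge_0|assumption]). lra. }
  assert (Hn : 0 <= n) by (apply Rmult_le_pos; [assumption|left; apply Rinv_0_lt_compat; lra]).
  pose proof (ap_mass t Ht) as HMt. rewrite HMm in HMt.
  set (a := fun j => Cmod (A t j)). set (d := fun j => Cmod (D t j)).
  assert (a0 : forall k, 0 <= a k) by (intros; apply Cmod_ge_0).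
  assert (d0 : forall k, 0 <= d k) by (intros; apply Cmod_ge_0).
  pose proof (trilinear_kk d a a n m m d0 a0 a0 Hn Hm Hm HDl HMt HMt) as K1.
  pose proof (trilinear_kk a d a m n m a0 d0 a0 Hm Hn Hm HMt HDl HMt) as K2.
  pose proof (trilinear_kk a a d m m n a0 a0 d0 Hm Hm Hn HMt HMt HDl) as K3.
  pose proof (bnd_plus _ _ _ _ (bnd_plus _ _ _ _ K1 K2) K3) as K.
  set (f := fun i => (RtoC (kk (snd i)) * (dtrip (A t) (D t) (fst i) (snd i) * ph t (snd i)))%C).
  assert (Hf : bnd (fun i => Cmod (f i)) (63 * (m ^ 2 * n))).
  { eapply bnd_le; [| |exact K].
    - intros i. unfold f. rewrite !Cmod_mult, ph_mod, Cmod_R, Rmult_1_r.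
      pose proof (Cmod_dtrip (A t) (D t) (fst i) (snd i)) as Hdt. cbv zeta in Hdt.
      fold a d in Hdt. pose proof (Rabs_pos (kk (snd i))).
      rewrite <- !Rmult_plus_distr_l. apply Rmult_le_compat_l; assumption.
    - right; ring. }
  assert (HQ : bnd (fun k => Cmod (Qnf t (A t) (D t) k)) (63 * (m ^ 2 * n))).
  { apply (bnd_hasum_fiber f); [assumption|]. intros k. apply tsum_ok.
    exists (63 * (m ^ 2 * n)). apply (bnd_fiber _ _ k Hf). }
  apply (bnd_scal t) in HQ; [|lra]. eapply bnd_le; [| |exact HQ]; [intros; apply Rle_refl|].
  right. unfold n. field. lra.
Qed.

(** Bounds the regular part of the derivative of [B - W] when the remainder has [l^1] norm at most [r]: the
    first term comes from [Snf], the second from [Qnf], whose moving amplitude is controlled by [Ncap]. *)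
Definition g0 (r : R) : R :=
  / (4 * PI) * ((1 + m ^ 2 / (8 * PI)) * (21 * m ^ 3) + 63 * (m ^ 2 * (Ncap X r m / (8 * PI)))).

Lemma th_le k : Rabs (th k) <= m ^ 2 / (8 * PI).
Proof.
  pose proof PI_RGT_0. unfold th. rewrite Rabs_mult, Hsig, Rmult_1_l, Rabs_pos_eq.
  - unfold Rdiv. apply Rmult_le_compat_r; [left; apply Rinv_0_lt_compat; lra|].
    apply pow_incr; split; [apply Cmod_ge_0|apply ap_al_le].
  - apply Rmult_le_pos; [apply pow2_ge_0|left; apply Rinv_0_lt_compat; lra].
Qed.

Lemma ap_G t r : 0 < t < T -> 0 <= r -> bnd (rem_at t) r ->
  bnd (fun k => Cmod (Gnf sigma (th k) t (A t) (D t) k)) (g0 r).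
Proof.
  intros Ht Hr Hrem. pose proof PI_RGT_0.
  pose proof (bnd_plus _ _ _ _ (bnd_scal (1 + m ^ 2 / (8 * PI)) _ _ ltac:(pose proof (pow2_ge_0 m);
     apply Rplus_le_le_0_compat; [lra|apply Rmult_le_pos; [assumption|left; apply Rinv_0_lt_compat; lra]])
     (ap_S t Ht)) (ap_Q t r Ht Hr Hrem)) as K.
  apply (bnd_scal (/ (4 * PI))) in K; [|left; apply Rinv_0_lt_compat; lra].
  eapply bnd_mono; [|exact K]. intros k; simpl. unfold Gnf.
  rewrite !Cmod_mult, cis_mod, Cmod_R, Rmult_1_l. unfold Rdiv at 1.
  rewrite Rabs_mult, Hsig, Rmult_1_l, Rabs_inv, (Rabs_pos_eq (4 * PI)) by lra.
  apply Rmult_le_compat_l; [left; apply Rinv_0_lt_compat; lra|].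
  apply Cmod_tri_le. rewrite !Cmod_mult, Cmod_R, (Rabs_pos_eq t) by lra.
  apply Rplus_le_compat_r, Rmult_le_compat_r; [apply Cmod_ge_0|].
  apply Cmod_tri_le. rewrite Cmod_1, Cmod_mult, Cmod_R.
  rewrite Cmod_Ci.
  pose proof (th_le k). lra.
Qed.

Let W (t : R) (k : Z) : C := Wnf sigma (th k) t (A t) k.
Let Zn (t : R) (k : Z) : C := (B t k - W t k)%C.

Lemma ap_W t : 0 < t < T -> bnd (fun k => Cmod (W t k)) (t / (4 * PI) * (21 * m ^ 3)).
Proof.
  intros Ht. pose proof PI_RGT_0.
  apply bnd_le with (fun k => t / (4 * PI) * Cmod (Snf t (A t) k)) (t / (4 * PI) * (21 * m ^ 3)).
  - intros k. unfold W, Wnf. rewrite !Cmod_mult, cis_mod, Cmod_R.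
    unfold Rdiv. rewrite !Rabs_mult, Hsig, Rabs_inv, (Rabs_pos_eq t), (Rabs_pos_eq (4 * PI)) by lra. lra.
  - lra.
  - apply bnd_scal; [|apply ap_S, Ht]. apply Rmult_le_pos; [lra|left; apply Rinv_0_lt_compat; lra].
Qed.

Definition lam (t : R) (k : Z) : R := sigma / (8 * PI * t) * (Cmod (al k) ^ 2 - Cmod (B t k) ^ 2).

(** Removing [W] cancels the oscillating interactions; what remains is a rotation by [lam], which is
    singular unless [|B_k|] stays close to [|alpha_k|], and the regular [Gnf]. *)
Lemma dC_Zn t k : 0 < t < T ->
  dC (fun x => Zn x k) t (Ci * RtoC (lam t k) * B t k - Gnf sigma (th k) t (A t) (D t) k)%C.
Proof.
  intros Ht. pose proof PI_RGT_0.
  assert (HW : dC (fun x => W x k) t (Ci * RtoC (sigma / (8 * PI * t)) *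
      (cis (th k * ln t) * Nres t (A t) k) + Gnf sigma (th k) t (A t) (D t) k)%C).
  { apply (dC_Wnf sigma (th k) A D (t / 2) T); try lra.
    - intros x j Hx; apply Hd; lra.
    - apply UA; lra.
    - apply UD; lra. }
  assert (H1 : dC (fun x => cis (th k * ln x)) t (Ci * RtoC (th k * / t) * cis (th k * ln t))%C).
  { apply (dC_cis (fun x => th k * ln x)). auto_derive; [lra|ring]. }
  pose proof (dC_minus _ _ _ _ _ (dC_mult _ _ _ _ _ H1 (Hd t k Ht)) HW) as K.
  match type of K with dC _ _ ?a => match goal with |- dC _ _ ?b =>
    replace b with a; [exact K|] end end.
  rewrite ap_D by assumption. unfold lam, B. rewrite Cmod_mult, cis_mod, Rmult_1_l.
  replace (th k * / t) with (sigma / (8 * PI * t) * Cmod (al k) ^ 2) by (unfold th; field; lra).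
  rewrite !RtoC_mult, RtoC_minus, Cmod2_conj with (c := A t k).
  ring.
Qed.

Lemma ap_Zn_lim (K : list Z) e t : 0 < e -> 0 < t < T ->
  (forall e, 0 < e -> exists d, 0 < d /\ forall t, 0 < t < d -> t < T -> bnd (rem_at t) e) ->
  exists s, 0 < s < t /\ s <= e /\ rsum (fun k => Cmod (Zn s k - al k)) K <= e.
Proof.
  intros He Ht Hlim. pose proof PI_RGT_0.
  set (n := INR (length K) + 1).
  assert (Hn : 1 <= n) by (unfold n; pose proof (pos_INR (length K)); lra).
  assert (He2 : 0 < e / (2 * n)) by (apply Rdiv_lt_0_compat; lra).
  destruct (Hlim _ He2) as (d & Hd0 & Hdl).
  set (c := / (4 * PI) * (21 * m ^ 3) + 1).
  assert (Hc : 1 <= c).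
  { unfold c. assert (0 <= / (4 * PI) * (21 * m ^ 3)); [|lra].
    apply Rmult_le_pos; [left; apply Rinv_0_lt_compat; lra|]. pose proof (pow_le m 3 Hm). lra. }
  assert (Hec : 0 < e / (2 * n) / c) by (apply Rdiv_lt_0_compat; lra).
  set (s := Rmin (Rmin (t / 2) (d / 2)) (Rmin e (e / (2 * n) / c))).
  assert (Hs0 : 0 < s) by (unfold s; repeat apply Rmin_glb_lt; lra).
  assert (Hs1 : s <= t / 2) by (unfold s; eapply Rle_trans; [apply Rmin_l|apply Rmin_l]).
  assert (Hs2 : s <= d / 2) by (unfold s; eapply Rle_trans; [apply Rmin_l|apply Rmin_r]).
  assert (Hs3 : s <= e) by (unfold s; eapply Rle_trans; [apply Rmin_r|apply Rmin_l]).
  assert (Hs4 : s <= e / (2 * n) / c) by (unfold s; eapply Rle_trans; [apply Rmin_r|apply Rmin_r]).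
  exists s; repeat split; [lra|lra|assumption|].
  assert (HsT : 0 < s < T) by lra.
  pose proof (Hdl s ltac:(lra) ltac:(lra)) as Hrs.
  pose proof (ap_W s HsT) as HWs.
  apply Rle_trans with (rsum (fun _ => e / (2 * n) + e / (2 * n)) K).
  - apply rsum_le; intros k _. unfold Zn.
    replace (B s k - W s k - al k)%C with ((B s k - al k) + - W s k)%C by ring.
    apply Cmod_tri_le. rewrite Cmod_opp. apply Rplus_le_compat.
    + apply (bnd_term (rem_at s) _ k Hrs).
    + eapply Rle_trans; [apply (bnd_term _ _ k HWs)|].
      apply Rle_trans with (s * c).
      * unfold Rdiv. rewrite Rmult_assoc. apply Rmult_le_compat_l; [lra|unfold c; lra].
      * apply Rle_trans with (e / (2 * n) / c * c); [apply Rmult_le_compat_r; lra|right; field; lra].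
  - rewrite rsum_const. replace (e / (2 * n) + e / (2 * n)) with (e * / n) by (field; lra).
    apply Rle_trans with (n * (e * / n)); [|right; field; lra].
    apply Rmult_le_compat_r; [|unfold n; lra].
    apply Rmult_le_pos; [lra|left; apply Rinv_0_lt_compat; lra].
Qed.

(** [r] is an a priori bound on the remainder and [gi] a primitive of [g0 (r t)].  The rotation has the
    singular rate [lam = O(1/t)], so it is handled in two rounds: the moduli of [Zn], which it does not
    move, first show that [|B_k| - |alpha_k| = O(t)] in [l^1]; then [lam B] is bounded and the displacement of
    [Zn] itself can be estimated. *)
Lemma ap_step (r gi : R -> R) t rmax : 0 < t < T ->
  (forall e, 0 < e -> exists d, 0 < d /\ forall t, 0 < t < d -> t < T -> bnd (rem_at t) e) ->
  (forall x, 0 < x <= t -> 0 <= r x <= rmax /\ bnd (rem_at x) (r x)) ->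
  (forall x, 0 < x <= t -> is_derive gi x (g0 (r x))) ->
  (forall x, 0 < x <= t -> 0 <= gi x) ->
  (forall x y, 0 <= x <= y -> g0 x <= g0 y) ->
  bnd (rem_at t) (gi t + t * (m ^ 2 / (4 * PI) * (g0 rmax + m ^ 2 * (21 * m ^ 3) / (32 * PI ^ 2)
     + 21 * m ^ 3 / (4 * PI))) + t * (21 * m ^ 3 / (4 * PI))).
Proof.
  intros Ht Hlim Hr Hgi Hgi0 Hmono K HK. pose proof PI_RGT_0.
  set (a := 21 * m ^ 3) in *. assert (Ha : 0 <= a) by (unfold a; pose proof (pow_le m 3 Hm); lra).
  assert (Hm2 : 0 <= m ^ 2) by apply pow2_ge_0.
  assert (Hpp : 0 < PI ^ 2) by (apply pow_lt; assumption).
  set (E := g0 rmax + m ^ 2 * a / (32 * PI ^ 2)).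
  set (C1 := E + a / (4 * PI)).
  (* the normal form is O(t), so the rotation of rate O(1/t) is bounded on it *)
  assert (HlamW : forall x, 0 < x <= t -> rsum (fun k => Rabs (lam x k) * Cmod (W x k)) K <= m ^ 2 * a / (32 * PI ^ 2)).
  { intros x Hx. assert (HxT : 0 < x < T) by lra.
    apply Rle_trans with (rsum (fun k => m ^ 2 / (8 * PI * x) * Cmod (W x k)) K).
    - apply rsum_le; intros k _. apply Rmult_le_compat_r; [apply Cmod_ge_0|].
      unfold lam, Rdiv. rewrite !Rabs_mult, Hsig, Rabs_inv, (Rabs_pos_eq (8 * PI * x))
        by (apply Rmult_le_pos; lra). rewrite Rmult_1_l, Rmult_comm.
      apply Rmult_le_compat_r; [left; apply Rinv_0_lt_compat, Rmult_lt_0_compat; lra|].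
      rewrite ap_B_mod. pose proof (ap_al_le k). pose proof (ap_A_le x k HxT).
      pose proof (Cmod_ge_0 (al k)). pose proof (Cmod_ge_0 (A x k)). apply Rabs_le. nra.
    - rewrite rsum_scal. pose proof (ap_W x HxT K HK) as HWx. fold a in HWx.
      apply Rle_trans with (m ^ 2 / (8 * PI * x) * (x / (4 * PI) * a)).
      + apply Rmult_le_compat_l; [|assumption]. apply Rmult_le_pos; [assumption|].
        left; apply Rinv_0_lt_compat, Rmult_lt_0_compat; lra.
      + right; field; lra. }
  assert (HG : forall x, 0 < x <= t -> rsum (fun k => Cmod (Gnf sigma (th k) x (A x) (D x) k)) K <= g0 (r x)).
  { intros x Hx. destruct (Hr x Hx) as [Hr1 Hr2]. apply (ap_G x (r x)); [lra|lra|assumption|assumption]. }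
  assert (Step1 : forall x, 0 < x <= t -> rsum (fun k => Rabs (Cmod (Zn x k) - Cmod (al k))) K <= E * x).
  { intros x Hx. apply le_epsilon; intros e He.
    destruct (ap_Zn_lim K e x He ltac:(lra) Hlim) as (s & Hs & Hse & Hlim').
    assert (HL : rsum (fun k => Rabs (Cmod (Zn x k) - Cmod (Zn s k))) K <= E * (x - s)).
    { apply (modulus_lip Zn lam (fun y k => Ci * RtoC (lam y k) * W y k - Gnf sigma (th k) y (A y) (D y) k)%C); [lra|..].
      - intros y k Hy _. pose proof (dC_Zn y k ltac:(lra)) as Kd.
        match type of Kd with dC _ _ ?u => match goal with |- dC _ _ ?v =>
          replace v with u; [exact Kd|] end end. unfold Zn. ring.
      - intros y Hy. eapply Rle_trans; [|apply Rplus_le_compat; [apply (Hmono (r y) rmax)|apply (HlamW y)]].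
        + rewrite Rplus_comm.
          eapply Rle_trans; [|apply Rplus_le_compat; [apply Rle_refl|apply (HG y)]]; [|lra].
          rewrite <- rsum_plus. apply rsum_le; intros k _.
          apply Cmod_tri_le. rewrite Cmod_opp, !Cmod_mult, Cmod_R.
          rewrite Cmod_Ci. lra.
        + destruct (Hr y ltac:(lra)); lra.
        + lra. }
    apply Rle_trans with (rsum (fun k => Rabs (Cmod (Zn x k) - Cmod (Zn s k)) + Cmod (Zn s k - al k)) K).
    - apply rsum_le; intros k _.
      replace (Cmod (Zn x k) - Cmod (al k)) with ((Cmod (Zn x k) - Cmod (Zn s k)) + (Cmod (Zn s k) - Cmod (al k))) by ring.
      eapply Rle_trans; [apply Rabs_triang|]. apply Rplus_le_compat_l.
      apply Rabs_le. pose proof (Cmod_triangle (Zn s k - al k) (al k)) as T1.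
      replace (Zn s k - al k + al k)%C with (Zn s k) in T1 by ring.
      pose proof (Cmod_triangle (al k - Zn s k) (Zn s k)) as T2.
      replace (al k - Zn s k + Zn s k)%C with (al k) in T2 by ring. rewrite (Cmod_sub_sym (al k)) in T2. lra.
    - rewrite rsum_plus.
      assert (HE : 0 <= E).
      { apply Rplus_le_le_0_compat.
        - destruct (Hr x Hx) as [Hr1 Hr2]. apply Rle_trans with (g0 (r x)); [|apply Hmono; lra].
          eapply Rle_trans; [|apply (HG x Hx)]. apply rsum_nonneg; intros; apply Cmod_ge_0.
        - apply Rmult_le_pos; [apply Rmult_le_pos; assumption|left; apply Rinv_0_lt_compat; lra]. }
      nra. }
  assert (Step2 : forall x, 0 < x <= t -> rsum (fun k => Rabs (Cmod (B x k) - Cmod (al k))) K <= C1 * x).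
  { intros x Hx. pose proof (ap_W x ltac:(lra) K HK) as HWx. fold a in HWx.
    apply Rle_trans with (rsum (fun k => Rabs (Cmod (Zn x k) - Cmod (al k)) + Cmod (W x k)) K).
    - apply rsum_le; intros k _.
      pose proof (Cmod_triangle (Zn x k) (W x k)) as T1.
      replace (Zn x k + W x k)%C with (B x k) in T1 by (unfold Zn; ring).
      pose proof (Cmod_triangle (B x k) (- W x k)) as T2. rewrite Cmod_opp in T2.
      change (B x k + - W x k)%C with (Zn x k) in T2.
      pose proof (Rle_abs (Cmod (Zn x k) - Cmod (al k))).
      pose proof (Rle_abs (- (Cmod (Zn x k) - Cmod (al k)))) as T3. rewrite Rabs_Ropp in T3.
      apply Rabs_le. lra.
    - rewrite rsum_plus. pose proof (Step1 x Hx). unfold C1.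
      replace (x / (4 * PI) * a) with (a / (4 * PI) * x) in HWx by (field; lra). lra. }
  assert (HlamB : forall x, 0 < x <= t -> rsum (fun k => Rabs (lam x k) * Cmod (B x k)) K <= m ^ 2 / (4 * PI) * C1).
  { intros x Hx. assert (HxT : 0 < x < T) by lra.
    apply Rle_trans with (rsum (fun k => m ^ 2 / (4 * PI * x) * Rabs (Cmod (B x k) - Cmod (al k))) K).
    - apply rsum_le; intros k _.
      unfold lam, Rdiv. rewrite !Rabs_mult, Hsig, Rabs_inv, (Rabs_pos_eq (8 * PI * x))
        by (apply Rmult_le_pos; lra). rewrite Rmult_1_l.
      replace (Cmod (al k) ^ 2 - Cmod (B x k) ^ 2) with
        (- (Cmod (B x k) - Cmod (al k)) * (Cmod (al k) + Cmod (B x k))) by ring.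
      rewrite Rabs_mult, Rabs_Ropp. set (z := Rabs (Cmod (B x k) - Cmod (al k))).
      assert (0 <= z) by apply Rabs_pos. rewrite ap_B_mod.
      pose proof (ap_al_le k). pose proof (ap_A_le x k HxT).
      pose proof (Cmod_ge_0 (al k)). pose proof (Cmod_ge_0 (A x k)).
      rewrite (Rabs_pos_eq (_ + _)) by lra.
      replace (m ^ 2 * / (4 * PI * x) * z) with (/ (8 * PI * x) * (z * (2 * (m * m)))) by (field; lra).
      replace (/ (8 * PI * x) * (z * (Cmod (al k) + Cmod (A x k))) * Cmod (A x k)) with
        (/ (8 * PI * x) * (z * ((Cmod (al k) + Cmod (A x k)) * Cmod (A x k)))) by ring.
      apply Rmult_le_compat_l; [left; apply Rinv_0_lt_compat, Rmult_lt_0_compat; lra|].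
      apply Rmult_le_compat_l; [assumption|]. nra.
    - rewrite rsum_scal. pose proof (Step2 x Hx).
      apply Rle_trans with (m ^ 2 / (4 * PI * x) * (C1 * x)).
      + apply Rmult_le_compat_l; [|assumption]. apply Rmult_le_pos; [assumption|].
        left; apply Rinv_0_lt_compat, Rmult_lt_0_compat; lra.
      + right; field; lra. }
  assert (Step3 : rsum (fun k => Cmod (Zn t k - al k)) K <= gi t + t * (m ^ 2 / (4 * PI) * C1)).
  { apply le_epsilon; intros e He.
    destruct (ap_Zn_lim K e t He ltac:(lra) Hlim) as (s & Hs & Hse & Hlim').
    set (q := m ^ 2 / (4 * PI) * C1) in *.
    assert (HL : rsum (fun k => Cmod (Zn t k - Zn s k)) K <= (gi t + q * t) - (gi s + q * s)).
    { apply (displacement_le Zn (fun x k => Ci * RtoC (lam x k) * B x k - Gnf sigma (th k) x (A x) (D x) k)%C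
        (fun x => gi x + q * x) (fun x => g0 (r x) + q)); [lra|..].
      - intros x k Hx _. apply dC_Zn; lra.
      - intros x Hx. apply @is_derive_plus; [apply Hgi; lra|]. auto_derive; [auto|ring].
      - intros x Hx. rewrite Rplus_comm.
        eapply Rle_trans; [|apply Rplus_le_compat; [apply (HlamB x)|apply (HG x)]]; [|lra|lra].
        rewrite <- rsum_plus. apply rsum_le; intros k _.
        apply Cmod_tri_le. rewrite Cmod_opp, !Cmod_mult, Cmod_R.
        rewrite Cmod_Ci. lra. }
    apply Rle_trans with (rsum (fun k => Cmod (Zn t k - Zn s k) + Cmod (Zn s k - al k)) K).
    - apply rsum_le; intros k _. apply Cmod_tri3.
    - rewrite rsum_plus. pose proof (Hgi0 s ltac:(lra)).
      assert (0 <= q).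
      { eapply Rle_trans; [|apply (HlamB t)]; [|lra]. apply rsum_nonneg; intros.
        apply Rmult_le_pos; [apply Rabs_pos|apply Cmod_ge_0]. }
      nra. }
  pose proof (ap_W t Ht K HK) as HWt. fold a in HWt.
  apply Rle_trans with (rsum (fun k => Cmod (Zn t k - al k) + Cmod (W t k)) K).
  - apply rsum_le; intros k _. unfold rem_at.
    replace (B t k - al k)%C with ((Zn t k - al k) + W t k)%C by (unfold Zn; ring). apply Cmod_triangle.
  - rewrite rsum_plus. replace (t / (4 * PI) * a) with (t * (a / (4 * PI))) in HWt by (field; lra). lra.
Qed.
End Apriori.

Lemma PI_gt_31 : 31 / 10 < PI.
Proof.
  apply Rnot_le_lt; intros L. pose proof PI2_3_2 as L3.
  set (a := PI / 2) in *. assert (Ha : 3 / 2 <= a <= 31 / 20) by (unfold a in *; lra).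
  assert (Hc : cos_approx a (2 * 1 + 1) <= cos a <= cos_approx a (2 * (1 + 1))).
  { apply cos_bound; unfold a in *; lra. }
  destruct Hc as [Hc _]. replace (cos a) with 0 in Hc by (symmetry; apply cos_PI2).
  replace (cos_approx a (2 * 1 + 1)) with (1 - a ^ 2 / 2 + a ^ 4 / 24 - a ^ 6 / 720) in Hc
    by (unfold cos_approx, cos_term; simpl; field).
  assert (0 < 1 - a ^ 2 / 2 + a ^ 4 / 24 - a ^ 6 / 720).
  { set (b := a ^ 2). replace (a ^ 4) with (b ^ 2) by (unfold b; ring).
    replace (a ^ 6) with (b ^ 3) by (unfold b; ring).
    assert (Hb : 9 / 4 <= b <= 961 / 400) by (unfold b; simpl; nra).
    replace (b ^ 2) with (b * b) by ring. replace (b ^ 3) with (b * (b * b)) by ring. nra. }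
  lra.
Qed.

(** Primitive in [y] of [Ncap X (X y) m]. *)
Definition Ncap_prim (X m y : R) : R :=
  454 / 100 * X ^ 3 * y + 3 * (15812 / 10000) * X ^ 3 * y ^ 2 / 2 + X ^ 2 * m * y ^ 3 + X ^ 3 * y ^ 4 / 4.

Lemma Ncap_mono X m x y : 0 <= X -> 0 <= m -> 0 <= x <= y -> 0 <= Ncap X x m <= Ncap X y m.
Proof.
  intros HX Hm H. unfold Ncap.
  pose proof (pow_le X 3 HX). pose proof (pow2_ge_0 X).
  pose proof (pow_incr x y 2 H). pose proof (pow_incr x y 3 H).
  pose proof (pow2_ge_0 x). pose proof (pow_le x 3 ltac:(lra)).
  assert (0 <= x * X ^ 2 <= y * X ^ 2) by (split; [apply Rmult_le_pos|apply Rmult_le_compat_r]; lra).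
  assert (0 <= x ^ 2 * m <= y ^ 2 * m) by (split; [apply Rmult_le_pos|apply Rmult_le_compat_r]; lra).
  lra.
Qed.

Lemma g0_mono m X x y : 0 <= X -> 0 <= m -> 0 <= x <= y -> 0 <= g0 m X x <= g0 m X y.
Proof.
  intros HX Hm H. pose proof PI_RGT_0. unfold g0. pose proof (Ncap_mono X m x y HX Hm H) as HN.
  assert (0 < / (4 * PI)) by (apply Rinv_0_lt_compat; lra).
  assert (0 < / (8 * PI)) by (apply Rinv_0_lt_compat; lra).
  pose proof (pow2_ge_0 m). pose proof (pow_le m 3 Hm).
  assert (0 <= (1 + m ^ 2 / (8 * PI)) * (21 * m ^ 3)).
  { apply Rmult_le_pos; [|lra]. assert (0 <= m ^ 2 / (8 * PI)) by (apply Rmult_le_pos; lra). lra. }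
  assert (0 <= m ^ 2 * (Ncap X x m / (8 * PI)) <= m ^ 2 * (Ncap X y m / (8 * PI))).
  { split; [apply Rmult_le_pos; [lra|apply Rmult_le_pos; lra]|].
    apply Rmult_le_compat_l; [lra|]. apply Rmult_le_compat_r; lra. }
  split; [apply Rmult_le_pos; lra|apply Rmult_le_compat_l; lra].
Qed.

Lemma mul_le2 a b A B : 0 <= a <= A -> 0 <= b <= B -> 0 <= a * b <= A * B.
Proof. intros; split; [apply Rmult_le_pos|apply Rmult_le_compat]; lra. Qed.

(** The factor [p] coming from the length of the time interval is absorbed by the mass: [p m^2 <= 2 X^2], and
    [p m^3] is largest for [p = 4]. *)
Lemma budget (p : R) X m : 1 <= p -> 0 <= X -> 0 <= m -> (p + 2) * m ^ 2 <= 2 * X ^ 2 ->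
  p * m ^ 3 <= 77 / 100 * X ^ 3 /\ p * m ^ 2 <= 2 * X ^ 2 /\ m ^ 2 <= 2 / 3 * X ^ 2 /\
  m <= 8166 / 10000 * X /\ m ^ 3 <= 5445 / 10000 * X ^ 3.
Proof.
  intros Hp1 HX Hm H. pose proof (pow2_ge_0 m) as Hm2. pose proof (pow2_ge_0 X) as HX2.
  assert (B2 : p * m ^ 2 <= 2 * X ^ 2) by lra.
  assert (B3 : m ^ 2 <= 2 / 3 * X ^ 2) by nra.
  assert (B4 : m <= 8166 / 10000 * X) by (apply sqr_le_of; nra).
  assert (B5 : m ^ 3 <= 5445 / 10000 * X ^ 3).
  { replace (m ^ 3) with (m * m ^ 2) by ring.
    apply Rle_trans with (8166 / 10000 * X * (2 / 3 * X ^ 2)); [apply Rmult_le_compat; lra|].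
    replace (8166 / 10000 * X * (2 / 3 * X ^ 2)) with (5444 / 10000 * X ^ 3) by field.
    pose proof (pow_le X 3 HX). lra. }
  repeat split; try assumption. apply sqr_le_of; [pose proof (pow_le X 3 HX); lra|].
  assert (Hc : ((p + 2) * m ^ 2) ^ 3 <= (2 * X ^ 2) ^ 3)
    by (apply pow_incr; split; [apply Rmult_le_pos; lra|assumption]).
  assert (Hpoly : 27 * p ^ 2 <= 2 * (p + 2) ^ 3).
  { replace (2 * (p + 2) ^ 3) with (27 * p ^ 2 + (p - 4) ^ 2 * (2 * p + 1)) by ring.
    pose proof (pow2_ge_0 (p - 4)). nra. }
  assert (Hm6 : 0 <= m ^ 6) by (apply pow_le; assumption).
  assert (HX6 : 0 <= X ^ 6) by (apply pow_le; assumption).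
  replace ((p * m ^ 3) ^ 2) with (p ^ 2 * m ^ 6) by ring.
  replace ((77 / 100 * X ^ 3) ^ 2) with (5929 / 10000 * X ^ 6) by field.
  replace (((p + 2) * m ^ 2) ^ 3) with ((p + 2) ^ 3 * m ^ 6) in Hc by ring.
  replace ((2 * X ^ 2) ^ 3) with (8 * X ^ 6) in Hc by ring.
  assert (27 * p ^ 2 * m ^ 6 <= 2 * (p + 2) ^ 3 * m ^ 6) by (apply Rmult_le_compat_r; assumption).
  lra.
Qed.

Lemma Ncap_prim_incr X m x : 0 <= X -> 0 <= m <= 8166 / 10000 * X -> 0 <= x <= 1 ->
  0 <= Ncap_prim X m (1 / 50 + 5 / 4 * x) - Ncap_prim X m (1 / 50) <= 5 / 4 * x * (946 / 100 * X ^ 3).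
Proof.
  intros HX Hm Hx. set (a := 1 / 50 + 5 / 4 * x). set (d := 1 / 50).
  assert (Hx2 : 0 <= x * x <= 1) by nra. assert (Hx3 : 0 <= x * (x * x) <= 1) by nra.
  pose proof (pow_le X 3 HX) as HX3. pose proof (pow2_ge_0 X) as HX2.
  assert (HXm : 0 <= X ^ 2 * m <= 8166 / 10000 * X ^ 3).
  { split; [apply Rmult_le_pos; lra|].
    replace (8166 / 10000 * X ^ 3) with (X ^ 2 * (8166 / 10000 * X)) by ring.
    apply Rmult_le_compat_l; lra. }
  set (q2 := 2 * d + 5 / 4 * x). set (q3 := 3 * d ^ 2 + 3 * d * (5 / 4) * x + 25 / 16 * (x * x)).
  set (q4 := 4 * d ^ 3 + 6 * d ^ 2 * (5 / 4) * x + 4 * d * (25 / 16) * (x * x) + 125 / 64 * (x * (x * x))).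
  assert (E : Ncap_prim X m a - Ncap_prim X m d = 5 / 4 * x * (454 / 100 * X ^ 3 + 3 * (15812 / 10000) / 2 * (X ^ 3 * q2)
     + X ^ 2 * m * q3 + / 4 * (X ^ 3 * q4))).
  { unfold Ncap_prim, q2, q3, q4, a, d. field. }
  rewrite E. assert (Q2 : 0 <= q2 <= 129 / 100) by (unfold q2, d; lra).
  assert (Q3 : 0 <= q3 <= 16388 / 10000) by (unfold q3, d; lra).
  assert (Q4 : 0 <= q4 <= 20813 / 10000) by (unfold q4, d; lra).
  pose proof (mul_le2 (X ^ 3) q2 _ _ (conj HX3 (Rle_refl _)) Q2).
  pose proof (mul_le2 (X ^ 3) q4 _ _ (conj HX3 (Rle_refl _)) Q4).
  pose proof (mul_le2 _ _ _ _ HXm Q3).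
  split; [apply Rmult_le_pos; lra|apply Rmult_le_compat_l; lra].
Qed.

(** Primitive in [t] of [g0] along the bound [X (1/50 + 5/4 t/(p/(2 PI)))]. *)
Definition g0_prim (p X m t : R) : R :=
  / (4 * PI) * ((1 + m ^ 2 / (8 * PI)) * (21 * m ^ 3) * t + 63 * (m ^ 2 / (8 * PI) *
     (p / (2 * PI) / (5 / 4) * (Ncap_prim X m (1 / 50 + 5 / 4 * (t / (p / (2 * PI)))) - Ncap_prim X m (1 / 50))))).

Lemma is_derive_g0_prim p X m t : 0 < p ->
  is_derive (g0_prim p X m) t (g0 m X (X * (1 / 50 + 5 / 4 * (t / (p / (2 * PI)))))).
Proof.
  intros Hp0. pose proof PI_RGT_0. unfold g0_prim, g0, Ncap_prim, Ncap.
  auto_derive; [auto|]. field. lra.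
Qed.

(** With [t = x p/(2 PI)] every term carries a factor [p m^2] or [p m^3], bounded by [budget]; the rest is a
    numerical check with [1/PI <= 10/31]. *)
Lemma final_budget p X m x : 1 <= p -> 0 <= X <= 1 -> 0 <= m -> (p + 2) * m ^ 2 <= 2 * X ^ 2 -> 0 <= x <= 1 ->
  let t := x * (p / (2 * PI)) in
  g0_prim p X m t + t * (m ^ 2 / (4 * PI) * (g0 m X (X * (127 / 100)) + m ^ 2 * (21 * m ^ 3) / (32 * PI ^ 2)
     + 21 * m ^ 3 / (4 * PI))) + t * (21 * m ^ 3 / (4 * PI)) <= 6 / 5 * X * x.
Proof.
  intros Hp1 HX Hm HpM Hx t. pose proof PI_gt_31 as HPI.
  set (u := / PI). assert (Hu : 0 <= u <= 10 / 31).
  { unfold u; split; [left; apply Rinv_0_lt_compat; lra|].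
    replace (10 / 31) with (/ (31 / 10)) by field. apply Rinv_le_contravar; lra. }
  destruct (budget p X m Hp1 (proj1 HX) Hm HpM) as (B1 & B2 & B3 & B4 & B5).
  pose proof (Ncap_prim_incr X m x (proj1 HX) (conj Hm B4) Hx) as HH.
  set (h := Ncap_prim X m (1 / 50 + 5 / 4 * x) - Ncap_prim X m (1 / 50)) in *.
  pose proof (pow_le m 3 Hm) as M3. pose proof (pow2_ge_0 m) as M2.
  pose proof (pow_le X 3 (proj1 HX)) as X3. pose proof (pow2_ge_0 X) as X2.
  assert (X2l : X ^ 2 <= 1) by (rewrite <- (pow1 2); apply pow_incr; assumption).
  assert (X3l : X ^ 3 <= X).
  { replace (X ^ 3) with (X ^ 2 * X) by ring. apply Rmult_le_1; lra. }
  assert (U2 : 0 <= u * u <= 100 / 961) by nra.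
  assert (U3 : 0 <= u * (u * u) <= 1000 / 29791) by nra.
  assert (Pm3 : 0 <= p * m ^ 3 <= 77 / 100 * X) by (split; [apply Rmult_le_pos; lra|lra]).
  assert (Pm2 : 0 <= p * m ^ 2 <= 2) by (split; [apply Rmult_le_pos; lra|lra]).
  assert (Th : 0 <= 1 + m ^ 2 * u / 8 <= 10269 / 10000).
  { pose proof (mul_le2 (m ^ 2) u (2 / 3) (10 / 31) ltac:(lra) Hu). lra. }
  assert (HN : 0 <= Ncap X (X * (127 / 100)) m <= 1657 / 100 * X ^ 3).
  { split; [apply (Ncap_mono X m (X * (127 / 100)) (X * (127 / 100))); lra|].
    assert (X ^ 2 * m <= 8166 / 10000 * X ^ 3).
    { replace (8166 / 10000 * X ^ 3) with (X ^ 2 * (8166 / 10000 * X)) by ring.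
      apply Rmult_le_compat_l; lra. }
    unfold Ncap.
    replace (X * (127 / 100) * X ^ 2) with (127 / 100 * X ^ 3) by ring.
    replace ((X * (127 / 100)) ^ 2 * m) with (16129 / 10000 * (X ^ 2 * m)) by field.
    replace ((X * (127 / 100)) ^ 3) with (2048383 / 1000000 * X ^ 3) by field. lra. }
  assert (HG : 0 <= g0 m X (X * (127 / 100)) <= 322 / 100 * X).
  { split; [apply (g0_mono m X (X * (127 / 100)) (X * (127 / 100))); lra|].
    unfold g0. replace (/ (4 * PI)) with (u / 4) by (unfold u; field; lra).
    replace (m ^ 2 / (8 * PI)) with (m ^ 2 * u / 8) by (unfold u; field; lra).
    set (N := Ncap _ _ _) in *. replace (N / (8 * PI)) with (u / 8 * N) by (unfold u; field; lra).
    pose proof (mul_le2 _ _ _ _ Th (conj M3 B5)) as Q1.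
    assert (HNu : 0 <= u / 8 * N <= 10 / 248 * (1657 / 100 * X ^ 3)) by (apply mul_le2; lra).
    assert (Q2 : 0 <= m ^ 2 * (u / 8 * N) <= 2 / 3 * (10 / 248 * (1657 / 100 * X ^ 3))).
    { apply mul_le2; [lra|assumption]. }
    pose proof (mul_le2 (u / 4) ((1 + m ^ 2 * u / 8) * (21 * m ^ 3) + 63 * (m ^ 2 * (u / 8 * N)))
      (10 / 124) (3982 / 100 * X) ltac:(lra) ltac:(lra)) as Q3. lra. }
  set (G := g0 m X (X * (127 / 100))) in *.
  assert (Ht : t = x * p * u / 2) by (unfold t, u; field; lra).
  assert (Hgi : g0_prim p X m t = x * (21 / 8 * (u * u) * (1 + m ^ 2 * u / 8) * (p * m ^ 3)) +
      63 / 64 * (u * (u * u)) * (p * m ^ 2) * (h / (5 / 4))).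
  { unfold g0_prim. replace (t / (p / (2 * PI))) with x by (unfold t; field; lra). fold h.
    unfold t, u. field. lra. }
  rewrite Hgi.
  replace (t * (m ^ 2 / (4 * PI) * (G + m ^ 2 * (21 * m ^ 3) / (32 * PI ^ 2) + 21 * m ^ 3 / (4 * PI)))) with
    (x * (/ 8 * (u * u) * (p * m ^ 2) * (G + 21 / 32 * (u * u) * (m ^ 2 * m ^ 3) + 21 / 4 * (u * m ^ 3))))
    by (rewrite Ht; unfold u; field; lra).
  replace (t * (21 * m ^ 3 / (4 * PI))) with (x * (21 / 8 * (u * u) * (p * m ^ 3)))
    by (rewrite Ht; unfold u; field; lra).
  pose proof (mul_le2 _ _ _ _ U2 Pm3) as K1.
  pose proof (mul_le2 _ _ _ _ Th K1) as K2.
  pose proof (mul_le2 _ _ _ _ U3 Pm2) as K3.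
  assert (Hh : 0 <= h / (5 / 4) <= x * (946 / 100 * X)) by (split; [lra|nra]).
  pose proof (mul_le2 _ _ _ _ K3 Hh) as K4.
  pose proof (mul_le2 _ _ _ _ U2 Pm2) as K5.
  assert (K6 : 0 <= m ^ 2 * m ^ 3 <= 2 / 3 * (5445 / 10000 * X)).
  { apply mul_le2; lra. }
  pose proof (mul_le2 _ _ _ _ U2 K6) as K7.
  assert (K8 : 0 <= u * m ^ 3 <= 10 / 31 * (5445 / 10000 * X)) by (apply mul_le2; lra).
  pose proof (mul_le2 (u * u * (p * m ^ 2)) (G + 21 / 32 * (u * u * (m ^ 2 * m ^ 3)) + 21 / 4 * (u * m ^ 3))
     (100 / 961 * 2) (418 / 100 * X) K5 ltac:(lra)) as K9.
  set (S1 := 21 / 8 * (u * u) * (1 + m ^ 2 * u / 8) * (p * m ^ 3)).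
  set (S3 := / 8 * (u * u) * (p * m ^ 2) * (G + 21 / 32 * (u * u) * (m ^ 2 * m ^ 3) + 21 / 4 * (u * m ^ 3))).
  set (S4 := 21 / 8 * (u * u) * (p * m ^ 3)).
  assert (HS1 : S1 <= 21601 / 100000 * X) by (unfold S1; lra).
  assert (HS3 : S3 <= 1088 / 10000 * X) by (unfold S3; lra).
  assert (HS4 : S4 <= 2104 / 10000 * X) by (unfold S4; lra).
  assert (HS2 : 63 / 64 * (u * (u * u)) * (p * m ^ 2) * (h / (5 / 4)) <= x * (6253 / 10000 * X)) by nra.
  assert (x * S1 + x * S3 + x * S4 <= x * (21601 / 100000 * X + 1088 / 10000 * X + 2104 / 10000 * X)) by nra.
  assert (0 <= x * X) by (apply Rmult_le_pos; lra).
  nra.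
Qed.

Lemma bnd_tri (f g h : Z -> C) A B :
  bnd (fun k => Cmod (f k - g k)) A -> bnd (fun k => Cmod (g k - h k)) B ->
  bnd (fun k => Cmod (f k - h k)) (A + B).
Proof.
  intros H1 H2. eapply bnd_mono; [|exact (bnd_plus _ _ _ _ H1 H2)].
  intros; apply Cmod_tri3.
Qed.

(** * Bootstrap *)

Section Bootstrap.
Context (sigma T M m X : R) (al : Z -> C) (A D : R -> Z -> C) (p : R).
Context (Hsig : Rabs sigma = 1) (Hm : 0 <= m) (HMm : M = m ^ 2) (HX : 0 < X <= 1).
Context (Hp1 : 1 <= p) (HpM : (p + 2) * m ^ 2 <= 2 * X ^ 2).
Context (Hd : forall t k, 0 < t < T -> dC (fun x => A x k) t (D t k)).
Context (HD : forall t k, 0 < t < T -> D t k = mode_rhs sigma t (fun _ => 2 * M) (A t) k).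
Context (UA : forall lo, 0 < lo -> US (fun x => lo < x < T) (fun x k => Cmod (A x k))).
Context (UD : forall lo, 0 < lo -> US (fun x => lo < x < T) (fun x k => Cmod (D x k))).
Context (Hmass : forall t, 0 < t < T -> hasum (fun k => A t k * Cconj (A t k))%C (RtoC M)).
Context (HalM : bnd (fun k => Cmod (al k) ^ 2) M).
Context (HalX : bnd (fun k => jap k * Cmod (al k) ^ 2) (X ^ 2)).

Let Bb (t : R) (k : Z) : C := (cis (sigma * (Cmod (al k) ^ 2 / (8 * PI)) * ln t) * A t k)%C.
Let rho := rem_at sigma al A.

Context (Hlim : forall e, 0 < e -> exists d, 0 < d /\ forall t, 0 < t < d -> t < T -> bnd (rho t) e).
Context (Hlip : forall lo, 0 < lo -> exists L, forall x y, lo < x < T -> lo < y < T ->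
  bnd (fun k => Cmod (Bb y k - Bb x k)) (L * Rabs (y - x))).

Let tp := p / (2 * PI).
Let r (t : R) : R := X * (1 / 50 + 5 / 4 * (t / tp)).

Lemma tp_pos : 0 < tp.
Proof. pose proof PI_RGT_0. unfold tp. apply Rdiv_lt_0_compat; lra. Qed.

(** [6/5 x] is smaller than [1/50 + 5/4 x] by a margin that does not vanish as [x] tends to [0], so the
    bound improves strictly. *)
Lemma bootstrap_step t : 0 < t < T -> t <= tp -> (forall x, 0 < x <= t -> bnd (rho x) (r x)) ->
  bnd (rho t) (6 / 5 * X * (t / tp)).
Proof.
  intros Ht Htp H. pose proof tp_pos as Hq.
  assert (Hx : forall x, 0 < x <= t -> 0 <= x / tp <= 1).
  { intros x Hx. split; [apply Rmult_le_pos; [lra|left; apply Rinv_0_lt_compat; assumption]|].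
    apply Rmult_le_reg_r with tp; [assumption|]. unfold Rdiv. rewrite Rmult_assoc, Rinv_l; lra. }
  pose proof (ap_step sigma T M m X al A D Hsig Hm HMm (Rlt_le _ _ (proj1 HX)) Hd HD UA UD Hmass HalM HalX
    r (g0_prim p X m) t (X * (127 / 100)) Ht Hlim) as K.
  eapply bnd_le; [intros; apply Rle_refl| |apply K].
  - pose proof (final_budget p X m (t / tp) Hp1 ltac:(lra) Hm HpM (Hx t ltac:(lra))) as F.
    cbv zeta in F. fold tp in F. replace (t / tp * tp) with t in F by (field; lra). exact F.
  - intros x Hx'. specialize (Hx x Hx'). split; [|apply H; assumption]. unfold r. split; [apply Rmult_le_pos; lra|].
    apply Rmult_le_compat_l; lra.
  - intros x Hx'. apply is_derive_g0_prim; lra.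
  - intros x Hx'. specialize (Hx x Hx'). pose proof PI_RGT_0. unfold g0_prim. fold tp.
    destruct (budget p X m Hp1 ltac:(lra) Hm HpM) as (_ & _ & _ & B4 & _).
    pose proof (Ncap_prim_incr X m (x / tp) ltac:(lra) (conj Hm B4) Hx) as HH.
    pose proof (pow2_ge_0 m). pose proof (pow_le m 3 Hm).
    assert (0 < / (8 * PI)) by (apply Rinv_0_lt_compat; lra).
    assert (0 <= m ^ 2 / (8 * PI)) by (apply Rmult_le_pos; lra).
    apply Rmult_le_pos; [left; apply Rinv_0_lt_compat; lra|]. apply Rplus_le_le_0_compat.
    + repeat apply Rmult_le_pos; lra.
    + apply Rmult_le_pos; [lra|]. apply Rmult_le_pos; [lra|]. apply Rmult_le_pos; lra.
  - intros x y Hxy. apply g0_mono; lra.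
Qed.

Lemma rho_shift x y lo L : (forall x y, lo < x < T -> lo < y < T ->
  bnd (fun k => Cmod (Bb y k - Bb x k)) (L * Rabs (y - x))) -> lo < x < T -> lo < y < T ->
  forall b, bnd (rho x) b -> bnd (rho y) (L * Rabs (y - x) + b).
Proof.
  intros HL Hx Hy b Hb. apply (bnd_tri (Bb y) (Bb x) al); [apply HL; assumption|exact Hb].
Qed.

(** Continuous induction.  The margin [1/50] starts it, because the remainder tends to [0] at [t = 0], and
    continues it past any time, because the remainder is Lipschitz in [l^1] away from [0]. *)
Theorem bootstrap t : 0 < t < T -> t <= tp -> bnd (rho t) (6 / 5 * X * (t / tp)).
Proof.
  intros Ht Htp. pose proof tp_pos as Hq.
  set (E := fun s => 0 <= s <= t /\ forall x, 0 < x <= s -> bnd (rho x) (r x)).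
  destruct (completeness E) as (s0 & Hub & Hlub).
  { exists t. intros s (Hs & _); lra. }
  { exists 0. split; [lra|]. intros x Hx; lra. }
  assert (Hs0t : s0 <= t) by (apply Hlub; intros s (Hs & _); lra).
  assert (Hbelow : forall x, 0 < x < s0 -> bnd (rho x) (6 / 5 * X * (x / tp))).
  { intros x Hx. apply bootstrap_step; [lra|lra|].
    destruct (classic (exists s, E s /\ x < s)) as [(s & (Hs & HE) & Hxs)|Hn].
    - intros y Hy; apply HE; lra.
    - exfalso. assert (s0 <= x); [|lra]. apply Hlub. intros s Hs. apply Rnot_lt_le; intros Hl.
      apply Hn; exists s; auto. }
  assert (Hpos : 0 < s0).
  { destruct (Hlim (X * (1 / 50)) ltac:(lra)) as (d & Hd0 & Hdl).
    assert (Hm0 : 0 < Rmin (d / 2) t) by (apply Rmin_glb_lt; lra).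
    pose proof (Rmin_l (d / 2) t). pose proof (Rmin_r (d / 2) t).
    assert (Rmin (d / 2) t <= s0); [|lra]. apply Hub. split; [lra|]. intros x Hx.
    eapply bnd_le; [intros; apply Rle_refl| |apply (Hdl x); lra]. unfold r.
    apply Rmult_le_compat_l; [lra|].
    assert (0 <= x / tp) by (apply Rmult_le_pos; [lra|left; apply Rinv_0_lt_compat; assumption]). lra. }
  assert (Hat : bnd (rho s0) (6 / 5 * X * (s0 / tp))).
  { destruct (Hlip (s0 / 2) ltac:(lra)) as (L & HL).
    intros l Hl. apply le_epsilon; intros e He.
    set (L' := Rabs L + 1). assert (HL' : 0 < L') by (unfold L'; pose proof (Rabs_pos L); lra).
    set (dd := Rmin (s0 / 4) (e / L')). assert (Hdd : 0 < dd).
    { apply Rmin_glb_lt; [lra|apply Rdiv_lt_0_compat; lra]. }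
    assert (Hdd1 : dd <= s0 / 4) by apply Rmin_l. assert (Hdd2 : dd <= e / L') by apply Rmin_r.
    pose proof (rho_shift (s0 - dd) s0 (s0 / 2) L HL ltac:(lra) ltac:(lra) _ (Hbelow (s0 - dd) ltac:(lra))) as K.
    eapply Rle_trans; [apply (K l Hl)|].
    replace (s0 - (s0 - dd)) with dd by ring. rewrite (Rabs_pos_eq dd) by lra.
    assert (L * dd <= e).
    { apply Rle_trans with (L' * dd).
      - apply Rmult_le_compat_r; [lra|]. unfold L'. pose proof (Rle_abs L). lra.
      - apply Rle_trans with (L' * (e / L')); [apply Rmult_le_compat_l; lra|right; field; lra]. }
    assert (6 / 5 * X * ((s0 - dd) / tp) <= 6 / 5 * X * (s0 / tp)).
    { apply Rmult_le_compat_l; [lra|]. unfold Rdiv. apply Rmult_le_compat_r; [left; apply Rinv_0_lt_compat; assumption|lra]. }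
    lra. }
  destruct (Req_dec s0 t) as [<-|Hne]; [exact Hat|]. exfalso.
  destruct (Hlip (s0 / 2) ltac:(lra)) as (L & HL).
  set (L' := Rabs L + 1). assert (HL' : 0 < L') by (unfold L'; pose proof (Rabs_pos L); lra).
  set (dd := Rmin (t - s0) (X * (1 / 50) / L')). assert (Hdd : 0 < dd).
  { apply Rmin_glb_lt; [lra|apply Rdiv_lt_0_compat; lra]. }
  assert (Hdd1 : dd <= t - s0) by apply Rmin_l. assert (Hdd2 : dd <= X * (1 / 50) / L') by apply Rmin_r.
  assert (s0 + dd <= s0); [|lra]. apply Hub. split; [lra|]. intros x Hx.
  assert (Hdiv : forall y z, y <= z -> y / tp <= z / tp).
  { intros y z Hyz. unfold Rdiv. apply Rmult_le_compat_r; [left; apply Rinv_0_lt_compat; assumption|lra]. }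
  assert (Hx0 : 0 <= x / tp) by (apply Rmult_le_pos; [lra|left; apply Rinv_0_lt_compat; assumption]).
  destruct (Rlt_le_dec x s0) as [Hl|Hl].
  - eapply bnd_le; [intros; apply Rle_refl| |apply (Hbelow x); lra]. unfold r. nra.
  - pose proof (rho_shift s0 x (s0 / 2) L HL ltac:(lra) ltac:(lra) _ Hat) as K.
    eapply bnd_le; [intros; apply Rle_refl| |exact K].
    rewrite (Rabs_pos_eq (x - s0)) by lra.
    assert (L * (x - s0) <= X * (1 / 50)).
    { apply Rle_trans with (L' * dd).
      - apply Rle_trans with (L' * (x - s0)); [apply Rmult_le_compat_r; [lra|]|apply Rmult_le_compat_l; lra].
        unfold L'. pose proof (Rle_abs L). lra.
      - apply Rle_trans with (L' * (X * (1 / 50) / L')); [apply Rmult_le_compat_l; lra|right; field; lra]. }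
    pose proof (Hdiv s0 x Hl). unfold r. nra.
Qed.
End Bootstrap.

(** * Test functions *)

(** The functions [x^(-n) e^{-1/x}], extended by [0] to the left, are closed under derivation up to linear
    combinations; this gives smoothness without an induction on explicit derivatives. *)
Definition flat (n : nat) (x : R) : R :=
  if Rle_dec x 0 then 0 else (/ x) ^ n * exp (- / x).

Lemma flat_neg n x : x <= 0 -> flat n x = 0.
Proof. intros H; unfold flat; destruct (Rle_dec x 0); [reflexivity|lra]. Qed.
Lemma flat_pos n x : 0 < x -> flat n x = (/ x) ^ n * exp (- / x).
Proof. intros H; unfold flat; destruct (Rle_dec x 0); [lra|reflexivity]. Qed.

Lemma pow_le_exp m z : 0 <= z -> z ^ S m <= INR (S m) ^ S m * exp z.
Proof.
  intros Hz. assert (Hm : 0 < INR (S m)) by (apply lt_0_INR; lia).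
  replace z with (INR (S m) * (z / INR (S m))) at 1 by (field; lra).
  rewrite Rpow_mult_distr. apply Rmult_le_compat_l; [apply pow_le; lra|].
  replace (exp z) with (exp (z / INR (S m)) ^ S m).
  - apply pow_incr. assert (0 <= z / INR (S m)) by (apply Rmult_le_pos; [assumption|left; apply Rinv_0_lt_compat; assumption]).
    split; [assumption|]. pose proof (exp_ineq1_le (z / INR (S m))). lra.
  - rewrite <- Rpower_pow by apply exp_pos. unfold Rpower. rewrite ln_exp. f_equal. field. lra.
Qed.

Lemma flat_small n y : 0 < y -> flat n y <= INR (S (S n)) ^ S (S n) * y ^ 2.
Proof.
  intros Hy. rewrite flat_pos by assumption.
  pose proof (pow_le_exp (S n) (/ y) (Rlt_le _ _ (Rinv_0_lt_compat _ Hy))) as H.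
  assert (He : exp (/ y) * exp (- / y) = 1) by (rewrite <- exp_plus, Rplus_opp_r; apply exp_0).
  pose proof (exp_pos (- / y)) as Hp. set (c := INR (S (S n)) ^ S (S n)) in *.
  apply Rmult_le_compat_r with (r := exp (- / y) * y ^ 2) in H; [|apply Rmult_le_pos; [lra|apply pow2_ge_0]].
  replace (c * exp (/ y) * (exp (- / y) * y ^ 2)) with (c * y ^ 2 * (exp (/ y) * exp (- / y))) in H by ring.
  rewrite He, Rmult_1_r in H. eapply Rle_trans; [|exact H]. right. simpl. field. lra.
Qed.

Lemma is_derive_flat n x : is_derive (flat n) x (flat (S (S n)) x - INR n * flat (S n) x).
Proof.
  destruct (Rtotal_order x 0) as [Hx|[->|Hx]].
  - rewrite !flat_neg by lra. replace (0 - INR n * 0) with 0 by ring.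
    apply (is_derive_ext_loc (fun _ => 0)); [|apply @is_derive_const].
    exists (mkposreal (- x) ltac:(lra)). intros y Hy. change (Rabs (y - x) < - x) in Hy.
    apply Rabs_lt_between' in Hy. symmetry; apply flat_neg. lra.
  - rewrite !flat_neg by lra. replace (0 - INR n * 0) with 0 by ring.
    apply is_derive_eps; intros e He. set (c := INR (S (S n)) ^ S (S n)).
    assert (Hc : 0 < c) by (apply pow_lt, lt_0_INR; lia).
    exists (e / c); split; [apply Rdiv_lt_0_compat; assumption|]. intros y Hy.
    rewrite Rminus_0_r in *.
    replace (norm _) with (Rabs (flat n y)).
    2:{ unfold norm; simpl. unfold abs; simpl. f_equal.
        unfold minus, plus, opp, scal, mult; simpl. unfold mult; simpl.
        rewrite (flat_neg n 0) by lra. ring. }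
    destruct (Rle_lt_dec y 0) as [L|L].
    + rewrite flat_neg, Rabs_R0 by assumption. apply Rmult_le_pos; [lra|apply Rabs_pos].
    + rewrite (Rabs_pos_eq y) in * by lra. rewrite Rabs_pos_eq.
      2:{ rewrite flat_pos by assumption. apply Rmult_le_pos; [|left; apply exp_pos].
          apply pow_le; left; apply Rinv_0_lt_compat; assumption. }
      eapply Rle_trans; [apply flat_small; assumption|]. fold c.
      assert (c * y <= e).
      { apply Rle_trans with (c * (e / c)); [apply Rmult_le_compat_l; lra|right; field; lra]. }
      nra.
  - rewrite !flat_pos by assumption.
    apply (is_derive_ext_loc (fun y => (/ y) ^ n * exp (- / y))).
    { exists (mkposreal x Hx). intros y Hy. change (Rabs (y - x) < x) in Hy.
      apply Rabs_lt_between' in Hy. symmetry; apply flat_pos. lra. }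
    auto_derive; [repeat split; lra|]. destruct n as [|n].
    + simpl. field. lra.
    + rewrite S_INR. simpl. field. lra.
Qed.

Inductive bump_span (a b : R) : (R -> R) -> Prop :=
| bs_base m n : bump_span a b (fun x => flat m (x - a) * flat n (b - x))
| bs_plus f g : bump_span a b f -> bump_span a b g -> bump_span a b (fun x => f x + g x)
| bs_scal c f : bump_span a b f -> bump_span a b (fun x => c * f x).

Lemma bump_span_derive a b f : bump_span a b f ->
  exists f', bump_span a b f' /\ forall x, is_derive f x (f' x).
Proof.
  induction 1 as [m n|f g _ (f' & Hf & Df) _ (g' & Hg & Dg)|c f _ (f' & Hf & Df)].
  - exists (fun x => (flat (S (S m)) (x - a) * flat n (b - x) + - INR m * (flat (S m) (x - a) * flat n (b - x)))
      + (-1 * (flat m (x - a) * flat (S (S n)) (b - x)) + INR n * (flat m (x - a) * flat (S n) (b - x)))).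
    split; [repeat constructor|]. intros x.
    assert (H1 : is_derive (fun y => flat m (y - a)) x (flat (S (S m)) (x - a) - INR m * flat (S m) (x - a))).
    { pose proof (is_derive_comp (flat m) (fun y => y - a) x _ 1 (is_derive_flat m (x - a))) as K.
      replace (flat (S (S m)) (x - a) - INR m * flat (S m) (x - a)) with
        (scal 1 (flat (S (S m)) (x - a) - INR m * flat (S m) (x - a))) by (unfold scal; simpl; unfold mult; simpl; ring).
      apply K. auto_derive; [auto|ring]. }
    assert (H2 : is_derive (fun y => flat n (b - y)) x (- (flat (S (S n)) (b - x) - INR n * flat (S n) (b - x)))).
    { pose proof (is_derive_comp (flat n) (fun y => b - y) x _ (-1) (is_derive_flat n (b - x))) as K.
      replace (- (flat (S (S n)) (b - x) - INR n * flat (S n) (b - x))) with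
        (scal (-1) (flat (S (S n)) (b - x) - INR n * flat (S n) (b - x))) by (unfold scal; simpl; unfold mult; simpl; ring).
      apply K. auto_derive; [auto|ring]. }
    pose proof (is_derive_mult_R _ _ _ _ _ H1 H2) as K.
    match type of K with is_derive _ _ ?u => match goal with |- is_derive _ _ ?v =>
      replace v with u; [exact K|ring] end end.
  - exists (fun x => f' x + g' x); split; [constructor; assumption|].
    intros x. apply @is_derive_plus; auto.
  - exists (fun x => c * f' x); split; [constructor; assumption|].
    intros x. apply is_derive_scal; auto.
Qed.

Lemma bump_span_Derive_n a b n f : bump_span a b f -> bump_span a b (Derive_n f n).
Proof.
  intros H. induction n as [|n IH]; [exact H|].
  destruct (bump_span_derive a b _ IH) as (f' & Hf' & Hd). simpl.
  replace (Derive (Derive_n f n)) with f'; [assumption|].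
  apply functional_extensionality; intros x. symmetry. apply is_derive_unique, Hd.
Qed.

Definition bump (a b x : R) : R := flat 0 (x - a) * flat 0 (b - x).

Lemma bump_test a b a' b' : a' <= a -> b <= b' -> test_function a' b' (bump a b).
Proof.
  intros Ha Hb. assert (Hs : bump_span a b (bump a b)) by apply bs_base. split.
  - intros [|n] x; [exact I|]. simpl.
    destruct (bump_span_derive a b _ (bump_span_Derive_n a b n _ Hs)) as (f' & _ & Hd).
    exists (f' x). apply Hd.
  - intros x Hx. unfold bump. destruct (Rle_lt_dec (x - a) 0) as [L|L].
    + rewrite flat_neg by assumption; ring.
    + rewrite (flat_neg 0 (b - x)); [ring|]. apply Rnot_lt_le; intros L'. apply Hx; lra.
Qed.

Lemma bump_pos a b x : a < x < b -> 0 < bump a b x.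
Proof.
  intros H. unfold bump. rewrite !flat_pos by lra. simpl.
  apply Rmult_lt_0_compat; apply Rmult_lt_0_compat; try lra; apply exp_pos.
Qed.

Lemma test_continuous a b phi n x : test_function a b phi -> continuous (Derive_n phi n) x.
Proof. intros [H _]. apply @ex_derive_continuous. apply (H (S n)). Qed.

Lemma continuous_Rmult (f g : R -> R) x : continuous f x -> continuous g x -> continuous (fun y => f y * g y) x.
Proof. intros H1 H2. apply (continuous_mult f g x); assumption. Qed.

(** A point where [w] is positive has a neighbourhood where it is positive; a bump supported there
    has a positive pairing. *)
Lemma fundamental_lemma (w : R -> R) : (forall x, continuous w x) ->
  (forall a b phi, a < b -> test_function a b phi -> RInt (fun x => w x * phi x) a b = 0) ->
  forall x, w x = 0.
Proof.
  assert (Hpos : forall w : R -> R, (forall x, continuous w x) ->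
    (forall a b phi, a < b -> test_function a b phi -> RInt (fun x => w x * phi x) a b = 0) ->
    forall x, w x <= 0).
  { clear w. intros w Hc H x0. apply Rnot_lt_le; intros Hw.
    assert (Hl : locally x0 (fun y => 0 < w y)).
    { apply (Hc x0). exists (mkposreal _ Hw). intros y Hy. change (Rabs (y - w x0) < w x0) in Hy.
      apply Rabs_lt_between' in Hy. lra. }
    destruct Hl as [[d Hd] Hl]. simpl in Hl.
    set (a := x0 - d / 2). set (b := x0 + d / 2). assert (Hab : a < b) by (unfold a, b; lra).
    specialize (H a b (bump a b) Hab (bump_test a b a b ltac:(lra) ltac:(lra))).
    assert (0 < RInt (fun x => w x * bump a b x) a b); [|lra].
    apply RInt_gt_0; [assumption| |].
    - intros y Hy. apply Rmult_lt_0_compat; [|apply bump_pos; assumption].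
      apply Hl. change (Rabs (y - x0) < d). apply Rabs_lt_between'. unfold a, b in Hy. lra.
    - intros y _. apply continuous_Rmult; [apply Hc|].
      apply (test_continuous a b (bump a b) 0 y), bump_test; lra. }
  intros Hc H x. apply Rle_antisym; [apply Hpos; assumption|].
  enough (- w x <= 0) by lra. apply (Hpos (fun y => - w y)).
  - intros y. apply (continuous_opp w), Hc.
  - intros a b phi Hab Hphi.
    rewrite (RInt_ext _ (fun y => opp (w y * phi y))) by (intros; unfold opp; simpl; ring).
    rewrite (@RInt_opp R_CompleteNormedModule (fun y => w y * phi y)).
    + rewrite (H a b phi Hab Hphi). unfold opp; simpl; ring.
    + apply @ex_RInt_continuous. intros y _. apply continuous_Rmult; [apply Hc|].
      apply (test_continuous a b phi 0 y Hphi).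
Qed.

(** * Pairings *)

Definition contC (f : R -> C) : Prop := forall x, continuous (fun y => fst (f y)) x /\ continuous (fun y => snd (f y)) x.

Lemma pairing_pair a b (f : R -> C) phi : contC f -> (forall x, continuous phi x) ->
  @is_RInt C_R_CompleteNormedModule (fun x => (f x * RtoC (phi x))%C) a b
    (RInt (fun x => fst (f x) * phi x) a b, RInt (fun x => snd (f x) * phi x) a b) /\
  pairing a b f phi = (RInt (fun x => fst (f x) * phi x) a b, RInt (fun x => snd (f x) * phi x) a b).
Proof.
  intros Hf Hphi.
  assert (K : @is_RInt C_R_CompleteNormedModule (fun x => (f x * RtoC (phi x))%C) a b
    (RInt (fun x => fst (f x) * phi x) a b, RInt (fun x => snd (f x) * phi x) a b)).
  { apply (is_RInt_fct_extend_pair (U := R_NormedModule) (V := R_NormedModule)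
      (fun x => (f x * RtoC (phi x))%C)); simpl.
    - apply (is_RInt_ext (fun x => fst (f x) * phi x)); [intros; simpl; ring|].
      apply (@RInt_correct R_CompleteNormedModule), @ex_RInt_continuous. intros y _.
      apply continuous_Rmult; [apply Hf|apply Hphi].
    - apply (is_RInt_ext (fun x => snd (f x) * phi x)); [intros; simpl; ring|].
      apply (@RInt_correct R_CompleteNormedModule), @ex_RInt_continuous. intros y _.
      apply continuous_Rmult; [apply Hf|apply Hphi]. }
  split; [exact K|]. unfold pairing. apply (@is_RInt_unique C_R_CompleteNormedModule). exact K.
Qed.

(** * The free evolution against a test function *)

(** [wave (PI/4)] and [wave (3 PI/4)] are the real and imaginary parts of the fundamental solution;
    [wave_t] is the time derivative, which is minus the second derivative in [x] of [wave (c + PI/2)]. *)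
Definition wave (c : R) (k : Z) (t x : R) : R :=
  / sqrt (4 * PI * t) * cos ((x - IZR k) ^ 2 / (4 * t) - c).

Definition wave_t (c : R) (k : Z) (t x : R) : R :=
  / sqrt (4 * PI * t) * (- cos ((x - IZR k) ^ 2 / (4 * t) - c) / (2 * t)
    + sin ((x - IZR k) ^ 2 / (4 * t) - c) * (x - IZR k) ^ 2 / (4 * t ^ 2)).

Lemma free_delta_wave k t x : 0 < t ->
  free_delta k t x = (wave (PI / 4) k t x, wave (3 * (PI / 4)) k t x).
Proof.
  intros Ht. rewrite free_delta_cis by assumption. unfold wave, cis, Cmult, RtoC; simpl.
  replace (3 * (PI / 4)) with (PI / 4 + PI / 2) by field.
  set (y := _ / (4 * t)). replace (y - (PI / 4 + PI / 2)) with (- (PI / 2 - (y - PI / 4))) by ring.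
  rewrite cos_neg, cos_shift. f_equal; ring.
Qed.

Lemma is_derive_wave_t c k t x : 0 < t -> is_derive (fun u => wave c k u x) t (wave_t c k t x).
Proof.
  intros Ht. pose proof PI_RGT_0. pose proof (four_pi_pos t Ht) as H4.
  assert (Hs : 0 < sqrt (4 * PI * t)) by (apply sqrt_lt_R0; assumption).
  unfold wave, wave_t. auto_derive.
  - repeat split; lra.
  - assert (E : / (sqrt (4 * PI * t) * sqrt (4 * PI * t)) = / (4 * PI * t)) by (rewrite sqrt_sqrt by lra; reflexivity).
    set (C := cos _). set (S := sin _). set (q := sqrt _) in *.
    rewrite E. field. lra.
Qed.

Lemma continuous_wave c k t x : continuous (wave c k t) x.
Proof.
  apply @ex_derive_continuous. unfold wave. auto_derive. auto.
Qed.

Lemma continuity_2d_wave_t c k t x : 0 < t -> continuity_2d_pt (wave_t c k) t x.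
Proof.
  intros Ht. pose proof PI_RGT_0. pose proof (four_pi_pos t Ht) as H4.
  assert (Hs : 0 < sqrt (4 * PI * t)) by (apply sqrt_lt_R0; assumption).
  assert (C0 : forall r, continuity_2d_pt (fun _ _ => r) t x) by (intros; apply continuity_2d_pt_const).
  assert (Cu : continuity_2d_pt (fun u _ => u) t x) by apply continuity_2d_pt_id1.
  assert (Cx : continuity_2d_pt (fun _ v => v - IZR k) t x)
    by (apply continuity_2d_pt_minus; [apply continuity_2d_pt_id2|apply C0]).
  assert (Cx2 : continuity_2d_pt (fun _ v => (v - IZR k) ^ 2) t x).
  { apply (continuity_2d_pt_ext (fun _ v => (v - IZR k) * (v - IZR k))); [intros; ring|].
    apply continuity_2d_pt_mult; assumption. }
  assert (Cp : continuity_2d_pt (fun u v => (v - IZR k) ^ 2 / (4 * u) - c) t x).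
  { apply continuity_2d_pt_minus; [|apply C0]. apply continuity_2d_pt_mult; [assumption|].
    apply continuity_2d_pt_inv; [|lra]. apply continuity_2d_pt_mult; [apply C0|assumption]. }
  unfold wave_t. apply continuity_2d_pt_mult.
  - apply continuity_2d_pt_inv; [|lra].
    apply (continuity_1d_2d_pt_comp sqrt (fun u _ => 4 * PI * u)).
    + apply continuity_pt_sqrt. lra.
    + apply continuity_2d_pt_mult; [apply C0|assumption].
  - apply continuity_2d_pt_plus.
    + apply continuity_2d_pt_mult.
      * apply continuity_2d_pt_opp.
        apply (continuity_1d_2d_pt_comp cos (fun u v => (v - IZR k) ^ 2 / (4 * u) - c)); [|assumption].
        apply continuity_cos.
      * apply continuity_2d_pt_inv; [|lra]. apply continuity_2d_pt_mult; [apply C0|assumption].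
    + apply continuity_2d_pt_mult.
      * apply continuity_2d_pt_mult; [|assumption].
        apply (continuity_1d_2d_pt_comp sin (fun u v => (v - IZR k) ^ 2 / (4 * u) - c)); [|assumption].
        apply continuity_sin.
      * apply continuity_2d_pt_inv; [|nra]. apply continuity_2d_pt_mult; [apply C0|].
        apply (continuity_2d_pt_ext (fun u _ => u * u)); [intros; ring|].
        apply continuity_2d_pt_mult; assumption.
Qed.

Lemma test_boundary a b phi : a < b -> test_function a b phi ->
  phi a = 0 /\ phi b = 0 /\ Derive phi a = 0 /\ Derive phi b = 0.
Proof.
  intros Hab [Hs Hz]. assert (Ha : phi a = 0) by (apply Hz; lra). assert (Hb : phi b = 0) by (apply Hz; lra).
  repeat split; try assumption.
  - assert (Hd : is_derive phi a (Derive phi a)) by (apply Derive_correct, (Hs 1%nat a)).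
    rewrite is_derive_eps in Hd. apply Rabs_eq_0. apply Rle_antisym; [|apply Rabs_pos].
    apply le_epsilon; intros e He. destruct (Hd e He) as (d & Hd0 & H).
    specialize (H (a - d / 2)). rewrite (Hz (a - d / 2)), Ha in H by lra.
    replace (a - d / 2 - a) with (- (d / 2)) in H by ring. rewrite Rabs_Ropp, Rabs_pos_eq in H by lra.
    specialize (H ltac:(lra)).
    assert (H' : Rabs (d / 2 * Derive phi a) <= e * (d / 2)).
    { refine (Rle_trans _ _ _ (Req_le _ _ _) H). unfold norm; simpl. unfold abs; simpl. f_equal.
      unfold minus, plus, opp, scal, mult; simpl. unfold mult; simpl. ring. }
    rewrite Rabs_mult, (Rabs_pos_eq (d / 2)) in H' by lra. nra.
  - assert (Hd : is_derive phi b (Derive phi b)) by (apply Derive_correct, (Hs 1%nat b)).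
    rewrite is_derive_eps in Hd. apply Rabs_eq_0. apply Rle_antisym; [|apply Rabs_pos].
    apply le_epsilon; intros e He. destruct (Hd e He) as (d & Hd0 & H).
    specialize (H (b + d / 2)). rewrite (Hz (b + d / 2)), Hb in H by lra.
    replace (b + d / 2 - b) with (d / 2) in H by ring. rewrite Rabs_pos_eq in H by lra.
    specialize (H ltac:(lra)).
    assert (H' : Rabs (d / 2 * Derive phi b) <= e * (d / 2)).
    { refine (Rle_trans _ _ _ (Req_le _ _ _) H). unfold norm; simpl. unfold abs; simpl.
      rewrite <- Rabs_Ropp. f_equal.
      unfold minus, plus, opp, scal, mult; simpl. unfold mult; simpl. ring. }
    rewrite Rabs_mult, (Rabs_pos_eq (d / 2)) in H' by lra. nra.
Qed.

(** The free equation [i e_t + e_xx = 0] in real form, integrated by parts twice. *)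
Lemma wave_by_parts c k t a b phi : 0 < t -> a < b -> test_function a b phi ->
  RInt (fun x => wave_t c k t x * phi x) a b =
  - RInt (fun x => wave (c + PI / 2) k t x * Derive_n phi 2 x) a b.
Proof.
  intros Ht Hab Hphi. destruct (test_boundary a b phi Hab Hphi) as (B1 & B2 & B3 & B4).
  set (s := / sqrt (4 * PI * t)). set (y := fun x => (x - IZR k) ^ 2 / (4 * t) - c).
  set (F := fun x => s * sin (y x) * Derive phi x - s * cos (y x) * ((x - IZR k) / (2 * t)) * phi x).
  set (dF := fun x => wave_t c k t x * phi x + wave (c + PI / 2) k t x * Derive_n phi 2 x).
  assert (Ew : forall x, wave (c + PI / 2) k t x = s * sin (y x)).
  { intros x. unfold wave, y. replace (_ - (c + PI / 2)) with (- (PI / 2 - ((x - IZR k) ^ 2 / (4 * t) - c))) by ring.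
    rewrite cos_neg, cos_shift. reflexivity. }
  assert (Hc0 : forall n x, continuous (Derive_n phi n) x) by (intros; apply (test_continuous a b); assumption).
  assert (Cw : forall x, continuous (fun x => wave_t c k t x * phi x) x).
  { intros x. apply continuous_Rmult; [|apply (Hc0 0%nat)]. apply @ex_derive_continuous.
    unfold wave_t. auto_derive. auto. }
  assert (Cw2 : forall x, continuous (fun x => wave (c + PI / 2) k t x * Derive_n phi 2 x) x).
  { intros x. apply continuous_Rmult; [apply continuous_wave|apply (Hc0 2%nat)]. }
  assert (HI : is_RInt dF a b (minus (F b) (F a))).
  { apply (is_RInt_derive F dF).
    - intros x _. unfold F, dF. rewrite Ew.
      assert (D1 : is_derive phi x (Derive phi x)) by (apply Derive_correct, (proj1 Hphi 1%nat x)).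
      assert (D2 : is_derive (Derive phi) x (Derive_n phi 2 x)) by (apply Derive_correct, (proj1 Hphi 2%nat x)).
      assert (D3 : is_derive (fun x => s * sin (y x)) x (s * cos (y x) * ((x - IZR k) / (2 * t)))).
      { unfold y. auto_derive; [auto|]. set (C := cos _). field. lra. }
      assert (D4 : is_derive (fun x => s * cos (y x) * ((x - IZR k) / (2 * t))) x
        (- wave_t c k t x)).
      { unfold y, wave_t. fold s. auto_derive; [auto|].
        set (C := cos _). set (S := sin _). field. lra. }
      pose proof (is_derive_minus _ _ _ _ _ (is_derive_mult_R _ _ _ _ _ D3 D2) (is_derive_mult_R _ _ _ _ _ D4 D1)) as K.
      match type of K with is_derive _ _ ?u => match goal with |- is_derive _ _ ?v =>
        replace v with u; [exact K|] end end. unfold minus, plus, opp; simpl. ring.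
    - intros x _. apply (continuous_plus (fun x => wave_t c k t x * phi x)); [apply Cw|apply Cw2]. }
  assert (E0 : minus (F b) (F a) = 0).
  { unfold F. rewrite B1, B2, B3, B4. unfold minus, plus, opp; simpl. ring. }
  rewrite E0 in HI. apply (@is_RInt_unique R_CompleteNormedModule dF a b 0) in HI. unfold dF in HI.
  rewrite (@RInt_plus R_CompleteNormedModule (fun x => wave_t c k t x * phi x)) in HI.
  - change (RInt (fun x => wave_t c k t x * phi x) a b + RInt (fun x => wave (c + PI / 2) k t x * Derive_n phi 2 x) a b = 0) in HI. lra.
  - apply @ex_RInt_continuous; intros; apply Cw.
  - apply @ex_RInt_continuous; intros; apply Cw2.
Qed.

Lemma is_derive_wave_int c k t a b phi : 0 < t -> a < b -> test_function a b phi ->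
  is_derive (fun u => RInt (fun x => wave c k u x * phi x) a b) t
    (- RInt (fun x => wave (c + PI / 2) k t x * Derive_n phi 2 x) a b).
Proof.
  intros Ht Hab Hphi. rewrite <- (wave_by_parts c k t a b phi Ht Hab Hphi).
  assert (Hc0 : forall x, continuous phi x) by (intros; apply (test_continuous a b phi 0); assumption).
  assert (HD : forall u x, 0 < u -> is_derive (fun z => wave c k z x * phi x) u (wave_t c k u x * phi x)).
  { intros u x Hu. pose proof (is_derive_mult_R _ _ _ _ _ (is_derive_wave_t c k u x Hu) (is_derive_const (phi x) u)) as K.
    match type of K with is_derive _ _ ?u1 => match goal with |- is_derive _ _ ?v =>
        replace v with u1; [exact K|] end end. unfold zero; simpl; ring. }
  assert (Hloc : locally t (fun u : R => 0 < u)).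
  { exists (mkposreal t Ht). intros u Hu. change (Rabs (u - t) < t) in Hu.
    apply Rabs_lt_between' in Hu. lra. }
  pose proof (is_derive_RInt_param (fun u x => wave c k u x * phi x) a b t) as K.
  assert (E : RInt (fun x => Derive (fun u => wave c k u x * phi x) t) a b =
     RInt (fun x => wave_t c k t x * phi x) a b).
  { apply RInt_ext. intros x _. apply is_derive_unique, HD, Ht. }
  rewrite <- E. apply K.
  - apply filter_imp with (2 := Hloc). intros u Hu x _. eexists. apply HD, Hu.
  - intros x _.
    apply continuity_2d_pt_ext_loc with (fun u v => wave_t c k u v * phi v).
    + exists (mkposreal t Ht). intros u v Hu _. symmetry. apply is_derive_unique, HD.
      simpl in Hu. apply Rabs_lt_between' in Hu. lra.
    + apply continuity_2d_pt_mult; [apply continuity_2d_wave_t, Ht|].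
      apply (continuity_1d_2d_pt_comp phi (fun _ v => v)); [|apply continuity_2d_pt_id2].
      apply continuity_pt_filterlim, Hc0.
  - apply filter_imp with (2 := Hloc). intros u Hu. apply @ex_RInt_continuous. intros x _.
    apply continuous_Rmult; [apply continuous_wave|apply Hc0].
Qed.

Lemma contC_free_delta k t : 0 < t -> contC (free_delta k t).
Proof.
  intros Ht x. split.
  - apply (continuous_ext (wave (PI / 4) k t)); [intros; rewrite free_delta_wave by assumption; reflexivity|].
    apply continuous_wave.
  - apply (continuous_ext (wave (3 * (PI / 4)) k t)); [intros; rewrite free_delta_wave by assumption; reflexivity|].
    apply continuous_wave.
Qed.

Lemma pairing_free k t a b phi : 0 < t -> (forall x, continuous phi x) ->
  pairing a b (free_delta k t) phi =
   (RInt (fun x => wave (PI / 4) k t x * phi x) a b, RInt (fun x => wave (3 * (PI / 4)) k t x * phi x) a b).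
Proof.
  intros Ht Hphi. rewrite (proj2 (pairing_pair a b _ phi (contC_free_delta k t Ht) Hphi)).
  f_equal; apply RInt_ext; intros x _; rewrite free_delta_wave by assumption; reflexivity.
Qed.

Lemma dC_pairing_free k t a b phi : 0 < t -> a < b -> test_function a b phi ->
  dC (fun u => pairing a b (free_delta k u) phi) t (Ci * pairing a b (free_delta k t) (Derive_n phi 2))%C.
Proof.
  intros Ht Hab Hphi.
  assert (Hc0 : forall x, continuous phi x) by (intros; apply (test_continuous a b phi 0); assumption).
  apply (dC_ext_loc (fun u => (RInt (fun x => wave (PI / 4) k u x * phi x) a b,
     RInt (fun x => wave (3 * (PI / 4)) k u x * phi x) a b)) _ t _ 0 (t + 1)); [lra| |].
  { intros u Hu. symmetry; apply pairing_free; [lra|assumption]. }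
  rewrite (pairing_free k t a b (Derive_n phi 2) Ht) by (intros; apply (test_continuous a b phi 2); assumption).
  apply dC_comp. unfold Ci, Cmult; cbn [fst snd]. split.
  - pose proof (is_derive_wave_int (PI / 4) k t a b phi Ht Hab Hphi) as K.
    match type of K with is_derive _ _ ?u1 => match goal with |- is_derive _ _ ?v =>
        replace v with u1; [exact K|] end end.
    replace (PI / 4 + PI / 2) with (3 * (PI / 4)) by field. ring.
  - pose proof (is_derive_wave_int (3 * (PI / 4)) k t a b phi Ht Hab Hphi) as K.
    match type of K with is_derive _ _ ?u1 => match goal with |- is_derive _ _ ?v =>
        replace v with u1; [exact K|] end end.
    rewrite Rmult_0_l, Rplus_0_l, Rmult_1_l.
    rewrite <- (@RInt_opp R_CompleteNormedModule).
    + apply RInt_ext. intros x _. unfold opp; simpl. unfold wave.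
      replace (3 * (PI / 4) + PI / 2) with (PI / 4 + PI) by field.
      set (z := (x - IZR k) ^ 2 / (4 * t)).
      replace (z - (PI / 4 + PI)) with (z - PI / 4 - PI) by ring.
      rewrite (cos_minus _ PI), cos_PI, sin_PI. ring.
    + apply @ex_RInt_continuous. intros x _. apply continuous_Rmult; [apply continuous_wave|].
      apply (test_continuous a b phi 2); assumption.
Qed.

Lemma test_bounded a b phi n : a < b -> test_function a b phi ->
  exists S, 0 <= S /\ forall x, Rabs (Derive_n phi n x) <= S.
Proof.
  intros Hab Hphi.
  assert (Hc : forall x, continuous (fun x => Rabs (Derive_n phi n x)) x).
  { intros x. apply (continuous_comp (Derive_n phi n) Rabs); [apply (test_continuous a b); assumption|].
    apply continuous_Rabs. }
  destruct (continuity_ab_maj (fun x => Rabs (Derive_n phi n x)) (a - 1) (b + 1)) as (M & HM & _); [lra| |].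
  { intros x _. apply continuity_pt_filterlim, Hc. }
  exists (Rabs (Derive_n phi n M)); split; [apply Rabs_pos|]. intros x.
  destruct (Rlt_le_dec x (a - 1)) as [L|L]; [|destruct (Rlt_le_dec (b + 1) x) as [L'|L']; [|apply HM; lra]].
  - replace (Derive_n phi n x) with 0; [rewrite Rabs_R0; apply Rabs_pos|].
    symmetry. transitivity (Derive_n (fun _ => 0) n x).
    + apply Derive_n_ext_loc. exists (mkposreal 1 Rlt_0_1). intros y Hy.
      change (Rabs (y - x) < 1) in Hy. apply Rabs_lt_between' in Hy. apply (proj2 Hphi). lra.
    + destruct n; [reflexivity|apply Derive_n_const].
  - replace (Derive_n phi n x) with 0; [rewrite Rabs_R0; apply Rabs_pos|].
    symmetry. transitivity (Derive_n (fun _ => 0) n x).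
    + apply Derive_n_ext_loc. exists (mkposreal 1 Rlt_0_1). intros y Hy.
      change (Rabs (y - x) < 1) in Hy. apply Rabs_lt_between' in Hy. apply (proj2 Hphi). lra.
    + destruct n; [reflexivity|apply Derive_n_const].
Qed.

Lemma pairing_free_bound k t a b phi S : 0 < t -> a < b -> (forall x, continuous phi x) ->
  0 <= S -> (forall x, Rabs (phi x) <= S) ->
  Cmod (pairing a b (free_delta k t) phi) <= 2 * ((b - a) * (/ sqrt (4 * PI * t) * S)).
Proof.
  intros Ht Hab Hphi HS Hb. rewrite pairing_free by assumption.
  assert (Hs : 0 < / sqrt (4 * PI * t)) by (apply Rinv_0_lt_compat, sqrt_lt_R0, four_pi_pos, Ht).
  assert (HB : forall c, Rabs (RInt (fun x => wave c k t x * phi x) a b) <= (b - a) * (/ sqrt (4 * PI * t) * S)).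
  { intros c. apply abs_RInt_le_const; [lra| |].
    - apply @ex_RInt_continuous. intros x _. apply continuous_Rmult; [apply continuous_wave|apply Hphi].
    - intros x _. rewrite Rabs_mult. unfold wave. rewrite Rabs_mult, (Rabs_pos_eq (/ _)) by lra.
      rewrite Rmult_assoc. apply Rmult_le_compat_l; [lra|].
      rewrite <- (Rmult_1_l S). apply Rmult_le_compat; try apply Rabs_pos; [|apply Hb].
      apply Rabs_le. apply COS_bound. }
  apply Cmod_le_parts; apply HB.
Qed.

(** * Continuity of uniformly summable series *)

Definition cC (f : R -> C) (t : R) : Prop :=
  forall e, 0 < e -> exists d, 0 < d /\ forall y, Rabs (y - t) < d -> Cmod (f y - f t) < e.

Lemma dC_cC f t D : dC f t D -> cC f t.
Proof.
  intros H e He. destruct (proj1 (dC_eps f t D) H 1 Rlt_0_1) as (d & Hd & K).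
  set (q := e / (2 + Cmod D)). pose proof (Cmod_ge_0 D) as HD0.
  assert (Hq : 0 < q) by (apply Rdiv_lt_0_compat; lra).
  exists (Rmin d q); split; [apply Rmin_pos; assumption|]. intros y Hy.
  specialize (K y (Rlt_le_trans _ _ _ Hy (Rmin_l _ _))).
  pose proof (Rlt_le_trans _ _ _ Hy (Rmin_r _ _)) as Hy2.
  replace (f y - f t)%C with ((f y - f t - RtoC (y - t) * D) + RtoC (y - t) * D)%C by ring.
  eapply Rle_lt_trans; [apply Cmod_triangle|]. rewrite Cmod_mult, Cmod_R.
  apply Rle_lt_trans with ((1 + Cmod D) * q).
  - pose proof (Rabs_pos (y - t)). nra.
  - replace e with ((2 + Cmod D) * q) by (unfold q; field; lra). nra.
Qed.

Lemma cC_plus f g t : cC f t -> cC g t -> cC (fun x => f x + g x)%C t.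
Proof.
  intros Hf Hg e He. destruct (Hf (e / 2) ltac:(lra)) as (d1 & Hd1 & H1), (Hg (e / 2) ltac:(lra)) as (d2 & Hd2 & H2).
  exists (Rmin d1 d2); split; [apply Rmin_pos; assumption|]. intros y Hy.
  specialize (H1 y (Rlt_le_trans _ _ _ Hy (Rmin_l _ _))). specialize (H2 y (Rlt_le_trans _ _ _ Hy (Rmin_r _ _))).
  replace (f y + g y - (f t + g t))%C with ((f y - f t) + (g y - g t))%C by ring.
  eapply Rle_lt_trans; [apply Cmod_triangle|]. lra.
Qed.

Lemma cC_mult f g t : cC f t -> cC g t -> cC (fun x => f x * g x)%C t.
Proof.
  intros Hf Hg e He. pose proof (Cmod_ge_0 (f t)) as F0. pose proof (Cmod_ge_0 (g t)) as G0.
  set (K := 1 + Cmod (f t) + Cmod (g t)). set (q := Rmin 1 (e / (2 * K))).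
  assert (HK : 0 < K) by (unfold K; lra).
  assert (Hq : 0 < q) by (apply Rmin_pos; [lra|apply Rdiv_lt_0_compat; lra]).
  destruct (Hf q Hq) as (d1 & Hd1 & H1), (Hg q Hq) as (d2 & Hd2 & H2).
  exists (Rmin d1 d2); split; [apply Rmin_pos; assumption|]. intros y Hy.
  specialize (H1 y (Rlt_le_trans _ _ _ Hy (Rmin_l _ _))). specialize (H2 y (Rlt_le_trans _ _ _ Hy (Rmin_r _ _))).
  replace (f y * g y - f t * g t)%C with ((f y - f t) * (g y - g t) + (f y - f t) * g t + f t * (g y - g t))%C by ring.
  eapply Rle_lt_trans; [apply Cmod_triangle|]. eapply Rle_lt_trans; [apply Rplus_le_compat_r, Cmod_triangle|].
  rewrite !Cmod_mult. set (u := Cmod (f y - f t)) in *. set (v := Cmod (g y - g t)) in *.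
  assert (0 <= u) by apply Cmod_ge_0. assert (0 <= v) by apply Cmod_ge_0.
  assert (q <= 1) by apply Rmin_l. assert (q <= e / (2 * K)) by apply Rmin_r.
  assert (K * q <= e / 2).
  { apply Rle_trans with (K * (e / (2 * K))); [apply Rmult_le_compat_l; lra|right; field; lra]. }
  assert (u * v <= q * 1) by (apply Rmult_le_compat; lra).
  assert (u * Cmod (g t) <= q * Cmod (g t)) by (apply Rmult_le_compat_r; lra).
  assert (Cmod (f t) * v <= Cmod (f t) * q) by (apply Rmult_le_compat_l; lra).
  unfold K in *. lra.
Qed.

Lemma cC_csum {I} (f : R -> I -> C) t (l : list I) :
  (forall i, cC (fun x => f x i) t) -> cC (fun x => csum (f x) l) t.
Proof.
  intros H. induction l as [|i l IH]; simpl.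
  - intros e He; exists 1; split; [lra|]. intros y _. replace (RtoC 0 - RtoC 0)%C with (RtoC 0) by ring. rewrite Cmod_0; assumption.
  - apply (cC_plus (fun x => f x i) (fun x => csum (f x) l)); auto.
Qed.

Lemma US_tail {I} (D : R -> Prop) (f : R -> I -> C) (S : R -> C) e : US D (fun x i => Cmod (f x i)) ->
  (forall x, D x -> hasum (f x) (S x)) -> 0 < e ->
  exists G, forall x, D x -> Cmod (csum (f x) G - S x) <= e.
Proof.
  intros (_ & _ & HU) HS He. destruct (HU e He) as (F & HF).
  destruct (nodup_ex F) as (F' & HN & HI). exists F'. intros x Hx.
  apply Rnot_lt_le; intros Hc. set (q := Cmod (csum (f x) F' - S x) - e).
  destruct (HS x Hx q ltac:(unfold q; lra)) as (G0 & HG0).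
  destruct (nodup_ex (F' ++ G0)) as (G & HGN & HGI).
  assert (H1 : Cmod (csum (f x) G - S x) < q).
  { apply HG0; [assumption|]. intros i Hi; apply HGI, in_or_app; auto. }
  assert (H2 : Cmod (csum (f x) G - csum (f x) F') <= e).
  { apply csum_diff_tail; [assumption| |assumption|intros i Hi; apply HGI, in_or_app; auto].
    intros H HH Hd. eapply Rle_trans; [|apply (HF x Hx H HH)]. apply rsum_le. intros i Hi.
    rewrite ind_out; [lra|]. intros Hin. apply (Hd i Hi), HI, Hin. }
  pose proof (Cmod_tri3 (csum (f x) F') (csum (f x) G) (S x)) as K. rewrite (Cmod_sub_sym (csum (f x) F') (csum (f x) G)) in K.
  unfold q in *. lra.
Qed.

(** Uniform limit of the finite partial sums. *)
Lemma cC_hasum {I} (f : R -> I -> C) (S : R -> C) a b t : a < t < b ->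
  (forall i, cC (fun x => f x i) t) -> (forall x, a < x < b -> hasum (f x) (S x)) ->
  US (fun x => a < x < b) (fun x i => Cmod (f x i)) -> cC S t.
Proof.
  intros Ht Hf HS HU e He.
  destruct (US_tail _ f S (e / 4) HU HS ltac:(lra)) as (G & HG).
  destruct (cC_csum f t G Hf (e / 4) ltac:(lra)) as (d & Hd & H).
  exists (Rmin d (Rmin (t - a) (b - t))). split; [repeat apply Rmin_pos; lra|]. intros y Hy.
  specialize (H y (Rlt_le_trans _ _ _ Hy (Rmin_l _ _))).
  pose proof (Rlt_le_trans _ _ _ Hy (Rmin_r _ _)) as Hy2.
  pose proof (Rlt_le_trans _ _ _ Hy2 (Rmin_l _ _)) as Ha. pose proof (Rlt_le_trans _ _ _ Hy2 (Rmin_r _ _)) as Hb.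
  assert (Hyr : a < y < b) by (split; unfold Rabs in *; destruct (Rcase_abs (y - t)); lra).
  pose proof (HG y Hyr) as G1. pose proof (HG t Ht) as G2.
  pose proof (Cmod_tri3 (S y) (csum (f y) G) (S t)) as T1. pose proof (Cmod_tri3 (csum (f y) G) (csum (f t) G) (S t)) as T2.
  rewrite (Cmod_sub_sym (S y) (csum (f y) G)) in T1. lra.
Qed.

Lemma cC_continuous f t : cC f t -> continuous (fun x => fst (f x)) t /\ continuous (fun x => snd (f x)) t.
Proof.
  intros H; split; intros P [[e He] HP]; destruct (H e He) as (d & Hd & K); exists (mkposreal d Hd);
    intros y Hy; apply HP; specialize (K y Hy); eapply Rle_lt_trans; [|exact K| |exact K].
  - apply (Cmod_parts (f y - f t)%C).
  - apply (Cmod_parts (f y - f t)%C).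
Qed.

(** * Equation in the sense of distributions and mode equations *)

Lemma hasum_tail_le {I} (f : I -> C) v (F : list I) e :
  hasum f v -> NoDup F ->
  (forall H, NoDup H -> (forall i, In i H -> ~ In i F) -> rsum (fun i => Cmod (f i)) H <= e) ->
  forall G, NoDup G -> incl F G -> Cmod (csum f G - v) <= e.
Proof.
  intros Hv HF Ht G HG Hi. apply le_epsilon; intros d Hd.
  destruct (ev_ex _ (ev_and _ _ (Hv d Hd) (ev_incl G))) as (G' & HG' & H1 & H2).
  destruct (nodup_diff G G' HG HG' H2) as (K & K1 & K2 & K3).
  pose proof (Cmod_tri3 (csum f G) (csum f G') v) as T.
  assert (Cmod (csum f G - csum f G') <= e); [|lra].
  rewrite (csum_perm f _ _ K3), csum_app. replace (_ - _)%C with (- csum f K)%C by ring.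
  rewrite Cmod_opp. eapply Rle_trans; [apply Cmod_csum|]. apply Ht; [assumption|].
  intros i HiK HiF. exact (K2 i HiK (Hi i HiF)).
Qed.

Lemma continuous_Rlin (r s : R) (f g : R -> R) x :
  continuous f x -> continuous g x -> continuous (fun y => r * f y + s * g y) x.
Proof.
  intros Hf Hg. apply @continuous_plus; apply continuous_Rmult; try assumption; apply continuous_const.
Qed.

Lemma RInt_Rext (f g : R -> R) a b : (forall x, f x = g x) -> RInt f a b = RInt g a b.
Proof. intros H. apply RInt_ext; intros; apply H. Qed.

Lemma RInt_Rlin (r s : R) (f g : R -> R) a b :
  (forall x, continuous f x) -> (forall x, continuous g x) ->
  RInt (fun x => r * f x + s * g x) a b = r * RInt f a b + s * RInt g a b.
Proof.
  intros Hf Hg.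
  assert (X : forall h : R -> R, (forall x, continuous h x) -> is_RInt h a b (RInt h a b)).
  { intros h Hh. apply (@RInt_correct R_CompleteNormedModule), @ex_RInt_continuous. intros; apply Hh. }
  apply (@is_RInt_unique R_CompleteNormedModule).
  exact (is_RInt_plus _ _ _ _ _ _ (is_RInt_scal _ _ _ r _ (X f Hf)) (is_RInt_scal _ _ _ s _ (X g Hg))).
Qed.

Lemma contC_plus f g : contC f -> contC g -> contC (fun x => f x + g x)%C.
Proof.
  intros Hf Hg x. destruct (Hf x) as [F1 F2]. destruct (Hg x) as [G1 G2]. split; simpl.
  - refine (continuous_ext _ _ _ _ (continuous_Rlin 1 1 _ _ x F1 G1)). intros y; simpl. ring.
  - refine (continuous_ext _ _ _ _ (continuous_Rlin 1 1 _ _ x F2 G2)). intros y; simpl. ring.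
Qed.

Lemma contC_scal c f : contC f -> contC (fun x => c * f x)%C.
Proof.
  intros Hf x. destruct (Hf x) as [F1 F2]. split; simpl.
  - refine (continuous_ext _ _ _ _ (continuous_Rlin (fst c) (- snd c) _ _ x F1 F2)). intros y; simpl. ring.
  - refine (continuous_ext _ _ _ _ (continuous_Rlin (fst c) (snd c) _ _ x F2 F1)). intros y; simpl. ring.
Qed.

Lemma contC_csum (f : Z -> R -> C) (c : Z -> C) l :
  (forall k, contC (f k)) -> contC (fun x => csum (fun k => c k * f k x)%C l).
Proof.
  intros H. induction l as [|a l IH]; simpl.
  - intros x; split; apply continuous_const.
  - apply (contC_plus (fun x => c a * f a x)%C); [apply contC_scal, H|assumption].
Qed.

Lemma pairing_plus a b f g phi : contC f -> contC g -> (forall x, continuous phi x) ->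
  pairing a b (fun x => f x + g x)%C phi = (pairing a b f phi + pairing a b g phi)%C.
Proof.
  intros Hf Hg Hp.
  rewrite (proj2 (pairing_pair a b _ phi (contC_plus f g Hf Hg) Hp)),
    (proj2 (pairing_pair a b f phi Hf Hp)), (proj2 (pairing_pair a b g phi Hg Hp)).
  assert (X : forall h : R -> R, (forall x, continuous h x) -> forall x, continuous (fun x => h x * phi x) x)
    by (intros; apply continuous_Rmult; auto).
  assert (F1 := X _ (fun x => proj1 (Hf x))). assert (F2 := X _ (fun x => proj2 (Hf x))).
  assert (G1 := X _ (fun x => proj1 (Hg x))). assert (G2 := X _ (fun x => proj2 (Hg x))).
  unfold Cplus; cbn [fst snd]. f_equal.
  - pose proof (RInt_Rlin 1 1 _ _ a b F1 G1) as K. rewrite !Rmult_1_l in K.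
    refine (eq_trans (RInt_Rext _ _ a b _) K). intros x; simpl; ring.
  - pose proof (RInt_Rlin 1 1 _ _ a b F2 G2) as K. rewrite !Rmult_1_l in K.
    refine (eq_trans (RInt_Rext _ _ a b _) K). intros x; simpl; ring.
Qed.

Lemma pairing_scal a b c f phi : contC f -> (forall x, continuous phi x) ->
  pairing a b (fun x => c * f x)%C phi = (c * pairing a b f phi)%C.
Proof.
  intros Hf Hp.
  rewrite (proj2 (pairing_pair a b _ phi (contC_scal c f Hf) Hp)), (proj2 (pairing_pair a b f phi Hf Hp)).
  assert (X : forall h : R -> R, (forall x, continuous h x) -> forall x, continuous (fun x => h x * phi x) x)
    by (intros; apply continuous_Rmult; auto).
  assert (F1 := X _ (fun x => proj1 (Hf x))). assert (F2 := X _ (fun x => proj2 (Hf x))).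
  unfold Cmult; cbn [fst snd]. f_equal.
  - pose proof (RInt_Rlin (fst c) (- snd c) _ _ a b F1 F2) as K.
    transitivity (fst c * RInt (fun x => fst (f x) * phi x) a b + - snd c * RInt (fun x => snd (f x) * phi x) a b); [|refine (_ : @eq R _ _); ring].
    refine (eq_trans (RInt_Rext _ _ a b _) K). intros x; simpl; ring.
  - pose proof (RInt_Rlin (fst c) (snd c) _ _ a b F2 F1) as K.
    refine (eq_trans (RInt_Rext _ _ a b _) K). intros x; simpl; ring.
Qed.

Lemma pairing_csum a b (f : Z -> R -> C) (c : Z -> C) phi l :
  (forall k, contC (f k)) -> (forall x, continuous phi x) ->
  pairing a b (fun x => csum (fun k => c k * f k x)%C l) phi = csum (fun k => c k * pairing a b (f k) phi)%C l.
Proof.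
  intros Hf Hp. induction l as [|k l IH].
  - simpl. assert (H0 : contC (fun _ => RtoC 0)) by (intros x; split; apply continuous_const).
    rewrite (proj2 (pairing_pair a b _ phi H0 Hp)). unfold RtoC; cbn [fst snd].
    rewrite (RInt_Rext (fun x => 0 * phi x) (fun _ => 0)) by (intros; ring).
    rewrite RInt_const. unfold scal; simpl; unfold mult; simpl. f_equal; ring.
  - change (pairing a b (fun x => (c k * f k x + csum (fun k => (c k * f k x)%C) l)%C) phi =
      (c k * pairing a b (f k) phi + csum (fun k => (c k * pairing a b (f k) phi)%C) l)%C).
    rewrite (pairing_plus a b (fun x => c k * f k x)%C), pairing_scal, IH; auto.
    + apply contC_scal, Hf.
    + apply contC_csum, Hf.
Qed.

Section Combs.
Context (t : R) (Ht : 0 < t) (c : Z -> C) (v : R -> C).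
Context (Hc : asum c) (Hv : forall x, hasum (fun k => c k * free_delta k t x)%C (v x)).

Lemma comb_uniform e : 0 < e -> ev (fun G => forall x, Cmod (csum (fun k => c k * free_delta k t x)%C G - v x) <= e).
Proof.
  intros He. destruct Hc as (B & HB).
  assert (Hs : 0 < sqrt (4 * PI * t)) by (apply sqrt_lt_R0, four_pi_pos, Ht).
  destruct (bnd_tail _ B (fun k => Cmod_ge_0 (c k)) HB (e * sqrt (4 * PI * t))) as (F & HF & HFt).
  { apply Rmult_lt_0_compat; assumption. }
  exists F; intros G HG Hi x. apply (hasum_tail_le _ _ F e (Hv x) HF); [|assumption|assumption].
  intros H HH Hd. rewrite (rsum_ext _ (fun k => Cmod (c k) * / sqrt (4 * PI * t))).
  - rewrite rsum_scal_r. apply Rle_trans with (e * sqrt (4 * PI * t) * / sqrt (4 * PI * t)).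
    + apply Rmult_le_compat_r; [left; apply Rinv_0_lt_compat; assumption|auto].
    + right; field; lra.
  - intros k _. rewrite Cmod_mult, free_delta_mod by assumption. reflexivity.
Qed.

Lemma comb_contC : contC v.
Proof.
  assert (Hs : 0 < / sqrt (4 * PI * t)) by (apply Rinv_0_lt_compat, sqrt_lt_R0, four_pi_pos, Ht).
  intros x. apply cC_continuous, (cC_hasum (fun y k => c k * free_delta k t y)%C v (x - 1) (x + 1)); [lra| |auto|].
  - intros k. apply (cC_mult (fun _ => c k)); [eapply dC_cC, dC_const|].
    eapply dC_cC, dC_ext; [intros y; symmetry; apply free_delta_cis, Ht|].
    apply dC_scal, (dC_cis (fun y => (y - IZR k) ^ 2 / (4 * t) - PI / 4)). auto_derive; [exact I|reflexivity].
  - destruct Hc as (B & HB). apply US_le with (g := fun _ k => Cmod (c k) * / sqrt (4 * PI * t)).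
    + intros y k _. rewrite Cmod_mult, free_delta_mod by assumption. split; [|lra].
      apply Rmult_le_pos; [apply Cmod_ge_0|lra].
    + apply US_const with (/ sqrt (4 * PI * t) * B).
      * intros k. apply Rmult_le_pos; [apply Cmod_ge_0|lra].
      * eapply bnd_mono; [|exact (bnd_scal _ _ _ (Rlt_le _ _ Hs) HB)]. intros k; cbv beta. lra.
Qed.

Lemma comb_pairing a b phi : a < b -> (forall x, continuous phi x) ->
  (exists S, 0 <= S /\ forall x, Rabs (phi x) <= S) ->
  hasum (fun k => c k * pairing a b (free_delta k t) phi)%C (pairing a b v phi).
Proof.
  intros Hab Hp (S & HS & HSb).
  pose proof (comb_contC) as Hcv.
  assert (Hlin : forall G, Cmod (csum (fun k => c k * pairing a b (free_delta k t) phi)%C G - pairing a b v phi) =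
     Cmod (pairing a b (fun x => csum (fun k => c k * free_delta k t x)%C G + (- (1)) * v x)%C phi)).
  { intros G. f_equal.
    rewrite (pairing_plus a b (fun x => csum (fun k => c k * free_delta k t x)%C G) (fun x => (- (1)) * v x)%C).
    - rewrite (pairing_csum a b (fun k => free_delta k t)), pairing_scal; auto; [ring|].
      intros k; apply contC_free_delta, Ht.
    - apply (contC_csum (fun k => free_delta k t)). intros k; apply contC_free_delta, Ht.
    - apply contC_scal, Hcv.
    - assumption. }
  intros e He. set (q := e / (4 * ((b - a) * (S + 1)))).
  assert (Hq0 : 0 < (b - a) * (S + 1)) by (apply Rmult_lt_0_compat; lra).
  assert (Hq : 0 < q) by (apply Rdiv_lt_0_compat; lra).
  generalize (comb_uniform q Hq). apply ev_mono. intros G HG HU. rewrite Hlin.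
  set (h := fun x => (csum (fun k => c k * free_delta k t x)%C G + (- (1)) * v x)%C).
  assert (Hh : contC h).
  { apply contC_plus; [|apply contC_scal, Hcv].
    apply (contC_csum (fun k => free_delta k t)). intros k; apply contC_free_delta, Ht. }
  assert (Hhb : forall x, Cmod (h x) <= q).
  { intros x. unfold h. replace (_ + _)%C with (csum (fun k => c k * free_delta k t x)%C G - v x)%C by ring. apply HU. }
  rewrite (proj2 (pairing_pair a b h phi Hh Hp)).
  assert (HB : forall g : R -> R, (forall x, continuous g x) -> (forall x, Rabs (g x) <= q) ->
     Rabs (RInt (fun x => g x * phi x) a b) <= (b - a) * (q * S)).
  { intros g Hg Hgb. apply abs_RInt_le_const; [lra| |].
    - apply @ex_RInt_continuous. intros x _. apply continuous_Rmult; [apply Hg|apply Hp].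
    - intros x _. rewrite Rabs_mult. apply Rmult_le_compat; try apply Rabs_pos; auto. }
  eapply Rle_lt_trans; [apply (Cmod_le_parts _ ((b - a) * (q * S)))|].
  - apply (HB (fun x => fst (h x))); [apply Hh|]. intros x. eapply Rle_trans; [apply (Cmod_parts (h x))|apply (Hhb x)].
  - apply (HB (fun x => snd (h x))); [apply Hh|]. intros x. eapply Rle_trans; [apply (Cmod_parts (h x))|apply (Hhb x)].
  - assert ((b - a) * (q * S) <= e / 4); [|lra].
    apply Rle_trans with ((b - a) * (S + 1) * q); [|right; unfold q; field; lra].
    replace ((b - a) * (q * S)) with ((b - a) * q * S) by ring.
    assert (0 < (b - a) * q) by (apply Rmult_lt_0_compat; lra). nra.
Qed.
End Combs.

Lemma dC_unique f t D E : dC f t D -> dC f t E -> D = E.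
Proof.
  intros H1 H2. apply dC_comp in H1 as [H1 H1']. apply dC_comp in H2 as [H2 H2'].
  apply injective_projections.
  - apply is_derive_unique in H1. apply is_derive_unique in H2. congruence.
  - apply is_derive_unique in H1'. apply is_derive_unique in H2'. congruence.
Qed.

(** The factor [e^{i x^2/(4t)}] is common to all [k]; without it the series in [x] is an absolutely
    convergent Fourier series with coefficients of the same modulus as [c]. *)
Lemma comb_zero t (c : Z -> C) : 0 < t -> asum c ->
  (forall x, hasum (fun k => c k * free_delta k t x)%C (RtoC 0)) -> forall k, c k = RtoC 0.
Proof.
  intros Ht Hc H k. pose proof PI_RGT_0.
  assert (Hs : 0 < sqrt (4 * PI * t)) by (apply sqrt_lt_R0, four_pi_pos, Ht).
  set (c' := fun k => (c k * cis (IZR k ^ 2 / (4 * t)))%C).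
  assert (Hc' : asum c') by (apply asum_twist; [assumption|intros; apply cis_mod]).
  assert (E : c' k = RtoC 0).
  { apply fourier_unique; [assumption|]. intros xi.
    set (x := 2 * t * xi).
    pose proof (hasum_scal (RtoC (sqrt (4 * PI * t)) * cis (- (x ^ 2 / (4 * t) - PI / 4)))%C _ _ (H x)) as K.
    rewrite Cmult_0_r in K. eapply hasum_ext; [|exact K]. intros j. unfold c'.
    rewrite free_delta_cis by assumption.
    replace (c j * cis (IZR j ^ 2 / (4 * t)) * cis (- IZR j * xi))%C with
      (c j * cis (IZR j ^ 2 / (4 * t) + - IZR j * xi))%C by (rewrite cis_plus; ring).
    replace (RtoC (sqrt (4 * PI * t)) * cis (- (x ^ 2 / (4 * t) - PI / 4)) *
      (c j * (RtoC (/ sqrt (4 * PI * t)) * cis ((x - IZR j) ^ 2 / (4 * t) - PI / 4))))%C with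
      ((RtoC (sqrt (4 * PI * t)) * RtoC (/ sqrt (4 * PI * t))) * (c j *
        cis (- (x ^ 2 / (4 * t) - PI / 4) + ((x - IZR j) ^ 2 / (4 * t) - PI / 4))))%C
      by (rewrite (cis_plus (- (x ^ 2 / (4 * t) - PI / 4))); ring).
    rewrite <- RtoC_mult, Rinv_r, Cmult_1_l by lra. do 2 f_equal. unfold x. field. lra. }
  unfold c' in E. replace (c k) with (c k * cis (IZR k ^ 2 / (4 * t)) * cis (- (IZR k ^ 2 / (4 * t))))%C.
  - rewrite E; ring.
  - rewrite <- Cmult_assoc, <- cis_plus, Rplus_opp_r, cis_0. ring.
Qed.

Section WeakForm.
Context (sigma M T : R) (A D : R -> Z -> C) (u : R -> R -> C).
Context (Hd : forall t k, 0 < t < T -> dC (fun x => A x k) t (D t k)).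
Context (UA : forall lo, 0 < lo -> US (fun x => lo < x < T) (fun x k => Cmod (A x k))).
Context (UD : forall lo, 0 < lo -> US (fun x => lo < x < T) (fun x k => Cmod (D x k))).
Context (Hu : forall t x, 0 < t < T -> hasum (fun k => A t k * free_delta k t x)%C (u t x)).

Lemma wf_asum t : 0 < t < T -> asum (A t) /\ asum (D t).
Proof.
  intros Ht. split.
  - apply (US_asum _ A t (UA (t / 2) ltac:(lra))). lra.
  - apply (US_asum _ D t (UD (t / 2) ltac:(lra))). lra.
Qed.

Lemma asum_comb t (c : Z -> C) x : 0 < t -> asum c -> asum (fun k => c k * free_delta k t x)%C.
Proof.
  intros Ht (B & HB). exists (/ sqrt (4 * PI * t) * B).
  eapply bnd_mono; [|apply bnd_scal; [|exact HB]].
  - intros k; simpl. rewrite Cmod_mult, free_delta_mod by assumption. lra.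
  - left; apply Rinv_0_lt_compat, sqrt_lt_R0, four_pi_pos, Ht.
Qed.

Definition vel (t x : R) : C := tsum (fun k => D t k * free_delta k t x)%C.

Lemma vel_ok t x : 0 < t < T -> hasum (fun k => D t k * free_delta k t x)%C (vel t x).
Proof. intros Ht. apply tsum_ok, asum_comb; [lra|apply wf_asum, Ht]. Qed.

(** Tested against [phi], the time derivative of [e_k] becomes a pairing with the second derivative of [phi],
    bounded uniformly in [k]: the series can be differentiated term by term although [u] need not be
    differentiable in [x]. *)
Lemma weak_derivative a b phi t : a < b -> test_function a b phi -> 0 < t < T ->
  exists E, dC (fun tau => pairing a b (u tau) phi) t E /\
   (Ci * E + pairing a b (u t) (Derive_n phi 2) = Ci * pairing a b (vel t) phi)%C.
Proof.
  intros Hab Hphi Ht.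
  assert (Hp : forall x, continuous phi x) by (intros; apply (test_continuous a b phi 0); assumption).
  assert (Hp2 : forall x, continuous (Derive_n phi 2) x) by (intros; apply (test_continuous a b phi 2); assumption).
  destruct (test_bounded a b phi 0 Hab Hphi) as (S0 & HS0 & HSb0).
  destruct (test_bounded a b phi 2 Hab Hphi) as (S2 & HS2 & HSb2).
  destruct (wf_asum t Ht) as [HA HDs].
  set (Ek := fun tau k => pairing a b (free_delta k tau) phi).
  set (E2 := fun tau k => pairing a b (free_delta k tau) (Derive_n phi 2)).
  set (lo := t / 2). assert (Hlo : 0 < lo) by (unfold lo; lra).
  set (g := fun tau k => (D tau k * Ek tau k + A tau k * (Ci * E2 tau k))%C).
  set (q := fun S => 2 * ((b - a) * (/ sqrt (4 * PI * lo) * S))).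
  assert (Hq : forall psi S tau k, lo < tau -> (forall x, continuous psi x) -> 0 <= S -> (forall x, Rabs (psi x) <= S) ->
     Cmod (pairing a b (free_delta k tau) psi) <= q S).
  { intros psi S tau k Htau Hpsi HS Hb.
    eapply Rle_trans; [apply (pairing_free_bound k tau a b psi S); auto; lra|]. unfold q.
    apply Rmult_le_compat_l; [lra|]. apply Rmult_le_compat_l; [lra|]. apply Rmult_le_compat_r; [assumption|].
    pose proof (four_pi_pos lo Hlo). pose proof PI_RGT_0.
    apply Rinv_le_contravar; [apply sqrt_lt_R0; assumption|].
    apply sqrt_le_1_alt. apply Rmult_le_compat_l; lra. }
  assert (Hq0 : forall S, 0 <= S -> 0 <= q S).
  { intros S HS. unfold q. apply Rmult_le_pos; [lra|]. apply Rmult_le_pos; [lra|].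
    apply Rmult_le_pos; [|assumption]. left; apply Rinv_0_lt_compat, sqrt_lt_R0, four_pi_pos, Hlo. }
  assert (UG : US (fun x => lo < x < T) (fun x k => Cmod (g x k))).
  { eapply US_le; [|exact (US_plus _ _ _ (US_scal _ (q S0) _ (Hq0 S0 HS0) (UD lo Hlo))
      (US_scal _ (q S2) _ (Hq0 S2 HS2) (UA lo Hlo)))].
    intros x k Hx. split; [apply Cmod_ge_0|]. unfold g.
    apply Cmod_tri_le. rewrite !Cmod_mult.
    rewrite Cmod_Ci.
    pose proof (Hq phi S0 x k ltac:(lra) Hp HS0 HSb0) as K1.
    pose proof (Hq (Derive_n phi 2) S2 x k ltac:(lra) Hp2 HS2 HSb2) as K2.
    fold (Ek x k) in K1. fold (E2 x k) in K2.
    pose proof (Cmod_ge_0 (D x k)). pose proof (Cmod_ge_0 (A x k)). nra. }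
  assert (HE : forall tau, 0 < tau < T -> hasum (fun k => A tau k * Ek tau k)%C (pairing a b (u tau) phi)).
  { intros tau Htau.
    exact (comb_pairing tau (proj1 Htau) (A tau) (u tau) (proj1 (wf_asum tau Htau)) (fun x => Hu tau x Htau)
      a b phi Hab Hp (ex_intro _ S0 (conj HS0 HSb0))). }
  pose proof (comb_pairing t ltac:(lra) (A t) (u t) HA (fun x => Hu t x Ht) a b (Derive_n phi 2) Hab Hp2
    (ex_intro _ S2 (conj HS2 HSb2))) as H2.
  pose proof (comb_pairing t ltac:(lra) (D t) (vel t) HDs (fun x => vel_ok t x Ht) a b phi Hab Hp
    (ex_intro _ S0 (conj HS0 HSb0))) as H1.
  exists (tsum (g t)). split.
  - apply (dC_hasum (fun tau k => A tau k * Ek tau k)%C g _ lo T); [unfold lo; lra| | |exact UG].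
    + intros x k Hx. unfold g.
      exact (dC_mult (fun y => A y k) (fun y => Ek y k) x _ _ (Hd x k ltac:(lra))
        (dC_pairing_free k x a b phi ltac:(lra) Hab Hphi)).
    + intros x Hx; apply HE; lra.
  - rewrite (tsum_eq (g t) (pairing a b (vel t) phi + Ci * pairing a b (u t) (Derive_n phi 2))%C).
    + replace (Ci * (pairing a b (vel t) phi + Ci * pairing a b (u t) (Derive_n phi 2)) +
        pairing a b (u t) (Derive_n phi 2))%C with
        (Ci * pairing a b (vel t) phi + (Ci * Ci + 1) * pairing a b (u t) (Derive_n phi 2))%C by ring.
      replace (Ci * Ci + 1)%C with (RtoC 0); [ring|].
      unfold Ci, RtoC, Cmult, Cplus; simpl. apply injective_projections; simpl; ring.
    + apply hasum_plus; [exact H1|]. apply (hasum_scal Ci) in H2.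
      eapply hasum_ext; [|exact H2]. intros k; unfold E2; simpl. ring.
Qed.

(** Coefficients of [i u_t + u_xx + (sigma/2)(|u|^2 - M/(2 PI t)) u] on the [e_k], the free parts
    having cancelled. *)
Definition defect (t : R) (k : Z) : C :=
  (Ci * D t k + RtoC (sigma / (8 * PI * t)) * (Ncub t (A t) k - RtoC (2 * M) * A t k))%C.

Lemma defect_pairing a b phi t : a < b -> test_function a b phi -> 0 < t < T ->
  asum (defect t) /\
  hasum (fun k => defect t k * pairing a b (free_delta k t) phi)%C
   (Ci * pairing a b (vel t) phi + RtoC (sigma / 2) *
     pairing a b (fun x => RtoC (Cmod (u t x) ^ 2 - M / (2 * PI * t)) * u t x)%C phi)%C.
Proof.
  intros Hab Hphi Ht. pose proof PI_RGT_0.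
  assert (Hp : forall x, continuous phi x) by (intros; apply (test_continuous a b phi 0); assumption).
  destruct (test_bounded a b phi 0 Hab Hphi) as (S0 & HS0 & HSb0).
  destruct (wf_asum t Ht) as [HA HDs].
  set (g := fun k => (RtoC (/ (4 * PI * t)) * (Ncub t (A t) k - RtoC (2 * M) * A t k))%C).
  assert (Hg : asum g).
  { apply asum_scal. destruct (bnd_Ncub (A t) t HA) as (B1 & HB1).
    apply (asum_plus (Ncub t (A t)) (fun k => - (RtoC (2 * M) * A t k))%C);
      [exists B1; assumption|].
    destruct (asum_scal (RtoC (2 * M)) _ HA) as (B2 & HB2). exists B2.
    eapply bnd_mono; [|exact HB2]. intros k. rewrite Cmod_opp. lra. }
  assert (Hgs : forall x, hasum (fun k => g k * free_delta k t x)%C (RtoC (Cmod (u t x) ^ 2 - M / (2 * PI * t)) * u t x)%C).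
  { intros x. pose proof (hasum_cubic (A t) t x (u t x) ltac:(lra) HA (Hu t x Ht)) as K1.
    pose proof (hasum_scal (RtoC (2 * M)) _ _ (Hu t x Ht)) as K2.
    pose proof (hasum_scal (RtoC (/ (4 * PI * t))) _ _ (hasum_minus _ _ _ _ K1 K2)) as K3.
    replace (RtoC (Cmod (u t x) ^ 2 - M / (2 * PI * t)) * u t x)%C with
      (RtoC (/ (4 * PI * t)) * (RtoC (4 * PI * t) * (RtoC (Cmod (u t x) ^ 2) * u t x) - RtoC (2 * M) * u t x))%C.
    - eapply hasum_ext; [|exact K3]. intros k; unfold g; simpl. ring.
    - rewrite RtoC_minus. replace (M / (2 * PI * t)) with (/ (4 * PI * t) * (2 * M)) by (field; lra).
      rewrite (RtoC_mult (/ (4 * PI * t)) (2 * M)).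
      replace (RtoC (/ (4 * PI * t)) * (RtoC (4 * PI * t) * (RtoC (Cmod (u t x) ^ 2) * u t x) - RtoC (2 * M) * u t x))%C
       with ((RtoC (/ (4 * PI * t)) * RtoC (4 * PI * t)) * (RtoC (Cmod (u t x) ^ 2) * u t x)
          - RtoC (/ (4 * PI * t)) * RtoC (2 * M) * u t x)%C by ring.
      rewrite <- (RtoC_mult (/ (4 * PI * t)) (4 * PI * t)), Rinv_l by (apply Rgt_not_eq, four_pi_pos; lra). ring. }
  pose proof (comb_pairing t ltac:(lra) g _ Hg Hgs a b phi Hab Hp (ex_intro _ S0 (conj HS0 HSb0))) as H2.
  pose proof (comb_pairing t ltac:(lra) (D t) (vel t) HDs (fun x => vel_ok t x Ht) a b phi Hab Hp
    (ex_intro _ S0 (conj HS0 HSb0))) as H1.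
  assert (Ed : forall k, defect t k = (Ci * D t k + RtoC (sigma / 2) * g k)%C).
  { intros k. unfold defect, g.
    replace (sigma / (8 * PI * t)) with (sigma / 2 * / (4 * PI * t)) by (field; lra). rewrite RtoC_mult. ring. }
  split.
  - destruct (asum_plus _ _ (asum_scal Ci _ HDs) (asum_scal (RtoC (sigma / 2)) _ Hg)) as (B & HB).
    exists B. eapply bnd_mono; [|exact HB]. intros k; simpl. rewrite Ed. lra.
  - eapply hasum_ext; [|exact (hasum_plus _ _ _ _ (hasum_scal Ci _ _ H1) (hasum_scal (RtoC (sigma / 2)) _ _ H2))].
    intros k; simpl. rewrite Ed. ring.
Qed.

Lemma nls_of_modes : (forall t k, 0 < t < T -> defect t k = RtoC 0) -> nls sigma M T u.
Proof.
  intros H0 a b phi Hab Hphi t Ht.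
  destruct (weak_derivative a b phi t Hab Hphi Ht) as (E & HE & Eq). exists E; split; [exact HE|].
  rewrite Eq. destruct (defect_pairing a b phi t Hab Hphi Ht) as [_ Hs].
  apply (hasum_unique _ _ _ Hs). eapply hasum_ext; [|apply hasum_0].
  intros k; simpl. rewrite H0 by assumption. ring.
Qed.

(** Tested against all bumps the comb with coefficients [defect] vanishes; being continuous it is zero,
    and so are its coefficients. *)
Lemma modes_of_nls : nls sigma M T u -> forall t k, 0 < t < T -> defect t k = RtoC 0.
Proof.
  intros Hn t k Ht.
  assert (Hz : forall a b phi, a < b -> test_function a b phi ->
    hasum (fun k => defect t k * pairing a b (free_delta k t) phi)%C (RtoC 0)).
  { intros a b phi Hab Hphi. destruct (weak_derivative a b phi t Hab Hphi Ht) as (E & HE & Eq).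
    destruct (Hn a b phi Hab Hphi t Ht) as (E' & HE' & Eq').
    rewrite (dC_unique _ _ _ _ HE' HE), Eq in Eq'.
    pose proof (proj2 (defect_pairing a b phi t Hab Hphi Ht)) as K. rewrite Eq' in K. exact K. }
  assert (Ha : asum (defect t)).
  { apply (defect_pairing 0 1 (bump 0 1) t Rlt_0_1); [apply bump_test; lra|assumption]. }
  assert (Htp : 0 < t) by lra.
  set (w := fun x => tsum (fun k => defect t k * free_delta k t x)%C).
  assert (Hw : forall x, hasum (fun k => defect t k * free_delta k t x)%C (w x))
    by (intros x; apply tsum_ok, asum_comb; assumption).
  pose proof (comb_contC t Htp (defect t) w Ha Hw) as Hcw.
  assert (Hwp : forall a b phi, a < b -> test_function a b phi -> pairing a b w phi = RtoC 0).
  { intros a b phi Hab Hphi.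
    assert (Hp : forall x, continuous phi x) by (intros; apply (test_continuous a b phi 0); assumption).
    destruct (test_bounded a b phi 0 Hab Hphi) as (S0 & HS0 & HSb0).
    apply (hasum_unique (fun k => defect t k * pairing a b (free_delta k t) phi)%C).
    - exact (comb_pairing t Htp (defect t) w Ha Hw a b phi Hab Hp (ex_intro _ S0 (conj HS0 HSb0))).
    - apply Hz; assumption. }
  assert (Hw0 : forall x, w x = RtoC 0).
  { intros x. apply injective_projections.
    - apply (fundamental_lemma (fun x => fst (w x))); [intros; apply Hcw|]. intros a b phi Hab Hphi.
      pose proof (Hwp a b phi Hab Hphi) as K.
      rewrite (proj2 (pairing_pair a b w phi Hcw (fun x => test_continuous a b phi 0 x Hphi))) in K.
      apply (f_equal fst) in K. exact K.
    - apply (fundamental_lemma (fun x => snd (w x))); [intros; apply Hcw|]. intros a b phi Hab Hphi.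
      pose proof (Hwp a b phi Hab Hphi) as K.
      rewrite (proj2 (pairing_pair a b w phi Hcw (fun x => test_continuous a b phi 0 x Hphi))) in K.
      apply (f_equal snd) in K. exact K. }
  apply (comb_zero t); [assumption|assumption|]. intros x. rewrite <- (Hw0 x). apply Hw.
Qed.
End WeakForm.

(** * Weighted summable sequences *)

Section Weighted.
Context (n : nat).

Definition wgt (k : Z) : R := jap k ^ n.
Definition wb (x : Z -> C) (B : R) : Prop := bnd (fun k => wgt k * Cmod (x k)) B.

Lemma wgt_ge1 k : 1 <= wgt k.
Proof. unfold wgt. apply pow_R1_Rle, jap_ge1. Qed.

(** Since [k = (k-a) - (k-a-b) + (k-b)]; this makes the weighted [l^1] space an algebra under convolution. *)
Lemma wgt_triple k a b : wgt k <= wgt (k - a) * wgt (k - a - b) * wgt (k - b).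
Proof.
  unfold wgt. rewrite <- !Rpow_mult_distr. apply pow_incr.
  pose proof (jap_ge1 k). split; [lra|]. unfold jap in *.
  set (x := Rabs (IZR (k - a))). set (y := Rabs (IZR (k - a - b))). set (z := Rabs (IZR (k - b))).
  assert (0 <= x /\ 0 <= y /\ 0 <= z) as (Hx & Hy & Hz) by (repeat split; apply Rabs_pos).
  assert (Rabs (IZR k) <= x + y + z).
  { replace (IZR k) with (IZR (k - a) + - IZR (k - a - b) + IZR (k - b)) by (rewrite !minus_IZR; ring).
    eapply Rle_trans; [apply Rabs_triang|]. apply Rplus_le_compat_r.
    eapply Rle_trans; [apply Rabs_triang|]. rewrite Rabs_Ropp. apply Rle_refl. }
  assert (0 <= x * y) by (apply Rmult_le_pos; assumption). assert (0 <= y * z) by (apply Rmult_le_pos; assumption).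
  assert (0 <= x * z) by (apply Rmult_le_pos; assumption). assert (0 <= x * y * z) by (apply Rmult_le_pos; assumption).
  nra.
Qed.

Lemma wb_nonneg x B : wb x B -> 0 <= B.
Proof. apply bnd_nonneg. Qed.

Lemma wb_l1 x B : wb x B -> bnd (fun k => Cmod (x k)) B.
Proof.
  intros H. eapply bnd_mono; [|exact H]. intros k; simpl.
  pose proof (wgt_ge1 k). pose proof (Cmod_ge_0 (x k)). nra.
Qed.

Lemma wb_asum x B : wb x B -> asum x.
Proof. intros H. exists B. apply wb_l1, H. Qed.

Lemma wb_term x B k : wb x B -> Cmod (x k) <= B.
Proof. intros H. apply (bnd_term _ _ k (wb_l1 x B H)). Qed.

Lemma wb_le x y A B : (forall k, Cmod (x k) <= Cmod (y k)) -> A <= B -> wb y A -> wb x B.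
Proof.
  intros H HAB Hy. eapply bnd_le; [|exact HAB|exact Hy]. intros k; simpl.
  apply Rmult_le_compat_l; [pose proof (wgt_ge1 k); lra|apply H].
Qed.

Lemma wb_up x A B : A <= B -> wb x A -> wb x B.
Proof. apply bnd_le; intros k; apply Rle_refl. Qed.

Lemma wb_tri x y z A B : (forall k, Cmod (x k) <= Cmod (y k) + Cmod (z k)) -> wb y A -> wb z B -> wb x (A + B).
Proof.
  intros H Hy Hz. eapply bnd_mono; [|exact (bnd_plus _ _ _ _ Hy Hz)]. intros k; simpl.
  pose proof (wgt_ge1 k). specialize (H k). nra.
Qed.

Lemma wb_mul (c : Z -> C) x A B : 0 <= A -> (forall k, Cmod (c k) <= A) -> wb x B -> wb (fun k => c k * x k)%C (A * B).
Proof.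
  intros HA H Hx. eapply bnd_mono; [|exact (bnd_scal A _ _ HA Hx)]. intros k; simpl.
  rewrite Cmod_mult. pose proof (wgt_ge1 k). specialize (H k). pose proof (Cmod_ge_0 (x k)).
  assert (Cmod (c k) * Cmod (x k) <= A * Cmod (x k)) by (apply Rmult_le_compat_r; assumption). nra.
Qed.

Lemma wb_rtrip x y z X Y Z' : wb x X -> wb y Y -> wb z Z' ->
  bnd (fun i => wgt (fst i) * rtrip (fun j => Cmod (x j)) (fun j => Cmod (y j)) (fun j => Cmod (z j)) (fst i) (snd i))
    (X * Y * Z').
Proof.
  intros HX HY HZ.
  assert (P : forall (x : Z -> C) k, 0 <= wgt k * Cmod (x k)).
  { intros u k. pose proof (wgt_ge1 k). apply Rmult_le_pos; [lra|apply Cmod_ge_0]. }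
  eapply bnd_mono; [|exact (bnd_rtrip _ _ _ _ _ _ (P x) (P y) (P z) HX HY HZ)].
  intros [k [a b]]. unfold rtrip; simpl.
  pose proof (wgt_triple k a b) as H.
  set (q := Cmod (x (k - a)%Z) * Cmod (y (k - a - b)%Z) * Cmod (z (k - b)%Z)).
  assert (0 <= q) by (unfold q; repeat apply Rmult_le_pos; apply Cmod_ge_0).
  replace (wgt (k - a) * Cmod (x (k - a)%Z) * (wgt (k - a - b) * Cmod (y (k - a - b)%Z)) * (wgt (k - b) * Cmod (z (k - b)%Z)))
    with ((wgt (k - a) * wgt (k - a - b) * wgt (k - b)) * q) by (unfold q; ring).
  fold q. apply Rmult_le_compat_r; assumption.
Qed.

(** [Nres], [Snf] and [Qnf] are fibre sums of a family over [(k,(a,b))] with bounded coefficients, so their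
    variations are bounded by that of the family, whatever the time. *)
Lemma wb_diff_sum (F F' : Z -> Z * Z -> C) (w : Z * Z -> R) t (S S' : Z -> C) E :
  (forall ab, Rabs (w ab) <= 1) ->
  (forall k, hasum (fun ab => RtoC (w ab) * (F k ab * ph t ab))%C (S k)) ->
  (forall k, hasum (fun ab => RtoC (w ab) * (F' k ab * ph t ab))%C (S' k)) ->
  bnd (fun i => wgt (fst i) * Cmod (F (fst i) (snd i) - F' (fst i) (snd i))) E ->
  wb (fun k => S k - S' k)%C E.
Proof.
  intros Hw HS HS' HE.
  assert (K := bnd_hasum_fiber (fun i : Z * (Z * Z) => RtoC (wgt (fst i)) * (RtoC (w (snd i)) * (F (fst i) (snd i) * ph t (snd i))
     - RtoC (w (snd i)) * (F' (fst i) (snd i) * ph t (snd i))))%C (fun k => RtoC (wgt k) * (S k - S' k))%C E).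
  eapply bnd_mono; [|apply K].
  - intros k; simpl. pose proof (wgt_ge1 k). rewrite Cmod_mult, Cmod_R, (Rabs_right (wgt k)) by lra. lra.
  - eapply bnd_mono; [|exact HE]. intros [k ab]; simpl.
    pose proof (wgt_ge1 k). rewrite Cmod_mult, Cmod_R, (Rabs_right (wgt k)) by lra.
    apply Rmult_le_compat_l; [lra|].
    replace (RtoC (w ab) * (F k ab * ph t ab) - RtoC (w ab) * (F' k ab * ph t ab))%C
      with (RtoC (w ab) * ((F k ab - F' k ab) * ph t ab))%C by ring.
    rewrite !Cmod_mult, Cmod_R, ph_mod, Rmult_1_r. specialize (Hw ab).
    pose proof (Cmod_ge_0 (F k ab - F' k ab)). nra.
  - intros k; simpl. apply hasum_scal. apply hasum_minus; [apply HS|apply HS'].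
Qed.

Lemma Cmod_prod3_diff (x y z x' y' z' : C) :
  Cmod (x * Cconj y * z - x' * Cconj y' * z') <=
  Cmod (x - x') * Cmod y * Cmod z + Cmod x' * Cmod (y - y') * Cmod z + Cmod x' * Cmod y' * Cmod (z - z').
Proof.
  replace (x * Cconj y * z - x' * Cconj y' * z')%C with
    ((x - x') * Cconj y * z + x' * Cconj (y - y') * z + x' * Cconj y' * (z - z'))%C
    by (rewrite Cconj_minus; ring).
  apply Cmod_tri_le. eapply Rle_trans; [apply Rplus_le_compat_r, Cmod_triangle|].
  rewrite !Cmod_mult, !Cmod_conj. apply Rle_refl.
Qed.

Lemma wb_tri3 x y z x' y' z' a d1 d2 d3 :
  wb x' a -> wb y a -> wb y' a -> wb z a ->
  wb (fun k => x k - x' k)%C d1 -> wb (fun k => y k - y' k)%C d2 -> wb (fun k => z k - z' k)%C d3 ->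
  bnd (fun i => wgt (fst i) * Cmod (x (fst i - fst (snd i))%Z * Cconj (y (fst i - fst (snd i) - snd (snd i))%Z) * z (fst i - snd (snd i))%Z
     - x' (fst i - fst (snd i))%Z * Cconj (y' (fst i - fst (snd i) - snd (snd i))%Z) * z' (fst i - snd (snd i))%Z))
    (a ^ 2 * (d1 + d2 + d3)).
Proof.
  intros Hx' Hy Hy' Hz H1 H2 H3.
  pose proof (bnd_plus _ _ _ _ (bnd_plus _ _ _ _ (wb_rtrip _ _ _ _ _ _ H1 Hy Hz) (wb_rtrip _ _ _ _ _ _ Hx' H2 Hz))
    (wb_rtrip _ _ _ _ _ _ Hx' Hy' H3)) as K.
  eapply bnd_le; [| |exact K]; [|right; ring].
  intros [k [p q]]; unfold rtrip; simpl. rewrite <- !Rmult_plus_distr_l.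
  apply Rmult_le_compat_l; [pose proof (wgt_ge1 k); lra|]. apply Cmod_prod3_diff.
Qed.

Section TrilinearDiff.
Context (t a d : R) (A A' : Z -> C).
Context (HA : wb A a) (HA' : wb A' a) (Hd : wb (fun k => A k - A' k)%C d).

Lemma wb_trip_diff :
  bnd (fun i => wgt (fst i) * Cmod (trip A (fst i) (snd i) - trip A' (fst i) (snd i))) (3 * a ^ 2 * d).
Proof.
  eapply bnd_le; [| |exact (wb_tri3 A A A A' A' A' a d d d HA' HA HA' HA Hd Hd Hd)]; [|right; ring].
  intros [k [p q]]; apply Rle_refl.
Qed.

Lemma wb_Nres_diff : wb (fun k => Nres t A k - Nres t A' k)%C (3 * a ^ 2 * d).
Proof.
  apply (wb_diff_sum (trip A) (trip A') nz t); [apply nz_abs| | |apply wb_trip_diff];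
    intros k; apply hasum_Nres; eapply wb_asum; eassumption.
Qed.

Lemma wb_Snf_diff : wb (fun k => Snf t A k - Snf t A' k)%C (3 * a ^ 2 * d).
Proof.
  apply (wb_diff_sum (trip A) (trip A') kk t); [apply kk_le1| | |apply wb_trip_diff];
    intros k; apply hasum_Snf; eapply wb_asum; eassumption.
Qed.

Context (e : R) (E E' : Z -> C).
Context (HE : wb E a) (HE' : wb E' a) (He : wb (fun k => E k - E' k)%C e).

Lemma hasum_Qnf (A0 E0 : Z -> C) k : asum A0 -> asum E0 ->
  hasum (fun ab => RtoC (kk ab) * (dtrip A0 E0 k ab * ph t ab))%C (Qnf t A0 E0 k).
Proof.
  intros (B1 & H1) (B2 & H2). apply tsum_ok.
  set (x := fun j => Cmod (A0 j)). set (y := fun j => Cmod (E0 j)).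
  assert (Px : forall j, 0 <= x j) by (intros; apply Cmod_ge_0).
  assert (Py : forall j, 0 <= y j) by (intros; apply Cmod_ge_0).
  pose proof (bnd_plus _ _ _ _ (bnd_plus _ _ _ _ (bnd_rtrip y x x _ _ _ Py Px Px H2 H1 H1)
    (bnd_rtrip x y x _ _ _ Px Py Px H1 H2 H1)) (bnd_rtrip x x y _ _ _ Px Px Py H1 H1 H2)) as K.
  eexists. eapply bnd_mono; [|exact (bnd_fiber _ _ k K)].
  intros ab; simpl. rewrite !Cmod_mult, Cmod_R, ph_mod, Rmult_1_r.
  eapply Rle_trans; [apply Rmult_le_1; [apply Cmod_ge_0|apply kk_le1]|]. apply Cmod_dtrip.
Qed.

Lemma wb_Qnf_diff : wb (fun k => Qnf t A E k - Qnf t A' E' k)%C (3 * a ^ 2 * (e + 2 * d)).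
Proof.
  apply (wb_diff_sum (dtrip A E) (dtrip A' E') kk t); [apply kk_le1| | |];
    try (intros k; apply hasum_Qnf; eapply wb_asum; eassumption).
  pose proof (bnd_plus _ _ _ _ (bnd_plus _ _ _ _ (wb_tri3 E A A E' A' A' a e d d HE' HA HA' HA He Hd Hd)
    (wb_tri3 A E A A' E' A' a d e d HA' HE HE' HA Hd He Hd)) (wb_tri3 A A E A' A' E' a d d e HA' HA HA' HE Hd Hd He)) as K.
  eapply bnd_le; [| |exact K]; [|right; ring].
  intros [k [p q]]; simpl. rewrite <- !Rmult_plus_distr_l.
  apply Rmult_le_compat_l; [pose proof (wgt_ge1 k); lra|]. unfold dtrip; simpl.
  match goal with |- Cmod (?u1 + ?u2 + ?u3 - (?v1 + ?v2 + ?v3)) <= _ =>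
    replace (u1 + u2 + u3 - (v1 + v2 + v3))%C with ((u1 - v1) + (u2 - v2) + (u3 - v3))%C by ring end.
  apply Cmod_tri_le. apply Rplus_le_compat_r, Cmod_triangle.
Qed.

Lemma wb_cube_diff (al : Z -> C) : (forall k, Cmod (al k) <= a) ->
  wb (fun k => RtoC (Cmod (al k) ^ 2 - Cmod (A k) ^ 2) * A k - RtoC (Cmod (al k) ^ 2 - Cmod (A' k) ^ 2) * A' k)%C
    (4 * a ^ 2 * d).
Proof.
  intros Hal. assert (Ha : 0 <= a) by (eapply wb_nonneg; exact HA).
  eapply bnd_mono; [|exact (bnd_scal (4 * a ^ 2) _ _ ltac:(nra) Hd)].
  intros k; cbv beta.
  replace (4 * a ^ 2 * (wgt k * Cmod (A k - A' k))) with (wgt k * (4 * (a ^ 2 * Cmod (A k - A' k)))) by ring.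
  apply Rmult_le_compat_l; [pose proof (wgt_ge1 k); lra|].
  pose proof (wb_term _ _ k HA) as B1. pose proof (wb_term _ _ k HA') as B2. specialize (Hal k).
  set (x := Cmod (al k)) in *. assert (0 <= x) by apply Cmod_ge_0.
  pose proof (Cmod_ge_0 (A k)). pose proof (Cmod_ge_0 (A' k)).
  assert (Hr : Rabs (Cmod (A k) - Cmod (A' k)) <= Cmod (A k - A' k)).
  { apply Rabs_le. pose proof (Cmod_triangle (A k - A' k) (A' k)) as T1.
    replace (A k - A' k + A' k)%C with (A k) in T1 by ring.
    pose proof (Cmod_triangle (A' k - A k) (A k)) as T2.
    replace (A' k - A k + A k)%C with (A' k) in T2 by ring. rewrite Cmod_sub_sym in T2. lra. }
  replace (RtoC (x ^ 2 - Cmod (A k) ^ 2) * A k - RtoC (x ^ 2 - Cmod (A' k) ^ 2) * A' k)%C with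
    (RtoC (x ^ 2 - Cmod (A k) ^ 2) * (A k - A' k) - RtoC ((Cmod (A k) - Cmod (A' k)) * (Cmod (A k) + Cmod (A' k))) * A' k)%C.
  2: { replace ((Cmod (A k) - Cmod (A' k)) * (Cmod (A k) + Cmod (A' k))) with ((x ^ 2 - Cmod (A' k) ^ 2) - (x ^ 2 - Cmod (A k) ^ 2)) by ring.
       rewrite !RtoC_minus. ring. }
  unfold Cminus at 1. apply Cmod_tri_le. rewrite Cmod_opp, !Cmod_mult, !Cmod_R.
  rewrite Rabs_mult, (Rabs_right (Cmod (A k) + Cmod (A' k))) by lra.
  set (D0 := Cmod (A k - A' k)) in *. assert (0 <= D0) by apply Cmod_ge_0.
  assert (Rabs (x ^ 2 - Cmod (A k) ^ 2) <= a ^ 2) by (apply Rabs_le; nra).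
  pose proof (Rabs_pos (x ^ 2 - Cmod (A k) ^ 2)). pose proof (Rabs_pos (Cmod (A k) - Cmod (A' k))).
  assert (Rabs (Cmod (A k) - Cmod (A' k)) * (Cmod (A k) + Cmod (A' k)) <= D0 * (2 * a)) by (apply Rmult_le_compat; lra).
  assert (Rabs (Cmod (A k) - Cmod (A' k)) * (Cmod (A k) + Cmod (A' k)) * Cmod (A' k) <= D0 * (2 * a) * a).
  { apply Rmult_le_compat; try lra. apply Rmult_le_pos; lra. }
  assert (Rabs (x ^ 2 - Cmod (A k) ^ 2) * D0 <= a ^ 2 * D0) by (apply Rmult_le_compat_r; lra).
  assert (0 <= a ^ 2 * D0) by (apply Rmult_le_pos; nra).
  replace (D0 * (2 * a) * a) with (2 * (a ^ 2 * D0)) in * by ring. lra.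
Qed.
End TrilinearDiff.
End Weighted.

(** * Primitives and their limits at an end point *)

Lemma primitive_R (f : R -> R) T : 0 < T -> (forall t, 0 < t < T -> continuous f t) ->
  exists P, forall t, 0 < t < T -> is_derive P t (f t).
Proof.
  intros HT Hf. exists (fun t => RInt f (T / 2) t). intros t Ht.
  apply (is_derive_RInt f (fun t => RInt f (T / 2) t) (T / 2) t); [|apply Hf, Ht].
  assert (Hm : 0 < Rmin t (T - t)) by (apply Rmin_pos; lra).
  exists (mkposreal _ Hm). intros y Hy.
  assert (Hyr : 0 < y < T).
  { unfold ball in Hy; simpl in Hy; unfold AbsRing_ball, abs, minus, plus, opp in Hy; simpl in Hy.
    pose proof (Rlt_le_trans _ _ _ Hy (Rmin_l _ _)). pose proof (Rlt_le_trans _ _ _ Hy (Rmin_r _ _)).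
    unfold Rabs in *; destruct (Rcase_abs _); lra. }
  apply (@RInt_correct R_CompleteNormedModule). apply @ex_RInt_continuous. intros z Hz. apply Hf.
  split; [eapply Rlt_le_trans; [|apply Hz]; apply Rmin_glb_lt; lra|
          eapply Rle_lt_trans; [apply Hz|]; apply Rmax_lub_lt; lra].
Qed.

Lemma primitive_C (f : R -> C) T : 0 < T -> (forall t, 0 < t < T -> cC f t) ->
  exists P, forall t, 0 < t < T -> dC P t (f t).
Proof.
  intros HT Hf.
  destruct (primitive_R (fun x => fst (f x)) T HT) as (P1 & H1); [intros t Ht; apply (cC_continuous f t (Hf t Ht))|].
  destruct (primitive_R (fun x => snd (f x)) T HT) as (P2 & H2); [intros t Ht; apply (cC_continuous f t (Hf t Ht))|].
  exists (fun t => (P1 t, P2 t)). intros t Ht. apply dC_comp; simpl; split; [apply H1, Ht|apply H2, Ht].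
Qed.

(** [f + c x] is nondecreasing, so its infimum is its limit at [0]. *)
Lemma lip_limit_R (f : R -> R) c T : 0 < T -> 0 <= c ->
  (forall x y, 0 < x < T -> 0 < y < T -> Rabs (f y - f x) <= c * Rabs (y - x)) ->
  exists l, forall t, 0 < t < T -> Rabs (f t - l) <= c * t.
Proof.
  intros HT Hc Hl.
  set (E := fun z => exists x, 0 < x < T /\ z = - (f x + c * x)).
  assert (Hord : forall x y, 0 < x <= y -> y < T -> f y - c * (y - x) <= f x <= f y + c * (y - x)).
  { intros x y Hx Hy. specialize (Hl x y ltac:(lra) ltac:(lra)). rewrite (Rabs_right (y - x)) in Hl by lra.
    unfold Rabs in Hl; destruct (Rcase_abs _); lra. }
  assert (Hub : forall t, 0 < t < T -> forall z, E z -> z <= - (f t - c * t)).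
  { intros t Ht z (x & Hx & ->). destruct (Rle_lt_dec x t).
    - pose proof (Hord x t ltac:(lra) ltac:(lra)). nra.
    - pose proof (Hord t x ltac:(lra) ltac:(lra)). nra. }
  destruct (completeness E) as (m & Hm1 & Hm2).
  - exists (- (f (T / 2) - c * (T / 2))). intros z Hz. apply (Hub (T / 2)); [lra|assumption].
  - exists (- (f (T / 2) + c * (T / 2))), (T / 2). split; [lra|reflexivity].
  - exists (- m). intros t Ht. apply Rabs_le. split.
    + assert (- (f t + c * t) <= m) by (apply Hm1; exists t; split; [lra|reflexivity]). lra.
    + assert (m <= - (f t - c * t)) by (apply Hm2; intros z Hz; apply (Hub t Ht z Hz)). lra.
Qed.

Lemma lip_limit_C (f df : R -> C) c T : 0 < T ->
  (forall t, 0 < t < T -> dC f t (df t)) -> (forall t, 0 < t < T -> Cmod (df t) <= c) ->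
  exists l, forall t, 0 < t < T -> Cmod (f t - l) <= 2 * c * t.
Proof.
  intros HT Hd Hb.
  assert (Hc : 0 <= c) by (eapply Rle_trans; [apply Cmod_ge_0|apply (Hb (T / 2)); lra]).
  assert (L : forall x y, 0 < x < T -> 0 < y < T -> Cmod (f y - f x) <= c * Rabs (y - x))
    by (intros; apply (mvt_C_lip f df c 0 T); assumption).
  destruct (lip_limit_R (fun x => fst (f x)) c T HT Hc) as (l1 & H1).
  { intros x y Hx Hy. eapply Rle_trans; [apply (Cmod_parts (f y - f x)%C)|apply (L x y Hx Hy)]. }
  destruct (lip_limit_R (fun x => snd (f x)) c T HT Hc) as (l2 & H2).
  { intros x y Hx Hy. eapply Rle_trans; [apply (Cmod_parts (f y - f x)%C)|apply (L x y Hx Hy)]. }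
  exists (l1, l2). intros t Ht. rewrite Rmult_assoc. apply Cmod_le_parts; [apply H1|apply H2]; assumption.
Qed.

(** The constants [q] may depend on [k]: they only serve to identify the limit at [0] of finitely many
    components, the uniform bound coming from the velocities. *)
Lemma wb_displacement n (Y dY : R -> Z -> C) (z0 : Z -> C) c T :
  (forall t k, 0 < t < T -> dC (fun x => Y x k) t (dY t k)) ->
  (forall k, exists q, forall t, 0 < t < T -> Cmod (Y t k - z0 k) <= q * t) ->
  (forall t, 0 < t < T -> wb n (dY t) c) ->
  forall t, 0 < t < T -> wb n (fun k => Y t k - z0 k)%C (c * t).
Proof.
  intros Hd Hq Hb t Ht l Hl.
  apply Rle_trans with (c * t + 0); [|lra].
  apply Rnot_lt_le; intros Hc.
  set (L := rsum (fun k => wgt n k * Cmod (Y t k - z0 k)) l) in *.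
  assert (Hfin : exists Q, 0 <= Q /\ forall s, 0 < s < T -> rsum (fun k => wgt n k * Cmod (Y s k - z0 k)) l <= Q * s).
  { clear - Hq. induction l as [|k l (Q & HQ & IH)].
    - exists 0; split; [lra|]. intros; simpl; lra.
    - destruct (Hq k) as (q & Hqk). exists (wgt n k * Rabs q + Q). pose proof (wgt_ge1 n k). pose proof (Rabs_pos q).
      split; [nra|]. intros s Hs. simpl. specialize (IH s Hs). specialize (Hqk s Hs).
      assert (q * s <= Rabs q * s) by (apply Rmult_le_compat_r; [lra|apply Rle_abs]).
      assert (wgt n k * Cmod (Y s k - z0 k) <= wgt n k * (Rabs q * s)) by (apply Rmult_le_compat_l; lra). nra. }
  destruct Hfin as (Q & HQ & HQs).
  set (s := Rmin (t / 2) ((L - c * t) / (2 * (Q + 1)))).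
  assert (Hs : 0 < s) by (apply Rmin_pos; [lra|apply Rdiv_lt_0_compat; lra]).
  assert (Hst : s <= t / 2) by apply Rmin_l.
  assert (HsQ : Q * s <= (L - c * t) / 2).
  { apply Rle_trans with ((Q + 1) * ((L - c * t) / (2 * (Q + 1)))); [|right; field; lra].
    apply Rmult_le_compat; [lra|lra|lra|apply Rmin_r]. }
  assert (Hc0 : 0 <= c) by (eapply wb_nonneg, (Hb t Ht)).
  assert (D1 : rsum (fun k => Cmod (RtoC (wgt n k) * Y t k - RtoC (wgt n k) * Y s k)) l <= c * t - c * s).
  { apply (displacement_le (fun x k => RtoC (wgt n k) * Y x k)%C (fun x k => RtoC (wgt n k) * dY x k)%C
      (fun x => c * x) (fun _ => c)).
    - lra.
    - intros x k Hx _. apply dC_scal, Hd. lra.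
    - intros x _. auto_derive; [exact I|ring].
    - intros x Hx. eapply Rle_trans; [|apply (Hb x ltac:(lra) l Hl)]. apply rsum_le. intros k _.
      pose proof (wgt_ge1 n k). rewrite Cmod_mult, Cmod_R, Rabs_right by lra. lra. }
  assert (L <= (c * t - c * s) + Q * s).
  { eapply Rle_trans; [|apply Rplus_le_compat; [exact D1|apply (HQs s ltac:(lra))]].
    rewrite <- rsum_plus. apply rsum_le. intros k _.
    pose proof (wgt_ge1 n k). replace (RtoC (wgt n k) * Y t k - RtoC (wgt n k) * Y s k)%C with (RtoC (wgt n k) * (Y t k - Y s k))%C by ring.
    rewrite Cmod_mult, Cmod_R, Rabs_right by lra. rewrite <- Rmult_plus_distr_l.
    apply Rmult_le_compat_l; [lra|]. apply Cmod_tri3. }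
  nra.
Qed.

(** * Geometrically convergent sequences *)

Lemma seq_cover (F : list nat) : exists N0, forall N, (N0 <= N)%nat -> incl F (seq 0 N).
Proof.
  induction F as [|a F (N0 & H)]; [exists O; intros N _ x []|].
  exists (Nat.max (S a) N0). intros N HN x [<-|Hx]; [apply in_seq; lia|apply H; [lia|assumption]].
Qed.

Lemma bnd_geom : bnd (fun m : nat => (1 / 2) ^ m) 2.
Proof.
  intros l Hl. destruct (seq_cover l) as (N & HN). specialize (HN N (le_n N)).
  apply Rle_trans with (rsum (fun m => (1 / 2) ^ m) (seq 0 N)).
  - apply rsum_incl; auto. intros; apply pow_le; lra.
  - clear. assert (H : rsum (fun m => (1 / 2) ^ m) (seq 0 N) = 2 - 2 * (1 / 2) ^ N).
    { induction N as [|N IH]; [simpl; ring|]. rewrite seq_S, rsum_app, IH. simpl. lra. }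
    rewrite H. assert (0 <= (1 / 2) ^ N) by (apply pow_le; lra). lra.
Qed.

Lemma csum_tele (x : nat -> C) N : csum (fun m => x (S m) - x m)%C (seq 0 N) = (x N - x O)%C.
Proof.
  induction N as [|N IH]; [simpl; ring|]. rewrite seq_S, csum_app, IH. simpl. ring.
Qed.

Section Geometric.
Context (n : nat) (x : nat -> Z -> C) (c : R).
Context (Hx : forall m, wb n (fun k => x (S m) k - x m k)%C (c * (1 / 2) ^ m)).

(** The limit is written as a telescoping series so that it can be differentiated term by term. *)
Definition glim (k : Z) : C := (x O k + tsum (fun m => x (S m) k - x m k))%C.

Lemma geo_asum k : asum (fun m => x (S m) k - x m k)%C.
Proof.
  exists (c * 2). assert (Hc : 0 <= c) by (pose proof (wb_nonneg _ _ _ (Hx 0)) as K; simpl in K; lra).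
  eapply bnd_mono; [|exact (bnd_scal c _ _ Hc bnd_geom)].
  intros m; simpl. exact (wb_term n _ _ k (Hx m)).
Qed.

Lemma glim_ok k e : 0 < e -> exists N0, forall N, (N0 <= N)%nat -> Cmod (x N k - glim k) < e.
Proof.
  intros He. destruct (tsum_ok _ (geo_asum k) e He) as (F & HF). destruct (seq_cover F) as (N0 & HN0).
  exists N0. intros N HN. specialize (HF (seq 0 N) (seq_NoDup N 0) (HN0 N HN)).
  rewrite (csum_tele (fun m => x m k)) in HF. unfold glim.
  replace (x N k - (x O k + tsum (fun m => x (S m) k - x m k)))%C with
    (x N k - x O k - tsum (fun m => x (S m) k - x m k))%C by ring. exact HF.
Qed.

Lemma glim_wb (y : Z -> C) B m : (forall N, (m <= N)%nat -> wb n (fun k => x N k - y k)%C B) ->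
  wb n (fun k => glim k - y k)%C B.
Proof.
  intros H l Hl. apply Rnot_lt_le; intros Hc.
  set (L := rsum (fun k => wgt n k * Cmod (glim k - y k)) l) in *.
  assert (HW : 0 <= rsum (wgt n) l) by (apply rsum_nonneg; intros k _; pose proof (wgt_ge1 n k); lra).
  set (q := (L - B) / (2 * (1 + rsum (wgt n) l))).
  assert (Hq : 0 < q) by (apply Rdiv_lt_0_compat; lra).
  assert (HN : exists N0, forall N, (N0 <= N)%nat -> forall k, In k l -> Cmod (x N k - glim k) < q).
  { clear - Hq Hx. clearbody q. induction l as [|k l (N0 & IH)]; [exists O; intros N _ k []|].
    destruct (glim_ok k q Hq) as (N1 & H1). exists (Nat.max N0 N1). intros N HN j [<-|Hj]; [apply H1; lia|apply IH; [lia|assumption]]. }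
  destruct HN as (N0 & HN). set (N := Nat.max m N0).
  assert (K : L <= B + q * rsum (wgt n) l).
  { eapply Rle_trans; [|apply Rplus_le_compat_r, (H N ltac:(unfold N; lia) l Hl)].
    rewrite <- rsum_scal, <- rsum_plus. apply rsum_le. intros k Hk.
    specialize (HN N ltac:(unfold N; lia) k Hk). pose proof (wgt_ge1 n k).
    pose proof (Cmod_tri3 (glim k) (x N k) (y k)) as T. rewrite (Cmod_sub_sym (glim k) (x N k)) in T.
    replace (wgt n k * Cmod (x N k - y k) + q * wgt n k) with (wgt n k * (Cmod (x N k - y k) + q)) by ring.
    apply Rmult_le_compat_l; lra. }
  assert (q * rsum (wgt n) l <= (L - B) / 2).
  { apply Rle_trans with (q * (1 + rsum (wgt n) l)); [nra|]. right; unfold q; field; lra. }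
  lra.
Qed.

Lemma geo_dist m N : (m <= N)%nat -> wb n (fun k => x N k - x m k)%C (2 * c * (1 / 2) ^ m - 2 * c * (1 / 2) ^ N).
Proof.
  intros HN. induction HN as [|N HN IH].
  - intros l Hl. rewrite (rsum_ext _ (fun _ => 0)), rsum_0; [lra|]. intros k _.
    replace (x m k - x m k)%C with (RtoC 0) by ring. rewrite Cmod_0; ring.
  - replace (2 * c * (1 / 2) ^ m - 2 * c * (1 / 2) ^ S N) with ((2 * c * (1 / 2) ^ m - 2 * c * (1 / 2) ^ N) + c * (1 / 2) ^ N)
      by (simpl; field).
    apply (wb_tri n _ (fun k => x N k - x m k)%C (fun k => x (S N) k - x N k)%C); [|exact IH|apply Hx].
    intros k. rewrite Rplus_comm. apply Cmod_tri3.
Qed.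

Lemma glim_rate m : wb n (fun k => glim k - x m k)%C (2 * c * (1 / 2) ^ m).
Proof.
  apply (glim_wb _ _ m). intros N HN.
  eapply wb_up; [|exact (geo_dist m N HN)].
  assert (0 <= c) by (pose proof (wb_nonneg _ _ _ (Hx 0)) as K; simpl in K; lra).
  assert (0 <= (1 / 2) ^ N) by (apply pow_le; lra). nra.
Qed.
End Geometric.

(** * Existence for small data *)

Lemma Nres_zero t k : Nres t (fun _ => RtoC 0) k = RtoC 0.
Proof. apply tsum_eq. eapply hasum_ext; [|apply hasum_0]. intros ab; unfold trip; simpl. ring. Qed.
Lemma Snf_zero t k : Snf t (fun _ => RtoC 0) k = RtoC 0.
Proof. apply tsum_eq. eapply hasum_ext; [|apply hasum_0]. intros ab; unfold trip; simpl. ring. Qed.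
Lemma Qnf_zero t k : Qnf t (fun _ => RtoC 0) (fun _ => RtoC 0) k = RtoC 0.
Proof. apply tsum_eq. eapply hasum_ext; [|apply hasum_0]. intros ab; unfold dtrip; simpl. ring. Qed.

Lemma Qnf_scal t c A E k : asum A -> asum E -> Qnf t A (fun j => RtoC c * E j)%C k = (RtoC c * Qnf t A E k)%C.
Proof.
  intros HA HE. apply tsum_eq. eapply hasum_ext; [|apply (hasum_scal (RtoC c)), hasum_Qnf; assumption].
  intros ab; unfold dtrip; simpl. rewrite !Cmult_conj.
  replace (Cconj (RtoC c)) with (RtoC c) by (unfold Cconj, RtoC; simpl; f_equal; ring). ring.
Qed.

Lemma is_derive_mult_ln v t : 0 < t -> is_derive (fun x => v * ln x) t (v * / t).
Proof. intros Ht. auto_derive; [assumption|ring]. Qed.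

Section Picard.
Context (n : nat) (sigma T rho : R) (al : Z -> C).
Context (Hsig : Rabs sigma = 1) (HT : 0 < T) (Hrho : 0 < rho <= 1) (Hal : wb n al rho).
Context (Hsmall : 48 * rho ^ 2 * (1 + T) <= 1).

Notation th k := (sigma * (Cmod (al k) ^ 2 / (8 * PI))).
(* a bounds the iterates and r their deviation from the data relative to t; stability and contraction
   of the iteration both reduce to 12 a^2 (1 + T) <= 1 *)
Let a := 2 * rho.
Let r := 6 * a ^ 3.

(** Puts back the logarithmic phase: [B] is the unknown that has a limit at [t = 0], [rot t B] the modes. *)
Definition rot (t : R) (B : Z -> C) (k : Z) : C := (cis (- (th k) * ln t) * B k)%C.
(** [t] times the derivative of [rot t (B t)] when [E] is [t] times the derivative of [B]: velocities are
    multiplied by [t] throughout, as they are of size [1/t]. *)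
Definition rotE (t : R) (B E : Z -> C) (k : Z) : C :=
  (cis (- (th k) * ln t) * (E k - Ci * RtoC (th k) * B k))%C.
Definition cube (B : Z -> C) (k : Z) : C := (RtoC (Cmod (al k) ^ 2 - Cmod (B k) ^ 2) * B k)%C.
(** [t] times the velocity of [B] prescribed by the mode system, the resonant terms having been reduced to
    the difference of [|alpha_k|^2] and [|B_k|^2]. *)
Definition Phi (t : R) (B : Z -> C) (k : Z) : C :=
  (Ci * RtoC (sigma / (8 * PI)) * (cis (th k * ln t) * Nres t (rot t B) k + cube B k))%C.
Definition Vnf (t : R) (B : Z -> C) (k : Z) : C := Wnf sigma (th k) t (rot t B) k.
(** [Gnf] with the factor [t] absorbed in the velocity. *)
Definition Gs (t : R) (B E : Z -> C) (k : Z) : C :=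
  (cis (th k * ln t) * (RtoC (sigma / (4 * PI)) *
    ((1 + Ci * RtoC (th k)) * Snf t (rot t B) k + Qnf t (rot t B) (rotE t B E) k)))%C.

Lemma pic_th k : Rabs (th k) <= 1 / 2.
Proof.
  pose proof PI_gt_31. pose proof (wb_term n al rho k Hal). pose proof (Cmod_ge_0 (al k)).
  rewrite Rabs_mult, Hsig, Rmult_1_l, Rabs_right.
  - apply Rmult_le_reg_r with (8 * PI); [lra|]. unfold Rdiv at 1. rewrite Rmult_assoc, Rinv_l by lra. nra.
  - apply Rle_ge, Rdiv_le_0_compat; [nra|lra].
Qed.

Lemma Cmod_rot t B k : Cmod (rot t B k) = Cmod (B k).
Proof. unfold rot. rewrite Cmod_mult, cis_mod. ring. Qed.

Lemma pic_sig c : 0 < c -> Rabs (sigma / c) = / c.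
Proof. intros Hc. unfold Rdiv. rewrite Rabs_mult, Hsig, Rabs_inv, Rabs_right by lra. ring. Qed.

Lemma pic_al k : Cmod (al k) <= a.
Proof. pose proof (wb_term n al rho k Hal). unfold a; lra. Qed.

Lemma a_small : 0 < a /\ 12 * a ^ 2 * (1 + T) <= 1.
Proof. unfold a; split; [lra|]. replace (12 * (2 * rho) ^ 2) with (48 * rho ^ 2) by ring. exact Hsmall. Qed.

Section Variation.
Context (t d e : R) (B B' E E' : Z -> C).
Context (HB : wb n B a) (HB' : wb n B' a) (Hd : wb n (fun k => B k - B' k)%C d).

Lemma rot_wb X b : wb n X b -> wb n (rot t X) b.
Proof. apply wb_le; [intros k; rewrite Cmod_rot|]; apply Rle_refl. Qed.

Lemma rot_diff : wb n (fun k => rot t B k - rot t B' k)%C d.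
Proof.
  eapply wb_le; [|apply Rle_refl|exact Hd]. intros k; cbv beta. unfold rot.
  replace (cis (- (th k) * ln t) * B k - cis (- (th k) * ln t) * B' k)%C with (cis (- (th k) * ln t) * (B k - B' k))%C by ring.
  rewrite Cmod_mult, cis_mod, Rmult_1_l. apply Rle_refl.
Qed.

Lemma inv_le_small c x y : 0 <= x -> 0 < c -> x <= c * y -> / c * x <= y.
Proof.
  intros Hx Hc H. apply Rmult_le_reg_l with c; [assumption|].
  rewrite <- Rmult_assoc, Rinv_r, Rmult_1_l by lra. assumption.
Qed.

Lemma Phi_diff : wb n (fun k => Phi t B k - Phi t B' k)%C (a ^ 2 * d).
Proof.
  pose proof PI_gt_31. destruct a_small as [Ha _]. assert (Hd0 : 0 <= d) by (eapply wb_nonneg, Hd).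
  pose proof (wb_Nres_diff n t a d _ _ (rot_wb B a HB) (rot_wb B' a HB') rot_diff) as K1.
  pose proof (wb_cube_diff n a d _ _ HB HB' Hd al pic_al) as K2.
  assert (K : wb n (fun k => (cis (th k * ln t) * Nres t (rot t B) k + cube B k) - (cis (th k * ln t) * Nres t (rot t B') k + cube B' k))%C
    (3 * a ^ 2 * d + 4 * a ^ 2 * d)).
  { eapply wb_tri; [|exact K1|exact K2]. intros k; cbv beta. unfold cube.
    set (p := (RtoC (Cmod (al k) ^ 2 - Cmod (B k) ^ 2) * B k)%C). set (p' := (RtoC (Cmod (al k) ^ 2 - Cmod (B' k) ^ 2) * B' k)%C).
    replace (cis (th k * ln t) * Nres t (rot t B) k + p - (cis (th k * ln t) * Nres t (rot t B') k + p'))%C with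
      (cis (th k * ln t) * (Nres t (rot t B) k - Nres t (rot t B') k) + (p - p'))%C by ring.
    apply Cmod_tri_le. rewrite Cmod_mult, cis_mod. lra. }
  eapply wb_le; [| |eapply (wb_mul n (fun _ => Ci * RtoC (sigma / (8 * PI)))%C _ (/ (8 * PI))); [| |exact K]].
  - intros k; apply Req_le; f_equal. unfold Phi. ring.
  - apply inv_le_small; [|lra|]; assert (0 <= a ^ 2 * d) by (apply Rmult_le_pos; nra); nra.
  - left; apply Rinv_0_lt_compat; lra.
  - intros k. rewrite Cmod_mult, Cmod_Ci, Cmod_R, pic_sig by lra. lra.
Qed.

Lemma cube_diff : wb n (fun k => cube B k - cube B' k)%C (4 * a ^ 2 * d).
Proof. exact (wb_cube_diff n a d _ _ HB HB' Hd al pic_al). Qed.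

Lemma V_diff : 0 < t -> wb n (fun k => Vnf t B k - Vnf t B' k)%C (t * (a ^ 2 * d)).
Proof.
  intros Ht. pose proof PI_gt_31. destruct a_small as [Ha _]. assert (Hd0 : 0 <= d) by (eapply wb_nonneg, Hd).
  pose proof (wb_Snf_diff n t a d _ _ (rot_wb B a HB) (rot_wb B' a HB') rot_diff) as K.
  eapply wb_le; [| |eapply (wb_mul n (fun k => cis (th k * ln t) * RtoC (sigma * t / (4 * PI)))%C _ (/ (4 * PI) * t)); [| |exact K]].
  - intros k; apply Req_le; f_equal. unfold Vnf, Wnf. ring.
  - replace (/ (4 * PI) * t * (3 * a ^ 2 * d)) with (/ (4 * PI) * (t * (3 * a ^ 2 * d))) by ring.
    assert (0 <= a ^ 2 * d) by (apply Rmult_le_pos; nra).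
    assert (0 <= t * (a ^ 2 * d)) by (apply Rmult_le_pos; lra).
    apply inv_le_small; [|lra|]; nra.
  - apply Rmult_le_pos; [left; apply Rinv_0_lt_compat; lra|lra].
  - intros k. rewrite Cmod_mult, cis_mod, Cmod_R. replace (sigma * t / (4 * PI)) with (sigma / (4 * PI) * t) by (field; lra).
    rewrite Rabs_mult, pic_sig, (Rabs_right t) by lra. lra.
Qed.

Context (HE : wb n (rotE t B E) a) (HE' : wb n (rotE t B' E') a) (He : wb n (fun k => E k - E' k)%C e).

Lemma rotE_diff : wb n (fun k => rotE t B E k - rotE t B' E' k)%C (e + d).
Proof.
  eapply wb_tri; [|exact He|exact Hd]. intros k; cbv beta. unfold rotE.
  replace (cis (- (th k) * ln t) * (E k - Ci * RtoC (th k) * B k) - cis (- (th k) * ln t) * (E' k - Ci * RtoC (th k) * B' k))%C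
    with (cis (- (th k) * ln t) * ((E k - E' k) + - (Ci * RtoC (th k) * (B k - B' k))))%C by ring.
  rewrite Cmod_mult, cis_mod, Rmult_1_l. apply Cmod_tri_le. apply Rplus_le_compat_l.
  rewrite Cmod_opp, !Cmod_mult, Cmod_Ci, Cmod_R, Rmult_1_l. apply Rmult_le_1; [apply Cmod_ge_0|].
  pose proof (pic_th k). lra.
Qed.

Lemma Gs_diff : wb n (fun k => Gs t B E k - Gs t B' E' k)%C (a ^ 2 * (2 * d + e)).
Proof.
  pose proof PI_gt_31. destruct a_small as [Ha _]. assert (Hd0 : 0 <= d) by (eapply wb_nonneg, Hd).
  assert (He0 : 0 <= e) by (eapply wb_nonneg, He).
  pose proof (wb_Snf_diff n t a d _ _ (rot_wb B a HB) (rot_wb B' a HB') rot_diff) as K1.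
  pose proof (wb_Qnf_diff n t a d _ _ (rot_wb B a HB) (rot_wb B' a HB') rot_diff (e + d) _ _ HE HE' rotE_diff) as K2.
  assert (K1' : wb n (fun k => (1 + Ci * RtoC (th k)) * (Snf t (rot t B) k - Snf t (rot t B') k))%C (3 / 2 * (3 * a ^ 2 * d))).
  { apply wb_mul; [lra| |exact K1]. intros k. apply Cmod_tri_le.
    rewrite Cmod_1, Cmod_mult, Cmod_Ci, Cmod_R. pose proof (pic_th k). lra. }
  assert (K : wb n (fun k => ((1 + Ci * RtoC (th k)) * Snf t (rot t B) k + Qnf t (rot t B) (rotE t B E) k) -
     ((1 + Ci * RtoC (th k)) * Snf t (rot t B') k + Qnf t (rot t B') (rotE t B' E') k))%C
     (3 / 2 * (3 * a ^ 2 * d) + 3 * a ^ 2 * (e + d + 2 * d))).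
  { eapply wb_tri; [|exact K1'|exact K2]. intros k; cbv beta.
    match goal with |- Cmod ?z <= Cmod ?x + Cmod ?y => replace z with (x + y)%C by ring end. apply Cmod_triangle. }
  eapply wb_le; [| |eapply (wb_mul n (fun k => cis (th k * ln t) * RtoC (sigma / (4 * PI)))%C _ (/ (4 * PI))); [| |exact K]].
  - intros k; apply Req_le; f_equal. unfold Gs. ring.
  - assert (0 <= a ^ 2 * d) by (apply Rmult_le_pos; nra). assert (0 <= a ^ 2 * e) by (apply Rmult_le_pos; nra).
    apply inv_le_small; [|lra|]; nra.
  - left; apply Rinv_0_lt_compat; lra.
  - intros k. rewrite Cmod_mult, cis_mod, Cmod_R, pic_sig by lra. lra.
Qed.
End Variation.

Context (Hn : (1 <= n)%nat).

(** The class preserved by the iteration.  The deviation from the data is measured relative to [t], so that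
    the singular coefficient [1/t] of [cube] is harmless. *)
Definition good (B E : R -> Z -> C) : Prop :=
  (forall t k, 0 < t < T -> dC (fun x => B x k) t (RtoC (/ t) * E t k)%C) /\
  forall t, 0 < t < T -> wb n (fun k => B t k - al k)%C (r * t) /\ wb n (E t) r.

Lemma r_small : 0 < r /\ r <= rho /\ r * T <= rho.
Proof.
  destruct a_small as [Ha Hs]. unfold r. replace (6 * a ^ 3) with (12 * a ^ 2 * rho) by (unfold a; ring).
  assert (0 < a ^ 2) by nra. repeat split; nra.
Qed.

Lemma wb_zero b : 0 <= b -> wb n (fun _ => RtoC 0) b.
Proof.
  intros Hb l Hl. rewrite (rsum_ext _ (fun _ => 0)), rsum_0; [assumption|]. intros k _. rewrite Cmod_0; ring.
Qed.

Lemma good_base : good (fun _ => al) (fun _ _ => RtoC 0).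
Proof.
  destruct r_small as (Hr & _). split.
  - intros t k Ht. rewrite Cmult_0_r. apply dC_const.
  - intros t Ht. split; [|apply wb_zero; lra].
    eapply wb_le; [|apply Rle_refl|apply (wb_zero (r * t)); nra].
    intros k. apply Req_le; f_equal. ring.
Qed.

Section Good.
Context (B E : R -> Z -> C) (HG : good B E) (t : R) (Ht : 0 < t < T).

Lemma good_B : wb n (B t) a.
Proof.
  destruct r_small as (Hr & H1 & H2). destruct HG as [_ H]. destruct (H t Ht) as [K _].
  replace a with (rho + rho) by (unfold a; ring).
  eapply wb_up; [|refine (wb_tri n (B t) _ _ _ _ _ K Hal)]; [nra|].
  intros k; cbv beta. replace (B t k) with ((B t k - al k) + al k)%C at 1 by ring. apply Cmod_triangle.
Qed.

Lemma good_rotE : wb n (rotE t (B t) (E t)) a.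
Proof.
  destruct r_small as (Hr & H1 & H2). destruct HG as [_ H]. destruct (H t Ht) as [_ K].
  assert (KB : wb n (fun k => Ci * RtoC (th k) * B t k)%C (1 / 2 * a)).
  { apply wb_mul; [lra| |apply good_B]. intros k. rewrite Cmod_mult, Cmod_Ci, Cmod_R, Rmult_1_l. apply pic_th. }
  eapply wb_up; [|refine (wb_tri n (rotE t (B t) (E t)) _ _ _ _ _ K KB)]; [unfold a in *; lra|].
  intros k; cbv beta. unfold rotE. rewrite Cmod_mult, cis_mod, Rmult_1_l.
  unfold Cminus. apply Cmod_tri_le. rewrite Cmod_opp. apply Rle_refl.
Qed.

Lemma dC_rot k : dC (fun x => rot x (B x) k) t (RtoC (/ t) * rotE t (B t) (E t) k)%C.
Proof.
  destruct HG as [H _].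
  assert (H1 : dC (fun x => cis (- (th k) * ln x)) t (Ci * RtoC (- (th k) * / t) * cis (- (th k) * ln t))%C).
  { apply (dC_cis (fun x => - (th k) * ln x)), is_derive_mult_ln; lra. }
  pose proof (dC_mult _ _ _ _ _ H1 (H t k Ht)) as K.
  refine (dC_eq _ _ _ _ K _).
  unfold rotE. set (v := th k) in *. rewrite (RtoC_mult (- v)), RtoC_opp. ring.
Qed.
End Good.

Lemma wb_l2s (x : Z -> C) b s : 0 <= s <= INR n -> wb n x b -> bnd (l2s_term s x) (b ^ 2).
Proof.
  intros Hs H. assert (P : forall k, 0 <= wgt n k * Cmod (x k)).
  { intros k. pose proof (wgt_ge1 n k). apply Rmult_le_pos; [lra|apply Cmod_ge_0]. }
  eapply bnd_mono; [|exact (bnd_sq_l1 _ b P H)].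
  intros k; cbv beta. unfold l2s_term. rewrite Rpow_mult_distr. apply Rmult_le_compat_r; [apply pow2_ge_0|].
  fold (jap k). unfold wgt. rewrite <- pow_mult.
  pose proof (jap_ge1 k). rewrite <- Rpower_pow by lra. apply Rle_Rpower; [assumption|].
  rewrite mult_INR; simpl; lra.
Qed.

Lemma wb_US (D : R -> Prop) (f : R -> Z -> C) b : 0 <= b ->
  (forall x, D x -> wb n (f x) b) -> US D (fun x k => Cmod (f x k)).
Proof.
  intros Hb H. apply (US_l2s D f 1 b); [lra|assumption|]. intros x Hx. apply wb_l2s; [|apply H, Hx].
  split; [lra|]. apply (le_INR 1); assumption.
Qed.

Lemma good_US B E lo : good B E -> 0 < lo ->
  US (fun x => lo < x < T) (fun x k => Cmod (rot x (B x) k)) /\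
  US (fun x => lo < x < T) (fun x k => Cmod (RtoC (/ x) * rotE x (B x) (E x) k)%C).
Proof.
  intros HG Hlo. destruct a_small as [Ha _]. split.
  - apply (wb_US _ _ a); [lra|]. intros x Hx. apply rot_wb, (good_B B E HG); lra.
  - apply (wb_US _ _ (/ lo * a)).
    + apply Rmult_le_pos; [left; apply Rinv_0_lt_compat; assumption|lra].
    + intros x Hx. apply (wb_mul n (fun _ => RtoC (/ x))).
      * left; apply Rinv_0_lt_compat; assumption.
      * intros _. rewrite Cmod_R, Rabs_right by (left; apply Rinv_0_lt_compat; lra). apply Rinv_le_contravar; lra.
      * apply (good_rotE B E HG); lra.
Qed.

(** [B1] solves the system with velocity computed from [B], with the data [al] at [t = 0]. *)
Definition stepP (B B1 : R -> Z -> C) : Prop :=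
  (forall t k, 0 < t < T -> dC (fun x => B1 x k) t (RtoC (/ t) * Phi t (B t) k)%C) /\
  forall k, exists q, forall t, 0 < t < T -> Cmod (B1 t k - al k) <= q * t.

(** The velocity of [B1 - Vnf t (B t)].  The normal form has absorbed the oscillating terms, so it is bounded
    near [t = 0] and the initial condition makes sense. *)
Definition vel_nf (t : R) (B E : Z -> C) (k : Z) : C :=
  (Ci * RtoC (sigma / (8 * PI * t)) * cube B k - Gs t B E k)%C.

Lemma dC_V B E t k : good B E -> 0 < t < T ->
  dC (fun x => Vnf x (B x) k) t (RtoC (/ t) * Phi t (B t) k - vel_nf t (B t) (E t) k)%C.
Proof.
  intros HG Ht. pose proof PI_RGT_0. destruct (good_US B E (t / 2) HG ltac:(lra)) as [U1 U2].
  pose proof (dC_Wnf sigma (th k) (fun x => rot x (B x)) (fun x j => RtoC (/ x) * rotE x (B x) (E x) j)%C (t / 2) T t k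
    ltac:(lra) ltac:(lra) (fun x j Hx => dC_rot B E HG x ltac:(lra) j) U1 U2) as K.
  refine (dC_eq _ _ _ _ K _).
  unfold Gnf, vel_nf, Phi, Gs. rewrite Qnf_scal.
  2: { apply (wb_asum n _ a), rot_wb, (good_B B E HG t Ht). }
  2: { apply (wb_asum n _ a), (good_rotE B E HG t Ht). }
  replace (sigma / (8 * PI * t)) with (/ t * (sigma / (8 * PI))) by (field; lra). rewrite RtoC_mult.
  assert (Ht' : (RtoC t * RtoC (/ t) = 1)%C) by (rewrite <- RtoC_mult, Rinv_r by lra; reflexivity).
  rewrite (Cmult_assoc (RtoC t)), Ht'. ring.
Qed.

Lemma dC_cube B E t k : good B E -> 0 < t < T -> exists D, dC (fun x => cube (B x) k) t D.
Proof.
  intros [H _] Ht. pose proof (H t k Ht) as H1. eexists.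
  eapply dC_ext; [|exact (dC_mult _ _ _ _ _ (dC_minus _ _ _ _ _ (dC_const (RtoC (Cmod (al k) ^ 2)) t)
     (dC_mult _ _ _ _ _ H1 (dC_conj _ _ _ H1))) H1)].
  intros x; cbv beta. unfold cube. rewrite RtoC_minus, (Cmod2_conj (B x k)). reflexivity.
Qed.

Lemma cC_Phi B E t k : good B E -> 0 < t < T -> cC (fun x => RtoC (/ x) * Phi x (B x) k)%C t.
Proof.
  intros HG Ht. pose proof PI_RGT_0.
  assert (H1 : cC (fun x => RtoC (/ x)) t).
  { eapply dC_cC. apply (dC_RtoC (fun x => / x)). auto_derive; [lra|reflexivity]. }
  assert (H2 : cC (fun x => cis (th k * ln x)) t).
  { eapply dC_cC. apply (dC_cis (fun x => th k * ln x)), is_derive_mult_ln; lra. }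
  destruct (dC_cube B E t k HG Ht) as (D & H3). apply dC_cC in H3.
  destruct (good_US B E (t / 2) HG ltac:(lra)) as [U1 U2].
  assert (H4 : cC (fun x => Nres x (rot x (B x)) k) t).
  { apply (cC_hasum (fun x ab => RtoC (nz ab) * (trip (rot x (B x)) k ab * ph x ab))%C _ (t / 2) T).
    - lra.
    - intros ab. eapply dC_cC, dC_scal, dC_mult; [|apply dC_ph; lra].
      apply (dC_trip (fun x => rot x (B x))). intros j. apply (dC_rot B E HG t Ht).
    - intros x Hx. apply hasum_Nres, (wb_asum n _ a), rot_wb, (good_B B E HG); lra.
    - eapply US_le; [|exact (US_rtrip_k _ _ _ _ k U1 U1 U1)]. intros x ab Hx; split; [apply Cmod_ge_0|].
      rewrite !Cmod_mult, ph_mod, Cmod_R, Cmod_trip, Rmult_1_r. apply Rmult_le_1; [|apply nz_abs].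
      apply rtrip_nonneg; intros; apply Cmod_ge_0. }
  apply (cC_mult (fun x => RtoC (/ x)) (fun x => Phi x (B x) k) t H1). unfold Phi.
  apply (cC_mult (fun _ => (Ci * RtoC (sigma / (8 * PI)))%C)); [eapply dC_cC, dC_const|].
  apply (cC_plus (fun x => (cis (th k * ln x) * Nres x (rot x (B x)) k)%C) (fun x => cube (B x) k)); [|exact H3].
  apply (cC_mult (fun x => cis (th k * ln x)) (fun x => Nres x (rot x (B x)) k)); assumption.
Qed.

Lemma rot_zero t k : rot t (fun _ => RtoC 0) k = RtoC 0.
Proof. unfold rot; ring. Qed.

Lemma Vnf_zero t k : Vnf t (fun _ => RtoC 0) k = RtoC 0.
Proof.
  unfold Vnf, Wnf. replace (rot t (fun _ => RtoC 0)) with (fun _ : Z => RtoC 0); [rewrite Snf_zero; ring|].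
  apply functional_extensionality; intros j; rewrite rot_zero; reflexivity.
Qed.

Lemma rotE_zero t k : rotE t (fun _ => RtoC 0) (fun _ => RtoC 0) k = RtoC 0.
Proof. unfold rotE; ring. Qed.

Lemma Gs_zero t k : Gs t (fun _ => RtoC 0) (fun _ => RtoC 0) k = RtoC 0.
Proof.
  unfold Gs. replace (rot t (fun _ => RtoC 0)) with (fun _ : Z => RtoC 0).
  2: { apply functional_extensionality; intros j; rewrite rot_zero; reflexivity. }
  replace (rotE t (fun _ => RtoC 0) (fun _ => RtoC 0)) with (fun _ : Z => RtoC 0).
  2: { apply functional_extensionality; intros j; rewrite rotE_zero; reflexivity. }
  rewrite Snf_zero, Qnf_zero. ring.
Qed.

Lemma cube_al k : cube al k = RtoC 0.
Proof. unfold cube. rewrite Rminus_diag. ring. Qed.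

Lemma wb_minus0 (X : Z -> C) b : wb n X b -> wb n (fun k => X k - RtoC 0)%C b.
Proof. apply wb_le; [intros k; apply Req_le; f_equal; ring|apply Rle_refl]. Qed.

Lemma V_bound t B : 0 < t -> wb n B a -> wb n (Vnf t B) (t * a ^ 3).
Proof.
  intros Ht HB. destruct a_small as [Ha _].
  pose proof (V_diff t a B _ HB (wb_zero a ltac:(lra)) (wb_minus0 B a HB) Ht) as K.
  eapply wb_le; [| |exact K]; [|right; ring]. intros k; cbv beta. rewrite Vnf_zero. apply Req_le; f_equal; ring.
Qed.

Lemma Gs_bound t B E e : wb n B a -> wb n (rotE t B E) a -> wb n E e -> wb n (Gs t B E) (a ^ 2 * (2 * a + e)).
Proof.
  intros HB HE He. destruct a_small as [Ha _].
  assert (Z' : wb n (rotE t (fun _ => RtoC 0) (fun _ => RtoC 0)) a).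
  { eapply wb_le; [|apply Rle_refl|apply (wb_zero a); lra]. intros k. rewrite rotE_zero; apply Rle_refl. }
  pose proof (Gs_diff t a e B _ E _ HB (wb_zero a ltac:(lra)) (wb_minus0 B a HB) HE Z' (wb_minus0 E e He)) as K.
  eapply wb_le; [|apply Rle_refl|exact K]. intros k; cbv beta. rewrite Gs_zero. apply Req_le; f_equal; ring.
Qed.

Lemma scaled_cube t (Y : Z -> C) b : 0 < t -> 0 <= b -> wb n Y (4 * a ^ 2 * (b * t)) ->
  wb n (fun k => Ci * RtoC (sigma / (8 * PI * t)) * Y k)%C (a ^ 2 * b).
Proof.
  intros Ht Hb K. pose proof PI_gt_31. assert (0 <= a ^ 2 * b) by (apply Rmult_le_pos; [apply pow2_ge_0|lra]).
  assert (Hp : 0 < 8 * PI * t) by (apply Rmult_lt_0_compat; lra).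
  eapply wb_up; [|eapply (wb_mul n (fun _ => Ci * RtoC (sigma / (8 * PI * t)))%C _ (/ (8 * PI * t))); [| |exact K]].
  - apply inv_le_small; [nra|assumption|]. replace (8 * PI * t * (a ^ 2 * b)) with (8 * PI * (a ^ 2 * b * t)) by ring.
    replace (4 * a ^ 2 * (b * t)) with (4 * (a ^ 2 * b * t)) by ring. assert (0 <= a ^ 2 * b * t) by (apply Rmult_le_pos; lra). nra.
  - left; apply Rinv_0_lt_compat; assumption.
  - intros k. rewrite Cmod_mult, Cmod_Ci, Cmod_R, pic_sig by assumption. lra.
Qed.

(** A primitive of the velocity away from [0] minus the normal form is Lipschitz, hence has a limit at [0];
    subtracting it imposes the data. *)
Lemma step_ex B E : good B E -> exists B1, stepP B B1.
Proof.
  intros HG. destruct a_small as [Ha _]. destruct r_small as (Hr & _).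
  assert (Hk : forall k, exists b : R -> C, (forall t, 0 < t < T -> dC b t (RtoC (/ t) * Phi t (B t) k)%C) /\
     exists q, forall t, 0 < t < T -> Cmod (b t - al k) <= q * t).
  { intros k. destruct (primitive_C (fun x => RtoC (/ x) * Phi x (B x) k)%C T HT) as (P & HP);
      [intros t Ht; apply (cC_Phi B E); assumption|].
    destruct (lip_limit_C (fun x => P x - Vnf x (B x) k)%C (fun t => vel_nf t (B t) (E t) k)
      (a ^ 2 * r + a ^ 2 * (2 * a + r)) T HT) as (l & Hl).
    - intros t Ht. pose proof (dC_minus _ _ _ _ _ (HP t Ht) (dC_V B E t k HG Ht)) as K.
      refine (dC_eq _ _ _ _ K _); ring.
    - intros t Ht. destruct HG as [Hd Hb]. destruct (Hb t Ht) as [Hb1 Hb2].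
      pose proof (good_B B E (conj Hd Hb) t Ht) as HB. pose proof (good_rotE B E (conj Hd Hb) t Ht) as HE.
      assert (Hala : wb n al a) by (eapply wb_up; [|exact Hal]; unfold a; lra).
      pose proof (scaled_cube t _ r ltac:(lra) ltac:(lra) (cube_diff (r * t) (B t) al HB Hala Hb1)) as K1.
      unfold vel_nf, Cminus. apply Cmod_tri_le. rewrite Cmod_opp. apply Rplus_le_compat.
      + eapply Rle_trans; [|apply (wb_term n _ _ k K1)]. cbv beta. rewrite cube_al. apply Req_le; f_equal; ring.
      + apply (wb_term n _ _ k), (Gs_bound t (B t) (E t) r HB HE Hb2).
    - exists (fun t => (P t - l + al k)%C). split.
      + intros t Ht. pose proof (dC_plus _ _ _ _ _ (dC_minus _ _ _ _ _ (HP t Ht) (dC_const l t)) (dC_const (al k) t)) as K.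
        refine (dC_eq _ _ _ _ K _); ring.
      + exists (2 * (a ^ 2 * r + a ^ 2 * (2 * a + r)) + a ^ 3). intros t Ht.
        replace (P t - l + al k - al k)%C with ((P t - Vnf t (B t) k - l) + Vnf t (B t) k)%C by ring.
        apply Cmod_tri_le. rewrite Rmult_plus_distr_r. apply Rplus_le_compat; [apply Hl, Ht|].
        rewrite (Rmult_comm _ t). apply (wb_term n _ _ k), V_bound; [lra|]. apply (good_B B E HG t Ht). }
  destruct (choice _ Hk) as (b & Hb). exists (fun t k => b k t). split.
  - intros t k Ht. apply (proj1 (Hb k)), Ht.
  - intros k. apply (proj2 (Hb k)).
Qed.

(** Contraction by [1/2] for the distance [sup_t (|B - B'|/t, |E - E'|)]: the difference of the normal form
    variables has velocity [O(a^2 d)], and that of the normal forms is [O(a^2 d t)]. *)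
Lemma step_diff B E B1 B' E' B1' d : good B E -> good B' E' -> stepP B B1 -> stepP B' B1' ->
  (forall t, 0 < t < T -> wb n (fun k => B t k - B' t k)%C (d * t) /\ wb n (fun k => E t k - E' t k)%C d) ->
  forall t, 0 < t < T -> wb n (fun k => B1 t k - B1' t k)%C (d / 2 * t) /\
    wb n (fun k => Phi t (B t) k - Phi t (B' t) k)%C (d / 2).
Proof.
  intros HG HG' [HS HSl] [HS' HSl'] HD. destruct a_small as [Ha Hs].
  assert (Hd0 : 0 <= d) by (eapply wb_nonneg, (HD (T / 2)); lra).
  assert (Had : 0 <= a ^ 2 * d) by (apply Rmult_le_pos; [apply pow2_ge_0|assumption]).
  assert (Hsd : 12 * (a ^ 2 * d) * (1 + T) <= d).
  { replace (12 * (a ^ 2 * d) * (1 + T)) with (12 * a ^ 2 * (1 + T) * d) by ring. rewrite <- (Rmult_1_l d) at 2.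
    apply Rmult_le_compat_r; assumption. }
  assert (HadT : 0 <= a ^ 2 * d * T) by (apply Rmult_le_pos; lra).
  assert (HY : forall t, 0 < t < T -> wb n (fun k => (B1 t k - Vnf t (B t) k) - (B1' t k - Vnf t (B' t) k) - RtoC 0)%C
     (a ^ 2 * d * (2 + 2 * T) * t)).
  { apply (wb_displacement n (fun t k => (B1 t k - Vnf t (B t) k) - (B1' t k - Vnf t (B' t) k))%C
      (fun t k => vel_nf t (B t) (E t) k - vel_nf t (B' t) (E' t) k)%C (fun _ => RtoC 0)).
    - intros t k Ht.
      pose proof (dC_minus _ _ _ _ _ (dC_minus _ _ _ _ _ (HS t k Ht) (dC_V B E t k HG Ht))
        (dC_minus _ _ _ _ _ (HS' t k Ht) (dC_V B' E' t k HG' Ht))) as K.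
      refine (dC_eq _ _ _ _ K _); ring.
    - intros k. destruct (HSl k) as (q & Hq), (HSl' k) as (q' & Hq'). exists (q + q' + 2 * a ^ 3). intros t Ht.
      replace (B1 t k - Vnf t (B t) k - (B1' t k - Vnf t (B' t) k) - RtoC 0)%C with
        ((B1 t k - al k) + - (B1' t k - al k) + (- Vnf t (B t) k + Vnf t (B' t) k))%C by ring.
      pose proof (wb_term n _ _ k (V_bound t (B t) ltac:(lra) (good_B B E HG t Ht))) as V1.
      pose proof (wb_term n _ _ k (V_bound t (B' t) ltac:(lra) (good_B B' E' HG' t Ht))) as V2.
      pose proof (Cmod_triangle ((B1 t k - al k) + - (B1' t k - al k))%C (- Vnf t (B t) k + Vnf t (B' t) k)%C) as T1.
      pose proof (Cmod_triangle (B1 t k - al k) (- (B1' t k - al k)))%C as T2.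
      pose proof (Cmod_triangle (- Vnf t (B t) k) (Vnf t (B' t) k))%C as T3.
      rewrite Cmod_opp in T2, T3. specialize (Hq t Ht). specialize (Hq' t Ht). lra.
    - intros t Ht. destruct (HD t Ht) as [D1 D2].
      pose proof (good_B B E HG t Ht) as GB. pose proof (good_B B' E' HG' t Ht) as GB'.
      pose proof (scaled_cube t _ d ltac:(lra) Hd0 (cube_diff (d * t) (B t) (B' t) GB GB' D1)) as K1.
      pose proof (Gs_diff t (d * t) d _ _ _ _ GB GB' D1 (good_rotE B E HG t Ht) (good_rotE B' E' HG' t Ht) D2) as K2.
      eapply wb_up; [|refine (wb_tri n _ _ _ _ _ _ K1 K2)].
      + assert (a ^ 2 * d * t <= a ^ 2 * d * T) by (apply Rmult_le_compat_l; lra). nra.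
      + intros k; cbv beta. unfold vel_nf.
        match goal with |- Cmod ?z <= Cmod ?x + Cmod ?y => replace z with (x + - y)%C by ring end.
        rewrite <- (Cmod_opp (Gs _ _ _ _ - _)). apply Cmod_triangle. }
  intros t Ht. destruct (HD t Ht) as [D1 _].
  pose proof (good_B B E HG t Ht) as GB. pose proof (good_B B' E' HG' t Ht) as GB'.
  assert (Hdt : d * t <= d * T) by (apply Rmult_le_compat_l; lra).
  assert (Hat : 0 <= a ^ 2 * d * t) by (apply Rmult_le_pos; lra). split.
  - pose proof (V_diff t (d * t) _ _ GB GB' D1 ltac:(lra)) as K.
    eapply wb_up; [|refine (wb_tri n _ _ _ _ _ _ (HY t Ht) K)].
    + replace (t * (a ^ 2 * (d * t))) with (a ^ 2 * d * t * t) by ring.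
      assert (a ^ 2 * d * t * t <= a ^ 2 * d * T * t).
      { apply Rmult_le_compat_r; [lra|]. apply Rmult_le_compat_l; lra. }
      nra.
    + intros k; cbv beta.
      match goal with |- Cmod ?z <= Cmod ?x + Cmod ?y => replace z with (x + y)%C by ring end. apply Cmod_triangle.
  - eapply wb_up; [|exact (Phi_diff t (d * t) _ _ GB GB' D1)].
    assert (a ^ 2 * (d * t) <= a ^ 2 * (d * T)) by (apply Rmult_le_compat_l; [apply pow2_ge_0|assumption]). nra.
Qed.

(** The constant path [al] has no cubic term, so its image deviates only through the normal form. *)
Lemma step_base B1 : stepP (fun _ => al) B1 ->
  forall t, 0 < t < T -> wb n (fun k => B1 t k - al k)%C (r / 2 * t) /\ wb n (Phi t al) (r / 2).
Proof.
  intros [HS HSl]. destruct a_small as [Ha Hs]. pose proof good_base as HG.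
  assert (Hala : wb n al a) by (eapply wb_up; [|exact Hal]; unfold a; lra).
  assert (HY : forall t, 0 < t < T -> wb n (fun k => (B1 t k - Vnf t al k) - al k)%C (2 * a ^ 3 * t)).
  { apply (wb_displacement n (fun t k => B1 t k - Vnf t al k)%C (fun t k => vel_nf t al (fun _ => RtoC 0) k)).
    - intros t k Ht. pose proof (dC_minus _ _ _ _ _ (HS t k Ht) (dC_V _ _ t k HG Ht)) as K.
      refine (dC_eq _ _ _ _ K _); cbv beta; ring.
    - intros k. destruct (HSl k) as (q & Hq). exists (q + a ^ 3). intros t Ht.
      replace (B1 t k - Vnf t al k - al k)%C with ((B1 t k - al k) + - Vnf t al k)%C by ring.
      apply Cmod_tri_le. rewrite Cmod_opp.
      pose proof (wb_term n _ _ k (V_bound t al ltac:(lra) Hala)). specialize (Hq t Ht). lra.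
    - intros t Ht. pose proof (Gs_bound t al (fun _ => RtoC 0) 0 Hala (good_rotE _ _ HG t Ht) (wb_zero 0 ltac:(lra))) as K.
      eapply wb_le; [| |exact K]; [|right; ring]. intros k; cbv beta. unfold vel_nf. rewrite cube_al, <- Cmod_opp.
      apply Req_le; f_equal; ring. }
  intros t Ht. split.
  - eapply wb_up; [|refine (wb_tri n _ _ _ _ _ _ (HY t Ht) (V_bound t al ltac:(lra) Hala))].
    + right; unfold r; field.
    + intros k; cbv beta. replace (B1 t k - al k)%C with ((B1 t k - Vnf t al k - al k) + Vnf t al k)%C at 1 by ring.
      apply Cmod_triangle.
  - pose proof (Phi_diff t a al _ Hala (wb_zero a ltac:(lra)) (wb_minus0 al a Hala)) as K.
    eapply wb_le; [| |exact K].
    + intros k; cbv beta. apply Req_le; f_equal. unfold Phi.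
      replace (rot t (fun _ => RtoC 0)) with (fun _ : Z => RtoC 0)
        by (apply functional_extensionality; intros j; rewrite rot_zero; reflexivity).
      rewrite Nres_zero. unfold cube. ring.
    + unfold r. assert (0 < a ^ 3) by (apply pow_lt; lra). replace (a ^ 2 * a) with (a ^ 3) by ring. lra.
Qed.

Lemma step_good B E B1 : good B E -> stepP B B1 -> good B1 (fun t => Phi t (B t)).
Proof.
  intros HG HS. split; [exact (proj1 HS)|]. intros t Ht. destruct (step_ex _ _ good_base) as (C1 & HC1).
  destruct (step_base C1 HC1 t Ht) as [S1 S2].
  destruct (step_diff B E B1 _ _ C1 r HG good_base HS HC1) with (t := t) as [D1 D2]; [|assumption|].
  { intros x Hx. destruct HG as [_ HG]. destruct (HG x Hx) as [G1 G2]. split; [assumption|apply wb_minus0; assumption]. }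
  split.
  - eapply wb_up; [|refine (wb_tri n _ _ _ _ _ _ D1 S1)]; [right; field|].
    intros k; cbv beta. apply Cmod_tri3.
  - eapply wb_up; [|refine (wb_tri n _ _ _ _ _ _ D2 S2)]; [right; field|].
    intros k; cbv beta. replace (Phi t (B t) k) with ((Phi t (B t) k - Phi t al k) + Phi t al k)%C at 1 by ring.
    apply Cmod_triangle.
Qed.

Fixpoint Bn (m : nat) : R -> Z -> C :=
  match m with
  | O => fun _ => al
  | S m => epsilon (inhabits (fun _ => al)) (stepP (Bn m))
  end.
Definition En (m : nat) : R -> Z -> C :=
  match m with O => fun _ _ => RtoC 0 | S m => fun t => Phi t (Bn m t) end.

Lemma Bn_good m : good (Bn m) (En m) /\ stepP (Bn m) (Bn (S m)).
Proof.
  assert (K : forall m, good (Bn m) (En m) -> stepP (Bn m) (Bn (S m))).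
  { intros j HG. apply (epsilon_spec (inhabits (fun _ => al)) (stepP (Bn j))), (step_ex _ _ HG). }
  induction m as [|m [IH1 IH2]].
  - split; [apply good_base|apply K, good_base].
  - assert (HG : good (Bn (S m)) (En (S m))) by exact (step_good _ _ _ IH1 IH2). split; [exact HG|apply K, HG].
Qed.

Lemma Bn_dist m : forall t, 0 < t < T ->
  wb n (fun k => Bn (S m) t k - Bn m t k)%C (r * t * (1 / 2) ^ m) /\
  wb n (fun k => En (S m) t k - En m t k)%C (r * (1 / 2) ^ m).
Proof.
  induction m as [|m IH]; intros t Ht.
  - destruct (Bn_good 1) as [[_ H] _]. destruct (H t Ht) as [H1 H2]. simpl pow. rewrite !Rmult_1_r. split; [exact H1|].
    apply wb_minus0, H2.
  - destruct (Bn_good m) as [G1 S1], (Bn_good (S m)) as [G2 S2].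
    destruct (step_diff (Bn (S m)) (En (S m)) (Bn (S (S m))) (Bn m) (En m) (Bn (S m)) (r * (1 / 2) ^ m) G2 G1 S2 S1) with (t := t)
      as [D1 D2]; [|assumption|].
    + intros x Hx. destruct (IH x Hx) as [I1 I2]. split; [|exact I2].
      replace (r * (1 / 2) ^ m * x) with (r * x * (1 / 2) ^ m) by ring. exact I1.
    + split.
      * replace (r * t * (1 / 2) ^ S m) with (r * (1 / 2) ^ m / 2 * t) by (simpl; field). exact D1.
      * replace (r * (1 / 2) ^ S m) with (r * (1 / 2) ^ m / 2) by (simpl; field). exact D2.
Qed.

(** The iterates converge geometrically, uniformly in time together with their velocities multiplied by [t],
    and [Phi] is continuous for that convergence. *)
Theorem picard : exists B E : R -> Z -> C,
  good B E /\ forall t k, 0 < t < T -> E t k = Phi t (B t) k.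
Proof.
  destruct r_small as (Hr & Hr1 & HrT).
  set (B := fun t => glim (fun m => Bn m t)). set (E := fun t => glim (fun m => En m t)).
  exists B, E.
  assert (HB : forall t m, 0 < t < T -> wb n (fun k => B t k - Bn m t k)%C (2 * (r * t) * (1 / 2) ^ m)).
  { intros t m Ht. exact (glim_rate n (fun m => Bn m t) (r * t) (fun j => proj1 (Bn_dist j t Ht)) m). }
  assert (HE : forall t m, 0 < t < T -> wb n (fun k => E t k - En m t k)%C (2 * r * (1 / 2) ^ m)).
  { intros t m Ht. exact (glim_rate n (fun m => En m t) r (fun j => proj2 (Bn_dist j t Ht)) m). }
  assert (HG : good B E).
  { split.
    - intros t k Ht. set (g := fun x m => (RtoC (/ x) * (En (S m) x k - En m x k))%C).
      assert (HUg : US (fun x => t / 2 < x < T) (fun x m => Cmod (g x m))).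
      { apply US_le with (g := fun _ m => / (t / 2) * r * (1 / 2) ^ m).
        - intros x m Hx. split; [apply Cmod_ge_0|]. unfold g. rewrite Cmod_mult, Cmod_R, Rmult_assoc.
          assert (/ x <= / (t / 2)) by (apply Rinv_le_contravar; lra).
          assert (0 < / x) by (apply Rinv_0_lt_compat; lra). rewrite Rabs_right by lra.
          apply Rmult_le_compat; [lra|apply Cmod_ge_0|assumption|].
          apply (wb_term n _ _ k (proj2 (Bn_dist m x ltac:(lra)))).
        - assert (0 < / (t / 2)) by (apply Rinv_0_lt_compat; lra).
          assert (H0 : 0 <= / (t / 2) * r) by (apply Rmult_le_pos; lra).
          apply US_const with (B := / (t / 2) * r * 2).
          + intros m. apply Rmult_le_pos; [assumption|apply pow_le; lra].
          + apply bnd_scal; [assumption|apply bnd_geom]. }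
      assert (K : dC (fun x => tsum (fun m => Bn (S m) x k - Bn m x k)%C) t (tsum (g t))).
      { apply (dC_hasum (fun x m => Bn (S m) x k - Bn m x k)%C g _ (t / 2) T); [lra| | |exact HUg].
        - intros x m Hx. pose proof (proj1 (proj1 (Bn_good (S m))) x k ltac:(lra)) as D1.
          pose proof (proj1 (proj1 (Bn_good m)) x k ltac:(lra)) as D2.
          pose proof (dC_minus _ _ _ _ _ D1 D2) as K.
          refine (dC_eq _ _ _ _ K _); unfold g; ring.
        - intros x Hx. apply tsum_ok. apply (geo_asum n (fun m => Bn m x) (r * x) (fun j => proj1 (Bn_dist j x ltac:(lra)))). }
      pose proof (dC_plus _ _ _ _ _ (dC_const (al k) t) K) as K'.
      replace (RtoC (/ t) * E t k)%C with (0 + tsum (g t))%C; [exact K'|].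
      rewrite Cplus_0_l. apply tsum_eq. unfold E, glim, g. simpl En at 3. rewrite Cplus_0_l. apply hasum_scal, tsum_ok.
      apply (geo_asum n (fun m => En m t) r (fun j => proj2 (Bn_dist j t Ht))).
    - intros t Ht. split.
      + apply (glim_wb n (fun m => Bn m t) (r * t) (fun j => proj1 (Bn_dist j t Ht)) al (r * t) 0).
        intros N _. apply (proj2 (proj1 (Bn_good N)) t Ht).
      + eapply wb_le; [| |apply (glim_wb n (fun m => En m t) r (fun j => proj2 (Bn_dist j t Ht)) (fun _ => RtoC 0) r 0)].
        * intros k; apply Req_le; f_equal. unfold E. ring.
        * lra.
        * intros N _. apply wb_minus0, (proj2 (proj1 (Bn_good N)) t Ht). }
  split; [exact HG|]. intros t k Ht. apply Ceq_eps. intros e He.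
  destruct a_small as [Ha _].
  assert (Hlim : exists m : nat, (2 * r + a ^ 2 * (2 * (r * t))) * (1 / 2) ^ m < e).
  { set (q := 2 * r + a ^ 2 * (2 * (r * t))). assert (Hq : 0 < q).
    { assert (0 <= a ^ 2 * (2 * (r * t))) by (apply Rmult_le_pos; [apply pow2_ge_0|nra]). unfold q; lra. }
    destruct (pow_lt_1_zero (1 / 2) ltac:(rewrite Rabs_right; lra) (e / q) ltac:(apply Rdiv_lt_0_compat; lra)) as (m & Hm).
    exists m. specialize (Hm m (le_n m)). rewrite Rabs_right in Hm by (apply Rle_ge, pow_le; lra).
    apply Rlt_le_trans with (q * (e / q)); [apply Rmult_lt_compat_l; assumption|right; field; lra]. }
  destruct Hlim as (m & Hm).
  pose proof (wb_term n _ _ k (HE t (S m) Ht)) as K1.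
  assert (HBm : wb n (fun k => Bn m t k - B t k)%C (2 * (r * t) * (1 / 2) ^ m)).
  { eapply wb_le; [|apply Rle_refl|exact (HB t m Ht)]. intros j; rewrite Cmod_sub_sym; apply Rle_refl. }
  pose proof (wb_term n _ _ k (Phi_diff t _ _ _ (good_B _ _ (proj1 (Bn_good m)) t Ht) (good_B _ _ HG t Ht) HBm)) as K2.
  cbv beta in K1, K2. change (En (S m) t k) with (Phi t (Bn m t) k) in K1.
  pose proof (Cmod_tri3 (E t k) (Phi t (Bn m t) k) (Phi t (B t) k)) as K3.
  assert (0 <= (1 / 2) ^ m) by (apply pow_le; lra). simpl pow in K1. nra.
Qed.
End Picard.

Lemma mass_real (A : Z -> C) m : hasum (fun k => A k * Cconj (A k))%C m -> m = RtoC (Re m).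
Proof.
  intros H. assert (K : Cconj m = m).
  { apply (hasum_unique _ _ _ (hasum_conj _ _ H)). eapply hasum_ext; [|exact H].
    intros k; simpl. rewrite Cmult_conj, Cconj_conj. ring. }
  destruct m as [x y]. unfold Cconj in K; simpl in K. injection K as K. unfold RtoC; simpl. f_equal. lra.
Qed.

Lemma mass_hasum (a : Z -> C) b : bnd (fun k => Cmod (a k) ^ 2) b ->
  hasum (fun k => a k * Cconj (a k))%C (RtoC (mass a)) /\ 0 <= mass a /\ bnd (fun k => Cmod (a k) ^ 2) (mass a).
Proof.
  intros H. destruct (bnd_ex_zsumR (fun k => Cmod (a k) ^ 2) b (fun k => pow2_ge_0 _) H) as (Hex & _ & H0).
  split; [|split; [exact H0|]].
  - eapply hasum_ext; [|exact (zsumR_hasum _ (fun k => pow2_ge_0 _) Hex)]. intros k; cbv beta. apply Cmod2_conj.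
  - apply ex_zsumR_bnd; [intros; apply pow2_ge_0|exact Hex].
Qed.

(** Near [t = 0] the remainder is small in [l^1], hence in [l^2], and phases do not change the mass. *)
Lemma mass_initial sigma T (d : R -> Z -> R) (A D : R -> Z -> C) (al : Z -> C) (M : R) : 0 < T ->
  (forall t k, 0 < t < T -> dC (fun x => A x k) t (D t k)) ->
  (forall t k, 0 < t < T -> D t k = mode_rhs sigma t (d t) (A t) k) ->
  (forall lo, 0 < lo -> US (fun x => lo < x < T) (fun x k => Cmod (A x k))) ->
  (forall lo, 0 < lo -> US (fun x => lo < x < T) (fun x k => Cmod (D x k))) ->
  asum al -> hasum (fun k => al k * Cconj (al k))%C (RtoC M) ->
  (forall e, 0 < e -> exists d, 0 < d /\ forall t, 0 < t < d -> t < T -> bnd (rem_at sigma al A t) e) ->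
  forall t, 0 < t < T -> hasum (fun k => A t k * Cconj (A t k))%C (RtoC M).
Proof.
  intros HT Hd HD UA UD (Bal & HBal) HM Hlim t Ht.
  assert (Has : forall x, 0 < x < T -> asum (A x)).
  { intros x Hx. apply (US_asum _ A x (UA (x / 2) ltac:(lra))). lra. }
  set (m := fun x => tsum (fun k => A x k * Cconj (A x k))%C).
  assert (Hm : forall x, 0 < x < T -> hasum (fun k => A x k * Cconj (A x k))%C (m x)).
  { intros x Hx. apply tsum_ok, asum_sq, Has, Hx. }
  assert (Hconst : forall x y, 0 < x < T -> 0 < y < T -> m x = m y).
  { intros x y Hx Hy. set (lo := Rmin x y / 2).
    assert (0 < Rmin x y) by (apply Rmin_pos; lra). pose proof (Rmin_l x y). pose proof (Rmin_r x y).
    apply (mass_const sigma d A D lo T m); unfold lo; try lra.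
    - intros; apply Hd; lra.
    - intros; apply HD; lra.
    - apply UA; lra.
    - apply UD; lra.
    - intros; apply Hm; lra. }
  replace (RtoC M) with (m t); [apply Hm, Ht|]. apply Ceq_eps. intros e He.
  assert (HB0 : 0 <= Bal) by (apply (bnd_nonneg _ _ HBal)).
  set (q := Rmin 1 (e / (2 * Bal + 1))). assert (Hq : 0 < q) by (apply Rmin_pos; [lra|apply Rdiv_lt_0_compat; lra]).
  destruct (Hlim q Hq) as (dl & Hdl & Hr). set (x := Rmin dl T / 2).
  assert (0 < Rmin dl T) by (apply Rmin_pos; lra). pose proof (Rmin_l dl T). pose proof (Rmin_r dl T).
  assert (Hx : 0 < x < T) by (unfold x; lra). specialize (Hr x ltac:(unfold x; lra) ltac:(unfold x; lra)).
  rewrite (Hconst t x Ht Hx).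
  apply Rle_trans with ((2 * Bal + 1) * q).
  2: { apply Rle_trans with ((2 * Bal + 1) * (e / (2 * Bal + 1))); [apply Rmult_le_compat_l; [lra|apply Rmin_r]|right; field; lra]. }
  apply (hasum_bound _ _ _ (hasum_minus _ _ _ _ (Hm x Hx) HM)).
  eapply bnd_mono; [|exact (bnd_scal (2 * Bal + 1) _ _ ltac:(lra) Hr)].
  intros k; cbv beta. unfold rem_at. set (c := cis _). set (b := (c * A x k)%C).
  assert (Eb : (A x k * Cconj (A x k) = b * Cconj b)%C).
  { unfold b. rewrite Cmult_conj. replace (c * A x k * (Cconj c * Cconj (A x k)))%C with ((c * Cconj c) * (A x k * Cconj (A x k)))%C by ring.
    unfold c. rewrite cis_conj_r. ring. }
  rewrite Eb. replace (b * Cconj b - al k * Cconj (al k))%C with ((b - al k) * Cconj b + al k * Cconj (b - al k))%C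
    by (rewrite Cconj_minus; ring).
  apply Cmod_tri_le. rewrite !Cmod_mult, !Cmod_conj.
  pose proof (bnd_term _ _ k Hr) as K1. unfold rem_at in K1. fold c b in K1.
  pose proof (bnd_term _ _ k HBal) as K2. cbv beta in K2.
  pose proof (Cmod_triangle (b - al k) (al k)) as K3. replace (b - al k + al k)%C with b in K3 by ring.
  pose proof (Cmod_ge_0 (b - al k)). assert (q <= 1) by apply Rmin_l. nra.
Qed.

Lemma defect_mode sigma M (A D : R -> Z -> C) t k :
  defect sigma M A D t k = RtoC 0 <-> D t k = mode_rhs sigma t (fun _ => 2 * M) (A t) k.
Proof.
  unfold defect, mode_rhs. set (c := RtoC (sigma / (8 * PI * t))). set (Y := (Ncub t (A t) k - RtoC (2 * M) * A t k)%C).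
  assert (HC : (Ci * Ci = - RtoC 1)%C) by (unfold Ci, RtoC, Cmult, Copp; simpl; f_equal; ring).
  split; intros H.
  - replace (D t k) with (- (Ci * Ci) * D t k)%C by (rewrite HC; ring).
    replace (- (Ci * Ci) * D t k)%C with (- Ci * (Ci * D t k + c * Y) + Ci * c * Y)%C by ring. rewrite H. ring.
  - rewrite H. replace (Ci * (Ci * c * Y) + c * Y)%C with ((Ci * Ci + 1) * (c * Y))%C by ring. rewrite HC. ring.
Qed.

Lemma phase_sqrt sigma v t : 0 < t -> - sigma * (v / (4 * PI)) * ln (sqrt t) = - (sigma * (v / (8 * PI))) * ln t.
Proof.
  intros Ht. pose proof PI_RGT_0. assert (E : ln t = 2 * ln (sqrt t)).
  { rewrite <- (sqrt_sqrt t) at 1 by lra. assert (0 < sqrt t) by (apply sqrt_lt_R0; assumption).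
    rewrite ln_mult by assumption. ring. }
  rewrite E. field. lra.
Qed.

Section SmallData.
Context (n : nat) (sigma s gamma T rho : R) (al : Z -> C).
Context (Hn : (1 <= n)%nat) (Hsn : s <= INR n) (Hs : 1 / 2 < s) (Hgamma : 0 < gamma < 1).
Context (Hsig : Rabs sigma = 1) (HT : 0 < T) (Hrho : 0 < rho <= 1) (Hal : wb n al rho).
Context (Hsmall : 48 * rho ^ 2 * (1 + T) <= 1).

Lemma wb_norm (x : Z -> C) b : wb n x b -> in_l2s s x /\ l2s_norm s x <= b.
Proof.
  intros H. apply bnd_in_l2s; [eapply wb_nonneg, H|]. apply (wb_l2s n x b s); [lra|assumption].
Qed.

(** The second part compares with the free evolution of the data carrying their logarithmic phases: the
    remainder is [O(rho^3 t)] in [l^1]. *)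
Theorem small_data_solution : exists u, solution_from sigma s gamma al T u /\
  forall t x v, 0 < t < T ->
    hasum (fun k => cis (- (sigma * (Cmod (al k) ^ 2 / (8 * PI))) * ln t) * al k * free_delta k t x)%C v ->
    Cmod (u t x - v) <= / sqrt (4 * PI * t) * (48 * rho ^ 3 * t).
Proof.
  destruct (picard n sigma T rho al Hsig HT Hrho Hal Hsmall Hn) as (B & E & HG & HE).
  pose proof PI_RGT_0.
  set (r := 48 * rho ^ 3). assert (Hr : 0 < r) by (unfold r; apply Rmult_lt_0_compat; [lra|apply pow_lt; lra]).
  assert (HR : forall t, 0 < t < T -> wb n (fun k => B t k - al k)%C (r * t) /\ wb n (E t) r).
  { intros t Ht. destruct (proj2 HG t Ht) as [K1 K2]. unfold r.
    replace (48 * rho ^ 3) with (6 * (2 * rho) ^ 3) by ring. split; assumption. }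
  set (A := fun t => rot sigma al t (B t)).
  set (D := fun t k => (RtoC (/ t) * rotE sigma al t (B t) (E t) k)%C).
  assert (Hd : forall t k, 0 < t < T -> dC (fun x => A x k) t (D t k)).
  { intros t k Ht. exact (dC_rot n sigma T rho al B E HG t Ht k). }
  assert (UA : forall lo, 0 < lo -> US (fun x => lo < x < T) (fun x k => Cmod (A x k))).
  { intros lo Hlo. apply (good_US n sigma T rho al Hsig HT Hrho Hal Hsmall Hn B E lo HG Hlo). }
  assert (UD : forall lo, 0 < lo -> US (fun x => lo < x < T) (fun x k => Cmod (D x k))).
  { intros lo Hlo. apply (good_US n sigma T rho al Hsig HT Hrho Hal Hsmall Hn B E lo HG Hlo). }
  assert (Has : forall t, 0 < t < T -> asum (A t)).
  { intros x Hx. apply (US_asum _ A x (UA (x / 2) ltac:(lra))). lra. }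
  assert (HDm : forall t k m, 0 < t < T -> hasum (fun j => A t j * Cconj (A t j))%C m ->
     D t k = mode_rhs sigma t (fun _ => 2 * Re m) (A t) k).
  { intros t k m Ht Hm. unfold mode_rhs. rewrite (Ncub_split (A t) k t m (Has t Ht) Hm).
    rewrite RtoC_mult, <- (mass_real _ _ Hm). unfold D, rotE. rewrite (HE t k Ht). unfold Phi, cube.
    fold (A t). set (v := sigma * (Cmod (al k) ^ 2 / (8 * PI))).
    assert (Ev : v = sigma / (8 * PI) * Cmod (al k) ^ 2) by (unfold v; field; lra).
    assert (EA : (A t k * Cconj (A t k) = RtoC (Cmod (B t k) ^ 2))%C).
    { rewrite <- Cmod2_conj. unfold A. rewrite Cmod_rot. reflexivity. }
    rewrite EA. replace (A t k) with (cis (- v * ln t) * B t k)%C by reflexivity.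
    replace (cis (- v * ln t) * (Ci * RtoC (sigma / (8 * PI)) * (cis (v * ln t) * Nres t (A t) k +
       RtoC (Cmod (al k) ^ 2 - Cmod (B t k) ^ 2) * B t k) - Ci * RtoC v * B t k))%C with
     (Ci * RtoC (sigma / (8 * PI)) * ((cis (- v * ln t) * cis (v * ln t)) * Nres t (A t) k +
       cis (- v * ln t) * (RtoC (Cmod (al k) ^ 2 - Cmod (B t k) ^ 2) * B t k)) - cis (- v * ln t) * (Ci * RtoC v * B t k))%C by ring.
    rewrite <- cis_plus. replace (- v * ln t + v * ln t) with 0 by ring. rewrite cis_0.
    replace (RtoC v) with (RtoC (sigma / (8 * PI)) * RtoC (Cmod (al k) ^ 2))%C by (rewrite Ev, RtoC_mult; reflexivity).
    replace (sigma / (8 * PI * t)) with (/ t * (sigma / (8 * PI))) by (field; lra). rewrite (RtoC_mult (/ t)), RtoC_minus.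
    change (RtoC 2) with (2 : C). ring. }
  destruct (wb_norm al rho Hal) as [Hin _].
  assert (HM : hasum (fun k => al k * Cconj (al k))%C (RtoC (mass al))).
  { apply (mass_hasum al (rho ^ 2)), bnd_sq_l1; [intros; apply Cmod_ge_0|apply (wb_l1 n), Hal]. }
  assert (HBrot : forall t k, (cis (sigma * (Cmod (al k) ^ 2 / (8 * PI)) * ln t) * A t k = B t k)%C).
  { intros t k. unfold A, rot. rewrite Cmult_assoc, <- cis_plus.
    match goal with |- (cis ?z * _)%C = _ => replace z with 0 by ring end. rewrite cis_0. ring. }
  assert (Hmass : forall t, 0 < t < T -> hasum (fun k => A t k * Cconj (A t k))%C (RtoC (mass al))).
  { apply (mass_initial sigma T (fun t _ => 2 * Re (tsum (fun j => A t j * Cconj (A t j))%C)) A D al (mass al) HT Hd); auto.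
    - intros t k Ht. apply HDm; [assumption|]. apply tsum_ok, asum_sq, Has, Ht.
    - eapply wb_asum, Hal.
    - intros e He. exists (e / r). split; [apply Rdiv_lt_0_compat; lra|]. intros t Ht HtT.
      apply (wb_l1 n) with (x := fun k => (cis (sigma * (Cmod (al k) ^ 2 / (8 * PI)) * ln t) * A t k - al k)%C).
      eapply wb_le; [| |exact (proj1 (HR t ltac:(lra)))].
      + intros k; rewrite HBrot; apply Rle_refl.
      + apply Rle_trans with (r * (e / r)); [apply Rmult_le_compat_l; lra|right; field; lra]. }
  set (u := fun t x => tsum (fun k => A t k * free_delta k t x)%C).
  assert (Hu : forall t x, 0 < t < T -> hasum (fun k => A t k * free_delta k t x)%C (u t x)).
  { intros t x Ht. apply tsum_ok, asum_comb; [lra|apply Has, Ht]. }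
  exists u. split.
  - split; [exact Hin|]. split.
    + apply (nls_of_modes sigma (mass al) T A D u Hd UA UD Hu). intros t k Ht. apply defect_mode.
      rewrite (HDm t k _ Ht (Hmass t Ht)). reflexivity.
    + exists (fun t k => (B t k - al k)%C). split.
      * intros t x Ht. apply hasum_is_zsum. eapply hasum_ext; [|exact (Hu t x Ht)]. intros k; cbv beta.
        rewrite phase_sqrt by lra. unfold A, rot. ring.
      * exists (fun t k => (RtoC (/ t) * E t k)%C), (r * (1 + T) + r + 1). intros t Ht.
        destruct (HR t Ht) as [R1 R2].
        assert (R3 : wb n (fun k => RtoC (/ t) * E t k)%C (/ t * r)).
        { apply (wb_mul n (fun _ => RtoC (/ t))); [left; apply Rinv_0_lt_compat; lra| |assumption].
          intros _. rewrite Cmod_R, Rabs_right; [lra|]. left; apply Rinv_0_lt_compat; lra. }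
        destruct (wb_norm _ _ R1) as [I1 N1]. destruct (wb_norm _ _ R3) as [I2 N2].
        split; [|split; [exact I1|split; [exact I2|]]].
        { intros k. pose proof (dC_minus _ _ _ _ _ (proj1 HG t k Ht) (dC_const (al k) t)) as K.
          refine (dC_eq _ _ _ _ K _); ring. }
        assert (P1 : Rpower t (- gamma) * t <= 1 + T).
        { pose proof (Rpower_pos t (- gamma)). destruct (Rle_lt_dec 1 t).
          - assert (Rpower t (- gamma) <= Rpower t 0) by (apply Rle_Rpower; lra). rewrite Rpower_O in * by lra. nra.
          - assert (Hl : ln t < 0) by (rewrite <- ln_1; apply ln_increasing; lra).
            assert (E1 : Rpower t (- gamma) * t = exp ((1 - gamma) * ln t)).
            { unfold Rpower. rewrite <- (exp_ln t) at 2 by lra. rewrite <- exp_plus. f_equal. ring. }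
            rewrite E1. assert (exp ((1 - gamma) * ln t) <= exp 0) by (left; apply exp_increasing; nra).
            rewrite exp_0 in *. lra. }
        assert (P2 : Rpower t (- gamma) * l2s_norm s (fun k => (B t k - al k)%C) <= r * (1 + T)).
        { apply Rle_trans with (Rpower t (- gamma) * (r * t)).
          - apply Rmult_le_compat_l; [left; apply Rpower_pos|exact N1].
          - replace (Rpower t (- gamma) * (r * t)) with (r * (Rpower t (- gamma) * t)) by ring. apply Rmult_le_compat_l; lra. }
        assert (P3 : t * l2s_norm s (fun k => (RtoC (/ t) * E t k)%C) <= r).
        { apply Rle_trans with (t * (/ t * r)); [apply Rmult_le_compat_l; [lra|exact N2]|right; field; lra]. }
        cbv beta in *. lra.
  - intros t x v Ht Hv.
    apply (hasum_bound _ _ _ (hasum_minus _ _ _ _ (Hu t x Ht) Hv)).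
    assert (0 < / sqrt (4 * PI * t)) by (apply Rinv_0_lt_compat, sqrt_lt_R0, four_pi_pos; lra).
    eapply bnd_mono; [|exact (bnd_scal (/ sqrt (4 * PI * t)) _ _ ltac:(lra) (wb_l1 n _ _ (proj1 (HR t Ht))))].
    intros k; cbv beta. unfold A, rot. set (c := cis _).
    replace (c * B t k * free_delta k t x - c * al k * free_delta k t x)%C with (c * (B t k - al k) * free_delta k t x)%C by ring.
    rewrite !Cmod_mult, free_delta_mod by lra. unfold c; rewrite cis_mod. lra.
Qed.
End SmallData.

Definition two_modes (e b : R) (k : Z) : C :=
  if (k =? 0)%Z then RtoC (e * b) else if (k =? 1)%Z then RtoC e else RtoC 0.

Lemma wb_two_modes n e b : 0 < e -> 0 < b <= 1 -> wb n (two_modes e b) (e * (2 ^ n + 1)).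
Proof.
  intros He Hb.
  assert (H2 : 0 < 2 ^ n) by (apply pow_lt; lra). assert (H3 : 0 <= e * 2 ^ n) by (apply Rmult_le_pos; lra).
  pose proof (bnd_plus _ _ _ _ (bnd_scal e _ _ ltac:(lra) bnd_eq0)
    (bnd_scal (e * 2 ^ n) _ _ H3 (bnd_inj eq0 (fun k => k - 1)%Z 1 ltac:(intros x y Hxy; cbv beta in Hxy; lia) bnd_eq0))) as K.
  eapply bnd_le; [| |exact K]; [|right; ring]. intros k; cbv beta. unfold two_modes, eq0, wgt, jap.
  destruct (Z.eqb_spec k 0) as [->|Hk0]; [|destruct (Z.eqb_spec k 1) as [->|Hk1]].
  - simpl (0 - 1 =? 0)%Z. cbv iota. rewrite Rabs_R0, Rplus_0_r, pow1, Cmod_R, Rabs_right by nra. nra.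
  - simpl (1 - 1 =? 0)%Z. cbv iota. rewrite Rabs_R1, Cmod_R, Rabs_right by lra. replace (1 + 1) with 2 by ring. lra.
  - destruct (Z.eqb_spec (k - 1) 0) as [?|_]; [lia|]. rewrite Cmod_0. lra.
Qed.

Lemma hasum_two (f : Z -> C) : (forall k, k <> 0%Z -> k <> 1%Z -> f k = RtoC 0) -> hasum f (f 0%Z + f 1%Z)%C.
Proof.
  intros H.
  assert (H0 : hasum (fun k => if (k =? 0)%Z then f k else RtoC 0) (f 0%Z)).
  { apply (hasum_single (fun k => if (k =? 0)%Z then f k else RtoC 0) 0%Z). intros i Hi.
    destruct (Z.eqb_spec i 0); [lia|reflexivity]. }
  assert (H1 : hasum (fun k => if (k =? 1)%Z then f k else RtoC 0) (f 1%Z)).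
  { apply (hasum_single (fun k => if (k =? 1)%Z then f k else RtoC 0) 1%Z). intros i Hi.
    destruct (Z.eqb_spec i 1); [lia|reflexivity]. }
  pose proof (hasum_plus _ _ _ _ H0 H1) as K.
  eapply hasum_ext; [|exact K]. intros k; cbv beta.
  destruct (Z.eqb_spec k 0) as [->|Hk0]; [simpl; ring|]. destruct (Z.eqb_spec k 1) as [->|Hk1]; [ring|].
  rewrite H by assumption. ring.
Qed.

(** The mode [0] is chosen much smaller than the mode [1]: at [x = 0] the linear evolution of the former is
    then dominated by that of the latter.  The nonlinear correction is cubic in the size of the data, so it is
    negligible against the mode [1] once the data are small relative to [T]. *)
Theorem concentration sigma s gamma T : Rabs sigma = 1 -> 1 / 2 < s -> 0 < gamma < 1 -> 0 < T ->
  exists (alpha : R -> Z -> C) (u : R -> R -> R -> C),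
    (forall lambda, 0 < lambda -> in_l2s s (alpha lambda) /\ solution_from sigma s gamma (alpha lambda) T (u lambda)) /\
    is_lim (fun lambda => l2s_norm s (alpha lambda)) p_infty 0 /\
    forall t, 0 < t < T ->
      (forall lambda, 0 < lambda -> alpha lambda 0%Z <> RtoC 0) /\
      is_lim (fun lambda => Cmod (u lambda t 0 / (alpha lambda 0%Z * free_delta 0%Z t 0))%C) p_infty p_infty.
Proof.
  intros Hsig Hs Hg HT.
  destruct (INR_unbounded s) as (n0 & Hn0). set (n := S n0).
  assert (Hn : (1 <= n)%nat) by (unfold n; lia).
  assert (Hsn : s <= INR n) by (unfold n; rewrite S_INR; lra).
  set (w := 2 ^ n + 1). assert (Hw : 1 < w) by (unfold w; assert (0 < 2 ^ n) by (apply pow_lt; lra); lra).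
  (* with this c one has 48 (e w)^2 (1 + T) <= 1/(4w), so the nonlinear correction is at most e/4 *)
  set (c := 192 * w * (1 + T)). assert (Hc : 192 < c) by (unfold c; nra).
  set (e := fun l => / (c * w * (1 + l))). set (b := fun l => / (2 * (1 + l))).
  set (al := fun l => two_modes (e l) (b l)).
  assert (HP : forall l, 0 < l -> 0 < e l /\ 0 < b l <= / 2 /\ e l * w <= / (1 + l) /\ e l * w <= / c).
  { intros l Hl. unfold e, b. assert (0 < c * w) by nra.
    assert (E1 : / (c * w * (1 + l)) * w = / c * / (1 + l)) by (field; lra).
    assert (0 < / c) by (apply Rinv_0_lt_compat; lra). assert (0 < / (1 + l)) by (apply Rinv_0_lt_compat; lra).
    assert (/ c <= 1) by (rewrite <- Rinv_1; apply Rinv_le_contravar; lra).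
    assert (/ (1 + l) <= 1) by (rewrite <- Rinv_1; apply Rinv_le_contravar; lra).
    assert (0 < c * w * (1 + l)) by (apply Rmult_lt_0_compat; lra).
    rewrite E1. split; [|split; [split|split]].
    - apply Rinv_0_lt_compat; assumption.
    - apply Rinv_0_lt_compat; lra.
    - apply Rinv_le_contravar; lra.
    - nra.
    - nra. }
  assert (Hwb : forall l, 0 < l -> wb n (al l) (e l * w)).
  { intros l Hl. destruct (HP l Hl) as (H1 & H2 & _). apply wb_two_modes; lra. }
  assert (Hrho : forall l, 0 < l -> 0 < e l * w <= 1).
  { intros l Hl. destruct (HP l Hl) as (H1 & _ & H3 & _). split; [nra|]. eapply Rle_trans; [exact H3|].
    rewrite <- Rinv_1; apply Rinv_le_contravar; lra. }
  assert (Hsm : forall l, 0 < l -> 48 * (e l * w) ^ 2 * (1 + T) <= / (4 * w)).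
  { intros l Hl. destruct (HP l Hl) as (_ & _ & _ & H4). destruct (Hrho l Hl) as [H5 H6].
    apply Rle_trans with (48 * / c * (1 + T)).
    - apply Rmult_le_compat_r; [lra|]. apply Rmult_le_compat_l; [lra|]. nra.
    - right; unfold c; field; lra. }
  assert (Hex : forall l, exists u, 0 < l -> solution_from sigma s gamma (al l) T u /\
     forall t x v, 0 < t < T ->
      hasum (fun k => cis (- (sigma * (Cmod (al l k) ^ 2 / (8 * PI))) * ln t) * al l k * free_delta k t x)%C v ->
      Cmod (u t x - v) <= / sqrt (4 * PI * t) * (48 * (e l * w) ^ 3 * t)).
  { intros l. destruct (Rlt_le_dec 0 l) as [Hl|Hl]; [|exists (fun _ _ => RtoC 0); lra].
    destruct (small_data_solution n sigma s gamma T (e l * w) (al l) Hn Hsn Hs Hg Hsig HT (Hrho l Hl) (Hwb l Hl)) as (u & Hu).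
    - eapply Rle_trans; [apply Hsm, Hl|]. rewrite <- Rinv_1; apply Rinv_le_contravar; lra.
    - exists u; intros _; exact Hu. }
  destruct (choice _ Hex) as (u & Hu). exists al, u. split; [|split].
  - intros l Hl. split; [|apply (Hu l Hl)]. apply (wb_norm n s Hsn Hs _ _ (Hwb l Hl)).
  - apply is_lim_spec. intros d. exists (Rmax 0 (/ d)). intros l Hl.
    assert (Hl0 : 0 < l) by (eapply Rle_lt_trans; [apply Rmax_l|exact Hl]).
    assert (Hl1 : / d < l) by (eapply Rle_lt_trans; [apply Rmax_r|exact Hl]).
    pose proof (cond_pos d) as Hd. rewrite Rminus_0_r, Rabs_right by (apply Rle_ge, l2s_norm_nonneg).
    eapply Rle_lt_trans; [apply (wb_norm n s Hsn Hs _ _ (Hwb l Hl0))|].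
    destruct (HP l Hl0) as (_ & _ & H3 & _). eapply Rle_lt_trans; [exact H3|].
    rewrite <- (Rinv_inv d). apply Rinv_lt_contravar; [|lra].
    apply Rmult_lt_0_compat; [apply Rinv_0_lt_compat; assumption|lra].
  - intros t Ht.
    assert (Hal0 : forall l, al l 0%Z = RtoC (e l * b l)) by reflexivity.
    assert (Hal1 : forall l, al l 1%Z = RtoC (e l)) by reflexivity.
    assert (Hnz : forall l, 0 < l -> al l 0%Z <> RtoC 0).
    { intros l Hl. rewrite Hal0. destruct (HP l Hl) as (H1 & H2 & _). intros K. apply RtoC_inj in K. nra. }
    split; [exact Hnz|].
    apply is_lim_spec. intros Q. exists (Rmax 0 (2 * Q)). intros l Hl.
    assert (Hl0 : 0 < l) by (eapply Rle_lt_trans; [apply Rmax_l|exact Hl]).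
    assert (Hl1 : 2 * Q < l) by (eapply Rle_lt_trans; [apply Rmax_r|exact Hl]).
    destruct (HP l Hl0) as (H1 & H2 & _). destruct (Hu l Hl0) as [_ Hv].
    set (f := fun k => (cis (- (sigma * (Cmod (al l k) ^ 2 / (8 * PI))) * ln t) * al l k * free_delta k t 0)%C).
    assert (Hf : hasum f (f 0%Z + f 1%Z)%C).
    { apply hasum_two. intros k Hk0 Hk1. unfold f, al, two_modes.
      destruct (Z.eqb_spec k 0); [contradiction|]. destruct (Z.eqb_spec k 1); [contradiction|]. ring. }
    specialize (Hv t 0 _ Ht Hf).
    assert (Hsq : 0 < sqrt (4 * PI * t)) by (apply sqrt_lt_R0, four_pi_pos; lra).
    set (g := / sqrt (4 * PI * t)) in *. assert (Hg0 : 0 < g) by (apply Rinv_0_lt_compat; assumption).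
    assert (F0 : Cmod (f 0%Z) = e l * b l * g).
    { unfold f. rewrite !Cmod_mult, cis_mod, free_delta_mod, Hal0, Cmod_R, Rabs_right by (try lra; nra). unfold g; ring. }
    assert (F1 : Cmod (f 1%Z) = e l * g).
    { unfold f. rewrite !Cmod_mult, cis_mod, free_delta_mod, Hal1, Cmod_R, Rabs_right by (try lra; nra). unfold g; ring. }
    assert (Hz : (al l 0%Z * free_delta 0 t 0)%C <> RtoC 0).
    { intros K. apply (f_equal Cmod) in K. rewrite Cmod_mult, free_delta_mod, Hal0, Cmod_R, Rabs_right, Cmod_0 in K by (try lra; nra).
      fold g in K. assert (0 < e l * b l) by nra. nra. }
    rewrite Cmod_div by exact Hz. rewrite Cmod_mult, free_delta_mod, Hal0, Cmod_R, Rabs_right by (try lra; nra). fold g.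
    assert (Herr : 48 * (e l * w) ^ 3 * t <= e l / 4).
    { replace (48 * (e l * w) ^ 3 * t) with (48 * (e l * w) ^ 2 * t * (e l * w)) by ring.
      apply Rle_trans with (/ (4 * w) * (e l * w)); [|right; field; lra]. apply Rmult_le_compat_r; [nra|].
      eapply Rle_trans; [|apply (Hsm l Hl0)]. apply Rmult_le_compat_l; [|lra]. pose proof (pow2_ge_0 (e l * w)). lra. }
    assert (Hlow : e l * g / 4 <= Cmod (u l t 0)).
    { pose proof (Cmod_triangle (u l t 0) (- (u l t 0 - (f 0%Z + f 1%Z)) - f 0%Z)%C) as T1.
      replace (u l t 0 + (- (u l t 0 - (f 0%Z + f 1%Z)) - f 0%Z))%C with (f 1%Z) in T1 by ring.
      pose proof (Cmod_triangle (- (u l t 0 - (f 0%Z + f 1%Z))) (- f 0%Z))%C as T2. rewrite !Cmod_opp in T2.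
      fold (Cminus (- (u l t 0 - (f 0%Z + f 1%Z)))%C (f 0%Z)) in T2.
      assert (e l * b l * g <= e l * g / 2) by (assert (0 < e l * g) by nra; nra).
      assert (g * (48 * (e l * w) ^ 3 * t) <= g * (e l / 4)) by (apply Rmult_le_compat_l; lra). lra. }
    apply Rlt_le_trans with ((1 + l) / 2); [lra|].
    apply Rle_trans with (e l * g / 4 / (e l * b l * g)).
    + right. unfold b. field. repeat split; lra.
    + apply Rmult_le_compat_r; [|exact Hlow]. left; apply Rinv_0_lt_compat. assert (0 < e l * b l) by nra. nra.
Qed.

(** * Almost vanishing at rational times *)

Lemma cis_sub1 y : Cmod (cis y - 1) <= Rabs y.
Proof.
  pose proof (Rabs_pos y). pose proof (Rle_abs y). pose proof (Rle_abs (- y)) as Hy. rewrite Rabs_Ropp in Hy.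
  assert (K : Cmod (cis y - cis 0) <= 1 * Rabs (y - 0)).
  { apply (mvt_C_lip cis (fun x => Ci * RtoC 1 * cis x)%C 1 (- (Rabs y + 1)) (Rabs y + 1)); try lra.
    - intros x _. apply (dC_cis (fun x => x)). auto_derive; [exact I|reflexivity].
    - intros x _. rewrite !Cmod_mult, Cmod_Ci, cis_mod, Cmod_1. lra. }
  rewrite cis_0, Rminus_0_r, Rmult_1_l in K. exact K.
Qed.

Lemma l2s_to_l1 s : 1 / 2 < s -> exists c, 0 < c /\ forall a b, 0 <= b -> bnd (l2s_term s a) (b ^ 2) ->
  bnd (fun k => Cmod (a k)) (c * b).
Proof.
  intros Hs. pose proof (bnd_jap (2 * s) ltac:(lra)) as H.
  set (W2 := 1 + 2 * (Rpower 2 (- (2 * s)) + Rpower 2 (1 - 2 * s) / (2 * s - 1))) in *.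
  assert (HW : 1 <= W2).
  { unfold W2. pose proof (Rpower_pos 2 (- (2 * s))). pose proof (Rpower_pos 2 (1 - 2 * s)).
    assert (0 < Rpower 2 (1 - 2 * s) / (2 * s - 1)) by (apply Rdiv_lt_0_compat; lra). lra. }
  exists (sqrt W2). assert (0 < sqrt W2) by (apply sqrt_lt_R0; lra). split; [assumption|]. intros a b Hb Ha.
  eapply bnd_mono; [|apply (l2s_l1 s a b (fun _ => 1) (sqrt W2)); try assumption; try lra].
  - intros k; cbv beta. lra.
  - intros; lra.
  - rewrite pow2_sqrt by lra. eapply bnd_mono; [|exact H]. intros k; cbv beta. lra.
Qed.

Lemma weak_l2s s a : 1 / 2 < s -> forall k, jap k * Cmod (a k) ^ 2 <= l2s_term s a k.
Proof.
  intros Hs k. unfold l2s_term. apply Rmult_le_compat_r; [apply pow2_ge_0|]. fold (jap k). pose proof (jap_ge1 k).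
  rewrite <- (Rpower_1 (jap k)) at 1 by lra. apply Rle_Rpower; lra.
Qed.

(** An odd [q] is [1] or at least [3].  In the second case [ln q >= 1], so the hypothesis gives
    [e^2 sqrt q <= 1/2] and even the term [e^2 ln p], bounded by [2 e^2 sqrt p], is at most
    [sqrt (p/q)], with a small factor in front; for [q = 1] there is room to spare. *)
Lemma arithmetic_budget (p q : nat) Q e : (1 <= p)%nat -> (1 <= q)%nat -> Nat.Odd q -> INR q <= Q -> 0 < e < 1 ->
  e ^ 2 * sqrt Q * ln Q < 1 / 2 ->
  6 / 5 / INR q + 5445 / 10000 * e ^ 2 * Rabs (ln (t_pq p q)) / (8 * PI) <= sqrt (2 * INR p / INR q).
Proof.
  intros Hp Hq Hodd HQ He HeQ. pose proof PI_gt_31 as HPI. pose proof PI_4.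
  assert (Hp1 : 1 <= INR p) by (apply (le_INR 1); assumption). assert (Hq1 : 1 <= INR q) by (apply (le_INR 1); assumption).
  set (y := sqrt (INR q)). set (z := sqrt (INR p)).
  assert (Hy : 1 <= y) by (unfold y; rewrite <- sqrt_1; apply sqrt_le_1_alt; assumption).
  assert (Hz : 1 <= z) by (unfold z; rewrite <- sqrt_1; apply sqrt_le_1_alt; assumption).
  assert (Hyy : y * y = INR q) by (apply sqrt_sqrt; lra). assert (Hzz : z * z = INR p) by (apply sqrt_sqrt; lra).
  assert (Hlnle : forall w, 0 < w -> ln w <= w - 1).
  { intros w Hw. pose proof (exp_ineq1_le (ln w)) as K. rewrite exp_ln in K by assumption. lra. }
  assert (Hln0 : forall w, 1 <= w -> 0 <= ln w).
  { intros w Hw. rewrite <- ln_1. destruct (Req_dec w 1) as [->|]; [apply Rle_refl|left; apply ln_increasing; lra]. }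
  assert (Hlnp : 0 <= ln (INR p) <= 2 * z).
  { split; [apply Hln0; assumption|]. rewrite <- Hzz, ln_mult by lra. pose proof (Hlnle z ltac:(lra)). lra. }
  assert (Hln2 : 0 <= ln (2 * PI) <= 3).
  { split; [apply Hln0; lra|]. apply Rle_trans with (ln (2 * 2 * 2)).
    - destruct (Req_dec (2 * PI) (2 * 2 * 2)) as [->|]; [apply Rle_refl|left; apply ln_increasing; lra].
    - rewrite !ln_mult by lra. pose proof (Hlnle 2 ltac:(lra)). lra. }
  assert (Hlnq : 0 <= ln (INR q)) by (apply Hln0; assumption).
  assert (Ht : Rabs (ln (t_pq p q)) <= ln (INR p) + ln (INR q) + ln (2 * PI)).
  { assert (Et : ln (t_pq p q) = - ln (2 * PI) + (ln (INR p) + - ln (INR q))).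
    { assert (0 < / INR q) by (apply Rinv_0_lt_compat; lra). assert (0 < / (2 * PI)) by (apply Rinv_0_lt_compat; lra).
      unfold t_pq, Rdiv. rewrite Rmult_1_l, (ln_mult (/ (2 * PI))), (ln_mult (INR p)), !ln_Rinv; try lra.
      apply Rmult_lt_0_compat; lra. }
    rewrite Et. apply Rabs_le. lra. }
  assert (Heq : e ^ 2 * y * ln (INR q) <= 1 / 2).
  { left; eapply Rle_lt_trans; [|exact HeQ]. apply Rmult_le_compat; [|assumption| |].
    - apply Rmult_le_pos; [apply pow2_ge_0|lra].
    - apply Rmult_le_compat_l; [apply pow2_ge_0|]. apply sqrt_le_1_alt; assumption.
    - destruct (Req_dec (INR q) Q) as [->|]; [apply Rle_refl|left; apply ln_increasing; lra]. }
  assert (He2 : 0 < e ^ 2 < 1) by nra.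
  assert (Hs2 : 1414 / 1000 <= sqrt 2).
  { rewrite <- (sqrt_pow2 (1414 / 1000)) by lra. apply sqrt_le_1_alt. lra. }
  assert (Hrhs : sqrt (2 * INR p / INR q) = sqrt 2 * z / y).
  { unfold z, y. rewrite <- sqrt_mult by lra. rewrite <- sqrt_div by lra. reflexivity. }
  rewrite Hrhs.
  set (L := ln (INR p) + ln (INR q) + ln (2 * PI)) in *.
  assert (HL0 : 0 <= L) by (unfold L; lra).
  assert (Hph : 5445 / 10000 * e ^ 2 * Rabs (ln (t_pq p q)) / (8 * PI) <= 22 / 1000 * (e ^ 2 * L)).
  { apply Rmult_le_reg_r with (8 * PI); [lra|]. unfold Rdiv at 1. rewrite Rmult_assoc, Rinv_l, Rmult_1_r by lra.
    assert (e ^ 2 * Rabs (ln (t_pq p q)) <= e ^ 2 * L) by (apply Rmult_le_compat_l; lra).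
    assert (0 <= e ^ 2 * L) by (apply Rmult_le_pos; lra). nra. }
  apply Rmult_le_reg_r with y; [lra|]. replace (sqrt 2 * z / y * y) with (sqrt 2 * z) by (field; lra).
  assert (Hsz : 1414 / 1000 * z <= sqrt 2 * z) by (apply Rmult_le_compat_r; lra).
  assert (HLy : e ^ 2 * L * y = e ^ 2 * y * ln (INR q) + e ^ 2 * y * (ln (INR p) + ln (2 * PI))) by (unfold L; ring).
  assert (Hqy : 6 / 5 / INR q * y = 6 / 5 / y) by (rewrite <- Hyy; field; lra).
  assert (Hmain : 6 / 5 / y + 22 / 1000 * (1 / 2 + e ^ 2 * y * (ln (INR p) + ln (2 * PI))) <= 1414 / 1000 * z).
  { destruct (Nat.eq_dec q 1) as [Hq0|Hq0].
    - assert (y = 1) by (unfold y; rewrite Hq0; simpl; apply sqrt_1). rewrite H0 in *.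
      assert (e ^ 2 * 1 * (ln (INR p) + ln (2 * PI)) <= 1 * (2 * z + 3)) by (apply Rmult_le_compat; lra). lra.
    - assert (Hq3 : 3 <= INR q).
      { destruct Hodd as (j & Hj). replace 3 with (INR 3) by (simpl; ring). apply le_INR. lia. }
      assert (Hlq : 1 <= ln (INR q)).
      { rewrite <- (ln_exp 1). pose proof exp_le_3. pose proof (exp_pos 1).
        destruct (Req_dec (exp 1) (INR q)) as [->|]; [apply Rle_refl|left; apply ln_increasing; lra]. }
      assert (Hey : e ^ 2 * y <= 1 / 2).
      { assert (0 <= e ^ 2 * y) by (apply Rmult_le_pos; lra). nra. }
      assert (Hy3 : 17 / 10 <= y).
      { unfold y. rewrite <- (sqrt_pow2 (17 / 10)) by lra. apply sqrt_le_1_alt. lra. }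
      assert (6 / 5 / y <= 6 / 5 / (17 / 10)).
      { apply Rmult_le_compat_l; [lra|]. apply Rinv_le_contravar; lra. }
      assert (e ^ 2 * y * (ln (INR p) + ln (2 * PI)) <= 1 / 2 * (2 * z + 3)).
      { apply Rmult_le_compat; try lra. apply Rmult_le_pos; lra. }
      lra. }
  nra.
Qed.

(** * Modes of a solution *)

Section SolutionModes.
Context (sigma s gamma T : R) (al : Z -> C) (u : R -> R -> C) (Rk : R -> Z -> C).
Context (Hsig : Rabs sigma = 1) (Hs : 1 / 2 < s) (Hgamma : 0 < gamma < 1) (HT : 0 < T).
Context (Hal2 : in_l2s s al) (Hal1 : l2s_norm s al <= 1).
Context (Hnls : nls sigma (mass al) T u) (Hans : ansatz sigma T al Rk u).
Context (dRk : R -> Z -> C) (K : R).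
Context (HR : forall t, 0 < t < T ->
  (forall k, @is_derive R_AbsRing C_R_NormedModule (fun tau => Rk tau k) t (dRk t k)) /\
  in_l2s s (Rk t) /\ in_l2s s (dRk t) /\ Rpower t (- gamma) * l2s_norm s (Rk t) + t * l2s_norm s (dRk t) < K).

Notation th k := (sigma * (Cmod (al k) ^ 2 / (8 * PI))).
(** The modes read off the ansatz, and their time derivatives. *)
Definition modeA (t : R) (k : Z) : C := (cis (- (th k) * ln t) * (al k + Rk t k))%C.
Definition modeD (t : R) (k : Z) : C :=
  (cis (- (th k) * ln t) * (dRk t k - Ci * RtoC (th k * / t) * (al k + Rk t k)))%C.

Lemma sm_K : 0 < K.
Proof.
  destruct (HR (T / 2) ltac:(lra)) as (_ & _ & _ & H). pose proof (Rpower_pos (T / 2) (- gamma)).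
  pose proof (l2s_norm_nonneg s (Rk (T / 2))). pose proof (l2s_norm_nonneg s (dRk (T / 2))). nra.
Qed.

Lemma sm_R t : 0 < t < T -> bnd (l2s_term s (Rk t)) ((K * Rpower t gamma) ^ 2).
Proof.
  intros Ht. destruct (HR t Ht) as (_ & H & _ & HK).
  eapply bnd_le; [intros k; apply Rle_refl| |exact (in_l2s_bnd s _ H)].
  pose proof (l2s_norm_nonneg s (Rk t)). pose proof (l2s_norm_nonneg s (dRk t)). pose proof (Rpower_pos t gamma).
  apply pow_incr; split; [assumption|].
  assert (E : Rpower t (- gamma) * Rpower t gamma = 1).
  { rewrite <- Rpower_plus. replace (- gamma + gamma) with 0 by ring. apply Rpower_O; lra. }
  replace (l2s_norm s (Rk t)) with (Rpower t (- gamma) * l2s_norm s (Rk t) * Rpower t gamma)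
    by (rewrite Rmult_assoc, (Rmult_comm (l2s_norm _ _)), <- Rmult_assoc, E; ring).
  apply Rmult_le_compat_r; [lra|]. assert (0 <= t * l2s_norm s (dRk t)) by (apply Rmult_le_pos; lra). lra.
Qed.

Lemma sm_dR t : 0 < t < T -> bnd (l2s_term s (dRk t)) ((K * / t) ^ 2).
Proof.
  intros Ht. destruct (HR t Ht) as (_ & _ & H & HK).
  eapply bnd_le; [intros k; apply Rle_refl| |exact (in_l2s_bnd s _ H)].
  pose proof (l2s_norm_nonneg s (Rk t)). pose proof (l2s_norm_nonneg s (dRk t)). pose proof (Rpower_pos t (- gamma)).
  apply pow_incr; split; [assumption|]. assert (0 < / t) by (apply Rinv_0_lt_compat; lra).
  replace (l2s_norm s (dRk t)) with (t * l2s_norm s (dRk t) * / t) by (field; lra).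
  apply Rmult_le_compat_r; [lra|]. assert (0 <= Rpower t (- gamma) * l2s_norm s (Rk t)) by (apply Rmult_le_pos; lra). lra.
Qed.

Lemma sm_th k : Rabs (th k) <= 1.
Proof.
  pose proof PI_gt_31.
  assert (Hk : Cmod (al k) ^ 2 <= 1).
  { pose proof (bnd_term _ _ k (in_l2s_bnd s al Hal2)) as H1. pose proof (weak_l2s s al Hs k). pose proof (jap_ge1 k).
    pose proof (l2s_norm_nonneg s al). pose proof (pow2_ge_0 (Cmod (al k))). nra. }
  pose proof (pow2_ge_0 (Cmod (al k))).
  rewrite Rabs_mult, Hsig, Rmult_1_l, Rabs_right by (apply Rle_ge, Rdiv_le_0_compat; lra).
  apply Rmult_le_reg_r with (8 * PI); [lra|]. unfold Rdiv. rewrite Rmult_assoc, Rinv_l by lra. lra.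
Qed.

Lemma sm_USal (D : R -> Prop) : US D (fun _ k => Cmod (al k)).
Proof.
  apply (US_l2s D (fun _ => al) s (l2s_norm s al)); [assumption|apply l2s_norm_nonneg|]. intros _ _. apply in_l2s_bnd, Hal2.
Qed.

Lemma sm_USB lo : 0 < lo -> US (fun x => lo < x < T) (fun x k => Cmod (al k) + Cmod (Rk x k)).
Proof.
  intros Hlo. apply US_plus; [apply sm_USal|].
  pose proof sm_K. pose proof (Rpower_pos T gamma).
  apply (US_l2s _ Rk s (K * Rpower T gamma)); [assumption|nra|]. intros x Hx.
  eapply bnd_le; [intros k; apply Rle_refl| |apply sm_R; lra]. pose proof (Rpower_pos x gamma).
  apply pow_incr; split; [nra|]. apply Rmult_le_compat_l; [lra|]. apply Rle_Rpower_l; lra.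
Qed.

Lemma sm_UA lo : 0 < lo -> US (fun x => lo < x < T) (fun x k => Cmod (modeA x k)).
Proof.
  intros Hlo. eapply US_le; [|apply sm_USB, Hlo]. intros x k _. split; [apply Cmod_ge_0|].
  unfold modeA. rewrite Cmod_mult, cis_mod, Rmult_1_l. apply Cmod_triangle.
Qed.

Lemma sm_UD lo : 0 < lo -> US (fun x => lo < x < T) (fun x k => Cmod (modeD x k)).
Proof.
  intros Hlo. pose proof sm_K. assert (Hli : 0 < / lo) by (apply Rinv_0_lt_compat; assumption).
  assert (U1 : US (fun x => lo < x < T) (fun x k => Cmod (dRk x k))).
  { apply (US_l2s _ dRk s (K * / lo)); [assumption|nra|]. intros x Hx.
    eapply bnd_le; [intros k; apply Rle_refl| |apply sm_dR; lra].
    assert (0 < / x) by (apply Rinv_0_lt_compat; lra). assert (/ x <= / lo) by (apply Rinv_le_contravar; lra).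
    apply pow_incr; split; nra. }
  eapply US_le; [|exact (US_plus _ _ _ U1 (US_scal _ (/ lo) _ ltac:(lra) (sm_USB lo Hlo)))].
  intros x k Hx. split; [apply Cmod_ge_0|]. unfold modeD. rewrite Cmod_mult, cis_mod, Rmult_1_l.
  unfold Cminus. apply Cmod_tri_le. rewrite Cmod_opp. apply Rplus_le_compat_l.
  rewrite !Cmod_mult, Cmod_Ci, Cmod_R, Rmult_1_l. apply Rmult_le_compat; try apply Rabs_pos; [apply Cmod_ge_0| |apply Cmod_triangle].
  assert (0 < / x) by (apply Rinv_0_lt_compat; lra). assert (/ x <= / lo) by (apply Rinv_le_contravar; lra).
  rewrite Rabs_mult, (Rabs_right (/ x)) by lra. pose proof (sm_th k). pose proof (Rabs_pos (th k)). nra.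
Qed.

Lemma sm_d t k : 0 < t < T -> dC (fun x => modeA x k) t (modeD t k).
Proof.
  intros Ht. pose proof (proj1 (HR t Ht) k) as H0.
  assert (H1 : dC (fun x => cis (- (th k) * ln x)) t (Ci * RtoC (- (th k) * / t) * cis (- (th k) * ln t))%C).
  { apply (dC_cis (fun x => - (th k) * ln x)), is_derive_mult_ln; lra. }
  pose proof (dC_mult _ _ _ _ _ H1 (dC_plus _ _ _ _ _ (dC_const (al k) t) H0)) as Q.
  refine (dC_eq _ _ _ _ Q _).
  unfold modeD. set (v := th k) in *. replace (- v * / t) with (- (v * / t)) by ring. rewrite RtoC_opp. ring.
Qed.

Lemma sm_rem t k : rem_at sigma al modeA t k = Cmod (Rk t k).
Proof.
  unfold rem_at, modeA. rewrite Cmult_assoc, <- cis_plus.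
  match goal with |- Cmod (cis ?z * _ - _) = _ => replace z with 0 by ring end. rewrite cis_0. f_equal. ring.
Qed.

Lemma sm_u t x : 0 < t < T -> hasum (fun k => modeA t k * free_delta k t x)%C (u t x).
Proof.
  intros Ht. apply is_zsum_hasum.
  - apply asum_comb; [lra|]. apply (US_asum _ modeA t (sm_UA (t / 2) ltac:(lra))). lra.
  - pose proof (Hans t x Ht) as Q. replace (fun k => (modeA t k * free_delta k t x)%C) with
      (fun k => (cis (- sigma * (Cmod (al k) ^ 2 / (4 * PI)) * ln (sqrt t)) * (al k + Rk t k) * free_delta k t x)%C); [exact Q|].
    apply functional_extensionality; intros k. rewrite phase_sqrt by lra. reflexivity.
Qed.

Lemma sm_D t k : 0 < t < T -> modeD t k = mode_rhs sigma t (fun _ => 2 * mass al) (modeA t) k.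
Proof.
  intros Ht. apply defect_mode.
  exact (modes_of_nls sigma (mass al) T modeA modeD u sm_d sm_UA sm_UD sm_u Hnls t k Ht).
Qed.

Lemma sm_lim e : 0 < e -> exists d, 0 < d /\ forall t, 0 < t < d -> t < T -> bnd (rem_at sigma al modeA t) e.
Proof.
  intros He. destruct (l2s_to_l1 s Hs) as (c & Hc & Hl1). pose proof sm_K as HK.
  assert (HcK : 0 < c * K) by nra. assert (Hq : 0 < e / (c * K)) by (apply Rdiv_lt_0_compat; lra).
  exists (Rpower (e / (c * K)) (/ gamma)). split; [apply Rpower_pos|]. intros t Ht HtT.
  assert (Hb : bnd (fun k => Cmod (Rk t k)) (c * (K * Rpower t gamma))).
  { apply Hl1; [pose proof (Rpower_pos t gamma); nra|apply sm_R; lra]. }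
  eapply bnd_le; [intros k; rewrite sm_rem; apply Rle_refl| |exact Hb].
  assert (Rpower t gamma <= e / (c * K)).
  { replace (e / (c * K)) with (Rpower (Rpower (e / (c * K)) (/ gamma)) gamma).
    - apply Rle_Rpower_l; lra.
    - rewrite Rpower_mult, Rinv_l, Rpower_1 by lra. reflexivity. }
  apply Rle_trans with (c * K * (e / (c * K))); [|right; field; lra]. rewrite <- Rmult_assoc. apply Rmult_le_compat_l; lra.
Qed.

(** The [l^{2,s}] bound on the derivative of the remainder controls its [l^1] norm, as [s > 1/2]. *)
Lemma sm_lip lo : 0 < lo -> exists L, forall x y, lo < x < T -> lo < y < T ->
  bnd (fun k => Cmod (cis (th k * ln y) * modeA y k - cis (th k * ln x) * modeA x k)) (L * Rabs (y - x)).
Proof.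
  intros Hlo. destruct (l2s_to_l1 s Hs) as (c & Hc & Hl1). pose proof sm_K as HK.
  assert (Hli : 0 < / lo) by (apply Rinv_0_lt_compat; assumption).
  exists (c * (K * / lo)).
  assert (HB : forall t k, (cis (th k * ln t) * modeA t k = al k + Rk t k)%C).
  { intros t k. unfold modeA. rewrite Cmult_assoc, <- cis_plus.
    match goal with |- (cis ?z * _)%C = _ => replace z with 0 by ring end. rewrite cis_0. ring. }
  assert (Hord : forall x y, lo < x -> x <= y -> y < T -> bnd (fun k => Cmod (Rk y k - Rk x k)) (c * (K * / lo) * (y - x))).
  { intros x y Hx Hxy Hy l Hl.
    replace (c * (K * / lo) * (y - x)) with (c * (K * / lo) * y - c * (K * / lo) * x) by ring.
    apply (displacement_le Rk dRk (fun t => c * (K * / lo) * t) (fun _ => c * (K * / lo))); [assumption| | |].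
    - intros t k Ht _. apply (proj1 (HR t ltac:(lra)) k).
    - intros t _. auto_derive; [exact I|ring].
    - intros t Ht. eapply Rle_trans; [apply (Hl1 (dRk t) (K * / t)); [|apply sm_dR; lra|assumption]|].
      + apply Rmult_le_pos; [lra|left; apply Rinv_0_lt_compat; lra].
      + apply Rmult_le_compat_l; [lra|]. apply Rmult_le_compat_l; [lra|]. apply Rinv_le_contravar; lra. }
  intros x y Hx Hy.
  assert (HE : forall k, Cmod (cis (th k * ln y) * modeA y k - cis (th k * ln x) * modeA x k) = Cmod (Rk y k - Rk x k)).
  { intros k. rewrite !HB. f_equal. ring. }
  destruct (Rle_lt_dec x y) as [Hxy|Hxy].
  - rewrite Rabs_right by lra. eapply bnd_le; [intros k; rewrite HE; apply Rle_refl|apply Rle_refl|apply Hord; lra].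
  - rewrite Rabs_left by lra. replace (- (y - x)) with (x - y) by ring.
    eapply bnd_le; [intros k; rewrite HE, Cmod_sub_sym; apply Rle_refl|apply Rle_refl|apply Hord; lra].
Qed.
End SolutionModes.

(** The free evolution of the data vanishes at the point, so [u] is the sum of the remainder, bounded by
    [6/5 eps/q] in [l^1], and of the effect of the logarithmic phases. *)
Theorem almost_vanishing sigma p Q eps s gamma eta u0hat alpha T u q x :
  Rabs sigma = 1 -> (1 <= p)%nat -> 0 < eps < 1 -> eps ^ 2 * sqrt Q * ln Q < 1 / 2 ->
  1 / 2 < s -> 0 < gamma < 1 ->
  periodic_2pi u0hat -> located_mod_2pi u0hat (eta * (PI / INR p)) ->
  has_fourier_coefficients u0hat alpha -> l2s_norm s alpha <= eps ->
  solution_from sigma s gamma alpha T u ->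
  (1 <= q)%nat -> INR q <= Q -> Nat.Odd q -> t_pq p q < T ->
  (forall m : Z, eta / INR q < Rabs (x - IZR m / INR q)) ->
  Cmod (u (t_pq p q) x) <= eps.
Proof.
  intros Hsig Hp Heps HQ Hs Hg Hper (r' & Hr' & Hloc) Hfc Hnorm (Hal2 & Hnls & Rk & Hans & dRk & K & HR) Hq HqQ Hodd HtT Hx.
  pose proof PI_gt_31 as HPI.
  assert (Hp1 : 1 <= INR p) by (apply (le_INR 1); assumption). assert (Hq1 : 1 <= INR q) by (apply (le_INR 1); assumption).
  assert (Hiq : 0 < / INR q) by (apply Rinv_0_lt_compat; lra). assert (Hip : 0 < / INR p) by (apply Rinv_0_lt_compat; lra).
  set (t := t_pq p q) in *.
  assert (Htv : t = INR p / (2 * PI) * / INR q) by (unfold t, t_pq; field; lra).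
  assert (Hpp : 0 < INR p / (2 * PI)) by (apply Rdiv_lt_0_compat; lra).
  assert (Ht0 : 0 < t) by (rewrite Htv; apply Rmult_lt_0_compat; lra).
  assert (HT : 0 < T) by lra. assert (Ht : 0 < t < T) by lra.
  (* every point is within 1/(2q) of a multiple of 1/q *)
  assert (Heta : eta < 1 / 2).
  { destruct (nearest_int (x * INR q)) as (j & Hj). specialize (Hx j).
    replace (x - IZR j / INR q) with ((x * INR q - IZR j) * / INR q) in Hx by (field; lra).
    rewrite Rabs_mult, (Rabs_right (/ INR q)) in Hx by lra.
    apply Rmult_lt_reg_r with (/ INR q); [assumption|]. eapply Rlt_le_trans; [exact Hx|]. apply Rmult_le_compat_r; lra. }
  assert (Hr2 : 2 * r' < PI / INR p).
  { assert (eta * (PI / INR p) <= 1 / 2 * (PI / INR p)); [|lra]. apply Rmult_le_compat_r; [apply Rlt_le, Rdiv_lt_0_compat|]; lra. }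
  assert (Hasal : asum alpha).
  { apply (US_asum (fun _ : R => True) (fun _ => alpha) 0); [|exact I]. apply (sm_USal s alpha Hs Hal2). }
  assert (Hlin : hasum (fun k => alpha k * free_delta k t x)%C (RtoC 0)).
  { apply (linear_vanish u0hat alpha p q r' x Hp Hq Hper Hloc Hasal Hfc). intros m.
    eapply Rlt_trans; [apply Hr'|]. specialize (Hx m).
    replace (eta * (PI / INR p)) with (PI * INR q / INR p * (eta / INR q)) by (field; lra).
    apply Rmult_lt_compat_l; [|exact Hx]. apply Rdiv_lt_0_compat; [apply Rmult_lt_0_compat; lra|lra]. }
  assert (HX : bnd (fun k => jap k * Cmod (alpha k) ^ 2) (eps ^ 2)).
  { eapply bnd_le; [apply (weak_l2s s alpha Hs)| |apply (in_l2s_bnd s alpha Hal2)].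
    apply pow_incr; split; [apply l2s_norm_nonneg|assumption]. }
  destruct (mass_hasum alpha (eps ^ 2)) as (HM & HM0 & HMb).
  { eapply bnd_mono; [|exact HX]. intros k; cbv beta. pose proof (jap_ge1 k). pose proof (pow2_ge_0 (Cmod (alpha k))). nra. }
  assert (Hbud : (INR p + 2) * mass alpha <= 2 * eps ^ 2).
  { apply (mass_localised alpha p (mass alpha) (eps ^ 2) Hp HX).
    - intros e He. destruct (ev_ex _ (HM e He)) as (l & Hl & Hc). exists l; split; [assumption|].
      pose proof (Re_le_Cmod (- (csum (fun k => (alpha k * Cconj (alpha k))%C) l - RtoC (mass alpha)))%C) as Q1.
      rewrite Cmod_opp in Q1. rewrite (rsum_ext _ (fun k => Re (alpha k * Cconj (alpha k))%C)).
      + rewrite <- Re_csum. unfold Re, Copp, Cminus, Cplus, RtoC in Q1 |- *; simpl in Q1 |- *.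
        simpl in Hc. unfold Cminus, Cplus, Copp, RtoC in *; simpl in *. lra.
      + intros k _. rewrite <- Cmod2_conj. reflexivity.
    - apply (equidistributed u0hat alpha p r' (mass alpha)); assumption. }
  set (m := sqrt (mass alpha)). assert (Hm0 : 0 <= m) by apply sqrt_pos.
  assert (Hmm : mass alpha = m ^ 2) by (unfold m; rewrite pow2_sqrt by assumption; reflexivity).
  assert (Hbm : (INR p + 2) * m ^ 2 <= 2 * eps ^ 2) by (rewrite <- Hmm; assumption).
  assert (Hal1 : l2s_norm s alpha <= 1) by lra.
  set (A := modeA sigma alpha Rk). set (D := modeD sigma alpha Rk dRk).
  pose proof (sm_d sigma s gamma T alpha Rk dRk K HR) as Hd. fold A D in Hd.
  pose proof (sm_UA sigma s gamma T alpha Rk Hs Hg HT Hal2 dRk K HR) as UA. fold A in UA.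
  pose proof (sm_UD sigma s gamma T alpha Rk Hsig Hs Hg HT Hal2 Hal1 dRk K HR) as UD. fold D in UD.
  assert (HD : forall t k, 0 < t < T -> D t k = mode_rhs sigma t (fun _ => 2 * mass alpha) (A t) k).
  { intros t0 k H. exact (sm_D sigma s gamma T alpha u Rk Hsig Hs Hg HT Hal2 Hal1 Hnls Hans dRk K HR t0 k H). }
  pose proof (sm_lim sigma s gamma T alpha Rk Hs Hg HT dRk K HR) as Hlim. fold A in Hlim.
  pose proof (sm_lip sigma s gamma T alpha Rk Hs HT dRk K HR) as Hlip. fold A in Hlip.
  pose proof (mass_initial sigma T (fun _ _ => 2 * mass alpha) A D alpha (mass alpha) HT Hd HD UA UD Hasal HM Hlim) as Hmass.
  assert (HR1 : bnd (fun k => Cmod (Rk t k)) (6 / 5 * eps * / INR q)).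
  { assert (Hle : t <= INR p / (2 * PI)).
    { rewrite Htv. rewrite <- (Rmult_1_r (INR p / (2 * PI))) at 2. apply Rmult_le_compat_l; [lra|].
      rewrite <- Rinv_1. apply Rinv_le_contravar; lra. }
    eapply bnd_le; [| |exact (bootstrap sigma T (mass alpha) m eps alpha A D (INR p) Hsig Hm0 Hmm ltac:(lra) Hp1 Hbm Hd HD UA UD
      Hmass HMb HX Hlim Hlip t Ht Hle)].
    - intros k; cbv beta. unfold A. rewrite sm_rem. apply Rle_refl.
    - right. rewrite Htv. field. repeat split; lra. }
  (* each phase moves alpha_k by at most |alpha_k|^3 |ln t| / (8 PI) *)
  set (c3 := Rabs (ln t) / (8 * PI) * m).
  assert (Hc3 : 0 <= c3).
  { apply Rmult_le_pos; [|assumption]. apply Rdiv_le_0_compat; [apply Rabs_pos|lra]. }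
  assert (Hdiff : bnd (fun k => Cmod (A t k - alpha k)) (6 / 5 * eps * / INR q + c3 * m ^ 2)).
  { eapply bnd_le; [| |exact (bnd_plus _ _ _ _ HR1 (bnd_scal c3 _ _ Hc3 HMb))]; [|rewrite Hmm; apply Rle_refl].
    intros k; cbv beta. unfold A, modeA. set (v := sigma * (Cmod (alpha k) ^ 2 / (8 * PI))).
    replace (cis (- v * ln t) * (alpha k + Rk t k) - alpha k)%C with
      (cis (- v * ln t) * Rk t k + (cis (- v * ln t) - 1) * alpha k)%C by ring.
    apply Cmod_tri_le. rewrite !Cmod_mult, cis_mod, Rmult_1_l. apply Rplus_le_compat_l.
    pose proof (cis_sub1 (- v * ln t)) as Q1.
    assert (Hv : Rabs (- v * ln t) = Rabs (ln t) / (8 * PI) * Cmod (alpha k) ^ 2).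
    { unfold v. rewrite Rabs_mult, Rabs_Ropp, Rabs_mult, Hsig, Rmult_1_l, Rabs_right.
      - field; lra.
      - apply Rle_ge, Rdiv_le_0_compat; [apply pow2_ge_0|lra]. }
    assert (Hak : Cmod (alpha k) <= m).
    { apply sqr_le_of; [assumption|]. rewrite <- Hmm. apply (bnd_term _ _ k HMb). }
    rewrite Hv in Q1. pose proof (Cmod_ge_0 (alpha k)). pose proof (pow2_ge_0 (Cmod (alpha k))).
    assert (H8 : 0 <= Rabs (ln t) / (8 * PI)) by (apply Rdiv_le_0_compat; [apply Rabs_pos|lra]).
    apply Rle_trans with (Rabs (ln t) / (8 * PI) * Cmod (alpha k) ^ 2 * m).
    - apply Rmult_le_compat; try assumption. apply Cmod_ge_0.
    - unfold c3. right; ring. }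
  assert (Hs4 : 0 < sqrt (4 * PI * t)) by (apply sqrt_lt_R0, four_pi_pos; assumption).
  assert (Hu : Cmod (u t x) <= / sqrt (4 * PI * t) * (6 / 5 * eps * / INR q + c3 * m ^ 2)).
  { pose proof (sm_u sigma s gamma T alpha u Rk Hs Hg HT Hal2 Hans dRk K HR t x Ht) as Hsum. fold A in Hsum.
    pose proof (hasum_minus _ _ _ _ Hsum Hlin) as Q1. replace (u t x - RtoC 0)%C with (u t x) in Q1 by ring.
    apply (hasum_bound _ _ _ Q1).
    eapply bnd_mono; [|exact (bnd_scal (/ sqrt (4 * PI * t)) _ _ ltac:(left; apply Rinv_0_lt_compat; assumption) Hdiff)].
    intros k; cbv beta. replace (A t k * free_delta k t x - alpha k * free_delta k t x)%C with ((A t k - alpha k) * free_delta k t x)%C by ring.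
    rewrite Cmod_mult, free_delta_mod by assumption. lra. }
  destruct (budget (INR p) eps m Hp1 ltac:(lra) Hm0 Hbm) as (_ & _ & _ & _ & Hm3).
  pose proof (arithmetic_budget p q Q eps Hp Hq Hodd HqQ Heps HQ) as Hfin. fold t in Hfin.
  assert (H4t : 4 * PI * t = 2 * INR p / INR q) by (rewrite Htv; field; lra).
  rewrite <- H4t in Hfin. eapply Rle_trans; [exact Hu|].
  apply inv_le_small; [apply Rplus_le_le_0_compat|assumption|].
  - apply Rmult_le_pos; lra.
  - apply Rmult_le_pos; [assumption|apply pow2_ge_0].
  - apply Rle_trans with (eps * (6 / 5 / INR q + 5445 / 10000 * eps ^ 2 * Rabs (ln t) / (8 * PI))).
    + assert (H8 : 0 <= Rabs (ln t) / (8 * PI)) by (apply Rdiv_le_0_compat; [apply Rabs_pos|lra]).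
      replace (c3 * m ^ 2) with (Rabs (ln t) / (8 * PI) * m ^ 3) by (unfold c3; ring).
      assert (Rabs (ln t) / (8 * PI) * m ^ 3 <= Rabs (ln t) / (8 * PI) * (5445 / 10000 * eps ^ 3)) by (apply Rmult_le_compat_l; assumption).
      replace (eps * (6 / 5 / INR q + 5445 / 10000 * eps ^ 2 * Rabs (ln t) / (8 * PI))) with
        (6 / 5 * eps * / INR q + Rabs (ln t) / (8 * PI) * (5445 / 10000 * eps ^ 3)) by (field; lra). lra.
    + rewrite (Rmult_comm (sqrt _)). apply Rmult_le_compat_l; [lra|exact Hfin].
Qed.

Theorem proposition3p2 (sigma : R) (Hsigma : sigma = 1 \/ sigma = - 1)
  (p : nat) (Hp : (1 <= p)%nat)
  (q_ : R -> R)
  (Hq_ : forall e : R, 0 < e < 1 -> e ^ 2 * sqrt (q_ e) * ln (q_ e) < 1 / 2)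
  (Hq_lim : filterlim q_ (at_right 0) (Rbar_locally p_infty))
  (eps : R) (Heps : 0 < eps < 1)
  (s : R) (Hs : 1 / 2 < s)
  (gamma : R) (Hgamma : 0 < gamma < 1) :
  (forall (eta : R) (u0hat : R -> C) (alpha : Z -> C) (T : R) (u : R -> R -> C),
     0 < eta < 1 ->
     periodic_2pi u0hat ->
     located_mod_2pi u0hat (eta * (PI / INR p)) ->
     has_fourier_coefficients u0hat alpha ->
     in_l2s s alpha ->
     l2s_norm s alpha <= eps ->
     solution_from sigma s gamma alpha T u ->
     forall q : nat, (1 <= q)%nat -> INR q <= q_ eps -> Nat.Odd q ->
     t_pq p q < T ->
     forall x : R,
       (forall m : Z, eta / INR q < Rabs (x - IZR m / INR q)) ->
       Cmod (u (t_pq p q) x) <= eps)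
  /\
  (exists (alpha : R -> Z -> C) (T : R -> R) (u : R -> R -> R -> C),
     (forall lambda : R, 0 < lambda ->
        in_l2s s (alpha lambda) /\
        solution_from sigma s gamma (alpha lambda) (T lambda) (u lambda)) /\
     is_lim (fun lambda : R => l2s_norm s (alpha lambda)) p_infty 0 /\
     forall q : nat, (1 <= q)%nat -> INR q <= q_ eps -> Nat.Odd q ->
       (forall lambda : R, 0 < lambda ->
          t_pq p q < T lambda /\ alpha lambda 0%Z <> RtoC 0) /\
       is_lim
         (fun lambda : R =>
            Cmod (u lambda (t_pq p q) 0
                  / (alpha lambda 0%Z * free_delta 0%Z (t_pq p q) 0))%C)
         p_infty p_infty).
Proof.
  assert (Hs1 : Rabs sigma = 1).
  { destruct Hsigma as [-> | ->]; [apply Rabs_R1|rewrite Rabs_left; lra]. }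
  split.
  - intros eta u0hat alpha T u _ Hper Hloc Hfc _ Hnorm Hsol q Hq HqQ Hodd HtT x Hx.
    exact (almost_vanishing sigma p (q_ eps) eps s gamma eta u0hat alpha T u q x Hs1 Hp Heps (Hq_ eps Heps)
      Hs Hgamma Hper Hloc Hfc Hnorm Hsol Hq HqQ Hodd HtT Hx).
  - assert (Hp1 : 1 <= INR p) by (apply (le_INR 1); assumption). pose proof PI_RGT_0.
    assert (Hpp : 0 < INR p / (2 * PI)) by (apply Rdiv_lt_0_compat; lra).
    (* no t_{p,q} exceeds p/(2 PI) *)
    set (T := INR p / (2 * PI) + 1).
    assert (HT : forall q, (1 <= q)%nat -> 0 < t_pq p q < T).
    { intros q Hq. assert (Hq1 : 1 <= INR q) by (apply (le_INR 1); assumption).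
      replace (t_pq p q) with (INR p / (2 * PI) * / INR q) by (unfold t_pq; field; lra).
      assert (0 < / INR q <= 1).
      { split; [apply Rinv_0_lt_compat; lra|rewrite <- Rinv_1; apply Rinv_le_contravar; lra]. }
      unfold T; split; nra. }
    destruct (concentration sigma s gamma T Hs1 Hs Hgamma ltac:(unfold T; lra)) as (alpha & u & Hsol & Hlim & Hratio).
    exists alpha, (fun _ => T), u. split; [exact Hsol|split; [exact Hlim|]].
    intros q Hq _ _. destruct (Hratio (t_pq p q) (HT q Hq)) as [Hnz Hinf].
    split; [|exact Hinf]. intros lambda Hl. split; [apply HT, Hq|apply Hnz, Hl].
Qed.
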